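(* The equality $\frac{d}{dt}J_{\mathcal D_1,\mathcal D_2}(g_t)|_{t=0}=0$ holds for all variations $g_t$ of $g$ keeping $\mathcal D_1$ and $\mathcal D_2$ orthogonal and satisfying $B(X,Y)=B(P_3X,P_3Y)$ for all vector fields $X,Y$ on $M$, if and only if the following Euler-Lagrange equation holds for all $X,Y\in\mathcal D_3$ (in the same tangent space): \begin{align*} &\sum_{a,i}\Big(-g(A^{\rm mix}_{23,a}\mathcal E_i,Y)\,g((h^{\rm mix}_{12}+T^{\rm mix}_{12})(E_a,\mathcal E_i),X)-g(A^{\rm mix}_{23,a}\mathcal E_i,X)\,g((h^{\rm mix}_{12}+T^{\rm mix}_{12})(E_a,\mathcal E_i),Y)\\ &\quad-g(A^{\rm mix}_{13,i}E_a,Y)\,g((h^{\rm mix}_{12}-T^{\rm mix}_{12})(E_a,\mathcal E_i),X)-g(A^{\rm mix}_{13,i}E_a,X)\,g((h^{\rm mix}_{12}-T^{\rm mix}_{12})(E_a,\mathcal E_i),Y)\\ &\quad-g(A^{\rm mix}_{23,a}\mathcal E_i,X)\,g(T^{\sharp{\rm mix}}_{23,a}\mathcal E_i,Y)-g(A^{\rm mix}_{23,a}\mathcal E_i,Y)\,g(T^{\sharp{\rm mix}}_{23,a}\mathcal E_i,X)\\ &\quad-g(A^{\rm mix}_{13,i}E_a,X)\,g(T^{\sharp{\rm mix}}_{13,i}E_a,Y)-g(A^{\rm mix}_{13,i}E_a,Y)\,g(T^{\sharp{\rm mix}}_{13,i}E_a,X)\\ &\quad-2g(T^{\sharp{\rm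 mix}}_{23,a}\mathcal E_i,X)\,g(T^{\sharp{\rm mix}}_{23,a}\mathcal E_i,Y)-2g(T^{\sharp{\rm mix}}_{13,i}E_a,X)\,g(T^{\sharp{\rm mix}}_{13,i}E_a,Y)\\ &\quad-2g(X,h^{\rm mix}_{12}(E_a,\mathcal E_i))\,g(Y,h^{\rm mix}_{12}(E_a,\mathcal E_i))-2g(X,T^{\rm mix}_{12}(E_a,\mathcal E_i))\,g(Y,T^{\rm mix}_{12}(E_a,\mathcal E_i))\Big)\\ &+g(P_3H_2,X)\,g(P_3H_1,Y)+g(P_3H_2,Y)\,g(P_3H_1,X)+S_{\mathcal D_1,\mathcal D_2}\,g(X,Y)=0 . \end{align*}
   Context: Let $(M,g)$ be a smooth Riemannian manifold, $\dim M>2$, with Levi-Civita connection $\nabla$ and curvature tensor $R$, and let $\mathcal D_1,\mathcal D_2$ be two $g$-orthogonal distributions (subbundles of $TM$). Let $\mathcal D_3$ be the $g$-orthogonal complement of $\mathcal D_1\oplus\mathcal D_2$, so $TM=\mathcal D_1\oplus\mathcal D_2\oplus\mathcal D_3$. $P_m$ is the orthoprojector onto $\mathcal D_m$, $P_m^\perp=\mathrm{id}-P_m$. $\{E_a\},\{\mathcal E_i\},\{e_\mu\}$ are local orthonormal frames of $\mathcal D_1,\mathcal D_2,\mathcal D_3$; sums run over whole frames. Tensors ($m=1,2,3$, $X,Y\in TM$): $h_m(X,Y)=\frac12P_m^\perp(\nabla_{P_mX}P_mY+\nabla_{P_mY}P_mX)$, $H_m=\operatorname{Tr}_gh_m$,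 $\tilde h_m(X,Y)=\frac12P_m(\nabla_{P_m^\perp X}P_m^\perp Y+\nabla_{P_m^\perp Y}P_m^\perp X)$, $\tilde T_m(X,Y)=\frac12P_m(\nabla_{P_m^\perp X}P_m^\perp Y-\nabla_{P_m^\perp Y}P_m^\perp X)$. Mixed tensors: for $\{i,j,k\}=\{1,2,3\}$, $h^{\rm mix}_{ij}(X,Y)=\tilde h_k(P_iX,P_jY)+\tilde h_k(P_jX,P_iY)$, $T^{\rm mix}_{ij}(X,Y)=\tilde T_k(P_iX,P_jY)+\tilde T_k(P_jX,P_iY)$, $g(A^{\rm mix}_{ij,Z}X,Y)=g(h^{\rm mix}_{ij}(X,Y),Z)$, $g(T^{\sharp{\rm mix}}_{ij,Z}X,Y)=g(T^{\rm mix}_{ij}(X,Y),Z)$. A frame index in place of $Z$ means the frame vector: $a$ stands for $E_a$, $i$ for $\mathcal E_i$ (e.g. $A^{\rm mix}_{23,a}=A^{\rm mix}_{23,E_a}$, $A^{\rm mix}_{13,i}=A^{\rm mix}_{13,\mathcal E_i}$). Mutual curvature: $S_{\mathcal D_1,\mathcal D_2}=\sum_{a,i}g(R(E_a,\mathcal E_i)\mathcal E_i,E_a)$ (sum of sectional curvatures of the planes $E_a\wedge\mathcal E_i$). The action is $J_{\mathcal D_1,\mathcal D_2}(g)=\int_MS_{\mathcal D_1,\mathcal D_2}\,d\mathrm{vol}_g$ on metrics making $\mathcal D_1,\mathcal D_2$ orthogonal (if $M$ is non-compact, one integrates over a relatively compact domain $\Omega$ containing the support of the variation; $\Omega$ can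 be chosen arbitrarily). A variation is a smooth family $g_t$, $|t|<\varepsilon$, of Riemannian metrics with $g_0=g$ and $g_t=g$ outside $\Omega$, and $B=\partial_tg_t|_{t=0}$. *)

(* Defs.v *)
From HB Require Import structures.
From mathcomp Require Import all_boot all_order all_algebra.
From mathcomp Require Import all_classical all_reals all_analysis.
From mathcomp Require Import ring.

Set Implicit Arguments.
Unset Strict Implicit.
Unset Printing Implicit Defensive.

Import Order.TTheory GRing.Theory Num.Theory.
Import numFieldNormedType.Exports.

Local Open Scope classical_set_scope.
Local Open Scope ring_scope.

(* Tangent vectors are row vectors of chart components; a matrix [P] acts on
   them by [v |-> v *m P], in accordance with the identity
   ['d f x v = v *m 'J f x]. *)

Section Smooth.
Context {R : realType}.

(* On an open subset of a finite-dimensional space, the existence and continuity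
   of all iterated directional derivatives up to order [k] is class C^k. *)
Fixpoint Ck_on {V W : normedModType R} (k : nat) (U : set V) (f : V -> W) :
    Prop :=
  (forall x, U x -> {for x, continuous f}) /\
  match k with
  | 0 => True
  | k'.+1 => forall v : V,
      (forall x, U x -> derivable f x v) /\ Ck_on k' U (fun x => 'D_v f x)
  end.

Definition smooth_on {V W : normedModType R} (U : set V) (f : V -> W) : Prop :=
  forall k, Ck_on k U f.

End Smooth.

(* A second countable smooth manifold without boundary, given by a countable
   atlas; some of the charts may have an empty domain. [cmap i] and [cinv i] are
   only meaningful on [cdom i] and [ccod i]. *)
Record manifold (R : realType) (n : nat) := Manifold {
  carrier :> topologicalType;
  cdom : nat -> set carrier;
  ccod : nat -> set 'rV[R]_n;
  cmap : nat -> carrier -> 'rV[R]_n;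
  cinv : nat -> 'rV[R]_n -> carrier;
  manifold_hausdorff : hausdorff_space carrier;
  cdom_open : forall i, open (cdom i);
  ccod_open : forall i, open (ccod i);
  cmap_cod : forall i p, cdom i p -> ccod i (cmap i p);
  cinv_dom : forall i u, ccod i u -> cdom i (cinv i u);
  cmapK : forall i p, cdom i p -> cinv i (cmap i p) = p;
  cinvK : forall i u, ccod i u -> cmap i (cinv i u) = u;
  cmap_continuous : forall i p, cdom i p -> {for p, continuous (cmap i)};
  cinv_continuous : forall i u, ccod i u -> {for u, continuous (cinv i)};
  cdom_cover : forall p, exists i, `[< cdom i p >];
  transition_smooth : forall i j,
    smooth_on [set u | ccod i u /\ cdom j (cinv i u)] (cmap j \o cinv i)
}.

(* A (0,2)-tensor field, given by its matrix of components in every chart. *)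
Definition tensor02 (R : realType) (n : nat) := nat -> 'rV[R]_n -> 'M[R]_n.

Section Manifold.
Context {R : realType} {n : nat} (M : manifold R n).

Definition chart_overlap (i j : nat) : set 'rV[R]_n :=
  [set u | ccod M i u /\ cdom j (cinv M i u)].

Definition transition (i j : nat) : 'rV[R]_n -> 'rV[R]_n :=
  @cmap _ _ M j \o cinv M i.

Definition riemannian (g : tensor02 R n) : Prop :=
  [/\ forall i, smooth_on (ccod M i) (g i),
      forall i u, ccod M i u -> (g i u)^T = g i u,
      forall i u (v : 'rV[R]_n), ccod M i u -> v != 0 ->
        0 < (v *m g i u *m v^T) 0 0
    & forall i j u, chart_overlap i j u ->
        'J (transition i j) u *m g j (transition i j u)
          *m ('J (transition i j) u)^T = g i u].

(* The fiber in chart [i] at [u] is the row space of [fiber i u]. *)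
Record subbundle := Subbundle {
  drank : nat;
  fiber : nat -> 'rV[R]_n -> 'M[R]_n;
  fiber_rank : forall i u, ccod M i u -> \rank (fiber i u) = drank;
  fiber_smooth : forall i u, ccod M i u ->
    exists (W : set 'rV[R]_n) (F : 'rV[R]_n -> 'M[R]_(drank, n)),
      [/\ open W, W u, W `<=` ccod M i, smooth_on W F
        & forall v, W v -> (F v == fiber i v)%MS];
  fiber_transition : forall i j u, chart_overlap i j u ->
    (fiber i u *m 'J (transition i j) u == fiber j (transition i j u))%MS
}.

Definition orthogonal_subbundles (g : tensor02 R n) (D1 D2 : subbundle) :
    Prop :=
  forall i u, ccod M i u -> fiber D1 i u *m g i u *m (fiber D2 i u)^T = 0.

Definition chart_at (p : M) : nat := ex_minn (cdom_cover p).

End Manifold.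

Section LocalGeometry.
Context {R : realType} {n : nat}.
Local Notation vec := 'rV[R]_n.
Local Notation field := ('rV[R]_n -> 'rV[R]_n).
Implicit Types (G D P : vec -> 'M[R]_n) (X Y Z : field) (u v w : vec).

Definition inner_g G u v w : R := (v *m G u *m w^T) 0 0.

Definition partial_deriv (f : vec -> R) (i : 'I_n) u : R :=
  'D_(delta_mx 0 i : vec) f u.

(* Gamma^k_{ij} *)
Definition christoffel G u (k i j : 'I_n) : R :=
  2^-1 * \sum_l invmx (G u) k l *
    (partial_deriv (fun v => G v j l) i u
     + partial_deriv (fun v => G v i l) j u
     - partial_deriv (fun v => G v i j) l u).

(* The Levi-Civita connection; see [nabla_torsion_free] and [nabla_metric]. *)
Definition nabla G X Y : field := fun u =>
  'D_(X u) Y u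
  + \row_k \sum_i \sum_j christoffel G u k i j * X u 0 i * Y u 0 j.

Definition bracket X Y : field := fun u => 'D_(X u) Y u - 'D_(Y u) X u.

Lemma christoffelC G u k i j :
  (\forall v \near u, (G v)^T = G v) ->
  christoffel G u k i j = christoffel G u k j i.
Proof.
move=> Gs; congr (_ * _); apply: eq_bigr => l _; congr (_ * _).
rewrite [in LHS](addrC (partial_deriv _ i u)); congr (_ - _).
apply: near_eq_derive; near=> v.
rewrite -[in LHS](_ : (G v)^T = G v) ?mxE //.
by near: v.
Unshelve. all: by end_near. Qed.

Lemma nabla_torsion_free G X Y u :
  (\forall v \near u, (G v)^T = G v) ->
  nabla G X Y u - nabla G Y X u = bracket X Y u.
Proof.
move=> Gs; rewrite /nabla /bracket opprD addrACA; set A := (X in _ + X).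
suff -> : A = 0 by rewrite addr0.
apply/rowP => k; rewrite !mxE; apply/eqP; rewrite subr_eq0; apply/eqP.
rewrite exchange_big; apply: eq_bigr => j _; apply: eq_bigr => i _.
by rewrite (christoffelC _ _ _ Gs) mulrAC.
Qed.

Lemma mul_christoffel G u i j m : (G u)^T = G u -> G u \in unitmx ->
  \sum_k christoffel G u k i j * G u k m =
  2^-1 * (partial_deriv (fun v => G v j m) i u
          + partial_deriv (fun v => G v i m) j u
          - partial_deriv (fun v => G v i j) m u).
Proof.
move=> Gs Gu; set d := fun l => partial_deriv (fun v => G v j l) i u
          + partial_deriv (fun v => G v i l) j u
          - partial_deriv (fun v => G v i j) l u.
under eq_bigr do rewrite -mulrA mulr_suml.
rewrite -mulr_sumr exchange_big /=; congr (_ * _).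
rewrite -/(d m).
transitivity (\sum_l (invmx (G u) *m G u) l m * d l).
  apply: eq_bigr => l _; rewrite mxE mulr_suml; apply: eq_bigr => k _.
  have -> : invmx (G u) k l = invmx (G u) l k.
    by rewrite -[in LHS]Gs -trmx_inv mxE.
  by rewrite -/(d l) mulrAC.
rewrite mulVmx // (bigD1 m) //= mxE eqxx mul1r big1 ?addr0 // => l /negbTE ne.
by rewrite mxE ne mul0r.
Qed.

Lemma deriv_partial (f : vec -> R) u v : differentiable f u ->
  'D_v f u = \sum_i v 0 i * partial_deriv f i u.
Proof.
move=> df; rewrite deriveE // {1}[v]row_sum_delta linear_sum.
by apply: eq_bigr => i _; rewrite linearZ /partial_deriv deriveE.
Qed.

Lemma inner_gE G u v w :
  inner_g G u v w = \sum_k \sum_l v 0 k * G u k l * w 0 l.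
Proof.
rewrite /inner_g mxE exchange_big /=; apply: eq_bigr => l _.
by rewrite !mxE mulr_suml.
Qed.

Lemma inner_g_christoffel G X Y u w : (G u)^T = G u -> G u \in unitmx ->
  inner_g G u
    (\row_k \sum_i \sum_j christoffel G u k i j * X u 0 i * Y u 0 j) w =
  \sum_j \sum_l \sum_i X u 0 i * Y u 0 j * w 0 l * (2^-1 *
    (partial_deriv (fun v => G v j l) i u
     + partial_deriv (fun v => G v i l) j u
     - partial_deriv (fun v => G v i j) l u)).
Proof.
move=> Gs Gu; rewrite inner_gE.
under eq_bigr => k _.
  under eq_bigr => l _.
    rewrite mxE -mulrA mulr_suml.
    under eq_bigr do rewrite mulr_suml.
    over.
  rewrite exchange_big /=; under eq_bigr do rewrite exchange_big /=.
  over.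
rewrite exchange_big /=.
under eq_bigr => i _ do
  (rewrite exchange_big /=; under eq_bigr do rewrite exchange_big /=).
rewrite exchange_big /=; apply: eq_bigr => j _.
rewrite exchange_big /=; apply: eq_bigr => l _; apply: eq_bigr => i _.
rewrite -(mul_christoffel _ _ _ Gs Gu) mulr_sumr.
by apply: eq_bigr => k _; ring.
Qed.

Lemma inner_gDl G u v v' w :
  inner_g G u (v + v') w = inner_g G u v w + inner_g G u v' w.
Proof. by rewrite /inner_g !mulmxDl mxE. Qed.

Lemma inner_gC G u v w : (G u)^T = G u -> inner_g G u v w = inner_g G u w v.
Proof.
move=> Gs; rewrite /inner_g.
have -> : v *m G u *m w^T = (w *m G u *m v^T)^T.
  by rewrite !trmx_mul trmxK Gs mulmxA.
by rewrite mxE.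
Qed.

Lemma nabla_metric G X Y Z u :
  (\forall v \near u, (G v)^T = G v) -> G u \in unitmx ->
  differentiable G u -> derivable Y u (X u) -> derivable Z u (X u) ->
  'D_(X u) (fun v => inner_g G v (Y v) (Z v)) u =
  inner_g G u (nabla G X Y u) (Z u) + inner_g G u (Y u) (nabla G X Z u).
Proof.
move=> Gns Gu dG dY dZ; have Gs := nbhs_singleton Gns.
have dGe k l : differentiable (fun v => G v k l) u.
  exact: (@differentiable_comp _ _ _ _ G (fun N : 'M[R]_n => N k l) _ dG
           (@differentiable_coord _ _ _ (G u) k l)).
have dYk k := (derivable_mxP _ _ _).1 dY 0 k.
have dZk k := (derivable_mxP _ _ _).1 dZ 0 k.
set w := X u in dY dZ dYk dZk *.
under eq_fun do rewrite inner_gE.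
have H : is_derive u w (fun v => \sum_k \sum_l Y v 0 k * G v k l * Z v 0 l)
  (\sum_k \sum_l ('D_w Y u 0 k * G u k l * Z u 0 l
   + Y u 0 k * 'D_w (fun v => G v k l) u * Z u 0 l
   + Y u 0 k * G u k l * 'D_w Z u 0 l)).
  have -> : (fun v => \sum_k \sum_l Y v 0 k * G v k l * Z v 0 l) =
     \sum_k \sum_l ((fun v => Y v 0 k) * (fun v => G v k l)
                      * (fun v => Z v 0 l)).
    apply/funext => v; rewrite fct_sumE; apply: eq_bigr => k _.
    by rewrite fct_sumE.
  apply: is_derive_sum => k; apply: is_derive_sum => l.
  have h1 := derivableP (dYk k).
  have h2 := derivableP (diff_derivable (v := w) (dGe k l)).
  have h3 := derivableP (dZk l).
  apply: is_derive_eq.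
  rewrite (derive_mx dY) (derive_mx dZ) !mxE.
  rewrite /GRing.scale /=.
  by rewrite mulrfctE; ring.
rewrite (@derive_val _ _ _ _ _ _ _ H).
rewrite /nabla -/w {H}.
rewrite inner_gDl [inner_g G u (Y u) _]inner_gC // inner_gDl.
rewrite [inner_g G u ('D_w Z u) _]inner_gC //.
rewrite !inner_g_christoffel // -/w !inner_gE.
under eq_bigr => k _ do rewrite !big_split /=.
rewrite !big_split /=.
set A := (X in _ = X + _ + _); set C1 := (X in _ = A + X + _).
set C := (X in _ = _ + (X + _)); set C2 := (X in _ = _ + (C + X)).
set B := (X in A + X + C = _); suff -> : B = C1 + C2 by ring.
rewrite {}/A {}/C {}/B {}/C1 {}/C2.
rewrite [X in _ = _ + X]exchange_big /= -big_split /=.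
apply: eq_bigr => k _; rewrite -big_split /=; apply: eq_bigr => l _.
rewrite -big_split /= deriv_partial // mulr_sumr mulr_suml.
apply: eq_bigr => i _.
have -> : partial_deriv (fun v => G v l k) i u =
          partial_deriv (fun v => G v k l) i u.
  apply: near_eq_derive; near=> v.
  by rewrite -[in LHS](_ : (G v)^T = G v) ?mxE //; near: v.
by rewrite -/w; field.
Unshelve. all: by end_near. Qed.

Definition curvature G X Y Z : field := fun u =>
  nabla G X (nabla G Y Z) u - nabla G Y (nabla G X Z) u
  - nabla G (bracket X Y) Z u.

Definition orth_compl (A B : 'M[R]_n) : 'M[R]_n := kermx (A *m B^T).

Definition orthoproj G D : vec -> 'M[R]_n := fun u =>
  proj_mx (D u) (orth_compl (G u) (D u)).

Definition third_distr G D1 D2 : vec -> 'M[R]_n := fun u =>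
  orth_compl (G u) (D1 u + D2 u)%MS.

Definition along P X : field := fun u => X u *m P u.

Definition perp P : vec -> 'M[R]_n := fun u => 1%:M - P u.

(* h_m, \tilde h_m and \tilde T_m, where P = P_m *)
Definition sff G P X Y : field :=
  along (perp P) (fun u => 2^-1 *:
    (nabla G (along P X) (along P Y) u + nabla G (along P Y) (along P X) u)).

Definition sff_perp G P X Y : field :=
  along P (fun u => 2^-1 *:
    (nabla G (along (perp P) X) (along (perp P) Y) u
     + nabla G (along (perp P) Y) (along (perp P) X) u)).

Definition int_perp G P X Y : field :=
  along P (fun u => 2^-1 *:
    (nabla G (along (perp P) X) (along (perp P) Y) u
     - nabla G (along (perp P) Y) (along (perp P) X) u)).

(* A tensor defined on vector fields is evaluated on tangent vectors [v], [w] at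
   [u] by extending them to fields with constant components. *)
Definition at_vec (T : field -> field -> field) u v w : vec :=
  T (cst v) (cst w) u.

Definition trace_g G (T : field -> field -> field) u : vec :=
  \sum_k \sum_l invmx (G u) k l *: at_vec T u (delta_mx 0 k) (delta_mx 0 l).

Definition mean_curv G P : field := trace_g G (sff G P).

(* h^mix_ij and T^mix_ij; the third projector is the one onto D_k,
   {i,j,k} = {1,2,3}. *)
Definition hmix G Pi Pj Pk X Y : field := fun u =>
  sff_perp G Pk (along Pi X) (along Pj Y) u
  + sff_perp G Pk (along Pj X) (along Pi Y) u.

Definition Tmix G Pi Pj Pk X Y : field := fun u =>
  int_perp G Pk (along Pi X) (along Pj Y) u
  + int_perp G Pk (along Pj X) (along Pi Y) u.

(* [adjoint_op G T u z v] is the vector A_z v such that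
   g(A_z v, w) = g(T(v, w), z) for all w. *)
Definition adjoint_op G (T : field -> field -> field) u z v : vec :=
  (\row_k inner_g G u (at_vec T u v (delta_mx 0 k)) z) *m invmx (G u).

Definition Amix G Pi Pj Pk := adjoint_op G (hmix G Pi Pj Pk).

Definition Tsharpmix G Pi Pj Pk := adjoint_op G (Tmix G Pi Pj Pk).

Definition orthonormal_frame G D (r : nat) u (E : 'M[R]_(r, n)) : Prop :=
  (E == D u)%MS /\ E *m G u *m E^T = 1%:M.

Definition frame_curv G (r1 r2 : nat) (E : 'M[R]_(r1, n)) (F : 'M[R]_(r2, n))
    u : R :=
  \sum_(a < r1) \sum_(i < r2)
    inner_g G u (curvature G (cst (row a E)) (cst (row i F)) (cst (row i F)) u)
      (row a E).

(* Independent of the orthonormal frames chosen by [xget]. *)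
Definition mutual_curv G D1 D2 (r1 r2 : nat) u : R :=
  frame_curv G
    (xget (0 : 'M[R]_(r1, n)) [set E | orthonormal_frame G D1 u E])
    (xget (0 : 'M[R]_(r2, n)) [set F | orthonormal_frame G D2 u F]) u.

End LocalGeometry.

Section Integration.
Context {R : realType}.

(* Integral of a nonnegative function over R^n with respect to Lebesgue measure,
   by iteration. *)
Fixpoint lebesgue_int (n : nat) : ('rV[R]_n -> \bar R) -> \bar R :=
  match n return ('rV[R]_n -> \bar R) -> \bar R with
  | 0 => fun f => f 0
  | n'.+1 => fun f => (\int[@lebesgue_measure R]_x
      lebesgue_int (fun v : 'rV[R]_n' => f (row_mx (const_mx x : 'rV_1) v)))%E
  end.

Context {n : nat} (M : manifold R n).

(* Integral over M of a nonnegative function with respect to the Riemannian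
   volume: M is cut into the pieces [chart_at p = i], and the i-th piece is
   integrated in the i-th chart against the density sqrt(det g). *)
Definition vol_int_nneg (g : tensor02 R n) (f : M -> \bar R) : \bar R :=
  (\sum_(0 <= i <oo) lebesgue_int (fun u : 'rV[R]_n =>
     if `[< ccod M i u /\ chart_at (cinv M i u) = i >]
     then f (cinv M i u) * (Num.sqrt (\det (g i u)))%:E else 0))%E.

Definition vol_int (Omega : set M) (g : tensor02 R n) (f : M -> R) : R :=
  let f0 : M -> \bar R := ((EFin \o f) \_ Omega)%E in
  fine (vol_int_nneg g (f0^\+)%E - vol_int_nneg g (f0^\-)%E)%E.

Definition mutual_curvature (D1 D2 : subbundle M) (g : tensor02 R n) (p : M) :
    R :=
  let i := chart_at p in
  mutual_curv (g i) (fiber D1 i) (fiber D2 i) (drank D1) (drank D2) (cmap i p).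

Definition curv_action (D1 D2 : subbundle M) (Omega : set M)
    (g : tensor02 R n) : R :=
  vol_int Omega g (mutual_curvature D1 D2 g).

Definition metric_variation (g : tensor02 R n) (Omega : set M) (eps : R)
    (gt : R -> tensor02 R n) : Prop :=
  [/\ 0 < eps,
      forall t, `|t| < eps -> riemannian M (gt t),
      forall i, smooth_on
        [set z : R^o * 'rV[R]_n | `|z.1| < eps /\ ccod M i z.2]
        (fun z => gt z.1 i z.2),
      forall i u, ccod M i u -> gt 0 i u = g i u
    & closure [set p : M | exists t i, [/\ `|t| < eps, cdom i p
          & gt t i (cmap i p) <> g i (cmap i p)]] `<=` Omega].

Definition variation_deriv (gt : R -> tensor02 R n) : tensor02 R n := fun i u =>
  'D_1 (fun t : R^o => gt t i u) 0.

End Integration.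

(* Main.v *)
Require Import Defs.
From HB Require Import structures.
From mathcomp Require Import all_boot all_order all_algebra.
From mathcomp Require Import all_classical all_reals all_analysis.
From mathcomp Require Import perm measurable_realfun ring lra.

Set Implicit Arguments.
Unset Strict Implicit.
Unset Printing Implicit Defensive.

Import Order.TTheory GRing.Theory Num.Theory.
Import numFieldNormedType.Exports.

Local Open Scope classical_set_scope.
Local Open Scope ring_scope.

(* Let B be the rate of change of the metric, and x, y vectors of D1, D2 extended
   to sections X, Y.  As B annihilates D1 and D2, differentiating the Koszul
   formula expresses the rate C of the Levi-Civita connection: g(C(U,V),W) = 0 for
   sections U, V, W of D1 and D2, g(C(z,Y),X) = B(z,[X,Y])/2, and
   g(C(X,Y),z) = -B(nabla_X Y + nabla_Y X, z)/2.  Differentiating the first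
   identity once more eliminates the derivatives of C from the rate of
   g(R(X,Y)Y,X), which is thus algebraic in B, namely
     B(nabla_Y Y, nabla_X X) - B(p,p) + B(p,q) - B(q,q)
   with p = nabla_X Y and q = nabla_Y X.  Hence, without any integration by parts,
   the rate of S sqrt(det g) is half the pairing of B with the Euler-Lagrange
   expression.  Conversely, the variations g + t chi xi xi^T, where chi is a bump
   function and xi is dual to a section of D3, force the expression to vanish on
   the diagonal, and it is symmetric and bilinear.

   Differentiation under the integral needs the volume of a relatively compact
   domain to be finite: the volume of a small cube read in another chart is
   bounded by bisection, from the local approximation of a transition map by its
   differential. *)

(** * Calculus of smooth maps *)

(** The curvature is defined through frames selected arbitrarily at each point, so nothing in it can
    be differentiated directly. It is rewritten as a contraction of the curvature tensor with
    matrices built from fixed local sections of the two distributions and from the Gram matrices of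
    these sections. As the rate of the metric annihilates both distributions, the Gram matrices are
    stationary at time 0 and only the curvature tensor moves. The annihilation holds on whole
    neighbourhoods, hence can be differentiated in space; this moves derivatives of the rate of the
    metric onto the sections. Each chart contributes to the integral through a piece that is
    measurable but in general not open, and near a point of a piece the good estimates may live in
    another chart. Local estimates are therefore stated for functions that do not depend on the
    chart, and made uniform over the closure of the domain by compactness. A Taylor remainder that
    is uniform in space is then integrated against a finite volume. *)

Section SmoothCalculus.
Context {R : realType} {V : normedModType R}.
Implicit Types (U : set V) (f g : V -> R) (x v w : V).

Lemma Ck_on_continuous {W : normedModType R} k U (f : V -> W) x :
  Ck_on k U f -> U x -> {for x, continuous f}.
Proof. by case: k => [|k] [h _]; exact: h. Qed.

Lemma Ck_onS {W : normedModType R} k U (f : V -> W) v :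
  Ck_on k.+1 U f -> Ck_on k U (fun x => 'D_v f x).
Proof. by case=> _ /(_ v) []. Qed.

Lemma Ck_on_derivable {W : normedModType R} k U (f : V -> W) x v :
  Ck_on k.+1 U f -> U x -> derivable f x v.
Proof. by case=> _ /(_ v) [h _]; exact: h. Qed.

Lemma Ck_onW {W : normedModType R} k U (f : V -> W) :
  Ck_on k.+1 U f -> Ck_on k U f.
Proof.
elim: k f => [|k IH] f [fc fd]; first by split.
split=> // v; have [d1 d2] := fd v; split=> //.
exact: IH.
Qed.

Lemma Ck_on_le {W : normedModType R} k l U (f : V -> W) :
  (k <= l)%N -> Ck_on l U f -> Ck_on k U f.
Proof.
move=> /subnK <-; elim: (l - k)%N => [//|m IH].
by rewrite addSn => /Ck_onW.
Qed.

Lemma Ck_on_sub {W : normedModType R} k U U' (f : V -> W) :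
  U' `<=` U -> Ck_on k U f -> Ck_on k U' f.
Proof.
move=> UU'; elim: k f => [|k IH] f [fc fd]; first by split=> // x /UU'; exact: fc.
split=> [x /UU'|v]; first exact: fc.
have [d1 d2] := fd v; split=> [x /UU'|]; first exact: d1.
exact: IH.
Qed.

Lemma open_near U x : open U -> U x -> \forall y \near x, U y.
Proof. by move=> oU Ux; exact: open_nbhs_nbhs. Qed.

Lemma open_near_eq {T : Type} U x (f g : V -> T) : open U -> U x ->
  (forall y, U y -> f y = g y) -> \forall y \near x, f y = g y.
Proof.
move=> oU Ux fg; apply: filterS (open_near oU Ux) => y; exact: fg.
Qed.

Lemma continuous_for_congr {T : topologicalType} x (f g : V -> T) :
  (\forall y \near x, f y = g y) -> {for x, continuous f} ->
  {for x, continuous g}.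
Proof.
move=> fg; rewrite /prop_for /continuous_at -(nbhs_singleton fg) => fc.
apply: cvg_trans fc; apply: near_eq_cvg.
by [].
Qed.

(** Directional derivatives depend only on germs, so equality on an open set suffices; the
    computations below replace a derivative by a formula valid on [U] alone. *)
Lemma Ck_on_congr {W : normedModType R} k U (f g : V -> W) :
  open U -> (forall x, U x -> f x = g x) -> Ck_on k U f -> Ck_on k U g.
Proof.
move=> oU; elim: k f g => [|k IH] f g fg [fc fd].
  split=> // x Ux; apply: continuous_for_congr (fc _ Ux).
  exact: open_near_eq fg.
split=> [x Ux|v].
  apply: continuous_for_congr (fc _ Ux); exact: open_near_eq fg.
have [d1 d2] := fd v; split=> [x Ux|].
  by apply: near_eq_derivable (d1 _ Ux); exact: open_near_eq fg.
apply: IH d2 => x Ux.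
by apply: near_eq_derive; exact: open_near_eq fg.
Qed.

Lemma Ck_on_cst {W : normedModType R} k U (a : W) : Ck_on k U (cst a).
Proof.
elim: k a => [|k IH] a; first by split=> // x _; exact: cst_continuous.
split=> [x _|v]; first exact: cst_continuous.
split=> [x _|]; first exact: derivable_cst.
by rewrite (_ : (fun x => _) = cst 0) //; apply/funext => x; rewrite derive_cst.
Qed.

Lemma Ck_onD {W : normedModType R} k U (f g : V -> W) : open U ->
  Ck_on k U f -> Ck_on k U g -> Ck_on k U (fun x => f x + g x).
Proof.
move=> oU; elim: k f g => [|k IH] f g [fc fd] [gc gd].
  by split=> // x Ux; apply: continuousD; [exact: fc|exact: gc].
split=> [x Ux|v]; first by apply: continuousD; [exact: fc|exact: gc].
have [d1 d2] := fd v; have [e1 e2] := gd v.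
split=> [x Ux|]; first by apply: derivableD; [exact: d1|exact: e1].
apply: Ck_on_congr (IH _ _ d2 e2) => // x Ux.
by rewrite deriveD //; [exact: d1|exact: e1].
Qed.

Lemma Ck_onM k U f g : open U ->
  Ck_on k U (f : V -> R^o) -> Ck_on k U (g : V -> R^o) ->
  Ck_on k U (fun x => f x * g x : R^o).
Proof.
move=> oU; elim: k f g => [|k IH] f g fk gk.
  by split=> // x Ux; apply: continuousM; [exact: (fk.1)|exact: (gk.1)].
split=> [x Ux|v]; first by apply: continuousM; [exact: (fk.1)|exact: (gk.1)].
have fd := fun x (Ux : U x) => Ck_on_derivable (v:=v) fk Ux.
have gd := fun x (Ux : U x) => Ck_on_derivable (v:=v) gk Ux.
split=> [x Ux|]; first by apply: derivableM; [exact: fd|exact: gd].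
apply: (@Ck_on_congr _ _ _ (fun x => f x * 'D_v g x + g x * 'D_v f x : R^o)) => //.
  by move=> x Ux; rewrite deriveM; [|exact: fd|exact: gd].
by apply: Ck_onD => //;
  [apply: IH (Ck_onW fk) (Ck_onS v gk)|apply: IH (Ck_onW gk) (Ck_onS v fk)].
Qed.

Lemma Ck_onN {W : normedModType R} k U (f : V -> W) : open U ->
  Ck_on k U f -> Ck_on k U (fun x => - f x).
Proof.
move=> oU; elim: k f => [|k IH] f [fc fd].
  by split=> // x Ux; apply: continuousN; exact: fc.
split=> [x Ux|v]; first by apply: continuousN; exact: fc.
have [d1 d2] := fd v.
split=> [x Ux|]; first by apply: derivableN; exact: d1.
apply: Ck_on_congr (IH _ d2) => // x Ux.
by rewrite deriveN //; exact: d1.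
Qed.

(** The derivative of the inverse is a product in which the inverse reappears, so the induction on
    [k] closes; [Ck_on_sqrt] follows the same pattern. *)
Lemma Ck_onV k U f : open U -> (forall x, U x -> f x != 0) ->
  Ck_on k U (f : V -> R^o) -> Ck_on k U (fun x => (f x)^-1 : R^o).
Proof.
move=> oU f0; elim: k => [|k IH] fk.
  by split=> // x Ux; apply: cvgV; [exact: f0|exact: (fk.1)].
split=> [x Ux|v]; first by apply: cvgV; [exact: f0|exact: (fk.1)].
have fd := fun x (Ux : U x) => Ck_on_derivable (v:=v) fk Ux.
split=> [x Ux|]; first by apply: derivableV; [exact: f0|exact: fd].
apply: (@Ck_on_congr _ _ _ (fun x => - ((f x)^-1 * (f x)^-1) * 'D_v f x : R^o)) => //.
  move=> x Ux; rewrite deriveV; [|exact: f0|exact: fd].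
  by rewrite -exprVn expr2.
have fV := IH (Ck_onW fk).
apply: Ck_onM => //; last exact: Ck_onS.
by apply: Ck_onN => //; apply: Ck_onM.
Qed.

(** Only one direction is available for [f], not a full differential, so the chain rule is applied
    to the restriction of [f] to the line through [x] along [v]. *)
Lemma is_derive_comp1 x v f (h : R -> R) : derivable (f : V -> R^o) x v ->
  derivable (h : R^o -> R^o) (f x) 1 ->
  is_derive x v (h \o f : V -> R^o) ('D_1 (h : R^o -> R^o) (f x) * 'D_v (f : V -> R^o) x).
Proof.
move=> fd hd; pose F t : R := f (t *: v + x).
have F0 : F 0 = f x by rewrite /F scale0r add0r.
have Fd : derivable F 0 1 by exact: (derivable1P _ _ _).1 fd.
have DE (k : V -> R^o) : 'D_v k x = 'D_1 (fun t : R^o => k (t *: v + x)) 0.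
  rewrite /derive; set g1 := fun h => h^-1 *: _; set g2 := fun h => h^-1 *: _.
  suff -> : g1 = g2 by [].
  by apply/funext => t; rewrite /g1 /g2 /= addr0 scale0r add0r [_%:A]mulr1.
have hF : derivable h (F 0) 1 := eq_ind_r (fun y => derivable (h : R^o -> R^o) y 1) hd F0.
have [d1 d2] := is_derive1_comp (derivableP hF) (derivableP Fd).
split; first exact/derivable1P.
by rewrite (DE f) -F0; exact: (etrans (DE (h \o f)) d2).
Qed.

Lemma is_derive_sqrt_comp x v f : 0 < f x -> derivable (f : V -> R^o) x v ->
  is_derive x v (fun y => Num.sqrt (f y) : R^o) ((2 * Num.sqrt (f x))^-1 * 'D_v f x).
Proof.
move=> f0 fd; have [d1 d2] := is_derive1_sqrt f0.
have [e1 e2] := is_derive_comp1 fd d1.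
by split=> //; rewrite e2 d2.
Qed.

Lemma Ck_on_sqrt k U f : open U -> (forall x, U x -> 0 < f x) ->
  Ck_on k U (f : V -> R^o) -> Ck_on k U (fun x => Num.sqrt (f x) : R^o).
Proof.
move=> oU f0; elim: k => [|k IH] fk.
  split=> // x Ux; apply: (@continuous_comp _ _ _ f Num.sqrt).
    exact: (fk.1).
  exact: sqrt_continuous.
split=> [x Ux|v].
  apply: (@continuous_comp _ _ _ f Num.sqrt); first exact: (fk.1).
  exact: sqrt_continuous.
have fd := fun x (Ux : U x) => Ck_on_derivable (v:=v) fk Ux.
have H := fun x (Ux : U x) => is_derive_sqrt_comp (f0 _ Ux) (fd _ Ux).
split=> [x Ux|]; first by have [] := H x Ux.
apply: (@Ck_on_congr _ _ _ (fun x => (2 * Num.sqrt (f x))^-1 * 'D_v f x : R^o)) => //.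
  by move=> x Ux; have [_ ->] := H x Ux.
apply: Ck_onM => //; last exact: Ck_onS.
apply: Ck_onV => //.
  by move=> x Ux; rewrite mulf_neq0 // sqrtr_eq0 -ltNge f0.
by apply: Ck_onM => //; [exact: Ck_on_cst|exact: IH (Ck_onW fk)].
Qed.

Lemma Ck_on_sum k U (I : Type) (r : seq I) (P : pred I) (f : I -> V -> R) : open U ->
  (forall i, P i -> Ck_on k U (f i : V -> R^o)) ->
  Ck_on k U (fun x => \sum_(i <- r | P i) f i x : R^o).
Proof.
move=> oU fk; elim: r => [|i r IH].
  under eq_fun do rewrite big_nil; exact: Ck_on_cst.
under eq_fun do rewrite big_cons.
case: (boolP (P i)) => // Pi.
by apply: Ck_onD => //; exact: fk.
Qed.

Lemma Ck_on_prod k U (I : Type) (r : seq I) (P : pred I) (f : I -> V -> R) : open U ->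
  (forall i, P i -> Ck_on k U (f i : V -> R^o)) ->
  Ck_on k U (fun x => \prod_(i <- r | P i) f i x : R^o).
Proof.
move=> oU fk; elim: r => [|i r IH].
  under eq_fun do rewrite big_nil; exact: Ck_on_cst.
under eq_fun do rewrite big_cons.
case: (boolP (P i)) => // Pi.
by apply: Ck_onM => //; exact: fk.
Qed.

Lemma continuous_mx m n (M : V -> 'M[R]_(m, n)) x :
  (forall i j, {for x, continuous (fun y => M y i j)}) <-> {for x, continuous M}.
Proof.
split=> [h|Mc i j].
  apply/cvgrPdist_lt => e e0.
  near=> y; rewrite /Num.Def.normr/= mx_normrE; apply: bigmax_lt => // -[i j] _.
  rewrite !mxE /=; move: i j; near: y.
  apply: filter_forall => i; apply: filter_forall => j.
  by have /cvgrPdist_lt /(_ _ e0) := h i j.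
exact: (@continuous_comp _ _ _ M (fun N : 'M[R]_(m, n) => N i j) _ Mc
           (@coord_continuous _ _ _ i j _)).
Unshelve. all: by end_near. Qed.

Lemma Ck_on_mxP k U m n (M : V -> 'M[R]_(m, n)) : open U ->
  Ck_on k U M <-> forall i j, Ck_on k U (fun x => M x i j : R^o).
Proof.
move=> oU; elim: k M => [|k IH] M; split.
- by move=> [Mc _] i j; split=> // x Ux; apply: (continuous_mx M x).2; exact: Mc.
- by move=> h; split=> // x Ux; apply/continuous_mx => i j; exact: (h i j).1.
- move=> Mk i j; split=> [x Ux|v].
    by apply: (continuous_mx M x).2; exact: (Mk.1).
  have Md := fun x (Ux : U x) => Ck_on_derivable (v:=v) Mk Ux.
  split=> [x Ux|]; first exact: ((derivable_mxP M x v).1 (Md _ Ux)).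
  apply: (Ck_on_congr oU _ ((IH _).1 (Ck_onS v Mk) i j)) => x Ux.
  by rewrite derive_mx ?mxE //; exact: Md.
- move=> h; split=> [x Ux|v].
    by apply/continuous_mx => i j; exact: (h i j).1.
  have Md x (Ux : U x) : derivable M x v.
    by apply/derivable_mxP => i j; exact: Ck_on_derivable (h i j) Ux.
  split=> //; apply/IH => i j.
  apply: (Ck_on_congr oU _ (Ck_onS v (h i j))) => x Ux.
  by rewrite derive_mx ?mxE //; exact: Md.
Qed.

End SmoothCalculus.

(** * Mean value theorem and symmetry of second derivatives *)

Section MeanValue.
Context {R : realType} {V : normedModType R}.
Implicit Types (U : set V) (f g : V -> R^o) (x v w : V) (h : R).

Lemma is_derive_line f x v (s h : R) : derivable f (x + (s * h) *: v) v ->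
  is_derive (s : R^o) 1 (fun s : R^o => f (x + (s * h) *: v))
    (h * 'D_v f (x + (s * h) *: v)).
Proof.
move=> fd; pose G (t : R^o) : R^o := f (x + t *: v).
have E : (fun k : R => k^-1 *: ((G \o shift (s * h)) (k *: 1) - G (s * h))) =
    (fun k : R => k^-1 *: ((f \o shift (x + (s * h) *: v)) (k *: v) -
        f (x + (s * h) *: v))).
  apply/funext => k; rewrite /G /=; congr (_ *: (f _ - _)).
  by rewrite [k *: 1]mulr1 scalerDl addrCA.
have Gd : derivable G (s * h) 1 by rewrite /derivable E.
have GE : 'D_1 G (s * h) = 'D_v f (x + (s * h) *: v) by rewrite /derive E.
have md : is_derive (s : R^o) 1 (fun s : R^o => s * h : R^o) h.
  have : is_derive (s : R^o) 1 (fun s : R^o => h *: s : R^o) (h *: 1).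
    exact: is_deriveZ.
  rewrite [h *: 1]mulr1 (_ : (fun s => h *: s) = (fun s => s * h : R^o)) //.
  by apply/funext => t; rewrite [h *: t]mulrC.
have [d1 d2] := @is_derive_comp1 R R^o (s : R^o) 1 (fun s : R^o => s * h) G (@ex_derive _ _ _ _ _ _ _ md) Gd.
by split=> //; rewrite d2 GE (@derive_val _ _ _ _ _ _ _ md) mulrC.
Qed.

(** The segment is parametrized over [0, 1], so that no case distinction on the sign of [h]
    arises. *)
Lemma line_MVT f x v h :
  (forall s, 0 <= s <= 1 -> derivable f (x + (s * h) *: v) v) ->
  exists2 s, 0 <= s <= 1 &
    f (x + h *: v) - f x = h * 'D_v f (x + (s * h) *: v).
Proof.
move=> fd.
pose F (s : R) : R := f (x + (s * h) *: v).
have Fd s : 0 <= s <= 1 -> is_derive (s : R^o) 1 (F : R^o -> R^o)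
    (h * 'D_v f (x + (s * h) *: v)).
  by move=> s01; exact: is_derive_line (fd _ s01).
have [||c] := @MVT_segment R F (fun s => h * 'D_v f (x + (s * h) *: v)) 0 1 ler01.
- move=> s; rewrite in_itv /= => /andP[s0 s1]; apply: Fd.
  by rewrite !ltW.
- apply: derivable_within_continuous => s; rewrite in_itv /= => s01.
  by have [] := Fd _ s01.
rewrite in_itv /= => c01; rewrite /F mul1r mul0r scale0r addr0 subr0 mulr1 => E.
by exists c.
Qed.

Lemma deriveZv f x v (a : R) : derivable f x v ->
  is_derive x (a *: v) f (a * 'D_v f x).
Proof.
move=> fd.
have := @is_derive_line f x v 0 a; rewrite mul0r scale0r addr0 => /(_ fd) [d1 d2].
pose F := fun s : R^o => f (x + (s * a) *: v).
have E : (fun k : R => k^-1 *: ((F \o shift 0) (k *: 1) - F 0)) =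
    (fun k : R => k^-1 *: ((f \o shift x) (k *: (a *: v)) - f x)).
  apply/funext => k; rewrite /F /= addr0 mul0r scale0r addr0.
  by rewrite (_ : k%:A = k) ?scalerA ?[_ + x]addrC // [k%:A]mulr1.
split; first by move: d1; rewrite /derivable E.
by rewrite -d2 /derive E.
Qed.

Lemma near_ball_segment U x : open U -> U x ->
  exists2 e : R, 0 < e & forall y, `|y - x| < e -> U y.
Proof.
move=> oU Ux; have /nbhs_ballP [e e0 eU] := open_near oU Ux.
exists e => // y yx; apply: eU; rewrite -ball_normE /= distrC //.
Qed.

Lemma continuous_forP (f : V -> R) x : {for x, continuous (f : V -> R^o)} ->
  forall e : R, 0 < e -> exists2 d : R, 0 < d &
    forall y, `|y - x| < d -> `|f y - f x| < e.
Proof.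
move=> fc e e0.
have /cvgrPdist_lt /(_ _ e0) /nbhs_ballP [d d0 H] := fc.
exists d => // y yx; rewrite distrC; apply: H; rewrite -ball_normE /= distrC //.
Qed.

(** Additivity in the direction may fail for bare directional derivatives. Class C^1 provides it: an
    increment along [h *: w] is followed by one along [h *: v], and the second quotient is the
    derivative along [v] at a point tending to [x]. *)
Lemma deriveDv U f x v w : open U -> U x -> Ck_on 1 U f ->
  is_derive x (v + w) f ('D_v f x + 'D_w f x).
Proof.
move=> oU Ux fk.
suff H : (fun h => h^-1 *: ((f \o shift x) (h *: (v + w)) - f x)) @ 0^' -->
    ('D_v f x + 'D_w f x : R^o).
  by split; [apply/cvg_ex; eexists; exact: H|apply/cvg_lim].
have wd : derivable f x w := Ck_on_derivable fk Ux.
have Hw : (fun h => h^-1 *: ((f \o shift x) (h *: w) - f x)) @ 0^' -->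
  ('D_w f x : R^o) by exact: wd.
have -> : (fun h => h^-1 *: ((f \o shift x) (h *: (v + w)) - f x)) =
  (fun h => h^-1 *: (f (x + h *: w + h *: v) - f (x + h *: w)) +
            h^-1 *: ((f \o shift x) (h *: w) - f x)).
  apply/funext => h; rewrite -scalerDr /= [h *: w + x]addrC subrKA.
  congr (_ *: (f _ - _)).
  by rewrite scalerDr addrC [h *: v + _]addrC addrA.
apply: cvgD; last exact: Hw.
apply/cvgrPdist_lt => e e0.
have [d1 d10 H1] := near_ball_segment oU Ux.
have [d2 d20 H2] := continuous_forP ((Ck_onS v fk).1 _ Ux) e0.
have N0 : 0 < `|v| + `|w| + 1 by rewrite ltr_wpDl // addr_ge0.
near=> h.
have small s : 0 <= s <= 1 ->
    `|x + h *: w + (s * h) *: v - x| < Num.min d1 d2.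
  move=> /andP[s0 s1].
  rewrite addrC -addrA addKr.
  apply: (@le_lt_trans _ _ (`|h| * (`|v| + `|w| + 1))).
    rewrite (le_trans (ler_normD _ _)) // !normrZ ?normrM (ger0_norm s0).
    have : s * `|h| * `|v| <= `|h| * `|v|.
      by rewrite ler_wpM2r // -[leRHS]mul1r ler_wpM2r.
    have := normr_ge0 h; rewrite !mulrDr mulr1; lra.
  rewrite -ltr_pdivlMr //; near: h; apply: dnbhs0_lt; rewrite divr_gt0 //.
  by rewrite lt_min d10.
have h0 : h != 0 by near: h; exact: nbhs_dnbhs_neq.
have [|s s01 ->] := @line_MVT f (x + h *: w) v h.
  move=> s s01; apply: (Ck_on_derivable fk); apply: H1.
  by apply: lt_le_trans (small _ s01) _; rewrite ge_min lexx.
rewrite [_ *: _]mulrA mulVf // mul1r distrC; apply: H2.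
by apply: lt_le_trans (small _ s01) _; rewrite ge_min lexx orbT.
Unshelve. all: by end_near. Qed.

(** The second difference of [f] over a small parallelogram does not depend on the order of the
    sides. The mean value theorem, used twice in either order, turns it into h^2 times a mixed
    derivative at a nearby point, and both mixed derivatives are continuous. *)
Lemma schwarz U f x v w : open U -> U x -> Ck_on 2 U f ->
  'D_v (fun y => 'D_w f y) x = 'D_w (fun y => 'D_v f y) x.
Proof.
move=> oU Ux fk.
wlog : / `|'D_v (fun y => 'D_w f y) x - 'D_w (fun y => 'D_v f y) x| > 0.
  move=> H; apply/eqP; rewrite -subr_eq0 -normr_le0 leNgt.
  by apply/negP => H0; move: (H0); rewrite (H H0) subrr normr0 ltxx.
set e := `|_| => e0; exfalso.
have e20 : 0 < e / 2 by rewrite divr_gt0.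
have [d1 d10 H1] := near_ball_segment oU Ux.
have [d2 d20 H2] := continuous_forP ((Ck_onS v (Ck_onS w fk)).1 _ Ux) e20.
have [d3 d30 H3] := continuous_forP ((Ck_onS w (Ck_onS v fk)).1 _ Ux) e20.
pose d := Num.min d1 (Num.min d2 d3).
have d0 : 0 < d by rewrite !lt_min d10 d20.
have [dd1 dd2 dd3] : [/\ d <= d1, d <= d2 & d <= d3].
  by rewrite /d !ge_min !lexx !orbT.
have N0 : 0 < `|v| + `|w| + 1 by rewrite ltr_wpDl // addr_ge0.
(* This [h] keeps the whole parallelogram within distance d / 2 of [x]; the summand 1 covers the
   case where [v] and [w] vanish. *)
have [h h0 hE] : exists2 h : R, 0 < h & h * (`|v| + `|w| + 1) = d / 2.
  exists (d / 2 / (`|v| + `|w| + 1)); first by rewrite !divr_gt0.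
  by rewrite divfK // gt_eqF.
have small (s t : R) : 0 <= s <= 1 -> 0 <= t <= 1 ->
    `|x + (s * h) *: v + (t * h) *: w - x| < d.
  move=> /andP[s0 s1] /andP[t0 t1].
  rewrite addrC -addrA addKr.
  apply: (@le_lt_trans _ _ (h * (`|v| + `|w| + 1))); last first.
    by rewrite hE ltr_pdivrMr // ltr_pMr // ltr1n.
  rewrite (le_trans (ler_normD _ _)) // !normrZ ?normrM !ger0_norm ?(ltW h0) //.
  have : s * h * `|v| <= h * `|v|.
    by rewrite ler_wpM2r // -[leRHS]mul1r ler_wpM2r // ltW.
  have : t * h * `|w| <= h * `|w|.
    by rewrite ler_wpM2r // -[leRHS]mul1r ler_wpM2r // ltW.
  rewrite !mulrDr mulr1; move: (h0); lra.
have D2 (a b : V) : (forall s t : R, 0 <= s <= 1 -> 0 <= t <= 1 ->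
    U (x + (s * h) *: a + (t * h) *: b)) ->
    exists s t : R, [/\ 0 <= s <= 1, 0 <= t <= 1 &
    f (x + h *: a + h *: b) - f (x + h *: b) - (f (x + h *: a) - f x) =
     h * (h * 'D_b (fun y => 'D_a f y) (x + (s * h) *: a + (t * h) *: b))].
  move=> HU.
  pose p y : R^o := f (y + h *: b) - f y.
  have sh y : derivable f (y + h *: b) a ->
     is_derive y a (fun y => f (y + h *: b)) ('D_a f (y + h *: b)).
    move=> fd.
    have E : (fun k : R => k^-1 *: (((fun y => f (y + h *: b)) \o shift y) (k *: a) - f (y + h *: b)))
     = (fun k : R => k^-1 *: ((f \o shift (y + h *: b)) (k *: a) - f (y + h *: b))).
      by apply/funext => k /=; rewrite addrA.
    by split; rewrite /derivable /derive E.
  have pd (s : R) : 0 <= s <= 1 -> is_derive (x + (s * h) *: a) a p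
     ('D_a f (x + (s * h) *: a + h *: b) - 'D_a f (x + (s * h) *: a)).
    move=> s01; have s1 : 0 <= (1 : R) <= 1 by rewrite lexx ler01.
    have s0 : 0 <= (0 : R) <= 1 by rewrite lexx ler01.
    have d1' : derivable f (x + (s * h) *: a + h *: b) a.
      apply: (Ck_on_derivable fk).
      by have := HU s 1 s01 s1; rewrite mul1r.
    have d2' : derivable f (x + (s * h) *: a) a.
      apply: (Ck_on_derivable fk).
      by have := HU s 0 s01 s0; rewrite mul0r scale0r addr0.
    have := sh _ d1'; have := derivableP d2' => i1 i2.
    exact: is_deriveB.
  have [|s s01 ps] := @line_MVT p x a h.
    by move=> s s01; have [] := pd s s01.
  have [|t t01 pt] := @line_MVT (fun y => 'D_a f y) (x + (s * h) *: a) b h.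
    move=> t t01; apply: (Ck_on_derivable (Ck_onS a fk)); exact: HU.
  exists s, t; split=> //; rewrite -pt -[in RHS](@derive_val _ _ _ _ _ _ _ (pd s s01)) -ps.
  by rewrite /p; ring.
have [|s [t [s01 t01 E1]]] := D2 v w.
  move=> s t s01 t01; apply: H1; exact: lt_le_trans (small _ _ s01 t01) dd1.
have sm (s' t' : R) : x + (s' * h) *: w + (t' * h) *: v = x + (t' * h) *: v + (s' * h) *: w.
  by rewrite addrAC.
have [|s' [t' [s01' t01' E2]]] := D2 w v.
  move=> s' t' s01' t01'; rewrite sm; apply: H1; exact: lt_le_trans (small _ _ t01' s01') dd1.
have hn0 : h != 0 by rewrite gt_eqF.
have : 'D_w (fun y => 'D_v f y) (x + (s * h) *: v + (t * h) *: w) =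
       'D_v (fun y => 'D_w f y) (x + (s' * h) *: w + (t' * h) *: v).
  move: E1 E2; rewrite [x + h *: w + h *: v]addrAC.
  move: ('D_w _ _) ('D_v _ _) (f _) (f _) (f _) (f _) => A B a b c k E1 E2.
  have EE : h * (h * A) = h * (h * B) by rewrite -E1 -E2; ring.
  exact: (mulfI hn0 (mulfI hn0 EE)).
rewrite sm => E.
have := H3 _ (lt_le_trans (small _ _ s01 t01) dd3).
have := H2 _ (lt_le_trans (small _ _ t01' s01') dd2).
rewrite E; set z := 'D_v _ _ => z1 z2.
have : e < e / 2 + e / 2.
  rewrite {1}/e; apply: le_lt_trans (ltrD z1 z2).
  rewrite [X in _ <= X + _]distrC; apply: le_trans (ler_normD _ _).
  by rewrite addrA subrK.
by rewrite -splitr ltxx.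
Qed.

End MeanValue.

(** * Algebraic operations on smooth functions and matrices *)

Section SmoothOn.
Context {R : realType} {V : normedModType R}.
Implicit Types (U : set V) (f g : V -> R^o).

Lemma smooth_onD {W : normedModType R} U (f g : V -> W) : open U ->
  smooth_on U f -> smooth_on U g -> smooth_on U (fun x => f x + g x).
Proof. by move=> oU fk gk k; apply: Ck_onD. Qed.

Lemma smooth_onN {W : normedModType R} U (f : V -> W) : open U ->
  smooth_on U f -> smooth_on U (fun x => - f x).
Proof. by move=> oU fk k; apply: Ck_onN. Qed.

Lemma smooth_onM U f g : open U ->
  smooth_on U f -> smooth_on U g -> smooth_on U (fun x => f x * g x : R^o).
Proof. by move=> oU fk gk k; apply: Ck_onM. Qed.

Lemma smooth_onV U f : open U -> (forall x, U x -> f x != 0) ->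
  smooth_on U f -> smooth_on U (fun x => (f x)^-1 : R^o).
Proof. by move=> oU f0 fk k; apply: Ck_onV. Qed.

Lemma smooth_on_sqrt U f : open U -> (forall x, U x -> 0 < f x) ->
  smooth_on U f -> smooth_on U (fun x => Num.sqrt (f x) : R^o).
Proof. by move=> oU f0 fk k; apply: Ck_on_sqrt. Qed.

Lemma smooth_on_cst {W : normedModType R} U (a : W) : smooth_on U (fun _ : V => a).
Proof. by move=> k; exact: Ck_on_cst. Qed.

Lemma smooth_on_sum U (I : Type) (r : seq I) (P : pred I) (f : I -> V -> R^o) :
  open U -> (forall i, P i -> smooth_on U (f i)) ->
  smooth_on U (fun x => \sum_(i <- r | P i) f i x : R^o).
Proof. by move=> oU fk k; apply: Ck_on_sum => // i Pi; exact: fk. Qed.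

Lemma smooth_on_prod U (I : Type) (r : seq I) (P : pred I) (f : I -> V -> R) :
  open U -> (forall i, P i -> smooth_on U (f i : V -> R^o)) ->
  smooth_on U (fun x => \prod_(i <- r | P i) f i x : R^o).
Proof. by move=> oU fk k; apply: Ck_on_prod => // i Pi; exact: fk. Qed.

Lemma smooth_on_mxP U m n (M : V -> 'M[R]_(m, n)) : open U ->
  smooth_on U M <-> forall i j, smooth_on U (fun x => M x i j : R^o).
Proof.
move=> oU; split=> [Mk i j k|h k]; first exact: (Ck_on_mxP k M oU).1.
by apply/Ck_on_mxP => // i j; exact: h.
Qed.

Lemma smooth_on_congr {W : normedModType R} U (f g : V -> W) :
  open U -> (forall x, U x -> f x = g x) -> smooth_on U f -> smooth_on U g.
Proof. by move=> oU fg fk k; apply: Ck_on_congr (fk k). Qed.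

Lemma smooth_on_sub {W : normedModType R} U U' (f : V -> W) :
  U' `<=` U -> smooth_on U f -> smooth_on U' f.
Proof. by move=> UU' fk k; apply: Ck_on_sub (fk k). Qed.

Lemma smooth_on_derive {W : normedModType R} U (f : V -> W) v :
  smooth_on U f -> smooth_on U (fun x => 'D_v f x).
Proof. by move=> fk k; apply: Ck_onS (fk k.+1). Qed.

Lemma smooth_on_derivable {W : normedModType R} U (f : V -> W) x v :
  smooth_on U f -> U x -> derivable f x v.
Proof. by move=> fk; exact: Ck_on_derivable (fk 1%N). Qed.

Lemma smooth_on_continuous {W : normedModType R} U (f : V -> W) x :
  smooth_on U f -> U x -> {for x, continuous f}.
Proof. by move=> fk; exact: (fk 0%N).1. Qed.

Lemma Ck_on_local {W : normedModType R} k U (f : V -> W) :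
  (forall x, U x -> exists2 N : set V, N x & Ck_on k N f) -> Ck_on k U f.
Proof.
elim: k f => [|k IH] f H.
  by split=> // x /H [N Nx [h _]]; exact: h.
split=> [x /H [N Nx [h _]]|v]; first exact: h.
split=> [x /H [N Nx h]|]; first exact: Ck_on_derivable h Nx.
by apply: IH => x /H [N Nx h]; exists N => //; exact: Ck_onS.
Qed.

Lemma smooth_on_local {W : normedModType R} U (f : V -> W) :
  (forall x, U x -> exists2 N : set V, N x & smooth_on N f) -> smooth_on U f.
Proof.
by move=> H k; apply: Ck_on_local => x /H [N Nx h]; exists N.
Qed.

Lemma smooth_on_mulmx U m n p (A : V -> 'M[R]_(m, n)) (B : V -> 'M[R]_(n, p)) :
  open U -> smooth_on U A -> smooth_on U B -> smooth_on U (fun x => A x *m B x).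
Proof.
move=> oU /(smooth_on_mxP _ oU) Ak /(smooth_on_mxP _ oU) Bk.
apply/smooth_on_mxP => // i j.
under eq_fun do rewrite mxE.
by apply: smooth_on_sum => // k _; apply: smooth_onM.
Qed.

Lemma smooth_on_trmx U m n (A : V -> 'M[R]_(m, n)) :
  open U -> smooth_on U A -> smooth_on U (fun x => (A x)^T).
Proof.
move=> oU /(smooth_on_mxP _ oU) Ak; apply/smooth_on_mxP => // i j.
by under eq_fun do rewrite mxE; exact: Ak.
Qed.

Lemma smooth_on_det U n (A : V -> 'M[R]_n) :
  open U -> smooth_on U A -> smooth_on U (fun x => \det (A x) : R^o).
Proof.
move=> oU /(smooth_on_mxP _ oU) Ak; rewrite /determinant.
apply: smooth_on_sum => // s _; apply: smooth_onM => //.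
  exact: smooth_on_cst.
by apply: smooth_on_prod => // i _.
Qed.

Lemma smooth_on_invmx U n (A : V -> 'M[R]_n) : open U ->
  (forall x, U x -> A x \in unitmx) ->
  smooth_on U A -> smooth_on U (fun x => invmx (A x)).
Proof.
move=> oU Au Ak; apply/smooth_on_mxP => // i j.
apply: (@smooth_on_congr _ _ (fun x => (\det (A x))^-1 * cofactor (A x) j i : R^o)) => //.
  by move=> x Ux; rewrite /invmx Au // !mxE.
apply: smooth_onM => //.
  apply: smooth_onV => //; last exact: smooth_on_det.
  by move=> x /Au; rewrite unitmxE unitfE.
apply: smooth_onM => //; first exact: smooth_on_cst.
apply: smooth_on_det => //; apply/smooth_on_mxP => // k l.
under eq_fun do rewrite !mxE.
by move/smooth_on_mxP: Ak; exact.
Qed.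

End SmoothOn.

(** * Differentiability of C^1 maps on row vectors *)

Section Differentiable.
Context {R : realType} {n : nat}.
Local Notation vec := 'rV[R]_n.
Implicit Types (U : set vec) (x v : vec).

Lemma norm_coord_le {m p} (A : 'M[R]_(m, p)) i j : `|A i j| <= `|A|.
Proof.
by rewrite [leRHS]/Num.Def.normr/= mx_normrE; apply: (le_bigmax _ _ (i, j)).
Qed.

Lemma derive_sum_partial U (f : vec -> R^o) x v : open U -> U x -> Ck_on 1 U f ->
  'D_v f x = \sum_i v 0 i * partial_deriv f i x.
Proof.
move=> oU Ux fk.
have H (r : seq 'I_n) : 'D_(\sum_(i <- r) v 0 i *: delta_mx 0 i) f x =
   \sum_(i <- r) v 0 i * partial_deriv f i x.
  elim: r => [|i r IH]; first by rewrite !big_nil derive0.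
  rewrite !big_cons -IH.
  have [_ ->] := deriveDv (v 0 i *: delta_mx 0 i)
      (\sum_(i <- r) v 0 i *: delta_mx 0 i) oU Ux fk.
  congr (_ + _).
  by have [_ ->] := deriveZv (v 0 i)
    (Ck_on_derivable (v:=delta_mx 0 i : vec) fk Ux).
by rewrite -H -row_sum_delta.
Qed.

(** The differential is a chosen linear map, and differentiability says that the choice meets its
    specification; exhibiting one continuous candidate is therefore enough. *)
Lemma differentiable_by_linear {V W : normedModType R} (f : V -> W)
    (df : {linear V -> W}) (x : V) : continuous df ->
  (forall e : {posnum R}, \forall h \near (0 : V),
     `|f (h + x) - (f x + df h)| <= e%:num * `|h|) -> differentiable f x.
Proof.
move=> dfc H.
have fdf : f = (fun y => f x + df (y - x)) +o_ x (fun y => y - x).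
  apply/eqaddoP => _/posnumP[e].
  have := H e; rewrite (near_shift x); apply: filterS => y.
  by rewrite /= sub0r subrK.
have E : lim (nbhs x) = x by exact: lim_id.
apply/diffP => /=.
apply: (@getPex _ (fun (df : {linear V -> W}) => continuous df /\
  forall y, f y = f (lim (nbhs x)) + df (y - lim (nbhs x))
                  +o_(y \near x) (y - lim (nbhs x)))).
exists df; split=> //; rewrite E => y.
by rewrite {1}fdf.
Qed.

(** The candidate differential pairs [h] with the partial derivatives at [x]. By the mean value
    theorem the increment is the same pairing at an intermediate point, where all partial
    derivatives are uniformly close. The quotient by [n + 1] instead of [n] covers dimension 0. *)
Lemma C1_differentiable_scalar U (f : vec -> R^o) x : open U -> U x ->
  Ck_on 1 U f -> differentiable f x.
Proof.
move=> oU Ux fk.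
pose df0 (h : vec) : R^o := \sum_i h 0 i * partial_deriv f i x.
have df0_lin : linear df0.
  move=> a h k; rewrite /df0 scaler_sumr -big_split /=; apply: eq_bigr => i _.
  by rewrite !mxE mulrDl -mulrA.
pose df : {linear vec -> R^o} := HB.pack df0
  (GRing.isLinear.Build R vec R^o _ df0 df0_lin).
have dfc : continuous df.
  move=> h; apply: (@Ck_on_continuous _ _ _ 0 setT) => //.
  apply: Ck_on_sum => [|i _]; first exact: openT.
  apply: Ck_onM; [exact: openT| |exact: Ck_on_cst].
  by split=> // y _; exact: coord_continuous.
apply: (differentiable_by_linear dfc) => e.
have N0 : 0 < n%:R + 1 :> R by rewrite ltr_wpDl.
have e1 : 0 < e%:num / (n%:R + 1) by rewrite divr_gt0.
have [d1 d10 H1] := near_ball_segment oU Ux.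
have : \forall y \near x, forall i,
    `|partial_deriv f i y - partial_deriv f i x| < e%:num / (n%:R + 1).
  apply: (@filter_forall _ _ (fun (i : 'I_n) (y : vec) =>
    `|partial_deriv f i y - partial_deriv f i x| < e%:num / (n%:R + 1)) (nbhs x)) => i.
  have [d2 d20 H2] := continuous_forP ((Ck_onS (delta_mx 0 i : vec) fk).1 _ Ux) e1.
  apply/nbhs_ballP; exists d2 => // y; rewrite -ball_normE /= distrC; exact: H2.
move=> /nbhs_ballP [d2 d20 H2].
apply/nbhs_ballP; exists (Num.min d1 d2) => [|h] /=; first by rewrite lt_min d10.
rewrite -ball_normE /= sub0r normrN => hd.
have small s : 0 <= s <= 1 -> `|x + (s * 1) *: h - x| < Num.min d1 d2.
  move=> /andP[s0 s1]; rewrite addrC addKr mulr1 normrZ ger0_norm //.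
  apply: (@le_lt_trans _ _ `|h|); first by rewrite -[leRHS]mul1r ler_wpM2r.
  exact: hd.
have [|s s01] := @line_MVT _ _ f x h 1.
  move=> s s01; apply: (Ck_on_derivable fk); apply: H1.
  by apply: lt_le_trans (small _ s01) _; rewrite ge_min lexx.
rewrite scale1r mul1r => E.
rewrite opprD addrA [h + x]addrC E.
rewrite (derive_sum_partial _ oU _ fk); last first.
  by apply: H1; apply: lt_le_trans (small _ s01) _; rewrite ge_min lexx.
rewrite /df0 -sumrB.
apply: (@le_trans _ _ (\sum_(i < n) `|h| * (e%:num / (n%:R + 1)))).
  apply: le_trans (ler_norm_sum _ _ _) _; apply: ler_sum => i _.
  rewrite -mulrBr normrM ler_pM // ?norm_coord_le //.
  apply: ltW; apply: H2; rewrite -ball_normE /= distrC.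
  by apply: lt_le_trans (small _ s01) _; rewrite ge_min lexx orbT.
have -> : \sum_(i < n) `|h| * (e%:num / (n%:R + 1)) = `|h| * (n%:R / (n%:R + 1) * e%:num).
  by rewrite sumr_const card_ord -[LHS]mulr_natl; ring.
rewrite [leRHS]mulrC ler_wpM2l // ger_pMl //.
by rewrite ler_pdivrMr // mul1r lerDl.
Qed.

Lemma differentiable_mx m p (M : vec -> 'M[R]_(m, p)) x :
  (forall i j, differentiable (fun y => M y i j : R^o) x) -> differentiable M x.
Proof.
move=> Md.
have -> : M = \sum_(ij : 'I_m * 'I_p) (fun y => (M y ij.1 ij.2) *: delta_mx ij.1 ij.2).
  apply/funext => y; rewrite fct_sumE [LHS]matrix_sum_delta.
  by rewrite pair_bigA.
apply: (big_ind (fun g => differentiable g x)) => [||[i j] _].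
- exact: differentiable_cst.
- by move=> A B Ad Bd; apply: differentiableD.
- exact: (differentiableZl _ (Md i j)).
Qed.

End Differentiable.

(** * Composition of smooth maps *)

Section Composition.
Context {R : realType} {n : nat}.
Local Notation vec := 'rV[R]_n.
Implicit Types (U : set vec) (x v : vec).

Lemma C1_differentiable_mx {m' : nat} (U : set 'rV[R]_m') m p (M : 'rV[R]_m' -> 'M[R]_(m, p)) (x : 'rV[R]_m') : open U -> U x ->
  Ck_on 1 U M -> differentiable M x.
Proof.
move=> oU Ux Mk; apply: differentiable_mx => i j.
exact: C1_differentiable_scalar oU Ux ((Ck_on_mxP 1 M oU).1 Mk i j).
Qed.

Lemma is_derive_chain {m : nat} {W : normedModType R} (phi : 'rV[R]_m -> vec) (f : vec -> W)
    (x v : 'rV[R]_m) : differentiable phi x -> differentiable f (phi x) ->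
  is_derive x v (f \o phi) ('D_('D_v phi x) f (phi x)).
Proof.
move=> pd fd; have cd : differentiable (f \o phi) x by exact: differentiable_comp.
by split; [exact: diff_derivable|rewrite !deriveE // diff_comp].
Qed.

(** The derivative of the composite is a sum of products of components of the derivative of [phi]
    with partial derivatives of [f] composed with [phi], to which the induction hypothesis
    applies. *)
Lemma Ck_on_comp (m : nat) k (U : set 'rV[R]_m) U' (phi : 'rV[R]_m -> vec)
    (f : vec -> R^o) : open U -> open U' ->
  (forall x : 'rV[R]_m, U x -> U' (phi x)) -> Ck_on k U phi -> Ck_on k U' f ->
  Ck_on k U (f \o phi : _ -> R^o).
Proof.
move=> oU oU' UU'; elim: k f => [|k IH] f pk fk.
  split=> // x Ux; apply: (@continuous_comp _ _ _ phi f); first exact: pk.1.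
  by apply: fk.1; exact: UU'.
split=> [x Ux|v].
  apply: (@continuous_comp _ _ _ phi f); first exact: pk.1.
  by apply: fk.1; exact: UU'.
have H (x : 'rV[R]_m) (Ux : U x) : is_derive x v (f \o phi) ('D_('D_v phi x) f (phi x)).
  have p1 : Ck_on 1 U phi by apply: Ck_on_le pk.
  have f1 : Ck_on 1 U' f by apply: Ck_on_le fk.
  apply: is_derive_chain; first exact: C1_differentiable_mx p1.
  exact: C1_differentiable_scalar (UU' _ Ux) f1.
split=> [x Ux|]; first by have [] := H x Ux.
apply: (@Ck_on_congr R _ R^o k U (fun x : 'rV[R]_m =>
  \sum_i 'D_v phi x 0 i * ((partial_deriv f i) \o phi) x : R^o)) => //.
  move=> x Ux; have [_ ->] := H x Ux.
  have f1 : Ck_on 1 U' f by apply: Ck_on_le fk.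
  by rewrite (derive_sum_partial _ oU' (UU' _ Ux) f1).
apply: Ck_on_sum => // i _; apply: Ck_onM => //.
  exact: (Ck_on_mxP k ('D_v phi) oU).1 (Ck_onS v pk) 0 i.
by apply: IH; [exact: Ck_onW|exact: Ck_onS].
Qed.

Lemma smooth_on_comp (m p q : nat) (U : set 'rV[R]_m) U' (phi : 'rV[R]_m -> vec)
    (f : vec -> 'M[R]_(p, q)) : open U -> open U' ->
  (forall x : 'rV[R]_m, U x -> U' (phi x)) -> smooth_on U phi -> smooth_on U' f ->
  smooth_on U (f \o phi).
Proof.
move=> oU oU' UU' pk /(smooth_on_mxP _ oU') fk; apply/smooth_on_mxP => // i j k.
exact: (Ck_on_comp oU oU' UU' (pk k) (fk i j k)).
Qed.

End Composition.

(** * Lebesgue measure on row vectors *)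

Section SigmaFiniteOf.
Context {d} {T : measurableType d} {R : realType} (m : {measure set T -> \bar R}).
Hypothesis msf : sigma_finite setT m.

(** An alias that carries the proof of sigma-finiteness in its type, so that the corresponding
    structure can be inferred. *)
Definition sigma_finite_of of sigma_finite setT m : set T -> \bar R := m.

HB.instance Definition _ := Measure.on (sigma_finite_of msf).

HB.instance Definition _ :=
  Measure_isSigmaFinite.Build _ _ _ (sigma_finite_of msf) msf.

End SigmaFiniteOf.

Section MeasurableVectors.
Context {R : realType}.
Local Open Scope ereal_scope.

Definition cylinders n : set (set 'rV[R]_n) :=
  [set A | exists (i : 'I_n) (B : set (measurableTypeR R)),
     measurable B /\ A = [set v : 'rV[R]_n | B (v 0%R i)]].

(* Carried by a copy of the type of row vectors; generated by the coordinates, so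
   that integration against [vol] below is the iterated integral [lebesgue_int]. *)
Definition mvec n := g_sigma_algebraType (@cylinders n).

Lemma measurable_mvec d (X : measurableType d) n (f : X -> mvec n) :
  (forall i, measurable_fun setT (fun x => (f x : 'rV[R]_n) 0%R i : measurableTypeR R)) ->
  measurable_fun setT f.
Proof.
move=> mf; apply: (@measurability _ _ X (mvec n : measurableType _) setT f (@cylinders n)) => //.
move=> _ [_ [i [B [mB ->]]] <-]; have := mf i measurableT B mB.
by rewrite setTI.
Qed.

Lemma measurable_coord n (i : 'I_n) :
  measurable_fun setT (fun v : mvec n => (v : 'rV[R]_n) 0%R i : measurableTypeR R).
Proof.
move=> _ B mB; rewrite setTI; apply: sub_sigma_algebra.
by exists i, B.
Qed.

Definition rvcons n (p : measurableTypeR R * mvec n) : mvec n.+1 :=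
  row_mx (const_mx (p.1 : R) : 'rV[R]_1) (p.2 : 'rV[R]_n).

Lemma rvcons0 n p : (@rvcons n p : 'rV[R]_n.+1) 0%R 0%R = p.1.
Proof.
rewrite /rvcons; have -> : 0%R = lshift n (0%R : 'I_1) by apply/val_inj.
have := row_mxEl (const_mx (p.1 : R) : 'rV[R]_1) (p.2 : 'rV[R]_n) 0%R 0%R.
by move=> ->; rewrite mxE.
Qed.

Lemma rvconsS n p (i : 'I_n) : (@rvcons n p : 'rV[R]_n.+1) 0%R (lift ord0 i) =
  (p.2 : 'rV[R]_n) 0%R i.
Proof.
rewrite /rvcons; have -> : lift ord0 i = rshift 1 i by apply/val_inj.
exact: (row_mxEr (const_mx (p.1 : R) : 'rV[R]_1) (p.2 : 'rV[R]_n) 0%R i).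
Qed.

Lemma measurable_rvcons n : measurable_fun setT (@rvcons n).
Proof.
apply: measurable_mvec => i; case: (unliftP ord0 i) => [j ->|->].
  under eq_fun do rewrite rvconsS.
  exact: (measurableT_comp (measurable_coord j) measurable_snd).
under eq_fun do rewrite rvcons0.
exact: measurable_fst.
Qed.

(** For [0 <= r] this is a closed ball of the sup norm; as a product of intervals it is measurable
    by construction and has an explicit volume. *)
Definition cube n (c : 'rV[R]_n) (r : R) : set 'rV[R]_n :=
  [set v | forall i, `|v 0 i - c 0 i| <= r]%R.

Lemma measurable_cube n c r : measurable (@cube n c r : set (mvec n)).
Proof.
rewrite (_ : cube c r = \bigcap_(i in [set: 'I_n])
  [set v : mvec n | (`|(v : 'rV[R]_n) 0 i - c 0 i| <= r)%R]); last first.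
  by apply/seteqP; split=> v /= h i; have := h i; exact.
apply: fin_bigcap_measurable => // i _.
apply: sub_sigma_algebra; exists i, [set x | (`|x - c 0 i| <= r)%R]; split=> //.
rewrite (_ : [set x | _] = `[(c 0 i - r)%R, (c 0 i + r)%R]%classic) //.
by apply/seteqP; split=> x /=; rewrite in_itv /= ler_distl.
Qed.

Lemma cube_ball n (c v : 'rV[R]_n) r : (0 <= r)%R -> cube c r v <-> (`|v - c| <= r)%R.
Proof.
move=> r0; split=> h.
  rewrite /Num.Def.normr/= mx_normrE; apply: bigmax_le => // -[i j] _ /=.
  by rewrite ord1 !mxE.
by move=> i; apply: le_trans h; have := norm_coord_le (v - c) (0%R : 'I_1) i; rewrite !mxE.
Qed.

Lemma rat_between (x y : R) : (x < y)%R -> exists q : rat, (x < ratr q < y)%R.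
Proof. by move=> xy; have [q] := rat_in_itvoo xy; rewrite in_itv /=; exists q. Qed.

(** The sigma-algebra is generated by coordinates, not by open sets; an open set is recovered as the
    countable union of the rational cubes that it contains. *)
Lemma open_measurable_mvec n (A : set 'rV[R]_n) : open A ->
  measurable (A : set (mvec n)).
Proof.
move=> oA.
pose Q (qr : 'rV[rat]_n * rat) : set (mvec n) :=
  cube (map_mx ratr qr.1) (ratr qr.2).
rewrite (_ : A = \bigcup_(qr in [set qr | Q qr `<=` A]) Q qr); last first.
  apply/seteqP; split=> [v Av|v [qr /=]]; last exact.
  have [e e0 eA] := near_ball_segment oA Av.
  (* Since [q] is below e / 2, a cube of radius [q] whose rational centre is within [q] of [v]
     contains [v] and lies in the ball of radius [e]. *)
  have [q /andP[q0 qe]] := rat_between (divr_gt0 e0 (ltr0Sn R 1)).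
  have H (i : 'I_n) : exists p : rat, ((v 0 i - ratr q < ratr p :> R) && (ratr p < v 0 i + ratr q :> R))%R.
    by apply: rat_between; rewrite ltrBlDr -addrA ltrDl addr_gt0.
  exists ((\row_i (xget 0%R [set p | ((v 0 i - ratr q < ratr p :> R) && (ratr p < v 0 i + ratr q :> R))%R]))%R, q) => [|i] /=.
    move=> w /(cube_ball _ _ (ltW q0)) hw; apply: eA.
    set z := map_mx _ _ in hw.
    have zv : (`|z - v| <= ratr q)%R.
      apply/(cube_ball _ _ (ltW q0)) => i; rewrite !mxE.
      have [p hp] := H i; case: xgetP => [p' -> /=|/(_ _ hp)//].
      by rewrite ler_distl => /andP[/ltW -> /ltW ->].
    rewrite -(subrK z w) -addrA; apply: le_lt_trans (ler_normD _ _) _.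
    rewrite (splitr e); apply: le_lt_trans (lerD hw zv) _.
    by rewrite ltrD.
  rewrite !mxE.
  have [p hp] := H i; case: xgetP => [p' -> /=|/(_ _ hp)//].
  rewrite ler_distl lerBlDr => /andP[/ltW h1 /ltW h2].
  by rewrite h2 -lerBlDr h1.
rewrite bigcup_mkcond; apply: countable_bigcupT_measurable => [|qr].
  exact: countableP.
by case: ifP => // _; exact: measurable_cube.
Qed.

Lemma continuous_measurable_mvec n (A : set 'rV[R]_n) (f : 'rV[R]_n -> R) :
  open A -> (forall x, A x -> {for x, continuous (f : _ -> R^o)}) ->
  measurable_fun (A : set (mvec n)) (f : mvec n -> measurableTypeR R).
Proof.
move=> oA fc; apply: (@measurability _ _ (mvec n : measurableType _) (measurableTypeR R) A f (@RGenOpens.G R)).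
  exact: RGenOpens.measurableE.
move=> _ [_ [a [b ->]] <-].
apply: open_measurable_mvec; rewrite openE => x [Ax fx].
have : \forall y \near x, A y /\ `]a, b[%classic (f y).
  apply: filterI; first exact: open_nbhs_nbhs (conj oA Ax).
  by apply: (fc _ Ax); apply: open_nbhs_nbhs; split.
by [].
Qed.

Lemma lebesgue_int_ext n (f g : 'rV[R]_n -> \bar R) :
  f =1 g -> lebesgue_int f = lebesgue_int g.
Proof. by move=> /funext ->. Qed.

(** Induction on [n]: the measure is the image under [rvcons] of the product of Lebesgue measure
    with the previous one, and Tonelli's theorem identifies its integral with the iterated one. The
    volume of cubes is carried along because it makes the measure sigma-finite, as the next product
    requires. *)
Lemma lebesgue_int_measure n :
  exists mu : {sigma_finite_measure set (mvec n) -> \bar R},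
    (forall f : mvec n -> \bar R, measurable_fun setT f -> (forall x, 0 <= f x) ->
       lebesgue_int (f : 'rV[R]_n -> \bar R) = \int[mu]_x f x) /\
    (forall c r, (0 <= r)%R -> mu (cube c r) = ((2 * r) ^+ n)%:E).
Proof.
elim: n => [|n [mu [IH1 IH2]]].
  (* In dimension 0 the iterated integral is evaluation at the only vector, that is, a Dirac
     mass. *)
  exists (\d_((0%R : 'rV[R]_0) : mvec 0) : {measure set (mvec 0) -> \bar R}); split.
    by move=> f mf f0; rewrite integral_dirac //= diracT mul1e.
  move=> c r r0; rewrite expr0 (_ : cube c r = setT); first exact: diracT.
  by apply/seteqP; split=> // v _ [].
pose nu0 := (pushforward (@lebesgue_measure R \x mu) (@rvcons n) :
   {measure set (mvec n.+1) -> \bar R}).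
pose nu1 := nu0 (@measurable_rvcons n).
have nucube c r : (0 <= r)%R -> nu1 (cube c r) = ((2 * r) ^+ n.+1)%:E.
  move=> r0; rewrite /nu1 /nu0 /= /pushforward.
  have -> : @rvcons n @^-1` cube c r = `[(c 0%R 0%R - r)%R, (c 0%R 0%R + r)%R]%classic `*`
      cube (\row_i c 0%R (lift ord0 i)) r.
    apply/seteqP; split=> -[x v] /= h.
      split; first by have := h 0%R; rewrite rvcons0 ler_distl in_itv.
      by move=> i; have := h (lift ord0 i); rewrite rvconsS !mxE.
    move=> i; case: (unliftP ord0 i) => [j ->|->].
      by rewrite rvconsS; have := h.2 j; rewrite !mxE.
    by rewrite rvcons0 ler_distl; have := h.1; rewrite in_itv.
  rewrite product_measure1E //=; last exact: measurable_cube.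
  rewrite [X in _ * X]IH2 // lebesgue_measure_itv /= lte_fin.
  case: ltP => [|h].
    rewrite -EFinD -EFinM exprS => _; congr ((_ * _)%:E); ring.
  have -> : r = 0%R by apply/eqP; rewrite eq_le r0 andbT; lra.
  by rewrite mul0e exprS mulr0 mul0r.
have nusf : sigma_finite setT nu1.
  exists (fun k => cube 0%R k%:R) => [|k].
    apply/esym/seteqP; split=> // v _.
    exists (Num.truncn `|v|%R).+1 => //; apply/cube_ball => //.
    by rewrite subr0 ltW // truncnS_gt.
  split; first exact: measurable_cube.
  by rewrite nucube ?ltry.
exists (sigma_finite_of nusf); split=> // f mf f0.
rewrite [RHS](_ : _ = \int[pushforward (@lebesgue_measure R \x mu) (@rvcons n)]_x f x) //.
rewrite ge0_integral_pushforward //=; last exact: (@measurable_rvcons n).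
rewrite preimage_setT fubini_tonelli1 //; last first.
  exact: measurableT_comp mf (@measurable_rvcons n).
apply: eq_integral => x _; rewrite /fubini_F.
rewrite -(IH1 (fun v => f (rvcons (x, v)))) //.
apply: measurableT_comp mf _.
exact: (measurableT_comp (@measurable_rvcons n) (pair1_measurable x)).
Qed.

Definition vol n : {sigma_finite_measure set (mvec n) -> \bar R} :=
  projT1 (cid (lebesgue_int_measure n)).

Lemma lebesgue_intE n (f : mvec n -> \bar R) : measurable_fun setT f ->
  (forall x, 0 <= f x) ->
  lebesgue_int (f : 'rV[R]_n -> \bar R) = \int[vol n]_x f x.
Proof. by move=> mf f0; have [h _] := projT2 (cid (lebesgue_int_measure n)); exact: h. Qed.

Lemma vol_cube n (c : 'rV[R]_n) r : (0 <= r)%R ->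
  vol n (cube c r) = ((2 * r) ^+ n)%:E.
Proof. by move=> r0; have [_ h] := projT2 (cid (lebesgue_int_measure n)); exact: h. Qed.

Lemma integral_volS n (f : mvec n.+1 -> \bar R) : measurable_fun setT f ->
  (forall x, 0 <= f x) ->
  \int[vol n.+1]_x f x =
  \int[@lebesgue_measure R]_x \int[vol n]_v f (rvcons (x, v)).
Proof.
move=> mf f0; rewrite -lebesgue_intE //=; apply: eq_integral => x _.
rewrite -(lebesgue_intE (f:=fun v => f (rvcons (x, v)))) //.
apply: measurableT_comp mf _.
exact: (measurableT_comp (@measurable_rvcons n) (pair1_measurable x)).
Qed.

(** The image of Lebesgue measure under the affine map, scaled by |s|, gives half-open intervals
    their length and hence is Lebesgue measure. For [s < 0] the preimage of an interval exchanges
    the open and the closed end. *)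
Lemma integral_lebesgue_affine (s k : R) (f : measurableTypeR R -> \bar R) :
  s != 0%R -> measurable_fun setT f -> (forall x, 0 <= f x) ->
  \int[@lebesgue_measure R]_x f (x * s + k)%R =
  (`|s|^-1)%:E * \int[@lebesgue_measure R]_x f x.
Proof.
move=> s0 mf f0.
have s0' : (0 < `|s|)%R by rewrite normr_gt0.
pose phi (x : measurableTypeR R) : measurableTypeR R := (x * s + k)%R.
have mphi : measurable_fun setT phi.
  by apply: measurable_funD => //; apply: measurable_funM.
pose m0 := (pushforward (@lebesgue_measure R) phi :
   {measure set (measurableTypeR R) -> \bar R}).
pose sn := NngNum (normr_ge0 s).
pose m1 := mscale sn (m0 mphi).
have E A : measurable A -> @lebesgue_measure R A = m1 A.
  apply: lebesgue_measure_unique => _ [[a b] _ <-] /=.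
  rewrite /m1 /mscale /= /pushforward.
  rewrite lebesgue_measure_itv /=.
  case: (ltgtP 0%R s) s0 => // sgn _.
    rewrite (_ : phi @^-1` _ = `]((a - k) / s)%R, ((b - k) / s)%R]%classic); last first.
      apply/seteqP; split=> x; rewrite /phi /= !in_itv /=
        ltr_pdivrMr // ler_pdivlMr // => /andP[h1 h2]; apply/andP; split; lra.
    rewrite lebesgue_measure_itv /= !lte_fin ltr_pM2r ?invr_gt0 // ltrD2r.
    case: ifP => ab; last by rewrite mule0.
    rewrite -!EFinD -EFinM gtr0_norm //; congr EFin; field.
    by rewrite gt_eqF.
  rewrite (_ : phi @^-1` _ = `[((b - k) / s)%R, ((a - k) / s)%R[%classic); last first.
    apply/seteqP; split=> x; rewrite /phi /= !in_itv /=
      ltr_ndivlMr // ler_ndivrMr // => /andP[h1 h2]; apply/andP; split; lra.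
  rewrite lebesgue_measure_itv /= !lte_fin ltr_nM2r ?invr_lt0 // ltrD2r.
  case: ifP => ab; last by rewrite mule0.
  rewrite -!EFinD -EFinM ltr0_norm //; congr EFin; field.
  by rewrite lt_eqF.
rewrite [X in _ = _ * X](eq_measure_integral m1) => [|A mA _]; last exact: E.
rewrite ge0_integral_mscale //= muleA -EFinM mulVf ?gt_eqF // mul1e.
rewrite [RHS](_ : _ = \int[pushforward (@lebesgue_measure R) phi]_x f x) //.
by rewrite ge0_integral_pushforward.
Qed.

(* Such matrices reduce to triangular shears and one-dimensional dilations
   without row exchanges; every invertible matrix is a limit of them. *)
Fixpoint trailing_minors_unit n : 'M[R]_n -> Prop :=
  match n return 'M[R]_n -> Prop with
  | 0 => fun=> True
  | n'.+1 => fun A => (A \in unitmx) /\ trailing_minors_unit (drsubmx (A : 'M[R]_(1 + n')%N))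
  end.

Lemma trailing_minors_unitmx n (A : 'M[R]_n) : trailing_minors_unit A -> A \in unitmx.
Proof. by case: n A => [A _|n A []//]; rewrite unitmxE det_mx00 unitr1. Qed.

Lemma measurable_fun_continuous_mvec n (f : 'rV[R]_n -> R) :
  (forall x, {for x, continuous (f : _ -> R^o)}) ->
  measurable_fun setT (f : mvec n -> measurableTypeR R).
Proof.
move=> fc; have := @continuous_measurable_mvec n setT f openT; apply => x _; exact: fc.
Qed.

Lemma smooth_on_id {V : normedModType R} (U : set V) : smooth_on U (fun v : V => v).
Proof.
move=> [|k]; first by split=> // x _; exact: cvg_id.
split=> [x _|v]; first exact: cvg_id.
split=> [x _|]; first exact: derivable_id.
rewrite (_ : (fun x => _) = cst v); first exact: Ck_on_cst.
by apply/funext => x; rewrite derive_id.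
Qed.

Lemma measurable_smooth n m (f : 'rV[R]_n -> 'rV[R]_m) : smooth_on setT f ->
  measurable_fun setT (f : mvec n -> mvec m).
Proof.
move=> fs; apply: measurable_mvec => i; apply: measurable_fun_continuous_mvec => x.
by apply: smooth_on_continuous I; exact: (smooth_on_mxP _ openT).1 fs 0%R i.
Qed.

(** Block elimination, one coordinate at a time. For a fixed first coordinate the induction
    hypothesis changes the remaining variables by the trailing block [D]; after Tonelli the first
    coordinate undergoes a one-dimensional dilation by the Schur complement [s] of [D]. *)
Lemma integral_vol_affine n (A : 'M[R]_n) (c : 'rV[R]_n) (f : mvec n -> \bar R) :
  trailing_minors_unit A -> measurable_fun setT f -> (forall x, 0 <= f x) ->
  \int[vol n]_v f ((v : 'rV[R]_n) *m A + c)%R =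
  (`|\det A|^-1)%:E * \int[vol n]_v f v.
Proof.
elim: n A c f => [|n IH] A c f.
  move=> _ mf f0; rewrite det_mx00 normr1 invr1 mul1e; apply: eq_integral => v _.
  by congr (f _); apply/rowP; case.
move=> [Au Dg] mf f0.
have /trailing_minors_unitmx Du := Dg.
set A' : 'M[R]_(1 + n)%N := A in Dg Du.
set D := drsubmx A' in Dg Du *.
set b := ursubmx A'; set cc := dlsubmx A'; pose a := A' 0%R 0%R.
(* In terms of the new remaining coordinates [w], the first coordinate of the image is
   [x * s + k w]: eliminating [v] leaves the Schur complement as the factor of [x]. *)
pose k (w : 'rV[R]_n) : R :=
  (((w - rsubmx (c : 'rV_(1 + n)%N)) *m (invmx D *m cc) : 'M[R]_1) 0 0 + c 0 0)%R.
pose s : R := (a - (b *m (invmx D *m cc)) 0 0)%R.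
have detA : (\det A = s * \det D)%R.
  (* [L] has determinant 1 and clears the upper right block, so the determinant is read off a block
     triangular matrix. *)
  pose L : 'M[R]_(1 + n)%N := block_mx 1%:M (- (b *m invmx D))%R 0%R 1%:M.
  have : (\det (L *m A') = s * \det D)%R.
    rewrite -[A']submxK -/D -/b -/cc /L mulmx_block !mul1mx !mul0mx !add0r.
    rewrite !mulNmx -!mulmxA mulVmx // mulmx1 subrr.
    rewrite det_lblock det_mx11 !mxE; congr (((_ + _) * _)%R).
      by rewrite /a; congr (A' _ _); apply/val_inj.
    by rewrite ?mxE.
  by rewrite det_mulmx det_ublock !det1 !mul1r.
have s0 : s != 0%R.
  by move: Au; rewrite unitmxE detA unitfE mulf_eq0 negb_or => /andP[].
pose t (x : R) (v : 'rV[R]_n) := (v *m D + (const_mx x *m b + rsubmx (c : 'rV_(1 + n)%N)))%R.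
have key (x : R) (v : 'rV[R]_n) :
    (rvcons ((x : measurableTypeR R), (v : mvec n)) *m A + c)%R = rvcons ((x * s + k (t x v))%R, t x v) :> 'rV[R]_n.+1.
  rewrite /rvcons /= -[in LHS](hsubmxK (c : 'rV_(1 + n)%N)).
  have -> : A = block_mx (ulsubmx A') b cc D by rewrite submxK.
  transitivity ((row_mx (const_mx x *m ulsubmx A' + (v : 'rV[R]_n) *m cc)
      (const_mx x *m b + (v : 'rV[R]_n) *m D) : 'rV[R]_(1 + n)%N) +
      row_mx (lsubmx (c : 'rV_(1 + n)%N)) (rsubmx (c : 'rV_(1 + n)%N)))%R.
    apply: (congr1 (fun z : 'rV[R]_(1 + n)%N =>
      z + row_mx (lsubmx (c : 'rV_(1 + n)%N)) (rsubmx (c : 'rV_(1 + n)%N)))%R).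
    exact: (@mul_row_block R 1 1 n 1 n (const_mx x) v (ulsubmx A') b cc D).
  have E := add_row_mx (const_mx x *m ulsubmx A' + v *m cc)%R
    (const_mx x *m b + v *m D)%R (lsubmx (c : 'rV_(1 + n)%N)) (rsubmx (c : 'rV_(1 + n)%N)).
  apply: (etrans E).
  congr row_mx; last by rewrite /t [RHS]addrA [(const_mx x *m b + _)%R]addrC.
  apply/rowP => i; rewrite ord1 !mxE /k /t.
  rewrite [(v *m D + _)%R]addrA addrK mulmxDl mulmxA mulmxK // -mulmxA !mxE !big_ord1 !mxE.
  have -> : A' (lshift n 0%R) (lshift n 0%R) = a by congr (A' _ _); apply/val_inj.
  have -> : (c : 'rV_(1 + n)%N) 0%R (lshift n 0%R) = c 0%R 0%R.
    by congr (c _ _); apply/val_inj.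
  rewrite /s [(b *m _)%R 0%R 0%R]mxE /a; ring.
pose h (x : R) (w : mvec n) : \bar R := f (rvcons ((x * s + k w)%R, w)).
have mk : measurable_fun setT (k : mvec n -> measurableTypeR R).
  apply: measurable_fun_continuous_mvec => w.
  have : smooth_on setT (fun w : 'rV[R]_n =>
     ((w - rsubmx (c : 'rV_(1 + n)%N)) *m (invmx D *m cc) : 'rV_1)%R).
    apply: smooth_on_mulmx; [exact: openT| |exact: smooth_on_cst].
    apply: smooth_onD; [exact: openT|exact: smooth_on_id|exact: smooth_on_cst].
  move=> /(smooth_on_mxP _ openT) /(_ 0%R 0%R) sk.
  apply: smooth_on_continuous (smooth_onD openT sk _) I; exact: smooth_on_cst.
have mh : measurable_fun setT (fun p : measurableTypeR R * mvec n => h p.1 p.2).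
  apply: (measurableT_comp mf); apply: (measurableT_comp (@measurable_rvcons n)).
  apply: measurable_fun_pair; last exact: measurable_snd.
  apply: measurable_funD; last exact: (measurableT_comp mk measurable_snd).
  by apply: measurable_funM => //; exact: measurable_fst.
rewrite integral_volS; last 2 first.
- apply: (measurableT_comp mf); apply: measurable_smooth.
  apply: smooth_onD; [exact: openT| |exact: smooth_on_cst].
  by apply: smooth_on_mulmx; [exact: openT|exact: smooth_on_id|exact: smooth_on_cst].
- by move=> x; exact: f0.
transitivity (\int[@lebesgue_measure R]_x ((`|\det D|^-1)%:E * \int[vol n]_w h x w)).
  apply: eq_integral => x _.
  transitivity (\int[vol n]_v h x ((v : 'rV[R]_n) *m D + (const_mx x *m b + rsubmx (c : 'rV_(1 + n)%N)))%R).
    by apply: eq_integral => v _; rewrite key.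
  rewrite IH //; last by move=> w; exact: f0.
  exact: (measurable_fun_pair2 x mh).
rewrite ge0_integralZl //=; last 2 first.
- have hp p : 0 <= h p.1 p.2 by exact: f0.
  exact: (measurable_fun_fubini_tonelli_F (m2:=vol n) _ mh hp).
- by move=> x _; apply: integral_ge0 => w _; exact: f0.
rewrite (fubini_tonelli (m1:=@lebesgue_measure R) (m2:=vol n) (fun p => h p.1 p.2)) //; last first.
  by move=> p; exact: f0.
transitivity ((`|\det D|^-1)%:E * \int[vol n]_w ((`|s|^-1)%:E * \int[@lebesgue_measure R]_x f (rvcons (x, w)))).
  congr (_ * _); apply: eq_integral => w _ /=.
  rewrite (integral_lebesgue_affine (k w) (f:=fun x => f (rvcons (x, w)))) //.
  apply: (measurableT_comp mf); apply: (measurableT_comp (@measurable_rvcons n)).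
  exact: pair2_measurable.
have mr : measurable_fun setT (fun p : measurableTypeR R * mvec n => f (rvcons p)).
  exact: (measurableT_comp mf (@measurable_rvcons n)).
rewrite ge0_integralZl //=; last 2 first.
- exact: (measurable_fun_fubini_tonelli_G (m1:=@lebesgue_measure R) _ mr (fun p => f0 _)).
- by move=> x _; apply: integral_ge0 => w _; exact: f0.
rewrite (integral_volS mf f0).
rewrite (fubini_tonelli (m1:=@lebesgue_measure R) (m2:=vol n) (fun p => f (rvcons p))) //.
rewrite muleA -EFinM; congr (_%:E * _).
by rewrite detA normrM invfM mulrC.
Qed.

End MeasurableVectors.

(** * Perturbing a matrix into one with invertible trailing blocks *)

Section Perturbation.
Context {R : realType}.

(** The power of the variable that divides [p] is split off: it vanishes only at 0, and the other
    factor is nonzero at 0, hence nearby. *)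
Lemma poly_near_neq0 (p : {poly R}) : p != 0 -> \forall e \near (0 : R)^', p.[e] != 0.
Proof.
move=> p0; have [m [q q0 pE]] := multiplicity_XsubC p 0.
move: q0; rewrite p0 /= /root => q0.
have qc : q.[x] @[x --> (0 : R)] --> q.[0] by exact: continuous_horner.
have : \forall e \near (0 : R), q.[e] != 0 by exact: (cvgr_neq0 _ qc q0).
move=> qn; near=> e; rewrite pE hornerM horner_exp hornerXsubC subr0 mulf_neq0 //.
  near: e; exact: nbhs_dnbhs.
rewrite expf_neq0 //; near: e; exact: nbhs_dnbhs_neq.
Unshelve. all: by end_near. Qed.

Lemma det_add_scalar n (A : 'M[R]_n) e : \det (A + e%:M) = (char_poly (- A)).[e].
Proof.
rewrite /char_poly -[RHS]horner_evalE -det_map_mx; congr (\det _).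
apply/matrixP => i j.
by rewrite !mxE rmorphB rmorphMn /= !horner_evalE hornerX hornerC opprK addrC.
Qed.

Lemma near_unit_add_scalar n (A : 'M[R]_n) :
  \forall e \near (0 : R)^', A + e%:M \in unitmx.
Proof.
have : char_poly (- A) != 0 by exact: monic_neq0 (char_poly_monic _).
move=> /poly_near_neq0; apply: filterS => e.
by rewrite unitmxE det_add_scalar unitfE.
Qed.

(** Adding a scalar matrix commutes with taking the trailing block, and each determinant is a
    nonzero polynomial in the scalar. *)
Lemma near_trailing_minors_unit n (A : 'M[R]_n) :
  \forall e \near (0 : R)^', trailing_minors_unit (A + e%:M).
Proof.
elim: n A => [|n IH] A; first by near=> e.
have H1 := near_unit_add_scalar A; have H2 := IH (drsubmx (A : 'M[R]_(1 + n)%N)).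
near=> e; split; first by near: e.
rewrite (_ : drsubmx _ = drsubmx (A : 'M[R]_(1 + n)%N) + e%:M); first by near: e.
apply/matrixP => i j; rewrite !mxE; congr (_ + _ *+ nat_of_bool _).
Unshelve. all: by end_near. Qed.

Lemma norm_mulmx_le n m (v : 'rV[R]_n) (A : 'M[R]_(n, m)) :
  `|v *m A| <= n%:R * `|A| * `|v|.
Proof.
rewrite [leLHS]/Num.Def.normr/= mx_normrE; apply: bigmax_le => [|[i j] _ /=].
  by rewrite !mulr_ge0.
rewrite ord1 mxE; apply: le_trans (ler_norm_sum _ _ _) _.
apply: (@le_trans _ _ (\sum_(k < n) `|v| * `|A|)).
  by apply: ler_sum => k _; rewrite normrM ler_pM // norm_coord_le.
have -> // : \sum_(k < n) `|v| * `|A| = n%:R * `|A| * `|v|.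
by rewrite sumr_const card_ord -[LHS]mulr_natl; ring.
Qed.

(** Makes an invertible Jacobian accessible to [integral_vol_affine], at the price of a factor 2 in
    the determinant and of an arbitrarily small relative error. *)
Lemma exists_trailing_minors_unit n (N : 'M[R]_n) (e : R) : N \in unitmx -> 0 < e ->
  exists N', [/\ trailing_minors_unit N', `|\det N| <= 2 * `|\det N'| &
    forall v : 'rV[R]_n, `|v *m (N' - N)| <= e * `|v|].
Proof.
move=> Nu e0.
have dN0 : 0 < `|\det N| by rewrite normr_gt0; move: Nu; rewrite unitmxE unitfE.
have dc : \forall s \near (0 : R), `|\det N| <= 2 * `|\det (N + s%:M)|.
  have pc : (char_poly (- N)).[x] @[x --> (0 : R)] --> (char_poly (- N)).[0].
    exact: continuous_horner.
  have /cvgrPdist_lt /(_ _ (divr_gt0 dN0 (ltr0Sn R 1))) := pc.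
  apply: filterS => s; rewrite -!det_add_scalar raddf0 addr0 => h.
  have := ler_normD (\det N - \det (N + s%:M)) (\det (N + s%:M)).
  rewrite subrK; lra.
have : \forall s \near (0 : R)^',
   [/\ trailing_minors_unit (N + s%:M), `|\det N| <= 2 * `|\det (N + s%:M)| & `|s| < e].
  near=> s; split; near: s.
  - exact: near_trailing_minors_unit.
  - exact: nbhs_dnbhs.
  - exact: dnbhs0_lt.
move=> /filter_ex [s [s1 s2 s3]]; exists (N + s%:M); split=> // v.
rewrite addrC addKr mul_mx_scalar normrZ ler_wpM2r // ltW //.
Unshelve. all: by end_near. Qed.

Lemma diff_approx n m (phi : 'rV[R]_n -> 'rV[R]_m) u0 (e : R) :
  differentiable phi u0 -> 0 < e ->
  \forall u \near u0, `|phi u - phi u0 - (u - u0) *m 'J phi u0| <= e * `|u - u0|.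
Proof.
move=> pd e0; have /diff_locally/eqaddoP/(_ e e0) H := pd.
have : \forall h \near (0 : 'rV[R]_n),
  `|(phi \o shift u0 - (cst (phi u0) + 'd phi u0)) h| <= e * `|h| by exact: H.
rewrite (near_shift u0); apply: filterS => u /=.
rewrite sub0r /jacobian mul_rV_lin1 => h; apply: le_trans h.
rewrite -[X in _ <= `|X|]/(phi (u - u0 + u0) - (phi u0 + 'd phi u0 (u - u0))).
by rewrite subrK opprD addrA.
Qed.

End Perturbation.

(** * Bisection of cubes *)

Section Bisection.
Context {R : realType} {n : nat}.
Local Open Scope ereal_scope.

Definition subcube_center (c : 'rV[R]_n) (r : R) (s : {ffun 'I_n -> bool}) : 'rV[R]_n :=
  (c + \row_i ((-1) ^+ s i * (r / 2)))%R.

Lemma subcube_centerP c r s : (0 <= r)%R -> (`|subcube_center c r s - c| <= r / 2)%R.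
Proof.
move=> r0; apply/cube_ball; first by rewrite divr_ge0.
move=> i; rewrite /subcube_center !mxE.
rewrite [X in `|X|%R](_ : _ = ((-1) ^+ s i * (r / 2))%R); last by ring.
rewrite normrM normrX normrN1 expr1n mul1r ger0_norm //.
by rewrite divr_ge0.
Qed.

Lemma subadditive_subcubes (nu : set (mvec n) -> \bar R) c r :
  nu set0 = 0 ->
  (forall A B, measurable A -> measurable B -> nu (A `|` B) <= nu A + nu B) ->
  (forall A B, measurable A -> measurable B -> A `<=` B -> nu A <= nu B) ->
  (0 < r)%R ->
  nu (cube c r) <=
  \sum_(s : {ffun 'I_n -> bool}) nu (cube (subcube_center c r s) (r / 2)%R).
Proof.
move=> nu0 nuU nuS r0.
pose A s : set (mvec n) := cube (subcube_center c r s) (r / 2)%R.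
have mA s : measurable (A s) by exact: measurable_cube.
have U (l : seq {ffun 'I_n -> bool}) :
    measurable (\big[setU/set0]_(s <- l) A s) /\
    nu (\big[setU/set0]_(s <- l) A s) <= \sum_(s <- l) nu (A s).
  elim: l => [|s l [IH1 IH2]]; first by rewrite !big_nil nu0.
  rewrite !big_cons; split; first exact: measurableU.
  by apply: le_trans (nuU _ _ (mA s) IH1) _; rewrite leeD2l.
have [U1 U2] := U (index_enum _).
apply: le_trans U2; apply: nuS => //; first exact: measurable_cube.
move=> v cv; rewrite -bigcup_seq.
(* The value [true] selects the lower half, as the offset carries the sign [(-1) ^+ s i]. *)
exists [ffun i => (v 0 i < c 0 i)%R] => [|i]; first exact: mem_index_enum.
rewrite /subcube_center !mxE ffunE; have := cv i; rewrite !ler_distl.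
by case: ltP => h; rewrite ?expr1 ?expr0 => /andP[h1 h2]; apply/andP; split; lra.
Qed.

(* If the bound failed on a cube, it would fail on one of its 2^n halves, and so on
   down to a point, around which it is assumed. *)
Lemma bisection (nu : set 'rV[R]_n -> \bar R) (C : R) c0 r0 : (0 < r0)%R ->
  (forall c r, (0 < r)%R -> nu (cube c r) <=
     \sum_(s : {ffun 'I_n -> bool}) nu (cube (subcube_center c r s) (r / 2)%R)) ->
  (forall x, cube c0 r0 x -> exists2 d : R, (0 < d)%R & forall c r,
      (0 < r < d)%R -> cube c r x -> nu (cube c r) <= (C * (2 * r) ^+ n)%:E) ->
  nu (cube c0 r0) <= (C * (2 * r0) ^+ n)%:E.
Proof.
move=> r00 nusub nuloc; rewrite leNgt; apply/negP => bad0.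
pose bad c r := (C * (2 * r) ^+ n)%:E < nu (cube c r).
have step c r : (0 < r)%R -> bad c r ->
    exists c', (`|c' - c| <= r / 2)%R /\ bad c' (r / 2)%R.
  move=> rp br.
  suff [s bs] : exists s, bad (subcube_center c r s) (r / 2)%R.
    by exists (subcube_center c r s); split=> //; apply: subcube_centerP; exact: ltW.
  apply: contrapT => /forallNP h; move: br; rewrite /bad ltNge => /negP; apply.
  apply: le_trans (nusub _ _ rp) _.
  apply: (@le_trans _ _ (\sum_(s : {ffun 'I_n -> bool}) (C * (2 * (r / 2)) ^+ n)%:E)).
    by apply: lee_sum => s _; rewrite leNgt; apply/negP; exact: h.
  rewrite sumEFin lee_fin sumr_const card_ffun card_bool card_ord.
  rewrite mulrCA divff // mulr1 exprMn -[leLHS]mulr_natl natrX.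
  by rewrite le_eqVlt; apply/orP; left; apply/eqP; ring.
pose rk k : R := (r0 / 2 ^+ k)%R.
have rkp k : (0 < rk k)%R by rewrite divr_gt0 ?exprn_gt0.
have rkS k : rk k.+1 = (rk k / 2)%R by rewrite /rk exprS invfM mulrA mulrAC.
(* The default [c] is never returned along the sequence below: its cubes are bad, so that [step]
   provides a point of the set. *)
pose next c r := xget c [set c' | (`|c' - c| <= r / 2)%R /\ bad c' (r / 2)%R].
pose ck := fix ck k := if k is k'.+1 then next (ck k') (rk k') else c0.
have ckbad k : bad (ck k) (rk k).
  elim: k => [|k IH]; first by rewrite /rk expr0 divr1.
  have [c' h] := step _ _ (rkp k) IH.
  by rewrite rkS /= /next; case: xgetP => [y _ []//|/(_ c')].
have ckS k : (`|ck k.+1 - ck k| <= rk k.+1)%R.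
  have [c' h] := step _ _ (rkp k) (ckbad k).
  by rewrite rkS /= /next; case: xgetP => [y _ []//|/(_ c')].
(* The displacements telescope, so every later centre stays in the [k]-th cube; a cluster point of
   the centres then lies in all cubes, which are closed. *)
have ckm k m : (`|ck (k + m)%N - ck k| <= rk k - rk (k + m)%N)%R.
  elim: m => [|m IH]; first by rewrite addn0 !subrr normr0.
  rewrite addnS -(subrK (ck (k + m)%N) (ck (k + m).+1)) -addrA.
  apply: le_trans (ler_normD _ _) _.
  have := ckS (k + m)%N; have : rk (k + m)%N = (2 * rk (k + m).+1)%R.
    by rewrite rkS mulrC divfK.
  move=> E h; apply: le_trans (lerD h IH) _; rewrite E; lra.
have ckin k m : (k <= m)%N -> cube (ck k) (rk k) (ck m).
  move=> /subnKC <-; apply/cube_ball; first exact: ltW.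
  by apply: le_trans (ckm _ _) _; rewrite gerBl ltW.
have closed_cube (c : 'rV[R]_n) (r : R) : (0 <= r)%R -> closed (cube c r).
  move=> r1.
  rewrite (_ : cube c r = closed_ball_ Num.norm c r); last first.
    apply/seteqP; split=> x; rewrite /closed_ball_ /=.
      by move=> /(cube_ball _ _ r1); rewrite distrC.
    by rewrite distrC => /(cube_ball _ _ r1).
  exact: closed_closed_ball_.
have cpt : compact (cube c0 r0).
  apply: bounded_closed_compact; last exact: closed_cube (ltW r00).
  exists (`|c0| + r0)%R; split=> [|y yr x]; first exact: num_real.
  move=> /(cube_ball _ _ (ltW r00)) xc.
  apply: ltW; apply: le_lt_trans yr.
  by rewrite -(subrK c0 x) [leRHS]addrC; apply: le_trans (ler_normD _ _) _; rewrite lerD2r.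
have [] := cpt (ck @ \oo) _.
  exists 0%N => // m _ /=.
  by have := ckin 0%N m isT; rewrite /rk expr0 divr1.
move=> x [Qx xcl].
have xin k : cube (ck k) (rk k) x.
  have := closed_cube (ck k) (rk k) (ltW (rkp k)); apply.
  move=> B xB; have := xcl (cube (ck k) (rk k)) B _ xB; apply.
  by exists k => // m /= km; exact: ckin.
have [d d0 hd] := nuloc x Qx.
have [k kd] : exists k, (rk k < d)%R.
  have h2 : (`|2^-1 : R| < 1)%R by rewrite ger0_norm ?invr_ge0 // invf_lt1 // ltr1n.
  have /cvgrPdist_lt /(_ (d / r0)%R (divr_gt0 d0 r00)) [k _ /(_ k (leqnn k))] := cvg_expr h2.
  rewrite sub0r normrN /= exprVn ger0_norm ?invr_ge0 ?exprn_ge0 // => hk.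
  by exists k; rewrite /rk mulrC -ltr_pdivlMr.
have := hd (ck k) (rk k); rewrite rkp kd => /(_ isT (xin k)).
by have := ckbad k; rewrite /bad ltNge => /negP.
Qed.

End Bisection.

(** * Volume of a small cube under a transition map *)

Section TransitionVolume.
Context {R : realType} {n : nat}.
Local Notation vec := 'rV[R]_n.
Local Open Scope ereal_scope.

Lemma measurable_preimage_mvec m (O : set vec) (phi : vec -> 'rV[R]_m) (A : set (mvec m)) :
  open O -> (forall u, O u -> {for u, continuous phi}) -> measurable A ->
  measurable (O `&` phi @^-1` A : set (mvec n)).
Proof.
move=> oO phic mA.
have mO : measurable (O : set (mvec n)) by exact: open_measurable_mvec.
suff : measurable_fun (O : set (mvec n)) (phi : mvec n -> mvec m) by move=> /(_ mO _ mA).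
apply: (@measurability _ _ (mvec n : measurableType _) (mvec m : measurableType _) O phi (@cylinders R m)) => //.
move=> _ [_ [i [B [mB ->]]] <-].
have := @continuous_measurable_mvec R n O (fun u => phi u 0%R i) oO.
apply=> // u Ou; exact: (continuous_mx phi u).2 (phic _ Ou) 0%R i.
Qed.

Lemma vol_affine_preimage (N : 'M[R]_n) t c (r : R) : trailing_minors_unit N -> (0 <= r)%R ->
  vol n [set u | cube c r (u *m N + t)%R] = (`|\det N|^-1 * (2 * r) ^+ n)%:E.
Proof.
move=> Ng r0; have mc : measurable (cube c r : set (mvec n)) by exact: measurable_cube.
have H := integral_vol_affine (A:=N) t (f:=fun v => (\1_(cube c r : set (mvec n)) v)%:E) Ng.
rewrite EFinM -(vol_cube c r0) -[in RHS](setIT (cube c r)) -integral_indic // -H; last 2 first.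
- by apply/measurable_EFinP; exact: measurable_indic.
- by move=> x; rewrite lee_fin.
have mp : measurable ([set u | cube c r (u *m N + t)%R] : set (mvec n)).
  rewrite -[X in measurable X]setTI.
  apply: (@measurable_smooth R n n (fun u => u *m N + t)%R) mc => //.
  apply: smooth_onD; [exact: openT| |exact: smooth_on_cst].
  by apply: smooth_on_mulmx; [exact: openT|exact: smooth_on_id|exact: smooth_on_cst].
by rewrite -[in LHS](setIT [set u | _]) -integral_indic.
Qed.

(** If [phi u] lies in a cube that contains [phi u0], the affine approximation at [u] lies in the
    doubled cube. Locally, the preimage of a cube under [phi] is thus contained in the preimage of a
    cube under an affine map, whose volume is known. *)
Lemma diff_invertible_estimate (O : set vec) (phi : vec -> vec) u0 : open O -> O u0 ->
  differentiable phi u0 -> 'J phi u0 \in unitmx ->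
  exists N, [/\ trailing_minors_unit N, (`|\det ('J phi u0)| <= 2 * `|\det N|)%R &
   \forall u \near u0, forall c r, (0 <= r)%R -> cube c r (phi u0) -> cube c r (phi u) ->
     cube c (2 * r)%R (u *m N + (phi u0 - u0 *m N))%R].
Proof.
move=> oO Ou0 pd; set J := 'J phi u0 => Ju.
pose L : R := (n%:R * `|invmx J| + 1)%R.
have L0 : (0 < L)%R by rewrite ltr_wpDl // mulr_ge0.
(* As L e = 1/8, the estimate |v| <= L (2 r + e |v|) gives |v| <= 4 L r, and the two errors e |v|
   together are at most [r]. *)
pose e : R := ((8 * L)^-1)%R.
have e0 : (0 < e)%R by rewrite invr_gt0 mulr_gt0.
have [N [N1 N2 N3]] := exists_trailing_minors_unit Ju e0.
exists N; split=> //.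
have := diff_approx pd e0; rewrite -/J; apply: filterS => u hu c r r0.
move=> /(cube_ball _ _ r0) h0 /(cube_ball _ _ r0) h1.
apply/cube_ball; first by rewrite mulr_ge0.
set v := (u - u0)%R in hu.
have vJ : (`|v| <= L * `|v *m J|)%R.
  rewrite -{1}(mulmxK Ju v); apply: le_trans (norm_mulmx_le _ _) _.
  by rewrite ler_wpM2r // /L lerDl.
have d2r : (`|phi u - phi u0| <= 2 * r)%R.
  rewrite -(subrK c (phi u)) -addrA; apply: le_trans (ler_normD _ _) _.
  rewrite (distrC c); lra.
have vJ2 : (`|v *m J| <= `|phi u - phi u0| + e * `|v|)%R.
  have -> : (v *m J = (phi u - phi u0) - (phi u - phi u0 - v *m J))%R by rewrite opprB addrC subrK.
  by apply: le_trans (ler_normB _ _) _; rewrite lerD2l.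
have Le : (L * e = 8^-1)%R by rewrite /e invfM mulrCA mulrV ?unitfE ?gt_eqF // mulr1.
have vr : (`|v| <= 4 * L * r)%R.
  have : (`|v| <= L * (2 * r + e * `|v|))%R.
    apply: le_trans vJ _; rewrite ler_pM2l //; lra.
  rewrite mulrDr [(L * (e * _))%R]mulrA Le.
  have : (0 <= L * r)%R by rewrite mulr_ge0 // ltW.
  have -> : (L * (2 * r) = 2 * (L * r))%R by ring.
  have -> : (4 * L * r = 4 * (L * r))%R by ring.
  move: (L * r)%R (`|v|)%R (normr_ge0 v) => Lr y y0; lra.
have err : (`|phi u - phi u0 - v *m N| <= r)%R.
  have -> : (phi u - phi u0 - v *m N = (phi u - phi u0 - v *m J) - v *m (N - J))%R.
    by rewrite mulmxBr opprB addrA subrK.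
  apply: le_trans (ler_normB _ _) _.
  apply: (@le_trans _ _ (e * `|v| + e * `|v|)%R); first by rewrite lerD.
  have : (e * `|v| <= e * (4 * L * r))%R by rewrite ler_pM2l.
  have -> : (e * (4 * L * r) = 4 * r * (L * e))%R by ring.
  rewrite Le; lra.
have -> : (u *m N + (phi u0 - u0 *m N) - c = (phi u - c) - (phi u - phi u0 - v *m N))%R.
  rewrite /v mulmxBl; move: (u *m N) (u0 *m N) (phi u) (phi u0) => a1 a2 a3 a4.
  by apply/rowP => i; rewrite !mxE; ring.
apply: le_trans (ler_normB _ _) _; lra.
Qed.

(** An upper bound up to a constant takes the place of the change of variables formula. In
    [4 * C0 * 2 ^+ n], one factor 2 comes from the continuity of [w], the other from the determinant
    of the perturbed Jacobian, and [2 ^+ n] from doubling the cube. *)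
Lemma transition_volume_bound (O O' : set vec) (phi psi : vec -> vec) (w W : vec -> R) c0 r0 C0 :
  open O -> open O' ->
  (forall u, O u -> O' (phi u)) -> (forall x, O' x -> O (psi x)) ->
  (forall u, O u -> psi (phi u) = u) -> (forall x, O' x -> phi (psi x) = x) ->
  (forall u, O u -> differentiable phi u) ->
  (forall x, O' x -> {for x, continuous psi}) ->
  (forall u, O u -> 'J phi u \in unitmx) ->
  (forall u, O u -> {for u, continuous (w : vec -> R^o)}) ->
  (forall u, O u -> 0 < w u)%R ->
  (forall u, O u -> w u = `|\det ('J phi u)| * W (phi u))%R ->
  (0 <= C0)%R -> (forall x, cube c0 r0 x -> W x <= C0)%R -> (0 < r0)%R ->
  \int[vol n]_(u in (O `&` phi @^-1` (cube c0 r0) : set (mvec n))) (w u)%:E <=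
    (4 * C0 * 2 ^+ n * (2 * r0) ^+ n)%:E.
Proof.
move=> oO oO' Ophi Opsi psiK phiK pd psic Ju wc w0 wW C00 WC r00.
have pc u (Ou : O u) : {for u, continuous phi} by exact: differentiable_continuous (pd _ Ou).
have mO : measurable (O : set (mvec n)) by exact: open_measurable_mvec.
have mw : measurable_fun (O : set (mvec n)) (fun u => (w u)%:E).
  by apply/measurable_EFinP; exact: continuous_measurable_mvec.
have mpre (A : set (mvec n)) : measurable A -> measurable (O `&` phi @^-1` A : set (mvec n)).
  exact: measurable_preimage_mvec.
have mwS (A : set (mvec n)) : measurable A ->
    measurable_fun (O `&` phi @^-1` A : set (mvec n)) (fun u => (w u)%:E).
  by move=> mA; apply: measurable_funS mw => //; exact: subIsetl.
have wge0 (A : set vec) u : (O `&` A) u -> 0 <= (w u)%:E.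
  by move=> [Ou _]; rewrite lee_fin ltW // w0.
(* Bisection asks for an estimate near every point of the cube, including points outside [O']. The
   sets [K m] are closed and exhaust [O']; once the integral is restricted to [K m], nothing remains
   to be estimated near such points. *)
pose K m : set vec := [set x | forall y, (`|y - x| < m.+1%:R^-1)%R -> O' y].
have K0 (x : vec) m : ~ K m x -> exists2 d : R, (0 < d)%R & forall z : vec, (`|z - x| < d)%R -> ~ K m z.
  move=> /existsNP [y /not_implyP [yx nO]].
  exists (m.+1%:R^-1 - `|y - x|)%R => [|z zx Kz]; first by rewrite subr_gt0.
  apply/nO/Kz; rewrite -(subrK x y) -addrA.
  apply: le_lt_trans (ler_normD _ _) _; rewrite (distrC x).
  by rewrite addrC -ltrBrDr.
have mK m : measurable (K m : set (mvec n)).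
  rewrite -[X in measurable X]setCK; apply: measurableC; apply: open_measurable_mvec.
  rewrite openE => x /= /K0 [d d0 hd]; apply/nbhs_ballP; exists d => // z.
  by rewrite -ball_normE /= distrC => /hd.
pose nu m (A : set (mvec n)) := \int[vol n]_(u in O `&` phi @^-1` (A `&` K m)) (w u)%:E.
have main m : nu m (cube c0 r0) <= (4 * C0 * 2 ^+ n * (2 * r0) ^+ n)%:E.
  apply: bisection => // [c r rp|x Qx].
    apply: subadditive_subcubes => //.
    - by rewrite /nu set0I preimage_set0 setI0 integral_set0.
    - move=> A B mA mB; rewrite /nu.
      have -> : O `&` phi @^-1` ((A `|` B) `&` K m) =
          (O `&` phi @^-1` (A `&` K m)) `|` (O `&` phi @^-1` ((B `\` A) `&` K m)).
        apply/seteqP; split=> u /=.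
          move=> [Ou [[Au|Bu] Ku]]; first by left.
          by have [Au|nAu] := pselect (A (phi u)); [left|right].
        by move=> [[Ou [Au Ku]]|[Ou [[Bu _] Ku]]]; split=> //; split=> //; [left|right].
      rewrite ge0_integral_setU //; last 5 first.
      - by apply: mpre; exact: measurableI.
      - by apply: mpre; apply: measurableI => //; exact: measurableD.
      - by rewrite -setIUr -preimage_setU; apply: mwS; apply: measurableU;
          apply: measurableI => //; exact: measurableD.
      - by move=> u [] /wge0.
      - apply/disj_setPLR => u [_ [Au _]] [_ [[_]]] //.
      rewrite leeD2l //; apply: ge0_subset_integral => //.
      - by apply: mpre; apply: measurableI => //; exact: measurableD.
      - by apply: mpre; exact: measurableI.
      - by apply: mwS; exact: measurableI.
      - by move=> u /wge0.
      - by move=> u [Ou [[Bu _] Ku]].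
    - move=> A B mA mB AB; apply: ge0_subset_integral => //.
      - by apply: mpre; exact: measurableI.
      - by apply: mpre; exact: measurableI.
      - by apply: mwS; exact: measurableI.
      - by move=> u /wge0.
      - by move=> u [Ou [/AB]].
  have Cge0 (r : R) : (0 < r)%R -> 0 <= (4 * C0 * 2 ^+ n * (2 * r) ^+ n)%:E.
    by move=> rp; rewrite lee_fin !mulr_ge0 // exprn_ge0 // mulr_ge0 // ltW.
  (* Outside the closed set [K m], small cubes around [x] miss it and the integral vanishes. *)
  have [Kx|nKx] := pselect (K m x); last first.
    have [d d0 hd] := K0 _ _ nKx.
    exists (d / 2)%R => [|c r /andP[rp rd] cx]; first by rewrite divr_gt0.
    rewrite /nu (_ : _ `&` _ = set0) ?integral_set0 ?Cge0 //.
    apply/seteqP; split=> // u [Ou [/(cube_ball _ _ (ltW rp)) cu]]; apply: hd.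
    move/(cube_ball _ _ (ltW rp)) : cx => cx.
    rewrite -(subrK c (phi u)) -addrA; apply: le_lt_trans (ler_normD _ _) _.
    rewrite (distrC c); lra.
  have O'x : O' x by apply: Kx; rewrite subrr normr0.
  pose u0 := psi x; have Ou0 : O u0 by exact: Opsi.
  have xE : phi u0 = x by exact: phiK.
  have [N [N1 N2 N3]] := diff_invertible_estimate oO Ou0 (pd _ Ou0) (Ju _ Ou0).
  have [d1 d10 h1] := continuous_forP (wc _ Ou0) (w0 _ Ou0).
  have [d2 /= d20 h2] : exists2 d2 : R, (0 < d2)%R & forall u, (`|u - u0| < d2)%R ->
      forall c r, (0 <= r)%R -> cube c r (phi u0) -> cube c r (phi u) ->
      cube c (2 * r)%R (u *m N + (phi u0 - u0 *m N))%R.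
    move/nbhs_ballP: N3 => [d2 d20 H]; exists d2 => // u.
    by rewrite distrC => hu; apply: H; rewrite -ball_normE.
  have d12 : (0 < Num.min d1 d2)%R by rewrite lt_min d10.
  have [d3 d30 h3] : exists2 d3 : R, (0 < d3)%R & forall y, (`|y - x| < d3)%R ->
      (`|psi y - u0| < Num.min d1 d2)%R.
    have /cvgrPdist_lt /(_ _ d12) /nbhs_ballP [d3 d30 H] := psic _ O'x.
    by exists d3 => // y yx; rewrite distrC; apply: H; rewrite -ball_normE /= distrC.
  exists (d3 / 2)%R => [|c r /andP[rp rd] cx]; first by rewrite divr_gt0.
  have Dsub u : (O `&` phi @^-1` (cube c r `&` K m)) u ->
     (w u <= 2 * w u0)%R /\ cube c (2 * r)%R (u *m N + (phi u0 - u0 *m N))%R.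
    move=> [Ou [cu _]].
    have hu : (`|u - u0| < Num.min d1 d2)%R.
      rewrite -(psiK u Ou); apply: h3.
      move/(cube_ball _ _ (ltW rp)) : cx; move/(cube_ball _ _ (ltW rp)) : (cu) => cu' cx.
      rewrite -(subrK c (phi u)) -addrA; apply: le_lt_trans (ler_normD _ _) _.
      rewrite (distrC c); lra.
    move: hu; rewrite lt_min => /andP[hu1 hu2]; split.
      have := h1 _ hu1; rewrite ltr_norml => /andP[_]; lra.
    by apply: h2 => //; [exact: ltW|rewrite xE].
  have mD : measurable (O `&` phi @^-1` (cube c r `&` K m) : set (mvec n)).
    by apply: mpre; apply: measurableI => //; exact: measurable_cube.
  apply: (@le_trans _ _ (\int[vol n]_(u in (O `&` phi @^-1` (cube c r `&` K m) : set (mvec n))) (2 * w u0)%:E)).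
    apply: ge0_le_integral => //.
    - by move=> u /wge0.
    - by apply: mwS; apply: measurableI => //; exact: measurable_cube.
    - by move=> u /Dsub [h _]; rewrite lee_fin.
  rewrite integral_cst //.
  have r20 : (0 <= 2 * r)%R by rewrite mulr_ge0 // ltW.
  have volD : vol n (O `&` phi @^-1` (cube c r `&` K m)) <=
      (`|\det N|^-1 * (2 * (2 * r)) ^+ n)%:E.
    rewrite -(@vol_affine_preimage N (phi u0 - u0 *m N)%R c (2 * r)%R) //.
    apply: le_measure; rewrite ?inE //; last by move=> u /Dsub [].
    rewrite -[X in measurable X]setTI.
    apply: (@measurable_smooth R n n (fun u => u *m N + (phi u0 - u0 *m N))%R) (measurable_cube _ _) => //.
    apply: smooth_onD; [exact: openT| |exact: smooth_on_cst].
    by apply: smooth_on_mulmx; [exact: openT|exact: smooth_on_id|exact: smooth_on_cst].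
  have w2 : (0 <= 2 * w u0)%R by rewrite mulr_ge0 // ltW // w0.
  apply: le_trans (lee_wpmul2l _ volD) _; first by rewrite lee_fin.
  rewrite -EFinM lee_fin.
  have Nu := trailing_minors_unitmx N1.
  have dN : (0 < `|\det N|)%R by rewrite normr_gt0; move: Nu; rewrite unitmxE unitfE.
  have -> : (2 * w u0 * (`|\det N|^-1 * (2 * (2 * r)) ^+ n) =
     (2 * w u0 / `|\det N|) * (2 ^+ n * (2 * r) ^+ n))%R by rewrite exprMn; ring.
  rewrite -[leRHS]mulrA ler_wpM2r ?mulr_ge0 ?exprn_ge0 //.
  rewrite ler_pdivrMr // wW // xE.
  have WCx := WC _ Qx.
  have := normr_ge0 (\det ('J phi u0)).
  move: (`|\det ('J phi u0)|)%R (`|\det N|)%R dN N2 => a b b0 ab a0.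
  have : (a * W x <= a * C0)%R by rewrite ler_wpM2l.
  have : (a * C0 <= 2 * b * C0)%R by rewrite ler_wpM2r.
  lra.
(* Monotone convergence along the exhaustion of [O']; the bound in [main] does not depend on [m]. *)
have cv := @ge0_nondecreasing_set_cvg_integral _ _ R
  (fun m => O `&` phi @^-1` (cube c0 r0 `&` K m) : set (mvec n)) (fun u => (w u)%:E) (vol n).
have UE : \bigcup_m (O `&` phi @^-1` (cube c0 r0 `&` K m)) = O `&` phi @^-1` (cube c0 r0).
  apply/seteqP; split=> [u [m _ [Ou [cu _]]] //|u [Ou cu]].
  have [e e0 he] := near_ball_segment oO' (Ophi _ Ou).
  have [m _ /(_ m (leqnn m)) hm] := near_infty_natSinv_lt (PosNum e0).
  exists m => //; split=> //; split=> // y yu; apply: he; exact: lt_trans yu hm.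
rewrite -UE; apply: (cvge_le _ (cv _ _ _ _)).
- by near=> m; exact: main.
- apply/nondecreasing_seqP => m; rewrite subsetEset => u [Ou [cu Ku]]; split=> //; split=> // y yu.
  by apply: Ku; apply: lt_le_trans yu _; rewrite lef_pV2 ?posrE // ler_nat.
- by move=> m; apply: mpre; apply: measurableI => //; exact: measurable_cube.
- by move=> m; apply: mwS; apply: measurableI => //; exact: measurable_cube.
- by move=> m u /wge0.
Unshelve. all: by end_near. Qed.

End TransitionVolume.

(** * Connection and curvature *)

Section MatrixDerivatives.
Context {R : realType} {V : normedModType R}.

Lemma is_derive_mxP m n (A : V -> 'M[R]_(m, n)) x v dA :
  is_derive x v A dA <->
  forall i j, is_derive x v (fun y => A y i j : R^o) (dA i j).
Proof.
split=> [[d1 d2] i j|h].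
  have := (derivable_mxP A x v).1 d1 i j => d3.
  by split=> //; rewrite -d2 derive_mx // mxE.
have d1 : derivable A x v by apply/derivable_mxP => i j; have [] := h i j.
split=> //; rewrite derive_mx //; apply/matrixP => i j; rewrite mxE.
by have [_ ->] := h i j.
Qed.

Lemma is_derive_sumr (I : Type) (r : seq I) (f : I -> V -> R^o) (df : I -> R) x v :
  (forall i, is_derive x v (f i) (df i)) ->
  is_derive x v (fun y => \sum_(i <- r) f i y : R^o) (\sum_(i <- r) df i).
Proof.
move=> fd; elim: r => [|i r IH].
  under eq_fun do rewrite big_nil.
  by rewrite big_nil; exact: is_derive_cst.
under eq_fun do rewrite big_cons.
rewrite big_cons; exact: is_deriveD.
Qed.

Lemma is_derive_mulr (f g : V -> R^o) x v df dg :
  is_derive x v f df -> is_derive x v g dg ->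
  is_derive x v (fun y => f y * g y : R^o) (df * g x + f x * dg).
Proof.
move=> fd gd.
have H : is_derive x v (fun y => f y * g y : R^o) (f x *: dg + g x *: df).
  exact: (@is_deriveM R V f g x v df dg fd gd).
by apply: (is_derive_eq H); rewrite addrC; congr (_ + _); exact: mulrC.
Qed.

Lemma is_derive_mulmx m n p (A : V -> 'M[R]_(m, n)) (B : V -> 'M[R]_(n, p)) x v dA dB :
  is_derive x v A dA -> is_derive x v B dB ->
  is_derive x v (fun y => A y *m B y) (dA *m B x + A x *m dB).
Proof.
move=> /is_derive_mxP Ad /is_derive_mxP Bd; apply/is_derive_mxP => i j.
under eq_fun do rewrite mxE.
rewrite !mxE -big_split /=; apply: is_derive_sumr => k.
exact: is_derive_mulr.
Qed.

Lemma is_derive_trmx m n (A : V -> 'M[R]_(m, n)) x v dA :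
  is_derive x v A dA -> is_derive x v (fun y => (A y)^T) dA^T.
Proof.
move=> /is_derive_mxP Ad; apply/is_derive_mxP => i j; rewrite mxE.
by under eq_fun do rewrite mxE.
Qed.

Lemma is_derive_near_eq {W : normedModType R} (f g : V -> W) x v df :
  (\forall y \near x, f y = g y) -> is_derive x v f df -> is_derive x v g df.
Proof. exact: near_eq_is_derive. Qed.

Lemma smooth_on_is_derive {W : normedModType R} U (f : V -> W) x v :
  smooth_on U f -> U x -> is_derive x v f ('D_v f x).
Proof. by move=> fs Ux; apply: derivableP; exact: smooth_on_derivable fs Ux. Qed.

(** Serves to differentiate an identity that holds on an open set. *)
Lemma is_derive_near_cst {W : normedModType R} (f : V -> W) x v df c :
  (\forall y \near x, f y = c) -> is_derive x v f df -> df = 0.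
Proof.
move=> fc fd; have H := is_derive_near_eq fc fd.
by rewrite -(@derive_val _ _ _ _ _ _ _ H) derive_cst.
Qed.

End MatrixDerivatives.

(** * Bilinear forms given by matrices *)

Section Bilinear.
Context {R : realType} {n : nat}.
Local Notation vec := 'rV[R]_n.
Implicit Types (A B : 'M[R]_n) (x y z : vec).

(* The opaque witness keeps unification from unfolding [bil]; the same device is
   used for the definitions by [sval] below. *)
Fact bil_sig : {f : 'M[R]_n -> vec -> vec -> R | f = fun A x y => (x *m A *m y^T) 0 0}.
Proof. by eexists. Qed.
Definition bil := sval bil_sig.

Lemma bilv A x y : bil A x y = (x *m A *m y^T) 0 0.
Proof. by rewrite /bil (svalP bil_sig). Qed.

Lemma bilDl A x x' y : bil A (x + x') y = bil A x y + bil A x' y.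
Proof. by rewrite !bilv !mulmxDl mxE. Qed.
Lemma bilDr A x y y' : bil A x (y + y') = bil A x y + bil A x y'.
Proof. by rewrite !bilv raddfD mulmxDr mxE. Qed.
Lemma bilNl A x y : bil A (- x) y = - bil A x y.
Proof. by rewrite !bilv !mulNmx mxE. Qed.
Lemma bilNr A x y : bil A x (- y) = - bil A x y.
Proof. by rewrite !bilv raddfN mulmxN mxE. Qed.
Lemma bilBl A x x' y : bil A (x - x') y = bil A x y - bil A x' y.
Proof. by rewrite bilDl bilNl. Qed.
Lemma bilBr A x y y' : bil A x (y - y') = bil A x y - bil A x y'.
Proof. by rewrite bilDr bilNr. Qed.
Lemma bilZl A (a : R) x y : bil A (a *: x) y = a * bil A x y.
Proof. by rewrite !bilv -!scalemxAl mxE. Qed.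
Lemma bilZr A (a : R) x y : bil A x (a *: y) = a * bil A x y.
Proof. by rewrite !bilv linearZ -scalemxAr mxE. Qed.
Lemma bil0l A y : bil A 0 y = 0.
Proof. by rewrite !bilv !mul0mx mxE. Qed.
Lemma bil0r A x : bil A x 0 = 0.
Proof. by rewrite !bilv trmx0 mulmx0 mxE. Qed.
Lemma bil0A x y : bil 0 x y = 0.
Proof. by rewrite !bilv mulmx0 mul0mx mxE. Qed.
Lemma bilDA A B x y : bil (A + B) x y = bil A x y + bil B x y.
Proof. by rewrite !bilv mulmxDr mulmxDl mxE. Qed.
Lemma bilZA A a x y : bil (a *: A) x y = a * bil A x y.
Proof. by rewrite !bilv -scalemxAr -scalemxAl mxE. Qed.
Lemma bil_suml A (I : Type) (r : seq I) (f : I -> vec) y :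
  bil A (\sum_(i <- r) f i) y = \sum_(i <- r) bil A (f i) y.
Proof. by elim/big_rec2: _ => [|i a b _ <-]; rewrite ?bil0l ?bilDl. Qed.
Lemma bil_sumr A (I : Type) (r : seq I) (f : I -> vec) x :
  bil A x (\sum_(i <- r) f i) = \sum_(i <- r) bil A x (f i).
Proof. by elim/big_rec2: _ => [|i a b _ <-]; rewrite ?bil0r ?bilDr. Qed.
Lemma bilC A x y : A^T = A -> bil A x y = bil A y x.
Proof.
move=> As; transitivity ((x *m A *m y^T)^T 0 0); first by rewrite mxE bilv.
by rewrite bilv !trmx_mul trmxK As mulmxA.
Qed.
Lemma bil_congr (M : 'M[R]_n) A x y : bil (M *m A *m M^T) x y = bil A (x *m M) (y *m M).
Proof. by rewrite !bilv trmx_mul !mulmxA. Qed.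
Lemma bilE A x y : bil A x y = \sum_k \sum_l x 0 k * A k l * y 0 l.
Proof.
rewrite !bilv mxE exchange_big /=; apply: eq_bigr => l _.
by rewrite !mxE mulr_suml.
Qed.

Lemma bil_inj A x y : A \in unitmx -> (forall z, bil A x z = bil A y z) -> x = y.
Proof.
move=> Au h; apply/eqP; rewrite -subr_eq0; apply/eqP.
rewrite -[x - y](mulmxK Au) (_ : (x - y) *m A = 0) ?mul0mx //.
apply/rowP => l; have := h (delta_mx 0 l).
rewrite mulmxBl !bilv trmx_delta -!colE !mxE => ->; exact: subrr.
Qed.

Lemma is_derive_bil {V : normedModType R} (A : V -> 'M[R]_n) (X Y : V -> vec) u v dA dX dY :
  is_derive u v A dA -> is_derive u v X dX -> is_derive u v Y dY ->
  is_derive u v (fun w => bil (A w) (X w) (Y w) : R^o)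
    (bil dA (X u) (Y u) + bil (A u) dX (Y u) + bil (A u) (X u) dY).
Proof.
move=> Ad Xd Yd.
have /is_derive_mxP /(_ 0 0) H := is_derive_mulmx (is_derive_mulmx Xd Ad) (is_derive_trmx Yd).
under eq_fun do rewrite bilv.
apply: (is_derive_eq H).
by rewrite !bilv mulmxDl !mxE; ring.
Qed.

Lemma smooth_on_bil {V : normedModType R} (U : set V) (A : V -> 'M[R]_n) (X Y : V -> vec) :
  open U -> smooth_on U A -> smooth_on U X -> smooth_on U Y ->
  smooth_on U (fun w => bil (A w) (X w) (Y w) : R^o).
Proof.
move=> oU As Xs Ys; under eq_fun do rewrite bilv.
apply: (smooth_on_mxP _ oU).1 0 0.
apply: smooth_on_mulmx => //; last exact: smooth_on_trmx.
exact: smooth_on_mulmx.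
Qed.

End Bilinear.

(** * Time and space derivatives as directional derivatives on a product *)

Section ProductSpace.
Context {R : realType} {V : normedModType R}.
Implicit Types (Z : set (R^o * V)%type).

Lemma derive_slice {W : normedModType R} (f : R^o * V -> W) t u v :
  'D_v (fun w => f (t, w)) u = 'D_((0, v) : R^o * V) f (t, u).
Proof.
rewrite /derive; set g1 := fun h => h^-1 *: _; set g2 := fun h => h^-1 *: _.
suff -> : g1 = g2 by [].
apply/funext => h; rewrite /g1 /g2 /=; congr (_ *: (f _ - _)).
by congr pair; rewrite [RHS]/= scaler0 add0r.
Qed.

Lemma derivable_slice {W : normedModType R} (f : R^o * V -> W) t u v :
  derivable f (t, u) ((0, v) : R^o * V) -> derivable (fun w => f (t, w)) u v.
Proof.
rewrite /derivable; set g1 := fun h => h^-1 *: _; set g2 := fun h => h^-1 *: _.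
suff -> : g1 = g2 by [].
apply/funext => h; rewrite /g1 /g2 /=; congr (_ *: (f _ - _)).
by congr pair; rewrite [LHS]/= scaler0 add0r.
Qed.

Lemma derive_time {W : normedModType R} (f : R^o * V -> W) t u :
  'D_1 (fun s : R^o => f (s, u)) t = 'D_((1, 0) : R^o * V) f (t, u).
Proof.
rewrite /derive; set g1 := fun h => h^-1 *: _; set g2 := fun h => h^-1 *: _.
suff -> : g1 = g2 by [].
apply/funext => h; rewrite /g1 /g2 /=; congr (_ *: (f _ - _)).
by congr pair; rewrite [RHS]/= scaler0 add0r.
Qed.

Lemma derivable_time {W : normedModType R} (f : R^o * V -> W) t u :
  derivable f (t, u) ((1, 0) : R^o * V) -> derivable (fun s : R^o => f (s, u)) t 1.
Proof.
rewrite /derivable; set g1 := fun h => h^-1 *: _; set g2 := fun h => h^-1 *: _.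
suff -> : g1 = g2 by [].
apply/funext => h; rewrite /g1 /g2 /=; congr (_ *: (f _ - _)).
by congr pair; rewrite [LHS]/= scaler0 add0r.
Qed.

Lemma continuous_slice {W : normedModType R} (f : R^o * V -> W) t u :
  {for (t, u), continuous f} -> {for u, continuous (fun w => f (t, w))}.
Proof.
move=> fc; apply: (@continuous_comp _ _ _ (fun w : V => (t, w) : R^o * V) f) => //.
move=> A [[B C] [/= Bt Cu] BC]; apply: filterS Cu => w Cw; apply: (BC (t, w)).
by split=> //=; exact: nbhs_singleton Bt.
Qed.

Lemma Ck_on_slice {W : normedModType R} k Z (f : R^o * V -> W) t :
  Ck_on k Z f -> Ck_on k [set u | Z (t, u)] (fun u => f (t, u)).
Proof.
elim: k f => [|k IH] f fk.
  by split=> // u Zu; apply: continuous_slice; exact: fk.1.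
split=> [u Zu|v]; first by apply: continuous_slice; exact: fk.1.
split=> [u Zu|]; first by apply: derivable_slice; exact: Ck_on_derivable fk Zu.
rewrite (_ : (fun x => _) = (fun u => 'D_((0, v) : R^o * V) f (t, u))).
  exact: IH (Ck_onS _ fk).
by apply/funext => u; rewrite derive_slice.
Qed.

Lemma smooth_on_slice {W : normedModType R} Z (f : R^o * V -> W) t :
  smooth_on Z f -> smooth_on [set u | Z (t, u)] (fun u => f (t, u)).
Proof. by move=> fs k; exact: Ck_on_slice (fs k). Qed.

Lemma Ck_on_snd {W : normedModType R} k (U : set V) (f : V -> W) :
  Ck_on k U f -> Ck_on k [set z : R^o * V | U z.2] (fun z => f z.2).
Proof.
elim: k f => [|k IH] f fk.
  split=> // z Uz; apply: (@continuous_comp _ _ _ snd f); last exact: fk.1.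
  exact: cvg_snd.
have E (z : R^o * V) (w : R^o * V) :
    (fun h : R => h^-1 *: (((fun z : R^o * V => f z.2) \o shift z) (h *: w) - f z.2)) =
    (fun h : R => h^-1 *: ((f \o shift z.2) (h *: w.2) - f z.2)) by [].
split=> [z Uz|w].
  apply: (@continuous_comp _ _ _ snd f); last exact: fk.1.
  exact: cvg_snd.
split=> [z Uz|]; first by rewrite /derivable E; exact: Ck_on_derivable fk Uz.
rewrite (_ : (fun x => _) = (fun z => 'D_(w.2) f z.2)); first exact: IH (Ck_onS _ fk).
by apply/funext => z; rewrite /derive E.
Qed.

Lemma smooth_on_snd {W : normedModType R} (U : set V) (f : V -> W) :
  smooth_on U f -> smooth_on [set z : R^o * V | U z.2] (fun z => f z.2).
Proof. by move=> fs k; exact: Ck_on_snd (fs k). Qed.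

Lemma smooth_on_fst (Z : set (R^o * V)%type) : smooth_on Z (fun z => z.1 : R^o).
Proof.
have E (z : R^o * V) (w : R^o * V) :
    (fun h : R => h^-1 *: (((fun z : R^o * V => z.1 : R^o) \o shift z) (h *: w) - z.1)) =
    (fun h : R => h^-1 *: ((id \o shift z.1) (h *: w.1) - z.1)) by [].
have fc (z : R^o * V) : {for z, continuous (fun z : R^o * V => z.1 : R^o)}.
  move=> A Az; exists (A, setT) => /=; first by split=> //; exact: filterT.
  by move=> [a b] [].
move=> [|k]; first by split=> [z _|]; [exact: fc|].
split=> [z _|w]; first exact: fc.
split=> [z _|]; first by rewrite /derivable E; exact: derivable_id.
rewrite (_ : (fun x => _) = cst w.1); first exact: Ck_on_cst.
by apply/funext => z; rewrite /derive E; exact: (derive_id z.1 w.1).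
Qed.

Lemma open_prodr (U : set V) : open U -> open [set z : R^o * V | U z.2].
Proof.
move=> oU; rewrite openE => -[t u] /= Uu; exists (setT, U) => /=.
  by split; [exact: filterT|exact: open_near].
by move=> [s w] [].
Qed.

End ProductSpace.

Section MatrixDerivatives.
Context {R : realType}.

Lemma derive_entry {V : normedModType R} m p (M : V -> 'M[R]_(m, p)) (t v : V) i j :
  derivable M t v -> 'D_v (fun s => M s i j : R^o) t = 'D_v M t i j.
Proof. by move=> Md; rewrite derive_mx // mxE. Qed.

Lemma schwarz_mx {V : normedModType R} m p (U : set V) (f : V -> 'M[R]_(m, p)) (x v w : V) :
  open U -> U x -> smooth_on U f ->
  'D_v (fun y : V => 'D_w f y) x = 'D_w (fun y : V => 'D_v f y) x.
Proof.
move=> oU Ux fs.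
have dd a b : derivable (fun y : V => 'D_a f y) x b.
  by apply: smooth_on_derivable Ux; exact: smooth_on_derive.
apply/matrixP => i j.
have E a b : 'D_b (fun y : V => 'D_a f y i j : R^o) x =
    'D_b (fun y : V => 'D_a (fun y : V => f y i j : R^o) y) x.
  apply: near_eq_derive; apply: open_near_eq oU Ux _ => y Uy.
  by apply/esym/derive_entry; exact: smooth_on_derivable fs Uy.
apply: (etrans (esym (derive_entry i j (dd w v)))).
apply: (etrans _ (derive_entry i j (dd v w))).
apply: (etrans (E w v)); apply: (etrans _ (esym (E v w))); apply: (schwarz _ _ oU Ux).
exact: (smooth_on_mxP _ oU).1 fs i j 2%N.
Qed.

Lemma is_derive_row_bil {V : normedModType R} n p (K : 'I_p -> V -> 'M[R]_n)
    (dK : 'I_p -> 'M[R]_n) (X Y : V -> 'rV[R]_n) (u w : V) dX dY :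
  (forall k, is_derive u w (K k) (dK k)) -> is_derive u w X dX -> is_derive u w Y dY ->
  is_derive u w (fun v => \row_k bil (K k v) (X v) (Y v) : 'rV[R]_p)
    (\row_k bil (dK k) (X u) (Y u) + \row_k bil (K k u) dX (Y u) + \row_k bil (K k u) (X u) dY).
Proof.
move=> Kd Xd Yd; apply/is_derive_mxP => i k.
under eq_fun do rewrite mxE.
by apply: (is_derive_eq (is_derive_bil (Kd k) Xd Yd)); rewrite !mxE.
Qed.

End MatrixDerivatives.

(** * Christoffel symbols and curvature tensor in a chart *)

Section Connection.
Context {R : realType} {n : nat}.
Local Notation vec := 'rV[R]_n.
Implicit Types (G : vec -> 'M[R]_n) (u v w x y z : vec) (U : set vec).

Definition chr G k u : 'M[R]_n := \matrix_(i, j) christoffel G u k i j.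

Fact gam_sig : {f : (vec -> 'M[R]_n) -> vec -> vec -> vec -> vec | f = fun G u x y => \row_k bil (chr G k u) x y}.
Proof. by eexists. Qed.
Definition gam := sval gam_sig.

Lemma gamE G u x y : gam G u x y = \row_k bil (chr G k u) x y.
Proof. by rewrite /gam (svalP gam_sig). Qed.

Lemma nablaE G X Y u : nabla G X Y u = 'D_(X u) Y u + gam G u (X u) (Y u).
Proof.
rewrite /nabla gamE; congr (_ + _); apply/rowP => k; rewrite !mxE bilE.
by apply: eq_bigr => i _; apply: eq_bigr => j _; rewrite mxE [X u 0 i * _]mulrC.
Qed.

Lemma gamDl G u x x' y : gam G u (x + x') y = gam G u x y + gam G u x' y.
Proof. by rewrite !gamE; apply/rowP => k; rewrite !mxE bilDl. Qed.
Lemma gamDr G u x y y' : gam G u x (y + y') = gam G u x y + gam G u x y'.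
Proof. by rewrite !gamE; apply/rowP => k; rewrite !mxE bilDr. Qed.
Lemma gamZl G u (a : R) x y : gam G u (a *: x) y = a *: gam G u x y.
Proof. by rewrite !gamE; apply/rowP => k; rewrite !mxE bilZl. Qed.
Lemma gamZr G u (a : R) x y : gam G u x (a *: y) = a *: gam G u x y.
Proof. by rewrite !gamE; apply/rowP => k; rewrite !mxE bilZr. Qed.
Lemma gam0l G u y : gam G u 0 y = 0.
Proof. by rewrite !gamE; apply/rowP => k; rewrite !mxE bil0l. Qed.

Lemma gamC G u x y : (\forall v \near u, (G v)^T = G v) -> gam G u x y = gam G u y x.
Proof.
move=> Gs; rewrite !gamE; apply/rowP => k; rewrite !mxE; apply: bilC.
by apply/matrixP => i j; rewrite !mxE christoffelC.
Qed.

(** Vectors are extended with constant components, so the bracket terms of the Koszul formula vanish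
    and only derivatives of the metric remain. *)
Lemma koszul U G u x y z : open U -> U u -> smooth_on U G ->
  (forall v, U v -> (G v)^T = G v) -> G u \in unitmx ->
  bil (G u) (gam G u x y) z =
  2^-1 * (bil ('D_x G u) y z + bil ('D_y G u) x z - bil ('D_z G u) x y).
Proof.
move=> oU Uu Gsm Gs Gu.
have -> : gam G u x y =
    \row_k \sum_i \sum_j christoffel G u k i j * (cst x : vec -> vec) u 0 i * (cst y : vec -> vec) u 0 j.
  rewrite gamE; apply/rowP => k; rewrite !mxE bilE.
  by apply: eq_bigr => i _; apply: eq_bigr => j _; rewrite mxE [x 0 i * _]mulrC.
rewrite bilv -[X in X = _]/(inner_g G u _ _) inner_g_christoffel //; last exact: Gs.
have Gd a : derivable G u a by exact: smooth_on_derivable Gsm Uu.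
have DG a i j : 'D_a G u i j = \sum_l a 0 l * partial_deriv (fun v => G v i j) l u.
  rewrite -derive_entry //; apply: (derive_sum_partial _ oU Uu).
  exact: (smooth_on_mxP _ oU).1 Gsm i j 1%N.
move: (DG x) (DG y) (DG z) => {DG}; move: ('D_x G u) ('D_y G u) ('D_z G u) => dx dy dz dxE dyE dzE.
rewrite (bilE dx) (bilE dy) (bilE dz).
under [X in 2^-1 * (X + _ - _)]eq_bigr => k _ do
  under eq_bigr => l _ do rewrite dxE mulr_sumr mulr_suml.
under [X in 2^-1 * (_ + X - _)]eq_bigr => k _ do
  under eq_bigr => l _ do rewrite dyE mulr_sumr mulr_suml.
under [X in 2^-1 * (_ + _ - X)]eq_bigr => k _ do
  under eq_bigr => l _ do rewrite dzE mulr_sumr mulr_suml.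
have -> : \sum_k \sum_l \sum_i x 0 k * (y 0 i * partial_deriv (fun v => G v k l) i u) * z 0 l =
   \sum_j \sum_l \sum_i x 0 i * (y 0 j * partial_deriv (fun v => G v i l) j u) * z 0 l.
  under eq_bigr do rewrite exchange_big.
  rewrite exchange_big; apply: eq_bigr => j _; exact: exchange_big.
have -> : \sum_k \sum_l \sum_i x 0 k * (z 0 i * partial_deriv (fun v => G v k l) i u) * y 0 l =
   \sum_j \sum_l \sum_i x 0 i * (z 0 l * partial_deriv (fun v => G v i j) l u) * y 0 j.
  rewrite exchange_big; apply: eq_bigr => j _; exact: exchange_big.
rewrite -big_split -sumrB mulr_sumr; apply: eq_bigr => j _ /=.
rewrite -big_split -sumrB mulr_sumr; apply: eq_bigr => l _ /=.
rewrite -big_split -sumrB mulr_sumr; apply: eq_bigr => i _ /=.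
by rewrite /cst; ring.
Qed.

(** The coordinate formula for R(x, y) z on vectors extended with constant components, whose
    brackets vanish. *)
Definition riem G u x y z : vec :=
  'D_x (fun v => gam G v y z) u - 'D_y (fun v => gam G v x z) u
  + gam G u x (gam G u y z) - gam G u y (gam G u x z).

Fact dgam_sig : {f : (vec -> 'M[R]_n) -> vec -> vec -> vec -> vec -> vec | f = fun G u x y z => 'D_x (fun v => gam G v y z) u}.
Proof. by eexists. Qed.
Definition dgam := sval dgam_sig.

Lemma dgamE G u x y z : 'D_x (fun v => gam G v y z) u = dgam G u x y z.
Proof. by rewrite /dgam (svalP dgam_sig). Qed.

Lemma riemE G u x y z : riem G u x y z =
  dgam G u x y z - dgam G u y x z + gam G u x (gam G u y z) - gam G u y (gam G u x z).
Proof. by rewrite -!dgamE. Qed.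

Lemma curvature_cst G x y z u : curvature G (cst x) (cst y) (cst z) u = riem G u x y z.
Proof.
have N a b : nabla G (cst a) (cst b) = (fun v => gam G v a b).
  by apply/funext => v; rewrite nablaE derive_cst add0r.
have B0 : bracket (cst x : vec -> vec) (cst y) = cst 0.
  by apply/funext => v; rewrite /bracket !derive_cst subrr.
rewrite /curvature B0.
have -> : nabla G (cst 0) (cst z) u = 0.
  by rewrite nablaE (_ : cst 0 u = 0 :> vec) // derive0 gam0l addr0.
rewrite subr0 !N !nablaE /riem.
by rewrite opprD addrACA addrA.
Qed.

(** The sum depends on the frame only through [E^T *m E], which is the same for all orthonormal
    frames of a subspace; this makes traces independent of the frame. *)
Lemma sum_row_frame (W : lmodType R) r (beta : vec -> vec -> W) (E : 'M[R]_(r, n)) :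
  (forall a x x' y, beta (a *: x + x') y = a *: beta x y + beta x' y) ->
  (forall a x y y', beta x (a *: y + y') = a *: beta x y + beta x y') ->
  \sum_(a < r) beta (row a E) (row a E) =
  \sum_p \sum_s (E^T *m E) p s *: beta (delta_mx 0 p) (delta_mx 0 s).
Proof.
move=> bl br.
have b0l y : beta 0 y = 0.
  have := bl (-1) 0 0 y; rewrite scaler0 addr0 scaleN1r addNr.
  by [].
have b0r x : beta x 0 = 0.
  by have := br (-1) x 0 0; rewrite scaler0 addr0 scaleN1r addNr.
have sl (I : Type) (l : seq I) (c : I -> R) (f : I -> vec) y :
    beta (\sum_(i <- l) c i *: f i) y = \sum_(i <- l) c i *: beta (f i) y.
  by elim: l => [|i l IH]; rewrite ?big_nil ?b0l // !big_cons bl IH.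
have sr (I : Type) (l : seq I) (c : I -> R) (f : I -> vec) x :
    beta x (\sum_(i <- l) c i *: f i) = \sum_(i <- l) c i *: beta x (f i).
  by elim: l => [|i l IH]; rewrite ?big_nil ?b0r // !big_cons br IH.
transitivity (\sum_(a < r) \sum_p \sum_s (E a p * E a s) *: beta (delta_mx 0 p) (delta_mx 0 s)).
  apply: eq_bigr => a _; rewrite [row a E]row_sum_delta sl; apply: eq_bigr => p _.
  rewrite sr scaler_sumr; apply: eq_bigr => s _.
  by rewrite scalerA !mxE.
rewrite exchange_big; apply: eq_bigr => p _; rewrite exchange_big; apply: eq_bigr => s _.
rewrite -scaler_suml mxE; congr (_ *: _); apply: eq_bigr => a _.
by rewrite mxE.
Qed.

End Connection.

(** * Joint smoothness in time and space *)

Section MetricFamily.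
Context {R : realType} {n : nat}.
Local Notation vec := 'rV[R]_n.
Variables (Z : set (R^o * vec)%type) (G : R^o -> vec -> 'M[R]_n).
Hypothesis oZ : open Z.
Hypothesis Gsm : smooth_on Z (fun z => G z.1 z.2).
Hypothesis Gunit : forall z, Z z -> G z.1 z.2 \in unitmx.

Lemma smooth_chr k : smooth_on Z (fun z => chr (G z.1) k z.2).
Proof.
apply/smooth_on_mxP => // i j.
under eq_fun do rewrite mxE /christoffel.
have pds a b c : smooth_on Z (fun z : R^o * vec => partial_deriv (fun v => G z.1 v a b) c z.2 : R^o).
  have H := smooth_on_derive ((0, delta_mx 0 c) : R^o * vec) ((smooth_on_mxP _ oZ).1 Gsm a b).
  apply: (smooth_on_congr oZ _ H); case=> t u _; apply: esym.
  exact: (@derive_slice _ _ _ (fun z : R^o * vec => G z.1 z.2 a b : R^o) t u).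
apply: smooth_onM => //; first exact: smooth_on_cst.
apply: smooth_on_sum => // l _; apply: smooth_onM => //.
  by apply: (smooth_on_mxP _ oZ).1; exact: smooth_on_invmx.
apply: smooth_onD => //; last exact: smooth_onN.
exact: smooth_onD.
Qed.

Lemma smooth_gam (X Y : R^o * vec -> vec) : smooth_on Z X -> smooth_on Z Y ->
  smooth_on Z (fun z => gam (G z.1) z.2 (X z) (Y z)).
Proof.
move=> Xs Ys; under eq_fun do rewrite gamE.
apply/smooth_on_mxP => // i k; under eq_fun do rewrite mxE.
by apply: smooth_on_bil => //; exact: smooth_chr.
Qed.

Lemma smooth_riem x y z : smooth_on Z (fun w => riem (G w.1) w.2 x y z).
Proof.
have gs a b : smooth_on Z (fun w => gam (G w.1) w.2 a b).
  by apply: smooth_gam; exact: smooth_on_cst.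
have ds a b c : smooth_on Z (fun w => 'D_c (fun v => gam (G w.1) v a b) w.2).
  have H := smooth_on_derive ((0, c) : R^o * vec) (gs a b).
  apply: (smooth_on_congr oZ _ H); case=> t v _; apply: esym.
  exact: (@derive_slice _ _ _ (fun z : R^o * vec => gam (G z.1) z.2 a b) t v).
apply: smooth_onD => //; last first.
  by apply: smooth_onN => //; apply: smooth_gam => //; exact: smooth_on_cst.
apply: smooth_onD => //; last by apply: smooth_gam => //; exact: smooth_on_cst.
by apply: smooth_onD => //; exact: smooth_onN.
Qed.

End MetricFamily.

(** * Connection and curvature under a change of chart *)

Section Covariance.
Context {R : realType} {n : nat}.
Local Notation vec := 'rV[R]_n.

Lemma smooth_chr1 (U : set vec) (G : vec -> 'M[R]_n) k : open U -> smooth_on U G ->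
  (forall u, U u -> G u \in unitmx) -> smooth_on U (chr G k).
Proof.
move=> oU Gs Gu.
have := @smooth_chr R n [set z : R^o * vec | U z.2] (fun=> G) (open_prodr oU)
  (smooth_on_snd Gs) (fun z Uz => Gu _ Uz) k.
by move=> /(@smooth_on_slice _ _ _ _ _ 0).
Qed.

Lemma smooth_gam1 (U : set vec) (G : vec -> 'M[R]_n) (X Y : vec -> vec) :
  open U -> smooth_on U G -> (forall u, U u -> G u \in unitmx) ->
  smooth_on U X -> smooth_on U Y -> smooth_on U (fun u => gam G u (X u) (Y u)).
Proof.
move=> oU Gs Gu Xs Ys; under eq_fun do rewrite gamE.
apply/smooth_on_mxP => // i k; under eq_fun do rewrite mxE.
by apply: smooth_on_bil => //; exact: smooth_chr1.
Qed.

Lemma derive_gam_cst (G : vec -> 'M[R]_n) (U : set vec) u w x y :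
  open U -> U u -> smooth_on U G -> (forall u, U u -> G u \in unitmx) ->
  'D_w (fun v => gam G v x y) u = \row_k bil ('D_w (chr G k) u) x y.
Proof.
move=> oU Uu Gs Gu.
have cd k := smooth_on_is_derive w (smooth_chr1 k oU Gs Gu) Uu.
under eq_fun do rewrite gamE.
have [_ ->] := is_derive_row_bil cd (is_derive_cst x u w) (is_derive_cst y u w).
apply/rowP => k; rewrite !mxE bil0l bil0r !addr0 //.
Qed.

Variables (U U' : set vec) (phi : vec -> vec) (G G' : vec -> 'M[R]_n).
Hypotheses (oU : open U) (oU' : open U') (phiU : forall u, U u -> U' (phi u)).
Hypotheses (phis : smooth_on U phi) (Gsm : smooth_on U G) (Gsm' : smooth_on U' G').
Hypotheses (Gsym : forall u, U u -> (G u)^T = G u) (Gsym' : forall u, U' u -> (G' u)^T = G' u).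
Hypotheses (Gu : forall u, U u -> G u \in unitmx) (Gu' : forall u, U' u -> G' u \in unitmx).
Hypothesis Ju : forall u, U u -> 'J phi u \in unitmx.
Hypothesis GE : forall u, U u -> 'J phi u *m G' (phi u) *m ('J phi u)^T = G u.

Lemma phi_diff u : U u -> differentiable phi u.
Proof. by move=> Uu; exact: C1_differentiable_mx oU Uu (phis 1%N). Qed.

Lemma derive_phi u v : U u -> 'D_v phi u = v *m 'J phi u.
Proof. by move=> /phi_diff; exact: deriveEjacobian. Qed.

Lemma derive_near (W : normedModType R) (f g : vec -> W) u v : U u ->
  (forall w, U w -> f w = g w) -> 'D_v f u = 'D_v g u.
Proof. by move=> Uu fg; apply: near_eq_derive; exact: open_near_eq fg. Qed.

Lemma is_derive_comp_phi (W : normedModType R) (f : vec -> W) u v : U u ->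
  differentiable f (phi u) -> is_derive u v (fun w => f (phi w)) ('D_(v *m 'J phi u) f (phi u)).
Proof.
move=> Uu fd; rewrite -derive_phi //; exact: is_derive_chain (phi_diff Uu) fd.
Qed.

Fact D2_sig : {f : vec -> vec -> vec -> vec | f = fun u x y => 'D_x (fun v => 'D_y phi v) u}.
Proof. by eexists. Qed.
Definition D2 := sval D2_sig.
Fact D3_sig : {f : vec -> vec -> vec -> vec -> vec | f = fun u x y z => 'D_x (fun v => 'D_y (fun v' => 'D_z phi v') v) u}.
Proof. by eexists. Qed.
Definition D3 := sval D3_sig.

Let D2E u x y : 'D_x (fun v => 'D_y phi v) u = D2 u x y.
Proof. by rewrite /D2 (svalP D2_sig). Qed.

Let D3E u x y z : 'D_x (fun v => 'D_y (fun v' => 'D_z phi v') v) u = D3 u x y z.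
Proof. by rewrite /D3 (svalP D3_sig). Qed.

Let D2C u x y : U u -> D2 u x y = D2 u y x.
Proof. by move=> Uu; rewrite -!D2E; exact: schwarz_mx oU Uu phis. Qed.

Let D3C u x y z : U u -> D3 u x y z = D3 u y x z.
Proof.
by move=> Uu; rewrite -!D3E; exact: schwarz_mx oU Uu (smooth_on_derive z phis).
Qed.

Let D2d u a b : U u -> is_derive u a (fun v => 'D_b phi v) (D2 u a b).
Proof.
by move=> Uu; rewrite -D2E; exact: smooth_on_is_derive a (smooth_on_derive b phis) Uu.
Qed.

(** Differentiating the pull-back relation [GE] expresses the derivatives of [G] by those of [G']
    and by second derivatives of [phi]. In the Koszul formula the latter, being symmetric, combine
    into a single inhomogeneous term. *)
Lemma gam_transition u x y : U u ->
  gam G u x y *m 'J phi u = D2 u x y + gam G' (phi u) (x *m 'J phi u) (y *m 'J phi u).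
Proof.
move=> Uu; set J := 'J phi u.
have G'd : differentiable G' (phi u).
  exact: C1_differentiable_mx oU' (phiU Uu) (Gsm' 1%N).
have [dG dGE] : exists dG, forall a, 'D_a G u = dG a by exists (fun a => 'D_a G u).
have [dG' dG'E] : exists dG', forall a, 'D_a G' (phi u) = dG' a.
  by exists (fun a => 'D_a G' (phi u)).
have K a b c : bil (G u) (gam G u a b) c =
    2^-1 * (bil (dG a) b c + bil (dG b) a c - bil (dG c) a b).
  by rewrite -!dGE; exact: koszul oU Uu Gsm Gsym (Gu Uu).
have K' a b c : bil (G' (phi u)) (gam G' (phi u) a b) c =
    2^-1 * (bil (dG' a) b c + bil (dG' b) a c - bil (dG' c) a b).
  by rewrite -!dG'E; exact: koszul oU' (phiU Uu) Gsm' Gsym' (Gu' (phiU Uu)).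
have DG a b c : bil (dG a) b c =
    bil (dG' (a *m J)) (b *m J) (c *m J)
    + bil (G' (phi u)) (D2 u a b) (c *m J)
    + bil (G' (phi u)) (b *m J) (D2 u a c).
  have H1 := is_derive_bil (is_derive_comp_phi a Uu G'd) (D2d a b Uu) (D2d a c Uu).
  have H2 := is_derive_bil (smooth_on_is_derive a Gsm Uu) (is_derive_cst b u a) (is_derive_cst c u a).
  rewrite bil0l bil0r !addr0 in H2.
  rewrite -dGE -dG'E.
  rewrite -(derive_phi b Uu) -(derive_phi c Uu) -[LHS](@derive_val _ _ _ _ _ _ _ H2)
    -[RHS](@derive_val _ _ _ _ _ _ _ H1).
  apply: derive_near => // v Uv; rewrite /cst !derive_phi // -bil_congr.
  by rewrite GE.
(* The Jacobian is invertible, so it suffices to test the identity against images of vectors under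
   it. *)
apply: (bil_inj (Gu' (phiU Uu))) => z'.
have -> : z' = (z' *m invmx J) *m J by rewrite mulmxKV // Ju.
move: (z' *m invmx J) => z {z'}.
rewrite -bil_congr GE // K bilDl K'.
have sym' a b : bil (G' (phi u)) a b = bil (G' (phi u)) b a.
  by apply: bilC; exact/Gsym'/phiU.
rewrite !DG (D2C y x Uu) (D2C z x Uu) (D2C z y Uu).
rewrite (sym' (x *m J) (D2 u y z)) (sym' (y *m J) (D2 u x z)).
by field.
Qed.

Lemma is_derive_gam_phi (X Y : vec -> vec) u w dX dY : U u ->
  is_derive u w X dX -> is_derive u w Y dY ->
  is_derive u w (fun v => gam G' (phi v) (X v) (Y v))
    (dgam G' (phi u) (w *m 'J phi u) (X u) (Y u)
     + gam G' (phi u) dX (Y u) + gam G' (phi u) (X u) dY).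
Proof.
move=> Uu Xd Yd.
have cd k : is_derive u w (fun v => chr G' k (phi v)) ('D_(w *m 'J phi u) (chr G' k) (phi u)).
  apply: is_derive_comp_phi => //.
  exact: C1_differentiable_mx oU' (phiU Uu) (smooth_chr1 k oU' Gsm' Gu' 1%N).
rewrite -dgamE (derive_gam_cst _ _ _ oU' (phiU Uu) Gsm' Gu').
by rewrite !gamE; under eq_fun do rewrite gamE; exact: is_derive_row_bil cd Xd Yd.
Qed.

(** The transformation law of the Christoffel symbols, differentiated along [x]. The product term is
    grouped with the derivative because the inhomogeneous terms of the sum are, taken together,
    symmetric in [x] and [y], and so cancel in the curvature. *)
Lemma dgam_transition u x y z : U u ->
  dgam G u x y z *m 'J phi u + gam G u x (gam G u y z) *m 'J phi u =
  D3 u x y z + dgam G' (phi u) (x *m 'J phi u) (y *m 'J phi u) (z *m 'J phi u)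
  + gam G' (phi u) (D2 u x y) (z *m 'J phi u)
  + gam G' (phi u) (y *m 'J phi u) (D2 u x z)
  + gam G' (phi u) (x *m 'J phi u) (D2 u y z)
  + gam G' (phi u) (x *m 'J phi u) (gam G' (phi u) (y *m 'J phi u) (z *m 'J phi u)).
Proof.
move=> Uu.
have gs : smooth_on U (fun v => gam G v y z).
  by apply: smooth_gam1 => //; exact: smooth_on_cst.
have Js : smooth_on U (fun v => 'J phi v).
  apply/smooth_on_mxP => // i j.
  have H := (smooth_on_mxP _ oU).1 (smooth_on_derive (delta_mx 0 i) phis) 0 j.
  apply: (smooth_on_congr oU _ H) => v Uv; rewrite derive_phi //.
  by rewrite -rowE mxE.
have Jd a : a *m 'D_x (fun v => 'J phi v) u = D2 u x a.
  have H := is_derive_mulmx (is_derive_cst a u x) (smooth_on_is_derive x Js Uu).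
  rewrite mul0mx add0r in H; rewrite -D2E -[LHS](@derive_val _ _ _ _ _ _ _ H).
  by apply: derive_near => // v Uv; rewrite derive_phi.
have HL : is_derive u x (fun v => gam G v y z *m 'J phi v)
    (dgam G u x y z *m 'J phi u + D2 u x (gam G u y z)).
  rewrite -Jd -dgamE.
  exact: is_derive_mulmx (smooth_on_is_derive x gs Uu) (smooth_on_is_derive x Js Uu).
have HR : is_derive u x
    (fun v => 'D_y (fun v' => 'D_z phi v') v + gam G' (phi v) ('D_y phi v) ('D_z phi v))
    (D3 u x y z + (dgam G' (phi u) (x *m 'J phi u) (y *m 'J phi u) (z *m 'J phi u)
       + gam G' (phi u) (D2 u x y) (z *m 'J phi u)
       + gam G' (phi u) (y *m 'J phi u) (D2 u x z))).
  have H := is_derive_gam_phi Uu (D2d x y Uu) (D2d x z Uu).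
  rewrite (derive_phi y Uu) (derive_phi z Uu) in H.
  apply: is_deriveD H; rewrite -D3E.
  exact: smooth_on_is_derive x (smooth_on_derive y (smooth_on_derive z phis)) Uu.
have E : dgam G u x y z *m 'J phi u + D2 u x (gam G u y z) = 
  D3 u x y z + (dgam G' (phi u) (x *m 'J phi u) (y *m 'J phi u) (z *m 'J phi u)
       + gam G' (phi u) (D2 u x y) (z *m 'J phi u)
       + gam G' (phi u) (y *m 'J phi u) (D2 u x z)).
  rewrite -[LHS](@derive_val _ _ _ _ _ _ _ HL) -[RHS](@derive_val _ _ _ _ _ _ _ HR).
  by apply: derive_near => // v Uv; rewrite gam_transition // -D2E !derive_phi.
move: {HL HR} E.
rewrite (gam_transition x (gam G u y z) Uu) (gam_transition y z Uu) gamDr => E.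
by rewrite addrA E !addrA.
Qed.

Lemma riem_antisym (d a b c p q r s : vec) :
  (d + p + a + b + c + r) - (d + q + a + c + b + s) = p - q + r - s.
Proof. by apply/rowP => i; rewrite !mxE; ring. Qed.

Lemma riem_transition u x y z : U u ->
  riem G u x y z *m 'J phi u =
  riem G' (phi u) (x *m 'J phi u) (y *m 'J phi u) (z *m 'J phi u).
Proof.
move=> Uu; have Exy := dgam_transition x y z Uu.
have Eyx := dgam_transition y x z Uu.
have -> : riem G u x y z *m 'J phi u =
  (dgam G u x y z *m 'J phi u + gam G u x (gam G u y z) *m 'J phi u)
  - (dgam G u y x z *m 'J phi u + gam G u y (gam G u x z) *m 'J phi u).
  by rewrite riemE !(mulmxDl, mulNmx) opprD !addrA; congr (_ - _); rewrite addrAC.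
rewrite Exy Eyx riemE (D3C y x z Uu) (D2C y x Uu).
exact: riem_antisym.
Qed.

End Covariance.

(** * Positive definite matrices and orthonormal frames *)

Section PositiveDefinite.
Context {R : realType}.

Definition posdef n (A : 'M[R]_n) :=
  A^T = A /\ forall v : 'rV[R]_n, v != 0 -> 0 < (v *m A *m v^T) 0 0.

Lemma posdef_unit n (A : 'M[R]_n) : posdef A -> A \in unitmx.
Proof.
move=> [_ pA]; rewrite -row_free_unit -kermx_eq0; apply/eqP/row_matrixP => i.
rewrite row0; apply/eqP/negPn/negP => /pA.
have /sub_kermxP -> : (row i (kermx A) <= kermx A)%MS by exact: row_sub.
by rewrite mul0mx mxE ltxx.
Qed.

Lemma posdef_congr n r (A : 'M[R]_n) (F : 'M[R]_(r, n)) : posdef A -> row_free F ->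
  posdef (F *m A *m F^T).
Proof.
move=> [sA pA] fF; split; first by rewrite !trmx_mul trmxK sA mulmxA.
move=> v v0; rewrite !mulmxA -[_ *m F *m A *m F^T *m v^T]mulmxA -trmx_mul.
apply: pA; apply: contra v0 => /eqP vF; apply/eqP; apply: (row_free_inj fF).
by rewrite vF mul0mx.
Qed.

(** One step of symmetric elimination with pivot [al]. The Schur complement [S] inherits positivity
    by testing the block matrix on vectors whose first component is chosen to cancel the mixed
    terms. *)
Lemma cholesky_step n (a : 'M[R]_1) (b : 'M[R]_(1, n)) (b' : 'M[R]_(n, 1)) (C : 'M[R]_n) :
  (forall A : 'M[R]_n, posdef A -> exists T : 'M[R]_n, T *m A *m T^T = 1%:M) ->
  posdef (block_mx a b b' C) ->
  exists T : 'M[R]_(1 + n), T *m block_mx a b b' C *m T^T = 1%:M.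
Proof.
move=> IH [sA pA].
rewrite tr_block_mx in sA.
have [sa sb sb' sC] := eq_block_mx sA.
pose al := a 0 0.
have al0 : 0 < al.
  have := pA (row_mx 1%:M 0); rewrite mul_row_block !mul1mx !mul0mx !addr0.
  rewrite tr_row_mx mul_row_col trmx0 mulmx0 addr0 trmx1 mulmx1; apply.
  apply/eqP => /matrixP/(_ 0 (lshift _ 0)); rewrite row_mxEl !mxE eqxx => /eqP.
  by rewrite oner_eq0.
have aE : a = al%:M by exact: mx11_scalar.
pose S := C - al^-1 *: (b' *m b).
have bb : b' = b^T by [].
have pS : posdef S.
  split.
    by rewrite /S linearB linearZ /= trmx_mul bb trmxK sC.
  move=> v v0.
  have := pA (row_mx (- al^-1 *: (v *m b')) v).
  rewrite mul_row_block tr_row_mx mul_row_col aE.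
  have -> : - al^-1 *: (v *m b') *m al%:M + v *m b' = 0.
    by rewrite mul_mx_scalar scalerA mulrN divff ?gt_eqF // scaleN1r addNr.
  rewrite mul0mx add0r.
  have -> : - al^-1 *: (v *m b') *m b + v *m C = v *m S.
    by rewrite /S mulmxBr -scalemxAl -scalemxAr mulmxA scaleNr addrC.
  apply; apply: contra v0 => /eqP E; apply/eqP.
  by move: E; rewrite -[RHS]row_mx0 => /eq_row_mx [].
have [T TE] := IH _ pS.
pose s := (Num.sqrt al)^-1.
have ssal : s * s * al = 1.
  by rewrite /s -invfM -expr2 sqr_sqrtr ?ltW // mulVf // gt_eqF.
pose T' : 'M[R]_(1 + n) := block_mx s%:M 0 (- al^-1 *: (T *m b')) T.
suff H : T' *m block_mx a b b' C *m T'^T = 1%:M by exists T'.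
rewrite /T' mulmx_block tr_block_mx mulmx_block.
rewrite !mul0mx !addr0 aE trmx0 !mulmx0 !addr0 tr_scalar_mx.
have -> : - al^-1 *: (T *m b') *m al%:M + T *m b' = 0.
  by rewrite mul_mx_scalar scalerA mulrN divff ?gt_eqF // scaleN1r addNr.
have -> : - al^-1 *: (T *m b') *m b + T *m C = T *m S.
  by rewrite /S mulmxBr -scalemxAl -scalemxAr mulmxA scaleNr addrC.
rewrite !mul0mx !add0r TE.
have -> : s%:M *m al%:M *m s%:M = 1%:M :> 'M[R]_1.
  by rewrite -!scalar_mxM -ssal; congr _%:M; ring.
have -> : s%:M *m al%:M *m (- al^-1 *: (T *m b'))^T + s%:M *m b *m T^T = 0.
  rewrite linearZ /= trmx_mul bb trmxK -scalar_mxM mul_scalar_mx scalerA.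
  by rewrite mulrN mulfK ?gt_eqF // mul_scalar_mx -scalemxAl scaleNr addNr.
by rewrite -scalar_mx_block.
Qed.

Lemma cholesky n (A : 'M[R]_n) : posdef A -> exists T : 'M[R]_n, T *m A *m T^T = 1%:M.
Proof.
elim: n A => [|n IH] A; first by move=> _; exists 0; apply/matrixP; case.
move=> pA; have := @cholesky_step n (@ulsubmx R 1 n 1 n A) (@ursubmx R 1 n 1 n A)
  (@dlsubmx R 1 n 1 n A) (@drsubmx R 1 n 1 n A) IH.
by rewrite submxK; exact.
Qed.

(* [A *m gramQ A F] is the A-orthogonal projector onto the row space of [F];
   unlike an orthonormal frame it is explicit, hence smooth, in [A] and [F]. *)
Definition gramQ n r (A : 'M[R]_n) (F : 'M[R]_(r, n)) : 'M[R]_n :=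
  F^T *m invmx (F *m A *m F^T) *m F.

Lemma exists_orthonormal n r (A : 'M[R]_n) (F : 'M[R]_(r, n)) : posdef A -> row_free F ->
  exists2 E : 'M[R]_(r, n), (E == F)%MS & E *m A *m E^T = 1%:M.
Proof.
move=> pA fF; have [T TE] := cholesky (posdef_congr pA fF).
have Tu : T \in unitmx.
  by rewrite -mulmxA in TE; have [] := mulmx1_unit TE.
exists (T *m F); last by rewrite trmx_mul !mulmxA -TE !mulmxA.
by apply/eqmxP; apply: eqmxMfull; rewrite row_full_unit.
Qed.

(** With [E = T *m F], orthonormality says that [T^T *m T] inverts the Gram matrix of [F]. Frames
    chosen by [xget] can therefore be traded for any local sections. *)
Lemma gramQE n r (A : 'M[R]_n) (E F : 'M[R]_(r, n)) : (E <= F)%MS ->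
  E *m A *m E^T = 1%:M -> E^T *m E = gramQ A F.
Proof.
move=> /submxP [T ->]; rewrite trmx_mul !mulmxA => TE.
have {}TE : T *m ((F *m A *m F^T) *m T^T) = 1%:M by rewrite !mulmxA.
have [Tu _] := mulmx1_unit TE.
have TE2 := mulmx1C TE.
rewrite /gramQ; congr (_ *m F); rewrite -(mulmxA F^T); congr (_ *m _).
have Au : F *m A *m F^T \in unitmx.
  have [] := mulmx1_unit (TE2 : (F *m A *m F^T *m T^T) *m T = 1%:M).
  by rewrite unitmx_mul => /andP [].
have -> : T^T *m T = invmx (F *m A *m F^T) *m (F *m A *m F^T *m T^T *m T).
  by rewrite -[X in invmx _ *m X]mulmxA mulKmx.
by rewrite TE2 mulmx1.
Qed.

Lemma gramQ_on n r (A : 'M[R]_n) (E : 'M[R]_(r, n)) :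
  E *m A *m E^T = 1%:M -> gramQ A E = E^T *m E.
Proof. by move=> EE; rewrite -(gramQE (submx_refl _) EE). Qed.

End PositiveDefinite.

(** * Orthogonal projectors *)

Section OrthogonalProjectors.
Context {R : realType} {n : nat}.
Implicit Types (A D : 'M[R]_n).

Lemma orth_cap0 A D : posdef A -> (D :&: orth_compl A D)%MS = 0.
Proof.
move=> [sA pA]; apply/eqP; rewrite -submx0; apply/rV_subP => w.
rewrite sub_capmx => /andP [wD /sub_kermxP]; rewrite mulmxA => wk; rewrite submx0.
apply/negPn/negP => /pA.
move/submxP: wD wk => [c cD] wk; rewrite {2}cD trmx_mul mulmxA wk mul0mx mxE.
by rewrite ltxx.
Qed.

Lemma proj_orthE A D (w p : 'rV[R]_n) : posdef A -> (p <= D)%MS ->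
  (w - p) *m A *m D^T = 0 -> w *m proj_mx D (orth_compl A D) = p.
Proof.
move=> pA pD wp.
have -> : w = p + (w - p) by rewrite addrC subrK.
rewrite mulmxDl proj_mx_id ?orth_cap0 // proj_mx_0 ?addr0 ?orth_cap0 //.
by apply/sub_kermxP; rewrite mulmxA.
Qed.

(** Vectors being rows, the projection sends w to the sum of the g(w, e_a) e_a, which is right
    multiplication by [A *m (E^T *m E)]. *)
Lemma proj_frame A D r (E : 'M[R]_(r, n)) : posdef A -> (E == D)%MS ->
  E *m A *m E^T = 1%:M -> proj_mx D (orth_compl A D) = A *m (E^T *m E).
Proof.
move=> pA /andP [ED DE] EE; apply/row_matrixP => i; rewrite rowE [RHS]rowE.
set w := delta_mx 0 i.
apply: proj_orthE => //.
  by rewrite !mulmxA (submx_trans _ ED) // submxMl.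
have [T DT] := submxP DE.
have H : (w - w *m (A *m (E^T *m E))) *m A *m E^T = 0.
  rewrite !mulmxBl; apply/eqP; rewrite subr_eq0; apply/eqP.
  by rewrite -[LHS]mulmx1 -EE !mulmxA.
by rewrite DT trmx_mul (mulmxA ((w - _) *m A)) H mul0mx.
Qed.

Lemma proj_third A D1 D2 r1 r2 (E : 'M[R]_(r1, n)) (F : 'M[R]_(r2, n)) : posdef A ->
  (E == D1)%MS -> E *m A *m E^T = 1%:M -> (F == D2)%MS -> F *m A *m F^T = 1%:M ->
  E *m A *m F^T = 0 ->
  let D3 := orth_compl A (D1 + D2)%MS in
  proj_mx D3 (orth_compl A D3) = 1%:M - A *m (E^T *m E) - A *m (F^T *m F).
Proof.
move=> pA /andP [ED DE] EE /andP [FD DF] FF EF D3.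
have [sA _] := pA.
have FE : F *m A *m E^T = 0.
  by apply: trmx_inj; rewrite !trmx_mul trmxK sA mulmxA EF trmx0.
apply/row_matrixP => i; rewrite rowE [RHS]rowE; set w := delta_mx 0 i.
set Q := _ - _ - _.
have QE : Q *m A *m E^T = 0.
  rewrite /Q !mulmxBl mul1mx -!mulmxA.
  rewrite (mulmxA E A) (mulmxA F A) EE FE mulmx1 !mulmx0 subr0.
  by rewrite subrr.
have QF : Q *m A *m F^T = 0.
  rewrite /Q !mulmxBl mul1mx -!mulmxA.
  rewrite (mulmxA E A) (mulmxA F A) EF FF mulmx1 !mulmx0 subr0.
  by rewrite subrr.
have D3E : D3 *m A *m E^T = 0 /\ D3 *m A *m F^T = 0.
  have : D3 *m (A *m (D1 + D2)%MS^T) = 0 by apply/sub_kermxP; exact: submx_refl.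
  rewrite mulmxA => H.
  have [T1 ET] : exists T, E = T *m (D1 + D2)%MS.
    by apply/submxP; exact: submx_trans ED (addsmxSl _ _).
  have [T2 FT] : exists T, F = T *m (D1 + D2)%MS.
    by apply/submxP; exact: submx_trans FD (addsmxSr _ _).
  by rewrite ET FT !trmx_mul !(mulmxA (D3 *m A)) H !mul0mx.
apply: proj_orthE => //.
  apply/sub_kermxP; rewrite !mulmxA.
  have [[T1 T2] /= ->] : exists T, (D1 + D2)%MS = T.1 *m E + T.2 *m F.
    apply/sub_addsmxP; rewrite addsmxS //.
  rewrite [(_ + _)^T]linearD /= !trmx_mul mulmxDr.
  have wE : w *m Q *m A *m E^T = 0 by rewrite -2!(mulmxA w) QE mulmx0.
  have wF : w *m Q *m A *m F^T = 0 by rewrite -2!(mulmxA w) QF mulmx0.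
  by rewrite !(mulmxA (w *m Q *m A)) wE wF !mul0mx addr0.
have [H1 H2] := D3E.
have ED3 : E *m A *m D3^T = 0.
  by apply: trmx_inj; rewrite trmx_mul trmxK trmx_mul sA mulmxA H1 trmx0.
have FD3 : F *m A *m D3^T = 0.
  by apply: trmx_inj; rewrite trmx_mul trmxK trmx_mul sA mulmxA H2 trmx0.
have -> : w - w *m Q = w *m (A *m (E^T *m E) + A *m (F^T *m F)).
  by rewrite /Q !mulmxBr mulmx1 mulmxDr !opprD !opprK !addrA subrr add0r.
rewrite -!mulmxA mulmxDl -!mulmxA.
by rewrite (mulmxA E A) (mulmxA F A) ED3 FD3 !mulmx0 addr0 mulmx0.
Qed.

End OrthogonalProjectors.

(** * Contraction of the curvature tensor *)

Section CurvatureContraction.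
Context {R : realType} {n : nat}.
Local Notation vec := 'rV[R]_n.
Implicit Types (b : vec -> vec -> vec -> vec -> R).

Definition linear4 b := [/\ forall y z w a x x', b (a *: x + x') y z w = a * b x y z w + b x' y z w,
  forall x z w a y y', b x (a *: y + y') z w = a * b x y z w + b x y' z w,
  forall x y w a z z', b x y (a *: z + z') w = a * b x y z w + b x y z' w
  & forall x y z a w w', b x y z (a *: w + w') = a * b x y z w + b x y z w'].

(** Frames enter only through the two matrices, for which [gramQ] gives an expression smooth in the
    metric. *)
Definition contract4 (Q1 Q2 : 'M[R]_n) b : R :=
  \sum_p \sum_s Q1 p s * (\sum_k \sum_l Q2 k l *
    b (delta_mx 0 p) (delta_mx 0 k) (delta_mx 0 l) (delta_mx 0 s)).

Lemma contract4_frame r1 r2 (E : 'M[R]_(r1, n)) (F : 'M[R]_(r2, n)) b : linear4 b ->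
  \sum_(a < r1) \sum_(i < r2) b (row a E) (row i F) (row i F) (row a E) =
  contract4 (E^T *m E) (F^T *m F) b.
Proof.
move=> [l1 l2 l3 l4].
have H x w : \sum_(i < r2) b x (row i F) (row i F) w =
    \sum_k \sum_l (F^T *m F) k l * b x (delta_mx 0 k) (delta_mx 0 l) w.
  exact: (@sum_row_frame R n R^o r2 (fun y z => b x y z w) F).
under eq_bigr do rewrite H.
apply: (@sum_row_frame R n R^o r1 (fun x w => \sum_k \sum_l (F^T *m F) k l * b x (delta_mx 0 k) (delta_mx 0 l) w) E).
- move=> a x x' y; rewrite /GRing.scale /= mulr_sumr -big_split; apply: eq_bigr => k _ /=.
  rewrite mulr_sumr -big_split; apply: eq_bigr => l _ /=; rewrite l1; ring.
- move=> a x y y'; rewrite /GRing.scale /= mulr_sumr -big_split; apply: eq_bigr => k _ /=.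
  rewrite mulr_sumr -big_split; apply: eq_bigr => l _ /=; rewrite l4; ring.
Qed.

Variables (U : set vec) (G : vec -> 'M[R]_n).
Hypotheses (oU : open U) (Gs : smooth_on U G).
Hypothesis (Gu : forall v, U v -> G v \in unitmx).

Definition Rm u x y z w : R := bil (G u) (riem G u x y z) w.

Lemma dgam_linear u : U u ->
  [/\ forall y z a x x', dgam G u (a *: x + x') y z = a *: dgam G u x y z + dgam G u x' y z,
  forall x z a y y', dgam G u x (a *: y + y') z = a *: dgam G u x y z + dgam G u x y' z
  & forall x y a z z', dgam G u x y (a *: z + z') = a *: dgam G u x y z + dgam G u x y z'].
Proof.
move=> Uu.
have [d dE dl] : exists2 d : 'I_n -> vec -> 'M[R]_n, forall k x, 'D_x (chr G k) u = d k x &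
    forall k a x x', d k (a *: x + x') = a *: d k x + d k x'.
  exists (fun k x => 'D_x (chr G k) u) => // k a x x'.
  have cd : differentiable (chr G k) u.
    exact: C1_differentiable_mx oU Uu (smooth_chr1 k oU Gs Gu 1%N).
  by rewrite (deriveE _ cd) (deriveE x cd) (deriveE x' cd) linearP.
have E x y z : dgam G u x y z = \row_k bil (d k x) y z.
  rewrite -dgamE (derive_gam_cst x y z oU Uu Gs Gu); apply/rowP => k.
  by rewrite !mxE dE.
split.
- by move=> y z a x x'; rewrite !E; apply/rowP => k; rewrite !mxE dl bilDA bilZA.
- by move=> x z a y y'; rewrite !E; apply/rowP => k; rewrite !mxE bilDl bilZl.
- by move=> x z a y y'; rewrite !E; apply/rowP => k; rewrite !mxE bilDr bilZr.
Qed.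

Lemma lin_comb4 (a : R) (p p' q q' r r' s s' : vec) :
  a *: p + p' - (a *: q + q') + (a *: r + r') - (a *: s + s') =
  a *: (p - q + r - s) + (p' - q' + r' - s').
Proof. by apply/rowP => i; rewrite !mxE; ring. Qed.

Lemma Rm_linear u : U u -> linear4 (Rm u).
Proof.
move=> Uu; have [l1 l2 l3] := dgam_linear Uu.
rewrite /Rm; split.
- by move=> y z w a x x'; rewrite -bilZl -bilDl !riemE l1 l2 !(gamDl, gamDr, gamZl, gamZr) lin_comb4.
- by move=> x z w a y y'; rewrite -bilZl -bilDl !riemE l1 l2 !(gamDl, gamDr, gamZl, gamZr) lin_comb4.
- by move=> x y w a z z'; rewrite -bilZl -bilDl !riemE !l3 !(gamDl, gamDr, gamZl, gamZr) lin_comb4.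
- by move=> x y z a w w'; rewrite bilDr bilZr.
Qed.

Lemma frame_curvE r1 r2 (E : 'M[R]_(r1, n)) (F : 'M[R]_(r2, n)) u : U u ->
  frame_curv G E F u = contract4 (E^T *m E) (F^T *m F) (Rm u).
Proof.
move=> Uu; rewrite -contract4_frame; last exact: Rm_linear.
by apply: eq_bigr => a _; apply: eq_bigr => i _; rewrite curvature_cst /Rm bilv.
Qed.

Lemma mutual_curvE (D1 D2 : vec -> 'M[R]_n) r1 r2 (F1 : 'M[R]_(r1, n)) (F2 : 'M[R]_(r2, n)) u :
  U u -> posdef (G u) -> (F1 == D1 u)%MS -> (F2 == D2 u)%MS -> row_free F1 -> row_free F2 ->
  mutual_curv G D1 D2 r1 r2 u = contract4 (gramQ (G u) F1) (gramQ (G u) F2) (Rm u).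
Proof.
move=> Uu pG D1E D2E f1 f2.
have K r (F : 'M[R]_(r, n)) (D : vec -> 'M[R]_n) : (F == D u)%MS -> row_free F ->
    let E := xget (0 : 'M[R]_(r, n)) [set E | orthonormal_frame G D u E] in
    E^T *m E = gramQ (G u) F.
  move=> FD fF E.
  have [E0 E0F E0E] := exists_orthonormal pG fF.
  have : [set E | orthonormal_frame G D u E] E.
    apply: (@xgetPex _ 0 [set E | orthonormal_frame G D u E]); exists E0; split=> //.
    by apply/eqmxP; apply: eqmx_trans (eqmxP FD); exact/eqmxP.
  move=> [/andP [ED _] EE]; apply: gramQE EE; case/andP: FD => _; exact: submx_trans.
by rewrite /mutual_curv frame_curvE // (K _ _ _ D1E f1) (K _ _ _ D2E f2).
Qed.

End CurvatureContraction.

(** * First variation of the mutual curvature *)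

Section DeterminantDerivative.
Context {R : realType} {V : normedModType R}.

Lemma is_derive_prodr (I : eqType) (r : seq I) (f : I -> V -> R^o) (df : I -> R) x v :
  uniq r -> (forall i, is_derive x v (f i) (df i)) ->
  is_derive x v (fun y => \prod_(i <- r) f i y : R^o)
    (\sum_(i <- r) df i * \prod_(j <- r | j != i) f j x).
Proof.
move=> + fd; elim: r => [_|a r IH /= /andP [ar ur]].
  under eq_fun do rewrite big_nil; rewrite big_nil; exact: is_derive_cst.
under eq_fun do rewrite big_cons.
apply: (is_derive_eq (is_derive_mulr (fd a) (IH ur))).
rewrite big_cons big_cons eqxx /=; congr (_ * _ + _).
  rewrite -[RHS]big_filter; have -> // : [seq j <- r | j != a] = r.
  by apply/all_filterP/allP => j jr; apply: contraNneq ar => <-.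
rewrite mulr_sumr !big_seq; apply: eq_bigr => i ir.
have ai : a != i by apply: contraNneq ar => ->.
by rewrite big_cons ai; exact: mulrCA.
Qed.

(** Jacobi's formula. The product rule on the Leibniz expansion gives the sum over [i] of the
    determinants in which row [i] is replaced by that of [dA]; each is expanded along this row. *)
Lemma is_derive_det n (A : V -> 'M[R]_n) x v dA : is_derive x v A dA ->
  is_derive x v (fun y => \det (A y) : R^o) (\tr (dA *m \adj (A x))).
Proof.
move=> /is_derive_mxP Ad; rewrite /determinant.
have H : is_derive x v (fun y => \sum_(s : 'S_n) (-1) ^+ s * \prod_i A y i (s i) : R^o)
    (\sum_(s : 'S_n) (-1) ^+ s * (\sum_i dA i (s i) * \prod_(j | j != i) A x j (s j))).
  apply: is_derive_sumr => s.
  have Hp := @is_derive_prodr _ (index_enum 'I_n) (fun i y => A y i (s i)) (fun i => dA i (s i)) x v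
    (index_enum_uniq _) (fun i => Ad i (s i)).
  apply: (is_derive_eq (is_derive_mulr (is_derive_cst ((-1) ^+ s : R) x v) Hp)).
  by rewrite mul0r add0r.
apply: (is_derive_eq H).
pose Bm i : 'M[R]_n := \matrix_(k, l) if k == i then dA k l else A x k l.
transitivity (\sum_i \det (Bm i)).
  rewrite /determinant exchange_big /=; apply: eq_bigr => s _.
  rewrite mulr_sumr; apply: eq_bigr => i _; congr (_ * _).
  rewrite [RHS](bigD1 i) //= mxE eqxx; congr (_ * _); apply: eq_bigr => j /negbTE ji.
  by rewrite mxE ji.
apply: eq_bigr => i _; rewrite (expand_det_row _ i) mxE; apply: eq_bigr => j _.
rewrite !mxE eqxx; congr (_ * _); rewrite /cofactor; congr (_ * \det _).
by apply/matrixP => k l; rewrite !mxE eq_sym (negbTE (neq_lift _ _)).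
Qed.

End DeterminantDerivative.

(** * Derivatives at time 0 *)

Section TimeDerivative.
Context {R : realType} {n : nat}.
Local Notation vec := 'rV[R]_n.
Variables (eps : R) (U : set vec).
Hypotheses (eps0 : 0 < eps) (oU : open U).

Definition cylinder : set (R^o * vec) := [set z | `|z.1| < eps /\ U z.2].

Lemma open_cylinder : open cylinder.
Proof.
rewrite openE => -[t v] [/= te Uv].
exists (ball t (eps - `|t|), U).
  by split => /=; [apply: nbhsx_ballx; rewrite subr_gt0|exact: open_near oU Uv].
move=> [s w] [/= st Uw]; split => //=.
move: st; rewrite /ball /= => st.
by rewrite -(subrK t s) (le_lt_trans (ler_normD _ _)) // -ltrBrDr distrC.
Qed.

Lemma cylinder0 v : U v -> cylinder (0, v).
Proof. by split=> //=; rewrite normr0. Qed.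

Variables (p q : nat) (f : R^o * vec -> 'M[R]_(p, q)).
Hypothesis fs : smooth_on cylinder f.

Lemma time_smooth : smooth_on U (fun v => 'D_1 (fun t : R^o => f (t, v)) 0).
Proof.
have H := @smooth_on_slice R vec _ _ _ 0 (smooth_on_derive ((1, 0) : R^o * vec) fs).
have H' := smooth_on_sub (fun v Uv => cylinder0 Uv) H.
apply: (smooth_on_congr oU _ H') => v Uv; apply: esym; exact: derive_time.
Qed.

Lemma time_is_derive v : U v ->
  is_derive (0 : R^o) 1 (fun t : R^o => f (t, v)) ('D_1 (fun t : R^o => f (t, v)) 0).
Proof.
move=> Uv; split=> //; apply: derivable_time.
exact: smooth_on_derivable fs (cylinder0 Uv).
Qed.

(** Time and space derivatives are both directional derivatives on the product, where Schwarz's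
    theorem exchanges them. *)
Lemma time_schwarz u x : U u ->
  is_derive (0 : R^o) 1 (fun t : R^o => 'D_x (fun v => f (t, v)) u)
    ('D_x (fun v => 'D_1 (fun t : R^o => f (t, v)) 0) u).
Proof.
move=> Uu.
have E1 : (fun t : R^o => 'D_x (fun v => f (t, v)) u) =
    (fun t : R^o => (fun z => 'D_((0, x) : R^o * vec) f z) (t, u)).
  by apply/funext => t; exact: derive_slice.
have E2 : (fun v => 'D_1 (fun t : R^o => f (t, v)) 0) =
    (fun v => (fun z => 'D_((1, 0) : R^o * vec) f z) (0, v)).
  by apply/funext => v; exact: derive_time.
rewrite E1 E2 {E1 E2}; split.
  apply: (@derivable_time R vec _ (fun z => 'D_((0, x) : R^o * vec) f z)).
  exact: smooth_on_derivable (smooth_on_derive _ fs) (cylinder0 Uu).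
apply: (etrans (@derive_time R vec _ (fun z => 'D_((0, x) : R^o * vec) f z) 0 u)).
apply: (etrans _ (esym (@derive_slice R vec _ (fun z => 'D_((1, 0) : R^o * vec) f z) 0 u x))).
by apply: schwarz_mx fs; [exact: open_cylinder|exact: cylinder0].
Qed.

End TimeDerivative.

(** * Rate of the connection and of the curvature *)

Section FirstVariation.
Context {R : realType} {n : nat}.
Local Notation vec := 'rV[R]_n.
Variables (eps : R) (U : set vec) (Gt : R^o -> vec -> 'M[R]_n).
Hypotheses (eps0 : 0 < eps) (oU : open U).
Hypothesis Gs : smooth_on (cylinder eps U) (fun z => Gt z.1 z.2).
Hypothesis Gsym : forall t v, `|t| < eps -> U v -> (Gt t v)^T = Gt t v.
Hypothesis Gunit : forall t v, `|t| < eps -> U v -> Gt t v \in unitmx.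

Fact metric_rate_sig : {f : vec -> 'M[R]_n | f = fun v => 'D_1 (fun t : R^o => Gt t v) 0}.
Proof. by eexists. Qed.
Definition metric_rate := sval metric_rate_sig.
Local Notation B := metric_rate.
Local Notation G0 := (Gt 0).
Fact chr_rate_sig : {f : 'I_n -> vec -> 'M[R]_n | f = fun k v => 'D_1 (fun t : R^o => chr (Gt t) k v) 0}.
Proof. by eexists. Qed.
Definition chr_rate := sval chr_rate_sig.
(** The rate of the Levi-Civita connection, which is a tensor although the Christoffel symbols are
    not. *)
Fact gam_rate_sig : {f : vec -> vec -> vec -> vec | f = fun v x y => \row_k bil (chr_rate k v) x y}.
Proof. by eexists. Qed.
Definition gam_rate := sval gam_rate_sig.
Fact dgam_rate_sig : {f : vec -> vec -> vec -> vec -> vec | f = fun u w x y => 'D_w (fun v => gam_rate v x y) u}.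
Proof. by eexists. Qed.
Definition dgam_rate := sval dgam_rate_sig.

Let e0 : `|0 : R| < eps. Proof. by rewrite normr0. Qed.
Let oZ : open (cylinder eps U). Proof. exact: open_cylinder. Qed.
Let Gu z : cylinder eps U z -> Gt z.1 z.2 \in unitmx.
Proof. by case: z => t v [/= te Uv]; exact: Gunit. Qed.

Lemma metric_rateE v : 'D_1 (fun t : R^o => Gt t v) 0 = B v.
Proof. by rewrite /metric_rate (svalP metric_rate_sig). Qed.

Lemma slice_smooth t : `|t| < eps -> smooth_on U (Gt t).
Proof.
move=> te; have H := @smooth_on_slice R vec _ _ _ t Gs.
by apply: smooth_on_sub H => v Uv; split.
Qed.

Lemma metric_rate_smooth : smooth_on U B.
Proof.
have := time_smooth eps0 oU Gs; apply: smooth_on_congr => // v _ /=.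
exact: metric_rateE.
Qed.

Lemma metric_rate_time v : U v -> is_derive (0 : R^o) 1 (fun t : R^o => Gt t v) (B v).
Proof. by move=> Uv; rewrite -metric_rateE; exact: (time_is_derive eps0 Gs Uv). Qed.

Lemma near0_eps : \forall t \near (0 : R^o), `|t| < eps.
Proof. by exists eps => //= t; rewrite /ball /= sub0r normrN. Qed.

Lemma metric_rate_sym v : U v -> (B v)^T = B v.
Proof.
move=> Uv; have H := is_derive_trmx (metric_rate_time Uv).
rewrite -[LHS](@derive_val _ _ _ _ _ _ _ H) -[RHS](@derive_val _ _ _ _ _ _ _ (metric_rate_time Uv)).
by apply: near_eq_derive; near=> t; apply: Gsym => //; near: t; exact: near0_eps.
Unshelve. all: by end_near. Qed.

Lemma chr_rate_smooth k : smooth_on U (chr_rate k).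
Proof.
have := time_smooth eps0 oU (smooth_chr oZ Gs Gu k); apply: smooth_on_congr => // v _ /=.
by rewrite /chr_rate (svalP chr_rate_sig).
Qed.

Lemma chr_rate_time k v : U v -> is_derive (0 : R^o) 1 (fun t : R^o => chr (Gt t) k v) (chr_rate k v).
Proof.
by move=> Uv; rewrite /chr_rate (svalP chr_rate_sig); exact: (time_is_derive eps0 (smooth_chr oZ Gs Gu k) Uv).
Qed.

Lemma gam_rateE v x y : gam_rate v x y = \row_k bil (chr_rate k v) x y.
Proof. by rewrite /gam_rate (svalP gam_rate_sig). Qed.

Lemma gam_rate_time v x y : U v ->
  is_derive (0 : R^o) 1 (fun t : R^o => gam (Gt t) v x y) (gam_rate v x y).
Proof.
move=> Uv; rewrite gam_rateE; under eq_fun do rewrite gamE.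
apply: (is_derive_eq (is_derive_row_bil (fun k => chr_rate_time k Uv)
  (is_derive_cst x _ _) (is_derive_cst y _ _))).
by apply/rowP => k; rewrite !mxE bil0l bil0r !addr0.
Qed.

Lemma gam_time (x y : vec) (X Y : R^o -> vec) dX dY v : U v ->
  is_derive (0 : R^o) 1 X dX -> is_derive (0 : R^o) 1 Y dY ->
  is_derive (0 : R^o) 1 (fun t : R^o => gam (Gt t) v (X t) (Y t))
    (gam_rate v (X 0) (Y 0) + gam G0 v dX (Y 0) + gam G0 v (X 0) dY).
Proof.
move=> Uv Xd Yd; rewrite gam_rateE !gamE; under eq_fun do rewrite gamE.
exact: is_derive_row_bil (fun k => chr_rate_time k Uv) Xd Yd.
Qed.

Lemma gam_rateC v x y : U v -> gam_rate v x y = gam_rate v y x.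
Proof.
move=> Uv.
rewrite -[LHS](@derive_val _ _ _ _ _ _ _ (gam_rate_time x y Uv)).
rewrite -[RHS](@derive_val _ _ _ _ _ _ _ (gam_rate_time y x Uv)).
apply: near_eq_derive; near=> t; apply: gamC; apply: open_near_eq oU Uv _ => w Uw.
by apply: Gsym => //; near: t; exact: near0_eps.
Unshelve. all: by end_near. Qed.

Lemma gam_rate_field u w (X Y : vec -> vec) dX dY : U u ->
  is_derive u w X dX -> is_derive u w Y dY ->
  is_derive u w (fun v => gam_rate v (X v) (Y v))
    (dgam_rate u w (X u) (Y u) + gam_rate u dX (Y u) + gam_rate u (X u) dY).
Proof.
move=> Uu Xd Yd.
have cd k := smooth_on_is_derive w (chr_rate_smooth k) Uu.
have -> : dgam_rate u w (X u) (Y u) = \row_k bil ('D_w (chr_rate k) u) (X u) (Y u).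
  rewrite /dgam_rate (svalP dgam_rate_sig); under eq_fun do rewrite gam_rateE.
  have [_ ->] := is_derive_row_bil cd (is_derive_cst (X u) u w) (is_derive_cst (Y u) u w).
  by apply/rowP => k; rewrite !mxE bil0l bil0r !addr0.
rewrite !gam_rateE; under eq_fun do rewrite gam_rateE.
exact: is_derive_row_bil cd Xd Yd.
Qed.

Lemma dgam_time u x y z : U u ->
  is_derive (0 : R^o) 1 (fun t : R^o => dgam (Gt t) u x y z) (dgam_rate u x y z).
Proof.
move=> Uu.
have gs : smooth_on (cylinder eps U) (fun w => gam (Gt w.1) w.2 y z).
  by apply: (smooth_gam oZ Gs Gu); exact: smooth_on_cst.
have H := time_schwarz eps0 oU gs x Uu.
under eq_fun do rewrite -dgamE.
apply: (is_derive_eq H).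
rewrite /dgam_rate (svalP dgam_rate_sig); apply: near_eq_derive; apply: open_near_eq oU Uu _ => v Uv.
by have [_ E] := gam_rate_time y z Uv; exact: E.
Qed.

Definition riem_rate u x y z : vec :=
  dgam_rate u x y z - dgam_rate u y x z
  + (gam_rate u x (gam G0 u y z) + gam G0 u x (gam_rate u y z))
  - (gam_rate u y (gam G0 u x z) + gam G0 u y (gam_rate u x z)).

Lemma riem_time u x y z : U u ->
  is_derive (0 : R^o) 1 (fun t : R^o => riem (Gt t) u x y z) (riem_rate u x y z).
Proof.
move=> Uu.
have H a b : is_derive (0 : R^o) 1 (fun t : R^o => gam (Gt t) u a (gam (Gt t) u b z))
    (gam_rate u a (gam G0 u b z) + gam G0 u a (gam_rate u b z)).
  apply: (is_derive_eq (gam_time a b Uu (is_derive_cst a _ _) (gam_rate_time b z Uu))).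
  by rewrite gam0l addr0.
under eq_fun do rewrite riemE.
exact: is_deriveB (is_deriveD (is_deriveB (dgam_time x y z Uu) (dgam_time y x z Uu)) (H x y)) (H y x).
Qed.

Fact metric_rate_deriv_sig : {f : vec -> vec -> 'M[R]_n | f = fun v w => 'D_w B v}.
Proof. by eexists. Qed.
Definition metric_rate_deriv := sval metric_rate_deriv_sig.
Local Notation dB := metric_rate_deriv.

Lemma metric_rate_derivE v w : 'D_w B v = dB v w.
Proof. by rewrite /metric_rate_deriv (svalP metric_rate_deriv_sig). Qed.

Lemma metric_rate_is_derive v w : U v -> is_derive v w B (dB v w).
Proof. by rewrite -metric_rate_derivE; exact: smooth_on_is_derive metric_rate_smooth. Qed.

Lemma metric_rate_deriv_sym v w : U v -> (dB v w)^T = dB v w.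
Proof.
move=> Uv; have D := metric_rate_is_derive w Uv; have H := is_derive_trmx D.
rewrite -[LHS](@derive_val _ _ _ _ _ _ _ H) -[RHS](@derive_val _ _ _ _ _ _ _ D).
by apply: near_eq_derive; apply: open_near_eq oU Uv _ => x; exact: metric_rate_sym.
Qed.

(** The Koszul formula differentiated in time; the rate of a space derivative of the metric is the
    space derivative of its rate. *)
Lemma koszul_rate v x y z : U v ->
  bil (B v) (gam G0 v x y) z + bil (G0 v) (gam_rate v x y) z =
  2^-1 * (bil (dB v x) y z + bil (dB v y) x z - bil (dB v z) x y).
Proof.
move=> Uv; rewrite -!metric_rate_derivE.
have H1 := is_derive_bil (metric_rate_time Uv) (gam_rate_time x y Uv) (is_derive_cst z _ _).
rewrite bil0r addr0 in H1; rewrite -[LHS](@derive_val _ _ _ _ _ _ _ H1).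
have Dt a b c : is_derive (0 : R^o) 1 (fun t : R^o => bil ('D_a (Gt t) v) b c : R^o) (bil ('D_a B v) b c).
  have H : is_derive (0 : R^o) 1 (fun t : R^o => 'D_a (Gt t) v) ('D_a B v).
    apply: (is_derive_eq (time_schwarz eps0 oU Gs a Uv)).
    apply: near_eq_derive; apply: open_near_eq oU Uv _ => w Uw.
    exact: metric_rateE.
  apply: (is_derive_eq (is_derive_bil H (is_derive_cst b _ _) (is_derive_cst c _ _))).
  by rewrite bil0l bil0r !addr0.
have H2 := is_derive_mulr (is_derive_cst (2^-1 : R) (0 : R^o) (1 : R^o))
  (is_deriveB (is_deriveD (Dt x y z) (Dt y x z)) (Dt z x y)).
rewrite mul0r add0r in H2; rewrite -[RHS](@derive_val _ _ _ _ _ _ _ H2).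
apply: near_eq_derive; near=> t.
have te : `|t| < eps by near: t; exact: near0_eps.
exact: koszul oU Uv (slice_smooth te) (fun w Uw => Gsym te Uw) (Gunit te Uv).
Unshelve. all: by end_near. Qed.

Lemma gam_metric v x y z : U v ->
  bil ('D_x G0 v) y z = bil (G0 v) (gam G0 v x y) z + bil (G0 v) y (gam G0 v x z).
Proof.
move=> Uv.
have K a b c := koszul a b c oU Uv (slice_smooth e0) (fun w Uw => Gsym e0 Uw) (Gunit e0 Uv).
have sD a b c : bil ('D_a G0 v) b c = bil ('D_a G0 v) c b.
  apply: bilC.
  have H := is_derive_trmx (smooth_on_is_derive a (slice_smooth e0) Uv).
  rewrite -[LHS](@derive_val _ _ _ _ _ _ _ H).
  by apply: near_eq_derive; apply: open_near_eq oU Uv _ => w Uw; exact: Gsym.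
rewrite (bilC y (gam G0 v x z) (Gsym e0 Uv)) !K.
have [dG dGE] : exists dG, forall a, 'D_a G0 v = dG a by exists (fun a => 'D_a G0 v).
have {}sD a b c : bil (dG a) b c = bil (dG a) c b by rewrite -dGE.
rewrite !dGE.
rewrite (sD x z y); by field.
Qed.

(** Models a section of one of the first two distributions together with its derivatives [dX].
    Annihilation is required on all of [U] because it is differentiated in space. *)
Definition killed (X : vec -> vec) (dX : vec -> vec -> vec) :=
  (forall v w, U v -> is_derive v w X (dX v w)) /\ forall v z, U v -> bil (B v) (X v) z = 0.

Lemma killedr X dX v z : killed X dX -> U v -> bil (B v) z (X v) = 0.
Proof. by move=> [_ k] Uv; rewrite bilC ?metric_rate_sym ?k. Qed.

(** The product rule for B(X, z) = 0 trades a derivative of [B] for a derivative of [X]. *)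
Lemma killed_deriv X dX v w z : killed X dX -> U v ->
  bil (dB v w) (X v) z = - bil (B v) (dX v w) z.
Proof.
move=> [XD k] Uv.
have H := is_derive_bil (metric_rate_is_derive w Uv) (XD v w Uv) (is_derive_cst z v w).
rewrite bil0r addr0 in H.
have := is_derive_near_cst (open_near_eq oU Uv (fun x Ux => k x z Ux)) H => /eqP.
by rewrite addr_eq0 => /eqP.
Qed.

Lemma killed_derivr X dX v w z : killed X dX -> U v ->
  bil (dB v w) z (X v) = - bil (B v) z (dX v w).
Proof.
move=> kX Uv; rewrite bilC ?metric_rate_deriv_sym // (killed_deriv _ _ kX Uv).
by rewrite bilC // metric_rate_sym.
Qed.

Lemma gam_rate_killed X Y W dX dY dW v : killed X dX -> killed Y dY -> killed W dW -> U v ->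
  bil (G0 v) (gam_rate v (X v) (Y v)) (W v) = 0.
Proof.
move=> kX kY kW Uv; have := koszul_rate (X v) (Y v) (W v) Uv.
rewrite (killedr _ kW Uv) add0r => ->.
rewrite (killed_derivr _ _ kW Uv) (killed_derivr _ (X v) kW Uv) (killed_deriv _ _ kX Uv).
by rewrite kY.2 // kX.2 // (killedr _ kY Uv) !oppr0 !addr0 mulr0.
Qed.

Lemma gam_rate_killed2 X Y dX dY v z : killed X dX -> killed Y dY -> U v ->
  bil (G0 v) (gam_rate v z (Y v)) (X v) =
  2^-1 * (bil (B v) z (dY v (X v)) - bil (B v) z (dX v (Y v))).
Proof.
move=> kX kY Uv; have := koszul_rate z (Y v) (X v) Uv.
rewrite (killedr _ kX Uv) add0r => ->.
rewrite (killed_deriv _ _ kY Uv) (killedr _ kX Uv) (killed_derivr _ z kX Uv).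
by rewrite (killed_derivr _ z kY Uv); ring.
Qed.

Lemma gam_rate_killed12 X Y dX dY v z : killed X dX -> killed Y dY -> U v ->
  bil (G0 v) (gam_rate v (X v) (Y v)) z =
  - (2^-1 * (bil (B v) (dY v (X v)) z + bil (B v) (dX v (Y v)) z))
  - bil (B v) (gam G0 v (X v) (Y v)) z.
Proof.
move=> kX kY Uv; have := koszul_rate (X v) (Y v) z Uv.
rewrite (killed_deriv _ _ kY Uv) (killed_deriv _ _ kX Uv) (killed_deriv _ _ kX Uv).
rewrite (killedr _ kY Uv) oppr0 subr0 => E.
by rewrite -[LHS](addKr (bil (B v) (gam G0 v (X v) (Y v)) z)) E; ring.
Qed.

(* The derivatives of [gam_rate] are eliminated by differentiating
   [gam_rate_killed] for (Y, Y, X) along X and for (X, Y, X) along Y. *)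
Lemma Rm_rate X Y dX dY u : killed X dX -> killed Y dY -> U u ->
  let e := X u in let f := Y u in
  let p := dY u e + gam G0 u e f in let q := dX u f + gam G0 u f e in
  bil (G0 u) (riem_rate u e f f) e =
  bil (B u) (dY u f + gam G0 u f f) (dX u e + gam G0 u e e)
  - bil (B u) p p + bil (B u) p q - bil (B u) q q.
Proof.
move=> kX kY Uu e f p q.
have [XD kX2] := kX; have [YD kY2] := kY.
have symB a b : bil (B u) a b = bil (B u) b a by apply: bilC; exact: metric_rate_sym.
have symG a b : bil (G0 u) a b = bil (G0 u) b a by apply: bilC; exact: Gsym.
have [dG dGE] : exists dG, forall a, 'D_a G0 u = dG a by exists (fun a => 'D_a G0 u).
have met a b c : bil (dG a) b c = bil (G0 u) (gam G0 u a b) c + bil (G0 u) b (gam G0 u a c).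
  by rewrite -dGE; exact: gam_metric.
have Gd a : is_derive u a G0 (dG a).
  by rewrite -dGE; exact: smooth_on_is_derive (slice_smooth e0) Uu.
have D1 : bil (dG e) (gam_rate u f f) e +
    bil (G0 u) (dgam_rate u e f f + gam_rate u (dY u e) f + gam_rate u f (dY u e)) e
    + bil (G0 u) (gam_rate u f f) (dX u e) = 0.
  have H := is_derive_bil (Gd e) (gam_rate_field Uu (YD u e Uu) (YD u e Uu)) (XD u e Uu).
  exact: is_derive_near_cst (open_near_eq oU Uu (fun v Uv => gam_rate_killed kY kY kX Uv)) H.
have D2 : bil (dG f) (gam_rate u e f) e +
    bil (G0 u) (dgam_rate u f e f + gam_rate u (dX u f) f + gam_rate u e (dY u f)) e
    + bil (G0 u) (gam_rate u e f) (dX u f) = 0.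
  have H := is_derive_bil (Gd f) (gam_rate_field Uu (XD u f Uu) (YD u f Uu)) (XD u f Uu).
  exact: is_derive_near_cst (open_near_eq oU Uu (fun v Uv => gam_rate_killed kX kY kX Uv)) H.
have b1 z : bil (G0 u) (gam_rate u z f) e = 2^-1 * (bil (B u) z (dY u e) - bil (B u) z (dX u f)).
  exact: gam_rate_killed2 kX kY Uu.
have b2 z : bil (G0 u) (gam_rate u e z) e = 0.
  by rewrite gam_rateC // (gam_rate_killed2 _ kX kX Uu) subrr mulr0.
have c1 z := gam_rate_killed12 z kY kY Uu.
have c2 z := gam_rate_killed12 z kX kY Uu.
rewrite /riem_rate !(bilBl, bilDl).
rewrite !met !(bilDl) in D1 D2.
rewrite (gam_rateC f (dY u e) Uu) in D1.
rewrite (gam_rateC f (gam G0 u e f) Uu).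
rewrite -/e -/f in c1 c2 *.
have gC : gam G0 u f e = gam G0 u e f.
  by apply: gamC; apply: open_near_eq oU Uu _ => v Uv; exact: Gsym.
rewrite !(b1, b2) in D1 D2 *.
rewrite gC in D2.
move: D1 D2.
rewrite !c1 !c2 /p /q gC !(bilDl, bilDr).
move: (symB (dX u f) (dY u e)) (symB (gam G0 u e f) (dY u e)) (symB (gam G0 u e f) (dX u f)) => -> -> ->.
move: (bil (G0 u) (gam G0 u e (gam_rate u f f)) e) (bil (G0 u) (gam G0 u f (gam_rate u e f)) e)
  (bil (G0 u) (dgam_rate u e f f) e) (bil (G0 u) (dgam_rate u f e f) e) => a b c d E1 E2.
lra.
Qed.

End FirstVariation.

(** * Mixed tensors in terms of covariant derivatives *)

Section MixedTensors.
Context {R : realType} {n : nat}.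
Local Notation vec := 'rV[R]_n.
Implicit Types (Pi Pj Pk : vec -> 'M[R]_n).

Lemma inner_bil (G : vec -> 'M[R]_n) u v w : inner_g G u v w = bil (G u) v w.
Proof. by rewrite bilv. Qed.

(** The covariant derivative, along the projection of [v] by [Pi], of the section obtained by
    projecting the constant field [w] by [Pj]. *)
Fact covd_sig : {f : (vec -> 'M[R]_n) -> vec -> (vec -> 'M[R]_n) -> (vec -> 'M[R]_n) -> vec -> vec -> vec |
  f = fun G u Pi Pj v w => w *m 'D_(v *m Pi u) Pj u + gam G u (v *m Pi u) (w *m Pj u)}.
Proof. by eexists. Qed.
Definition covd := sval covd_sig.

Lemma covE G u Pi Pj v w :
  covd G u Pi Pj v w = w *m 'D_(v *m Pi u) Pj u + gam G u (v *m Pi u) (w *m Pj u).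
Proof. by rewrite /covd (svalP covd_sig). Qed.

Variables (U : set vec) (G : vec -> 'M[R]_n) (u : vec).
Hypotheses (oU : open U) (Uu : U u).
Local Notation cov := (covd G u).

Lemma nabla_along Pi Pj (X Y : vec -> vec) v w : smooth_on U Pj ->
  X u = v *m Pi u -> (forall x, U x -> Y x = w *m Pj x) ->
  nabla G X Y u = cov Pi Pj v w.
Proof.
move=> Ps Xu YE; rewrite nablaE covE Xu (YE u Uu); congr (_ + _).
have H := is_derive_mulmx (is_derive_cst w u (v *m Pi u)) (smooth_on_is_derive (v *m Pi u) Ps Uu).
rewrite mul0mx add0r in H; rewrite -[RHS](@derive_val _ _ _ _ _ _ _ H).
by apply: near_eq_derive; exact: open_near_eq oU Uu YE.
Qed.

Lemma cov_linr Pi Pj v a w w' : cov Pi Pj v (a *: w + w') = a *: cov Pi Pj v w + cov Pi Pj v w'.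
Proof.
rewrite !covE !mulmxDl -!scalemxAl gamDr gamZr scalerDr !addrA; congr (_ + _).
by rewrite -!addrA; congr (_ + _); rewrite addrC.
Qed.

Lemma cov_linl Pi Pj v a v' w : smooth_on U Pj ->
  cov Pi Pj (a *: v + v') w = a *: cov Pi Pj v w + cov Pi Pj v' w.
Proof.
move=> Ps; rewrite !covE !mulmxDl -!scalemxAl gamDl gamZl.
have Pd : differentiable Pj u by exact: C1_differentiable_mx oU Uu (Ps 1%N).
rewrite (deriveE _ Pd) (deriveE (v *m Pi u) Pd) (deriveE (v' *m Pi u) Pd) linearP.
rewrite mulmxDr -scalemxAr scalerDr !addrA; congr (_ + _).
by rewrite -!addrA; congr (_ + _); rewrite addrC.
Qed.

Section Mixed.
Variables (Pi Pj Pk : vec -> 'M[R]_n).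
Hypotheses (Pis : smooth_on U Pi) (Pjs : smooth_on U Pj).
Hypotheses (Pik : forall x, U x -> Pi x *m Pk x = 0) (Pjk : forall x, U x -> Pj x *m Pk x = 0).

Let perpE (P : vec -> 'M[R]_n) (v : vec) x : P x *m Pk x = 0 ->
  along (perp Pk) (along P (cst v)) x = v *m P x.
Proof. by move=> PPk; rewrite /along /perp /cst mulmxBr mulmx1 -mulmxA PPk mulmx0 subr0. Qed.

Let nabla_perp (A B : vec -> 'M[R]_n) v w : smooth_on U B ->
  (forall x, U x -> A x *m Pk x = 0) -> (forall x, U x -> B x *m Pk x = 0) ->
  nabla G (along (perp Pk) (along A (cst v))) (along (perp Pk) (along B (cst w))) u = cov A B v w.
Proof.
move=> Bs AP BP; apply: nabla_along => // [|x Ux]; first exact/perpE/AP.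
exact/perpE/BP.
Qed.

Lemma hmixE v w : at_vec (hmix G Pi Pj Pk) u v w =
  (2^-1 *: (cov Pi Pj v w + cov Pj Pi w v + (cov Pj Pi v w + cov Pi Pj w v))) *m Pk u.
Proof.
rewrite /at_vec /hmix /sff_perp /along -!/(along _ _) -mulmxDl -scalerDr.
by rewrite !nabla_perp.
Qed.

Lemma TmixE v w : at_vec (Tmix G Pi Pj Pk) u v w =
  (2^-1 *: (cov Pi Pj v w - cov Pj Pi w v + (cov Pj Pi v w - cov Pi Pj w v))) *m Pk u.
Proof.
rewrite /at_vec /Tmix /int_perp /along -!/(along _ _) -mulmxDl -scalerDr.
by rewrite !nabla_perp.
Qed.

End Mixed.

Lemma sffE P v w : smooth_on U P -> at_vec (sff G P) u v w =
  (2^-1 *: (cov P P v w + cov P P w v)) *m perp P u.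
Proof.
move=> Ps; rewrite /at_vec /sff /along -!/(along _ _).
by congr ((_ *: (_ + _)) *m _); apply: nabla_along.
Qed.

Lemma adjoint_opE (T : (vec -> vec) -> (vec -> vec) -> vec -> vec) z v w : G u \in unitmx ->
  (G u)^T = G u ->
  (forall a w w', at_vec T u v (a *: w + w') = a *: at_vec T u v w + at_vec T u v w') ->
  bil (G u) (adjoint_op G T u z v) w = bil (G u) (at_vec T u v w) z.
Proof.
move=> Gu Gs lT.
rewrite bilv /adjoint_op mulmxKV //.
have T0 : at_vec T u v 0 = 0.
  by have := lT (-1) 0 0; rewrite scaler0 addr0 scaleN1r addNr.
have sT (s : seq 'I_n) (c : 'I_n -> R) (f : 'I_n -> vec) :
    at_vec T u v (\sum_(i <- s) c i *: f i) = \sum_(i <- s) c i *: at_vec T u v (f i).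
  by elim: s => [|i s IH]; rewrite ?big_nil ?T0 // !big_cons lT IH.
rewrite [in RHS](row_sum_delta w) sT bil_suml mxE; apply: eq_bigr => k _.
by rewrite !mxE bilZl mulrC inner_bil.
Qed.

End MixedTensors.

(** Complementary projectors onto orthogonal distributions; the last three fields say that they are
    self-adjoint for [G]. Idempotence follows from [sp_sum] and the vanishing products. *)
Record splitting {R : realType} {n : nat} (U : set 'rV[R]_n) (G P1 P2 P3 : 'rV[R]_n -> 'M[R]_n) :
    Prop := Splitting {
  sp_metric : smooth_on U G;
  sp_posdef : forall v, U v -> posdef (G v);
  sp_smooth1 : smooth_on U P1; sp_smooth2 : smooth_on U P2; sp_smooth3 : smooth_on U P3;
  sp_sum : forall v, U v -> P1 v + P2 v + P3 v = 1%:M;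
  sp_12 : forall v, U v -> P1 v *m P2 v = 0; sp_13 : forall v, U v -> P1 v *m P3 v = 0;
  sp_21 : forall v, U v -> P2 v *m P1 v = 0; sp_23 : forall v, U v -> P2 v *m P3 v = 0;
  sp_31 : forall v, U v -> P3 v *m P1 v = 0; sp_32 : forall v, U v -> P3 v *m P2 v = 0;
  sp_adj1 : forall v, U v -> P1 v *m G v = G v *m (P1 v)^T;
  sp_adj2 : forall v, U v -> P2 v *m G v = G v *m (P2 v)^T;
  sp_adj3 : forall v, U v -> P3 v *m G v = G v *m (P3 v)^T }.

(** * The Euler-Lagrange expression at a point *)

Section EulerLagrange.
Context {R : realType} {n : nat}.
Local Notation vec := 'rV[R]_n.
Variables (U : set vec) (G P1 P2 P3 : vec -> 'M[R]_n) (u : vec).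
Hypotheses (oU : open U) (Uu : U u) (sp : splitting U G P1 P2 P3).
Let Gs := sp_metric sp. Let Gpos := sp_posdef sp.
Let P1s := sp_smooth1 sp. Let P2s := sp_smooth2 sp. Let P3s := sp_smooth3 sp.
Let P12 := sp_12 sp. Let P13 := sp_13 sp. Let P21 := sp_21 sp. Let P23 := sp_23 sp.
Let P31 := sp_31 sp. Let P32 := sp_32 sp.
Let P1a := sp_adj1 sp. Let P2a := sp_adj2 sp. Let P3a := sp_adj3 sp.
Let P11 v : U v -> P1 v *m P1 v = P1 v.
Proof. by move=> Uv; rewrite -[RHS]mulmx1 -(sp_sum sp Uv) !mulmxDr P12 // P13 // !addr0. Qed.
Let P22 v : U v -> P2 v *m P2 v = P2 v.
Proof. by move=> Uv; rewrite -[RHS]mulmx1 -(sp_sum sp Uv) !mulmxDr P21 // P23 // addr0 add0r. Qed.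
Local Notation cov := (covd G u).
Local Notation ip := (bil (G u)).

Let Gsym v : U v -> (G v)^T = G v. Proof. by move=> /Gpos []. Qed.
Let Gunit v : U v -> G v \in unitmx. Proof. by move=> /Gpos /posdef_unit. Qed.

Lemma ipC x y : ip x y = ip y x.
Proof. by apply: bilC; exact: Gsym. Qed.

Lemma ip_adj (P : 'M[R]_n) x y : P *m G u = G u *m P^T -> ip (x *m P) y = ip x (y *m P).
Proof. by move=> Pa; rewrite !bilv trmx_mul mulmxA -!mulmxA (mulmxA P) Pa !mulmxA. Qed.

Lemma cov_zero Pi Pj v w : v *m Pi u = 0 -> w *m Pj u = 0 -> cov Pi Pj v w = 0.
Proof. by move=> v0 w0; rewrite covE v0 gam0l addr0 derive0 mulmx0. Qed.

Lemma gam_metric1 x y z :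
  bil ('D_x G u) y z = ip (gam G u x y) z + ip y (gam G u x z).
Proof.
have K a b c := koszul a b c oU Uu Gs Gsym (Gunit Uu).
have [dG dGE] : exists dG, forall a, 'D_a G u = dG a by exists (fun a => 'D_a G u).
have sD a b c : bil (dG a) b c = bil (dG a) c b.
  apply: bilC; rewrite -dGE.
  have H := is_derive_trmx (smooth_on_is_derive a Gs Uu).
  rewrite -[LHS](@derive_val _ _ _ _ _ _ _ H).
  by apply: near_eq_derive; exact: open_near_eq oU Uu Gsym.
by rewrite (ipC y) !K !dGE (sD x z y); field.
Qed.

(* Differentiates [ip (v *m Pi) (w *m Pj) = 0]. *)
Lemma cov_skew Ph Pi Pj x v w : smooth_on U Pi -> smooth_on U Pj ->
  (forall y, U y -> Pi y *m G y *m (Pj y)^T = 0) ->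
  ip (cov Ph Pi x v) (w *m Pj u) = - ip (v *m Pi u) (cov Ph Pj x w).
Proof.
move=> Pis Pjs PiPj; set d := x *m Ph u.
have Fd (P : vec -> 'M[R]_n) (y : vec) : smooth_on U P -> is_derive u d (fun z => y *m P z) (y *m 'D_d P u).
  move=> Ps; have H := is_derive_mulmx (is_derive_cst y u d) (smooth_on_is_derive d Ps Uu).
  by rewrite mul0mx add0r in H.
have H := is_derive_bil (smooth_on_is_derive d Gs Uu) (Fd Pi v Pis) (Fd Pj w Pjs).
have := is_derive_near_cst (c := 0) _ H; rewrite gam_metric1 !covE -/d !bilDl !bilDr => H0.
have : \forall y \near u, bil (G y) (v *m Pi y) (w *m Pj y) = 0.
  apply: open_near_eq oU Uu _ => y Uy.
  by rewrite bilv trmx_mul !mulmxA -[v *m _ *m _]mulmxA -[v *m _ *m _]mulmxA PiPj // mulmx0 mul0mx mxE.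
by move=> /H0; lra.
Qed.

Section Frames.
Variables (e f : vec).
Hypotheses (eP1 : e *m P1 u = e) (fP2 : f *m P2 u = f).

Let eP2 : e *m P2 u = 0. Proof. by rewrite -eP1 -mulmxA P12 // mulmx0. Qed.
Let fP1 : f *m P1 u = 0. Proof. by rewrite -fP2 -mulmxA P21 // mulmx0. Qed.
Let eP3 : e *m P3 u = 0. Proof. by rewrite -eP1 -mulmxA P13 // mulmx0. Qed.
Let fP3 : f *m P3 u = 0. Proof. by rewrite -fP2 -mulmxA P23 // mulmx0. Qed.

Let p := cov P1 P2 e f.
Let q := cov P2 P1 f e.

Lemma h12E : at_vec (hmix G P1 P2 P3) u e f = (2^-1 *: (p + q)) *m P3 u.
Proof.
rewrite (hmixE G oU Uu) // (cov_zero (Pi := P2) (Pj := P1) eP2 fP1).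
by rewrite (cov_zero (Pi := P1) (Pj := P2) fP1 eP2) !addr0.
Qed.

Lemma t12E : at_vec (Tmix G P1 P2 P3) u e f = (2^-1 *: (p - q)) *m P3 u.
Proof.
rewrite (TmixE G oU Uu) // (cov_zero (Pi := P2) (Pj := P1) eP2 fP1).
by rewrite (cov_zero (Pi := P1) (Pj := P2) fP1 eP2) !subr0 addr0.
Qed.

Lemma hmix_lin Pi Pj Pk v a w w' : smooth_on U Pi -> smooth_on U Pj ->
  (forall x, U x -> Pi x *m Pk x = 0) -> (forall x, U x -> Pj x *m Pk x = 0) ->
  at_vec (hmix G Pi Pj Pk) u v (a *: w + w') =
  a *: at_vec (hmix G Pi Pj Pk) u v w + at_vec (hmix G Pi Pj Pk) u v w'.
Proof.
move=> Pis Pjs ik jk; rewrite !(hmixE G oU Uu) // !cov_linr.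
rewrite (cov_linl G oU Uu Pj w a w' v Pis) (cov_linl G oU Uu Pi w a w' v Pjs).
rewrite scalemxAl -mulmxDl; congr (_ *m _).
by apply/rowP => k; rewrite !mxE; ring.
Qed.

Lemma Tmix_lin Pi Pj Pk v a w w' : smooth_on U Pi -> smooth_on U Pj ->
  (forall x, U x -> Pi x *m Pk x = 0) -> (forall x, U x -> Pj x *m Pk x = 0) ->
  at_vec (Tmix G Pi Pj Pk) u v (a *: w + w') =
  a *: at_vec (Tmix G Pi Pj Pk) u v w + at_vec (Tmix G Pi Pj Pk) u v w'.
Proof.
move=> Pis Pjs ik jk; rewrite !(TmixE G oU Uu) // !cov_linr.
rewrite (cov_linl G oU Uu Pj w a w' v Pis) (cov_linl G oU Uu Pi w a w' v Pjs).
rewrite scalemxAl -mulmxDl; congr (_ *m _).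
by apply/rowP => k; rewrite !mxE; ring.
Qed.

Section Vertical.
Variable (Y : vec).
Hypothesis YP3 : Y *m P3 u = Y.
Let YP1 : Y *m P1 u = 0. Proof. by rewrite -YP3 -mulmxA P31 // mulmx0. Qed.
Let YP2 : Y *m P2 u = 0. Proof. by rewrite -YP3 -mulmxA P32 // mulmx0. Qed.
Let w := ip (cov P3 P2 Y f) e.

Let orth (Pi Pj : vec -> 'M[R]_n) v : U v -> Pi v *m G v = G v *m (Pi v)^T -> Pj v *m Pi v = 0 ->
  Pi v *m G v *m (Pj v)^T = 0.
Proof. by move=> Uv Pa PP; rewrite Pa -mulmxA -trmx_mul PP trmx0 mulmx0. Qed.

(** Metric compatibility moves the derivative of the section extending [Y] onto the extension of [e]
    or [f]. Every mixed tensor with two arguments in these directions is then expressed by [p], [q]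
    and the single number [w]. *)
Lemma skew_q : ip (cov P2 P3 f Y) e = - ip q Y.
Proof.
rewrite -{1}eP1 (@cov_skew P2 P3 P1 f Y e) // ?YP3 1?ipC //.
by move=> y Uy; apply: orth => //; [exact: P3a|exact: P13].
Qed.

Lemma skew_p : ip (cov P1 P3 e Y) f = - ip p Y.
Proof.
rewrite -{1}fP2 (@cov_skew P1 P3 P2 e Y f) // ?YP3 1?ipC //.
by move=> y Uy; apply: orth => //; [exact: P3a|exact: P23].
Qed.

Lemma skew_w : ip (cov P3 P1 Y e) f = - w.
Proof.
rewrite -{1}fP2 (@cov_skew P3 P1 P2 Y e f) // ?eP1 1?ipC //.
by move=> y Uy; apply: orth => //; [exact: P1a|exact: P21].
Qed.

Lemma A23E : ip (Amix G P2 P3 P1 u e f) Y = 2^-1 * (- ip q Y + w).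
Proof.
rewrite /Amix adjoint_opE ?Gunit ?Gsym //; last by move=> *; exact: hmix_lin.
rewrite (hmixE G oU Uu) // (cov_zero (Pi := P3) (Pj := P2) fP3 YP2).
rewrite (cov_zero (Pi := P2) (Pj := P3) YP2 fP3) !addr0.
by rewrite ip_adj ?P1a // eP1 bilZl bilDl skew_q.
Qed.

Lemma T23E : ip (Tsharpmix G P2 P3 P1 u e f) Y = 2^-1 * (- ip q Y - w).
Proof.
rewrite /Tsharpmix adjoint_opE ?Gunit ?Gsym //; last by move=> *; exact: Tmix_lin.
rewrite (TmixE G oU Uu) // (cov_zero (Pi := P3) (Pj := P2) fP3 YP2).
rewrite (cov_zero (Pi := P2) (Pj := P3) YP2 fP3) !subr0 addr0.
by rewrite ip_adj ?P1a // eP1 bilZl bilBl skew_q.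
Qed.

Lemma A13E : ip (Amix G P1 P3 P2 u f e) Y = 2^-1 * (- ip p Y - w).
Proof.
rewrite /Amix adjoint_opE ?Gunit ?Gsym //; last by move=> *; exact: hmix_lin.
rewrite (hmixE G oU Uu) // (cov_zero (Pi := P3) (Pj := P1) eP3 YP1).
rewrite (cov_zero (Pi := P1) (Pj := P3) YP1 eP3) !addr0.
by rewrite ip_adj ?P2a // fP2 bilZl bilDl skew_p skew_w.
Qed.

Lemma T13E : ip (Tsharpmix G P1 P3 P2 u f e) Y = 2^-1 * (- ip p Y + w).
Proof.
rewrite /Tsharpmix adjoint_opE ?Gunit ?Gsym //; last by move=> *; exact: Tmix_lin.
rewrite (TmixE G oU Uu) // (cov_zero (Pi := P3) (Pj := P1) eP3 YP1).
rewrite (cov_zero (Pi := P1) (Pj := P3) YP1 eP3) !subr0 addr0.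
by rewrite ip_adj ?P2a // fP2 bilZl bilBl skew_p skew_w opprK.
Qed.

End Vertical.

(* [p] and [q] stand for nabla_e f and nabla_f e; the terms g(nabla_X f, e) in the
   tensors A and T cancel out of the Euler-Lagrange expression. *)
Definition el_term p q X Y : R :=
  ip p X * ip q Y + ip p Y * ip q X - 2 * ip p X * ip p Y - 2 * ip q X * ip q Y.

Lemma el_termE X Y : X *m P3 u = X -> Y *m P3 u = Y ->
  let A23 := Amix G P2 P3 P1 u in
  let A13 := Amix G P1 P3 P2 u in
  let T23 := Tsharpmix G P2 P3 P1 u in
  let T13 := Tsharpmix G P1 P3 P2 u in
  let h12 := at_vec (hmix G P1 P2 P3) u in
  let t12 := at_vec (Tmix G P1 P2 P3) u in
  let ip := inner_g G u in
  - ip (A23 e f) Y * ip (h12 e f + t12 e f) X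
  - ip (A23 e f) X * ip (h12 e f + t12 e f) Y
  - ip (A13 f e) Y * ip (h12 e f - t12 e f) X
  - ip (A13 f e) X * ip (h12 e f - t12 e f) Y
  - ip (A23 e f) X * ip (T23 e f) Y
  - ip (A23 e f) Y * ip (T23 e f) X
  - ip (A13 f e) X * ip (T13 f e) Y
  - ip (A13 f e) Y * ip (T13 f e) X
  - 2 * ip (T23 e f) X * ip (T23 e f) Y
  - 2 * ip (T13 f e) X * ip (T13 f e) Y
  - 2 * ip X (h12 e f) * ip Y (h12 e f)
  - 2 * ip X (t12 e f) * ip Y (t12 e f) = el_term p q X Y.
Proof.
move=> XP YP A23 A13 T23 T13 h12 t12 ip.
have hA23 Z (ZP : Z *m P3 u = Z) : bil (G u) (A23 e f) Z = _ := A23E ZP.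
have hT23 Z (ZP : Z *m P3 u = Z) : bil (G u) (T23 e f) Z = _ := T23E ZP.
have hA13 Z (ZP : Z *m P3 u = Z) : bil (G u) (A13 f e) Z = _ := A13E ZP.
have hT13 Z (ZP : Z *m P3 u = Z) : bil (G u) (T13 f e) Z = _ := T13E ZP.
have hh : h12 e f = _ := h12E.
have ht : t12 e f = _ := t12E.
move: (A23 e f) (T23 e f) (A13 f e) (T13 f e) (h12 e f) (t12 e f) hA23 hT23 hA13 hT13 hh ht.
clear A23 T23 A13 T13 h12 t12 => A23 T23 A13 T13 h12 t12 hA23 hT23 hA13 hT13 -> ->.
rewrite {}/ip !inner_bil.
rewrite (hA23 X XP) (hA23 Y YP) (hT23 X XP) (hT23 Y YP).
rewrite (hA13 X XP) (hA13 Y YP) (hT13 X XP) (hT13 Y YP).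
have E Z z : Z *m P3 u = Z -> bil (G u) (z *m P3 u) Z = bil (G u) z Z.
  by move=> ZP; rewrite ip_adj ?P3a // ZP.
rewrite !(ipC X) !(ipC Y) -!mulmxDl -!mulmxBl !(E X _ XP) !(E Y _ YP).
rewrite !(bilDl, bilNl, bilZl).
rewrite /el_term.
move: (ip (cov P3 P2 X f) e) (ip (cov P3 P2 Y f) e) (ip p X) (ip p Y) (ip q X) (ip q Y) => a b c d g h.
by field.
Qed.

End Frames.

(** Replacing constant fields by their projections at [u] does not change the D3 component:
    differentiating [Pi *m Pi = Pi] and multiplying by [P3] shows that the derivative of [Pi],
    followed by [P3], may be preceded by [Pi]. *)
Lemma covd_proj Pi v w : smooth_on U Pi -> (forall x, U x -> Pi x *m Pi x = Pi x) ->
  (forall x, U x -> Pi x *m P3 x = 0) ->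
  cov Pi Pi (v *m Pi u) (w *m Pi u) *m P3 u = cov Pi Pi v w *m P3 u.
Proof.
move=> Pis PP PP3; rewrite !covE -[v *m _ *m _]mulmxA -[w *m Pi u *m Pi u]mulmxA !PP //.
rewrite !mulmxDl; congr (_ + _); rewrite -!mulmxA; congr (_ *m _).
set d := v *m _.
have Pd := smooth_on_is_derive d Pis Uu.
have H := is_derive_mulmx Pd Pd.
have E : 'D_d Pi u = 'D_d Pi u *m Pi u + Pi u *m 'D_d Pi u.
  rewrite -[RHS](@derive_val _ _ _ _ _ _ _ H).
  by apply: near_eq_derive; apply: open_near_eq oU Uu _ => x Ux; rewrite PP.
by rewrite [in RHS]E mulmxDl -[X in X + _]mulmxA PP3 // mulmx0 add0r mulmxA.
Qed.

(** The trace with the inverse metric is the sum over an orthonormal frame [T] of the whole space.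
    By [covd_proj] the rows of [T] may be projected by [Pi], and the projected family has the same
    matrix [E^T *m E] as the orthonormal frame [E]. *)
Lemma mean_curvE Pi r (E : 'M[R]_(r, n)) : smooth_on U Pi ->
  (forall x, U x -> Pi x *m Pi x = Pi x) -> (forall x, U x -> Pi x *m P3 x = 0) ->
  Pi u = G u *m (E^T *m E) -> E *m G u *m E^T = 1%:M ->
  mean_curv G Pi u *m P3 u = \sum_(a < r) cov Pi Pi (row a E) (row a E) *m P3 u.
Proof.
move=> Pis PP PP3 PE EE.
have f1 : row_free (1%:M : 'M[R]_n) by rewrite row_free_unit unitmx1.
have [T _ TT] := exists_orthonormal (Gpos Uu) f1.
have TG : T^T *m T = invmx (G u).
  rewrite (gramQE (submx1 T) TT) /gramQ trmx1 !mul1mx !mulmx1 //.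
pose b x y := cov Pi Pi x y *m P3 u.
have bl a x x' y : b (a *: x + x') y = a *: b x y + b x' y.
  by rewrite /b (cov_linl G oU Uu Pi x a x' y Pis) mulmxDl scalemxAl.
have br a x y y' : b x (a *: y + y') = a *: b x y + b x y'.
  by rewrite /b cov_linr mulmxDl scalemxAl.
transitivity (\sum_p \sum_s (T^T *m T) p s *: b (delta_mx 0 p) (delta_mx 0 s)).
  rewrite /mean_curv /trace_g mulmx_suml.
  transitivity (\sum_k \sum_l invmx (G u) k l *: (2^-1 *: (b (delta_mx 0 k) (delta_mx 0 l) + b (delta_mx 0 l) (delta_mx 0 k)))).
    apply: eq_bigr => k _; rewrite mulmx_suml; apply: eq_bigr => l _.
    rewrite -scalemxAl (sffE G oU Uu) // /perp -mulmxA mulmxBl mul1mx PP3 // subr0.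
    by rewrite -scalemxAl mulmxDl.
  have symI k l : invmx (G u) k l = invmx (G u) l k.
    by rewrite -{1}(Gsym Uu) -trmx_inv mxE.
  rewrite TG.
  transitivity (2^-1 *: (\sum_p \sum_s invmx (G u) p s *: b (delta_mx 0 p) (delta_mx 0 s)
     + \sum_p \sum_s invmx (G u) p s *: b (delta_mx 0 p) (delta_mx 0 s))).
    rewrite [X in _ + X]exchange_big -big_split scaler_sumr; apply: eq_bigr => k _ /=.
    rewrite -big_split scaler_sumr; apply: eq_bigr => l _ /=.
    by rewrite (symI l k) -scalerDr !scalerA mulrC.
  by move: (\sum_p \sum_s _) => x; apply/rowP => k; rewrite !mxE; field.
rewrite -(sum_row_frame T bl br).
transitivity (\sum_(a < n) b (row a (T *m Pi u)) (row a (T *m Pi u))).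
  by apply: eq_bigr => a _; rewrite !row_mul /b covd_proj.
rewrite (sum_row_frame _ bl br) (sum_row_frame _ bl br).
have -> // : (T *m Pi u)^T *m (T *m Pi u) = E^T *m E.
rewrite trmx_mul mulmxA -(mulmxA (Pi u)^T) TG PE.
rewrite !trmx_mul trmxK Gsym // -!mulmxA (mulmxA (G u)) mulmxV ?Gunit // mul1mx.
by rewrite !mulmxA -(mulmxA _ E) -(mulmxA _ (E *m _)) EE mulmx1.
Qed.

End EulerLagrange.

(** * Algebra of Gram matrices *)

Section GramProjectors.
Context {R : realType} {n : nat}.
Implicit Types (A : 'M[R]_n).

Lemma bil_rank1 (x y a b : 'rV[R]_n) :
  bil (x^T *m y) a b = (a *m x^T) 0 0 * (y *m b^T) 0 0.
Proof. by rewrite bilv mulmxA -mulmxA mxE big_ord1. Qed.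

Lemma bil_row A a (C : 'M[R]_n) k : bil A a (row k C) = (a *m A *m C^T) 0 k.
Proof. by rewrite bilv tr_row colE mulmxA -colE mxE. Qed.

Lemma posdef_det A : posdef A -> 0 < \det A.
Proof.
move=> /cholesky [T TT]; have := congr1 determinant TT.
rewrite !det_mulmx det_tr det1 => E.
have : 0 < \det T ^+ 2 * \det A by rewrite expr2 mulrAC E ltr01.
by rewrite pmulr_rgt0 // lt_neqAle sqr_ge0 andbT eq_sym sqrf_eq0; apply: contra_eqN E => /eqP ->; rewrite !mul0r eq_sym oner_eq0.
Qed.

Lemma gramQ_sym r A (F : 'M[R]_(r, n)) : A^T = A -> (gramQ A F)^T = gramQ A F.
Proof.
move=> sA; rewrite /gramQ !trmx_mul trmxK trmx_inv !trmx_mul trmxK sA.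
by rewrite !mulmxA.
Qed.

Lemma gramQ_idem r A (F : 'M[R]_(r, n)) : F *m A *m F^T \in unitmx ->
  gramQ A F *m A *m gramQ A F = gramQ A F.
Proof.
move=> Mu; rewrite /gramQ; set M := F *m A *m F^T.
have -> : F^T *m invmx M *m F *m A *m (F^T *m invmx M *m F) =
   F^T *m (invmx M *m M) *m (invmx M *m F) by rewrite /M !mulmxA.
by rewrite mulVmx // mulmx1 mulmxA.
Qed.

Lemma gramQ_orth r s A (E : 'M[R]_(r, n)) (F : 'M[R]_(s, n)) :
  E *m A *m F^T = 0 -> gramQ A E *m A *m gramQ A F = 0.
Proof.
move=> EF; rewrite /gramQ.
have -> : E^T *m invmx (E *m A *m E^T) *m E *m A *m (F^T *m invmx (F *m A *m F^T) *m F) =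
   E^T *m invmx (E *m A *m E^T) *m (E *m A *m F^T) *m (invmx (F *m A *m F^T) *m F) by rewrite !mulmxA.
by rewrite EF mulmx0 mul0mx.
Qed.

End GramProjectors.

(** * Rate of the curvature density *)

Section Density.
Context {R : realType} {n r1 r2 : nat}.
Local Notation vec := 'rV[R]_n.
Variables (eps : R) (U : set vec) (Gt : R^o -> vec -> 'M[R]_n).
Variables (F1 : vec -> 'M[R]_(r1, n)) (F2 : vec -> 'M[R]_(r2, n)).
Hypotheses (eps0 : 0 < eps) (oU : open U).
Hypothesis Gs : smooth_on (cylinder eps U) (fun z => Gt z.1 z.2).
Hypothesis Gpos : forall t v, `|t| < eps -> U v -> posdef (Gt t v).
Hypotheses (F1s : smooth_on U F1) (F2s : smooth_on U F2).
Hypotheses (F1f : forall v, U v -> row_free (F1 v)) (F2f : forall v, U v -> row_free (F2 v)).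

Let Gsym t v : `|t| < eps -> U v -> (Gt t v)^T = Gt t v.
Proof. by move=> te Uv; have [] := Gpos te Uv. Qed.
Let Gunit t v : `|t| < eps -> U v -> Gt t v \in unitmx.
Proof. by move=> te Uv; exact: posdef_unit (Gpos te Uv). Qed.
Let e0 : `|0 : R| < eps. Proof. by rewrite normr0. Qed.
Let oZ : open (cylinder eps U). Proof. exact: open_cylinder. Qed.
Let Gu z : cylinder eps U z -> Gt z.1 z.2 \in unitmx.
Proof. by case: z => t v [/= te Uv]; exact: Gunit. Qed.
Local Notation B := (metric_rate Gt).
Local Notation G0 := (Gt 0).

Let gram_unit t v r (F : vec -> 'M[R]_(r, n)) : (forall v, U v -> row_free (F v)) ->
  `|t| < eps -> U v -> F v *m Gt t v *m (F v)^T \in unitmx.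
Proof. by move=> Ff te Uv; apply/posdef_unit/posdef_congr; [exact: Gpos|exact: Ff]. Qed.

(** The mutual curvature of the metric at time [t], computed from sections that do not move with [t]
    and need not be orthonormal. *)
Definition mutual_scal t v : R :=
  contract4 (gramQ (Gt t v) (F1 v)) (gramQ (Gt t v) (F2 v)) (Rm (Gt t) v).

Let smooth_lift p q (F : vec -> 'M[R]_(p, q)) : smooth_on U F ->
  smooth_on (cylinder eps U) (fun z => F z.2).
Proof. by move=> /smooth_on_snd; apply: smooth_on_sub => z []. Qed.

Lemma smooth_gram_inv r (F : vec -> 'M[R]_(r, n)) : smooth_on U F ->
  (forall v, U v -> row_free (F v)) ->
  smooth_on (cylinder eps U) (fun z => invmx (F z.2 *m Gt z.1 z.2 *m (F z.2)^T)).
Proof.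
move=> /smooth_lift Fs Ff.
apply: smooth_on_invmx => //; first by move=> z [ze Uz]; exact: gram_unit.
apply: smooth_on_mulmx => //; last exact: smooth_on_trmx.
exact: smooth_on_mulmx.
Qed.

Lemma smooth_gramQ r (F : vec -> 'M[R]_(r, n)) : smooth_on U F ->
  (forall v, U v -> row_free (F v)) ->
  smooth_on (cylinder eps U) (fun z => gramQ (Gt z.1 z.2) (F z.2)).
Proof.
move=> Fs Ff; apply: smooth_on_mulmx => //; last exact: smooth_lift.
apply: smooth_on_mulmx => //; last exact: smooth_gram_inv.
by apply: smooth_on_trmx => //; exact: smooth_lift.
Qed.

Lemma smooth_mutual_scal : smooth_on (cylinder eps U) (fun z => mutual_scal z.1 z.2 : R^o).
Proof.
have Q1s := smooth_gramQ F1s F1f; have Q2s := smooth_gramQ F2s F2f.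
apply: smooth_on_sum => // p _; apply: smooth_on_sum => // s _; apply: smooth_onM => //.
  exact: (smooth_on_mxP _ oZ).1 Q1s p s.
apply: smooth_on_sum => // k _; apply: smooth_on_sum => // l _; apply: smooth_onM => //.
  exact: (smooth_on_mxP _ oZ).1 Q2s k l.
apply: smooth_on_bil => //; last exact: smooth_on_cst.
exact: smooth_riem.
Qed.

Definition Rm_rate4 u x y z w : R := bil (B u) (riem G0 u x y z) w + bil (G0 u) (riem_rate Gt u x y z) w.

Lemma Rm_time u x y z w : U u ->
  is_derive (0 : R^o) 1 (fun t : R^o => Rm (Gt t) u x y z w : R^o) (Rm_rate4 u x y z w).
Proof.
move=> Uu.
apply: (is_derive_eq (is_derive_bil (metric_rate_time eps0 Gs Uu)
  (riem_time eps0 oU Gs Gunit x y z Uu) (is_derive_cst w _ _))).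
by rewrite bil0r addr0.
Qed.

(** Linearity in each argument is inherited from [Rm] at all small times, because differentiation
    preserves linear relations. *)
Lemma Rm_rate4_linear u : U u -> linear4 (Rm_rate4 u).
Proof.
move=> Uu.
have lin (f g h : R^o -> R^o) (a df dg dh : R) :
    (forall t, `|t| < eps -> f t = a * g t + h t) ->
    is_derive (0 : R^o) 1 f df -> is_derive (0 : R^o) 1 g dg -> is_derive (0 : R^o) 1 h dh ->
    df = a * dg + dh.
  move=> E fd gd hd.
  have H := is_deriveD (is_derive_mulr (is_derive_cst (a : R^o) (0 : R^o) (1 : R^o)) gd) hd.
  rewrite mul0r add0r in H.
  rewrite -(@derive_val _ _ _ _ _ _ _ fd) -[RHS](@derive_val _ _ _ _ _ _ _ H).
  by apply: near_eq_derive; near=> t; apply: E; near: t; exact: near0_eps.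
have L t (te : `|t| < eps) := Rm_linear oU (slice_smooth Gs te) (fun v Uv => Gunit te Uv) Uu.
split.
- move=> y z w a x x'; apply: (lin _ _ _ a _ _ _ _ (Rm_time _ _ _ _ Uu) (Rm_time _ _ _ _ Uu) (Rm_time _ _ _ _ Uu)).
  by move=> t te; have [-> _ _ _] := L t te.
- move=> x z w a y y'; apply: (lin _ _ _ a _ _ _ _ (Rm_time _ _ _ _ Uu) (Rm_time _ _ _ _ Uu) (Rm_time _ _ _ _ Uu)).
  by move=> t te; have [_ -> _ _] := L t te.
- move=> x y w a z z'; apply: (lin _ _ _ a _ _ _ _ (Rm_time _ _ _ _ Uu) (Rm_time _ _ _ _ Uu) (Rm_time _ _ _ _ Uu)).
  by move=> t te; have [_ _ -> _] := L t te.
- move=> x y z a w w'; apply: (lin _ _ _ a _ _ _ _ (Rm_time _ _ _ _ Uu) (Rm_time _ _ _ _ Uu) (Rm_time _ _ _ _ Uu)).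
  by move=> t te; have [_ _ _ ->] := L t te.
Unshelve. all: by end_near. Qed.

Hypotheses (F1B : forall v, U v -> F1 v *m B v = 0) (F2B : forall v, U v -> F2 v *m B v = 0).

(** The rate of the metric annihilates the rows of [F u], so their Gram matrix is stationary; so is
    its inverse, by differentiating the product of the two. *)
Lemma gramQ_rate r (F : vec -> 'M[R]_(r, n)) u : U u -> smooth_on U F -> (forall v, U v -> row_free (F v)) ->
  F u *m B u = 0 -> is_derive (0 : R^o) 1 (fun t : R^o => gramQ (Gt t u) (F u)) (0 : 'M[R]_n).
Proof.
move=> Uu Fs Ff FB.
have Md : is_derive (0 : R^o) 1 (fun t : R^o => F u *m Gt t u *m (F u)^T) (0 : 'M[R]_r).
  apply: (is_derive_eq (is_derive_mulmx (is_derive_mulmx (is_derive_cst (F u) _ _)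
    (metric_rate_time eps0 Gs Uu)) (is_derive_cst (F u)^T _ _))).
  by rewrite mul0mx add0r /cst FB mul0mx mulmx0 addr0.
have [d Id] : exists d : 'M[R]_r,
    is_derive (0 : R^o) 1 (fun t : R^o => invmx (F u *m Gt t u *m (F u)^T)) d.
  exists ('D_1 (fun t : R^o => invmx (F u *m Gt t u *m (F u)^T)) 0).
  by have H := time_is_derive eps0 (smooth_gram_inv Fs Ff) Uu; exact: H.
have d0 : d = 0.
  have H := is_derive_mulmx Md Id.
  have E : \forall t \near (0 : R^o), (F u *m Gt t u *m (F u)^T) *m invmx (F u *m Gt t u *m (F u)^T) = 1%:M.
    near=> t; apply: mulmxV; apply: gram_unit => //; near: t; exact: near0_eps.
  have := is_derive_near_cst E H; rewrite mul0mx add0r => Md0.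
  by rewrite -[d](mulKmx (gram_unit Ff e0 Uu)) Md0 mulmx0.
rewrite d0 in Id.
apply: (is_derive_eq (is_derive_mulmx (is_derive_mulmx (is_derive_cst (F u)^T _ _) Id)
  (is_derive_cst (F u) _ _))).
by rewrite !(mulmx0, mul0mx, addr0).
Unshelve. all: by end_near. Qed.

Lemma mutual_scal_time u : U u ->
  is_derive (0 : R^o) 1 (fun t : R^o => mutual_scal t u : R^o)
    (contract4 (gramQ (G0 u) (F1 u)) (gramQ (G0 u) (F2 u)) (Rm_rate4 u)).
Proof.
move=> Uu.
have /is_derive_mxP Q1 := gramQ_rate Uu F1s F1f (F1B Uu).
have /is_derive_mxP Q2 := gramQ_rate Uu F2s F2f (F2B Uu).
apply: is_derive_sumr => p; apply: is_derive_sumr => s.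
have H : is_derive (0 : R^o) 1 (fun t : R^o => \sum_k \sum_l gramQ (Gt t u) (F2 u) k l *
    Rm (Gt t) u (delta_mx 0 p) (delta_mx 0 k) (delta_mx 0 l) (delta_mx 0 s) : R^o)
    (\sum_k \sum_l gramQ (G0 u) (F2 u) k l *
    Rm_rate4 u (delta_mx 0 p) (delta_mx 0 k) (delta_mx 0 l) (delta_mx 0 s)).
  apply: is_derive_sumr => k; apply: is_derive_sumr => l.
  apply: (is_derive_eq (is_derive_mulr (Q2 k l) (Rm_time _ _ _ _ Uu))).
  by rewrite mxE mul0r add0r.
apply: (is_derive_eq (is_derive_mulr (Q1 p s) H)).
by rewrite mxE mul0r add0r.
Qed.

Definition frame_proj r (F : vec -> 'M[R]_(r, n)) v : 'M[R]_n := G0 v *m gramQ (G0 v) (F v).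
Local Notation P1 := (frame_proj F1).
Local Notation P2 := (frame_proj F2).
Definition frame_proj3 v : 'M[R]_n := 1%:M - P1 v - P2 v.
Local Notation P3 := frame_proj3.

Lemma smooth_frame_proj r (F : vec -> 'M[R]_(r, n)) : smooth_on U F ->
  (forall v, U v -> row_free (F v)) -> smooth_on U (frame_proj F).
Proof.
move=> Fs Ff; apply: smooth_on_mulmx => //; first by have := slice_smooth Gs e0; exact.
have H := @smooth_on_slice R vec _ _ _ 0 (smooth_gramQ Fs Ff).
by apply: smooth_on_sub H => v Uv; split.
Qed.

Hypothesis F12 : forall v, U v -> F1 v *m G0 v *m (F2 v)^T = 0.

Lemma frame_splitting : splitting U G0 P1 P2 P3.
Proof.
have F21 v : U v -> F2 v *m G0 v *m (F1 v)^T = 0.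
  by move=> Uv; apply: trmx_inj; rewrite trmx_mul trmxK trmx_mul (Gsym e0 Uv) mulmxA F12 // trmx0.
have I r (F : vec -> 'M[R]_(r, n)) v : (forall v, U v -> row_free (F v)) -> U v ->
    frame_proj F v *m frame_proj F v = frame_proj F v.
  move=> Ff Uv; rewrite /frame_proj -mulmxA; congr (_ *m _).
  by rewrite mulmxA gramQ_idem // gram_unit.
have O r s (F : vec -> 'M[R]_(r, n)) (F' : vec -> 'M[R]_(s, n)) v :
    F v *m G0 v *m (F' v)^T = 0 -> frame_proj F v *m frame_proj F' v = 0.
  by move=> FF'; rewrite /frame_proj -mulmxA (mulmxA _ (G0 v)) gramQ_orth // mulmx0.
have A r (F : vec -> 'M[R]_(r, n)) v : U v ->
    frame_proj F v *m G0 v = G0 v *m (frame_proj F v)^T.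
  by move=> Uv; rewrite /frame_proj trmx_mul (gramQ_sym _ (Gsym e0 Uv)) (Gsym e0 Uv); exact: (esym (mulmxA _ _ _)).
have s1 := smooth_frame_proj F1s F1f; have s2 := smooth_frame_proj F2s F2f.
split.
- by have := slice_smooth Gs e0; exact.
- by move=> v; exact: Gpos.
- exact: s1.
- exact: s2.
- apply: smooth_onD => //; last exact: smooth_onN.
  by apply: smooth_onD => //; [exact: smooth_on_cst|exact: smooth_onN].
- move=> v _; rewrite /frame_proj3; move: (P1 v) (P2 v) => a b.
  by apply/matrixP => i j; rewrite !mxE; ring.
- by move=> v Uv; exact/O/F12.
- by move=> v Uv; rewrite /P3 !mulmxBr mulmx1 I // (O _ _ _ _ _ (F12 Uv)) subrr subr0.
- by move=> v Uv; exact/O/F21.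
- by move=> v Uv; rewrite /P3 !mulmxBr mulmx1 I // (O _ _ _ _ _ (F21 _ Uv)) subr0 subrr.
- by move=> v Uv; rewrite /P3 !mulmxBl mul1mx I // (O _ _ _ _ _ (F21 _ Uv)) subrr subr0.
- by move=> v Uv; rewrite /P3 !mulmxBl mul1mx I // (O _ _ _ _ _ (F12 Uv)) subr0 subrr.
- by move=> v; exact: A.
- by move=> v; exact: A.
- move=> v Uv; rewrite /P3 !mulmxBl mul1mx !A //.
  have -> : (1%:M - P1 v - P2 v)^T = 1%:M - (P1 v)^T - (P2 v)^T by rewrite !raddfB /= trmx1.
  by rewrite !mulmxBr mulmx1.
Qed.

Section AtPoint.
Variables (u : vec) (E : 'M[R]_(r1, n)) (F : 'M[R]_(r2, n)).
Hypotheses (Uu : U u) (EF1 : (E <= F1 u)%MS) (FF2 : (F <= F2 u)%MS).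
Hypotheses (EE : E *m G0 u *m E^T = 1%:M) (FF : F *m G0 u *m F^T = 1%:M).
Local Notation ip := (bil (G0 u)).
Local Notation cov := (covd G0 u).

Lemma row_proj r (E' : 'M[R]_(r, n)) (F' : vec -> 'M[R]_(r, n)) a : (E' <= F' u)%MS ->
  E' *m G0 u *m E'^T = 1%:M -> row a E' *m frame_proj F' u = row a E'.
Proof.
move=> EF' EE'; rewrite /frame_proj -(gramQE EF' EE') -row_mul !mulmxA EE'.
by rewrite mul1mx.
Qed.

Let killed_proj r (F' : vec -> 'M[R]_(r, n)) x : smooth_on U F' ->
  (forall v, U v -> row_free (F' v)) -> (forall v, U v -> F' v *m B v = 0) ->
  killed U Gt (fun v => x *m frame_proj F' v) (fun v w => x *m 'D_w (frame_proj F') v).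
Proof.
move=> Fs Ff FB; split.
  move=> v w Uv.
  have H := is_derive_mulmx (is_derive_cst x v w) (smooth_on_is_derive w (smooth_frame_proj Fs Ff) Uv).
  by rewrite mul0mx add0r in H.
move=> v z Uv; rewrite bilv /frame_proj /gramQ.
by rewrite !mulmxA -(mulmxA _ (F' v)) FB // mulmx0 mul0mx mxE.
Qed.

Definition first_var_term (A : 'M[R]_n) e f : R :=
  let p := cov P1 P2 e f in let q := cov P2 P1 f e in
  bil A (cov P2 P2 f f) (cov P1 P1 e e) - bil A p p + bil A p q - bil A q q.

(** Projected constant fields are killed sections through the frame vectors, so [Rm_rate] applies to
    them; the term in which [B] lowers the index of the curvature vanishes because the frame vector
    is itself killed. *)
Lemma Rm_rate4_frame a j : Rm_rate4 u (row a E) (row j F) (row j F) (row a E) =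
  first_var_term (B u) (row a E) (row j F).
Proof.
have eP := row_proj a EF1 EE; have fP := row_proj j FF2 FF.
have := Rm_rate eps0 oU Gs Gsym Gunit (killed_proj (row a E) F1s F1f F1B)
  (killed_proj (row j F) F2s F2f F2B) Uu.
rewrite /= eP fP => RE.
rewrite /Rm_rate4 RE bilC ?(metric_rate_sym eps0 Gs Gsym Uu) //.
have -> : bil (B u) (row a E) (riem G0 u (row a E) (row j F) (row j F)) = 0.
  by rewrite -{1}eP; apply: (killed_proj (row a E) F1s F1f F1B).2.
by rewrite add0r /first_var_term !covE eP fP.
Qed.

Lemma mutual_scal_rate : is_derive (0 : R^o) 1 (fun t : R^o => mutual_scal t u : R^o)
  (\sum_(a < r1) \sum_(j < r2) first_var_term (B u) (row a E) (row j F)).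
Proof.
apply: (is_derive_eq (mutual_scal_time Uu)).
rewrite -(gramQE EF1 EE) -(gramQE FF2 FF) -contract4_frame; last exact: Rm_rate4_linear.
by apply: eq_bigr => a _; apply: eq_bigr => j _; exact: Rm_rate4_frame.
Qed.

Definition normal_mean r (E' : 'M[R]_(r, n)) P : vec :=
  \sum_(a < r) cov P P (row a E') (row a E') *m P3 u.
Local Notation H1 := (normal_mean E P1).
Local Notation H2 := (normal_mean F P2).

(** The Euler-Lagrange expression after the cancellations of [el_termE]. *)
Definition el_form X Y : R :=
  \sum_(a < r1) \sum_(j < r2) el_term G0 u
     (cov P1 P2 (row a E) (row j F)) (cov P2 P1 (row j F) (row a E)) X Y
  + ip H2 X * ip H1 Y + ip H2 Y * ip H1 X + mutual_scal 0 u * ip X Y.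

(** The second summand is the rate of the volume density, by Jacobi's formula and the derivative of
    the square root. *)
Definition density_rate : R :=
  \sum_(a < r1) \sum_(j < r2) first_var_term (B u) (row a E) (row j F)
  + 2^-1 * mutual_scal 0 u * \tr (invmx (G0 u) *m B u).

Lemma density_time : is_derive (0 : R^o) 1
  (fun t : R^o => mutual_scal t u * (Num.sqrt (\det (Gt t u)) / Num.sqrt (\det (G0 u))) : R^o) density_rate.
Proof.
have d0 : 0 < \det (G0 u) by exact: posdef_det (Gpos e0 Uu).
have s0 : Num.sqrt (\det (G0 u)) != 0 by rewrite gt_eqF // sqrtr_gt0.
have Dd := is_derive_det (metric_rate_time eps0 Gs Uu).
have [Dd1 Dd2] := Dd.
have Ds := @is_derive_sqrt_comp R R^o 0 1 (fun y => \det (Gt y u)) d0 Dd1.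
rewrite Dd2 in Ds.
have Dq := is_derive_mulr Ds (is_derive_cst ((Num.sqrt (\det (G0 u)))^-1 : R) (0 : R^o) (1 : R^o)).
apply: (is_derive_eq (is_derive_mulr mutual_scal_rate Dq)).
rewrite mulr0 addr0 /cst mulfV // mulr1 /density_rate; congr (_ + _).
have -> : \tr (B u *m \adj (G0 u)) = \det (G0 u) * \tr (invmx (G0 u) *m B u).
  by rewrite [in RHS]/invmx (Gunit e0 Uu) -scalemxAl mxtraceZ mxtrace_mulC mulrA mulfV ?gt_eqF ?mul1r.
move: (Num.sqrt (\det (G0 u))) s0 (sqr_sqrtr (ltW d0)) => s s0 <-; by field.
Qed.

Lemma P3_idem : P3 u *m P3 u = P3 u.
Proof.
have [_ _ _ _ _ s _ _ _ _ p31 p32 _ _ _] := frame_splitting.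
have := mulmx1 (P3 u); rewrite -(s u Uu) !mulmxDr p31 // p32 // !add0r.
exact.
Qed.

Lemma rateP3 a b : bil (B u) (a *m P3 u) (b *m P3 u) = bil (B u) a b.
Proof.
have K x r (F' : vec -> 'M[R]_(r, n)) z : F' u *m B u = 0 -> bil (B u) (x *m frame_proj F' u) z = 0.
  by move=> FB; rewrite bilv /frame_proj /gramQ !mulmxA -(mulmxA _ (F' u)) FB mulmx0 mul0mx mxE.
have sB := bilC _ _ (metric_rate_sym eps0 Gs Gsym Uu).
have L x z : bil (B u) (x *m P3 u) z = bil (B u) x z.
  by rewrite /P3 !mulmxBr mulmx1 !bilBl !K ?F1B ?F2B // !subr0.
by rewrite L sB L sB.
Qed.

(** The factor 2 clears the halves. The value of [B] on [p] and [q] is written twice to match the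
    two mixed products in [el_term]. *)
Lemma density_rateE :
  2 * density_rate = \sum_(a < r1) \sum_(j < r2)
     (let p := cov P1 P2 (row a E) (row j F) in let q := cov P2 P1 (row j F) (row a E) in
      bil (B u) p q + bil (B u) p q - 2 * bil (B u) p p - 2 * bil (B u) q q)
  + 2 * bil (B u) H2 H1 + mutual_scal 0 u * \tr (invmx (G0 u) *m B u).
Proof.
rewrite /density_rate mulrDr; congr (_ + _); last by field.
have -> : bil (B u) H2 H1 = \sum_(a < r1) \sum_(j < r2)
    bil (B u) (cov P2 P2 (row j F) (row j F)) (cov P1 P1 (row a E) (row a E)).
  rewrite bil_suml exchange_big; apply: eq_bigr => j _ /=.
  by rewrite bil_sumr; apply: eq_bigr => a _; rewrite rateP3.
rewrite !mulr_sumr -big_split; apply: eq_bigr => a _ /=.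
rewrite !mulr_sumr -big_split; apply: eq_bigr => j _ /=.
rewrite /first_var_term /=; ring.
Qed.

(** For such a rate, B(a, b) is [s] times g(a, X) g(b, X), so each value of [B] becomes the
    corresponding product of the Euler-Lagrange expression on the diagonal. *)
Lemma density_rate_rank1 X (s : R) : X *m P3 u = X ->
  B u = s *: ((X *m G0 u)^T *m (X *m G0 u)) -> 2 * density_rate = s * el_form X X.
Proof.
move=> XP BE; rewrite density_rateE.
have bE a b : bil (B u) a b = s * (ip a X * ip b X).
  rewrite BE bilZA; congr (_ * _).
  rewrite bil_rank1 (bilC _ _ (Gsym e0 Uu)) [ip b X](bilC _ _ (Gsym e0 Uu)) !bilv; congr (_ * _).
  by transitivity ((X *m G0 u *m a^T)^T 0 0); [rewrite [in RHS]trmx_mul trmxK|rewrite mxE].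
have tE : \tr (invmx (G0 u) *m B u) = s * ip X X.
  rewrite BE -scalemxAr mxtraceZ; congr (_ * _).
  have E0 : invmx (G0 u) *m (X *m G0 u)^T = X^T.
    by rewrite trmx_mul (Gsym e0 Uu) mulKmx ?(Gunit e0 Uu).
  by rewrite (mulmxA (invmx (G0 u))) E0 mxtrace_mulC /mxtrace big_ord1 bilv.
rewrite tE /el_form /el_term !mulrDr !bE; congr (_ + _); last by ring.
rewrite -!addrA; congr (_ + _); last by ring.
rewrite mulr_sumr; apply: eq_bigr => a _; rewrite mulr_sumr; apply: eq_bigr => j _ /=.
rewrite !bE; ring.
Qed.

(** The k-th row of [invmx (G0 u) *m P3 u] represents the k-th coordinate of the D3 component: its
    inner product with [a] is the k-th entry of [a *m P3 u]. Since [B] sees only D3 components, its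
    values are contractions of products of such inner products. *)
Lemma density_rate_contract :
  2 * density_rate = \sum_k \sum_l B u k l *
    el_form (row k (invmx (G0 u) *m P3 u)) (row l (invmx (G0 u) *m P3 u)).
Proof.
have sp := frame_splitting.
pose x k := row k (invmx (G0 u) *m P3 u).
have ipx a k : ip a (x k) = (a *m P3 u) 0 k.
  rewrite /x bil_row trmx_mul trmx_inv (Gsym e0 Uu) mulmxA -(mulmxA a) -(sp_adj3 sp Uu).
  by rewrite mulmxA mulmxK ?(Gunit e0 Uu).
have bE a b : bil (B u) a b = \sum_k \sum_l B u k l * (ip a (x k) * ip b (x l)).
  rewrite -rateP3 bilE; apply: eq_bigr => k _; apply: eq_bigr => l _.
  by rewrite !ipx; ring.
have tE : \tr (invmx (G0 u) *m B u) = \sum_k \sum_l B u k l * ip (x k) (x l).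
  have B3 : P3 u *m B u = B u.
    by rewrite /P3 !mulmxBl mul1mx /frame_proj /gramQ -!mulmxA F1B // F2B // !mulmx0 !subr0.
  transitivity (\tr (invmx (G0 u) *m (P3 u *m B u))); first by rewrite B3.
  rewrite mulmxA /mxtrace exchange_big /=; apply: eq_bigr => l _.
  rewrite mxE; apply: eq_bigr => k _.
  by rewrite (bilC _ _ (Gsym e0 Uu)) ipx /x -row_mul -mulmxA P3_idem mulrC [in RHS]mxE.
(* Pairing with [B] is linear in the array [f], so the identity is checked on each kind of product
   occurring in [el_form]. *)
pose Phi (f : 'I_n -> 'I_n -> R) := \sum_k \sum_l B u k l * f k l.
have PhiD f g : Phi (fun k l => f k l + g k l) = Phi f + Phi g.
  rewrite /Phi -big_split; apply: eq_bigr => k _; rewrite -big_split; apply: eq_bigr => l _.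
  exact: mulrDr.
have PhiZ c f : Phi (fun k l => c * f k l) = c * Phi f.
  rewrite /Phi mulr_sumr; apply: eq_bigr => k _; rewrite mulr_sumr; apply: eq_bigr => l _.
  exact: mulrCA.
have PhiS r (f : 'I_r -> 'I_n -> 'I_n -> R) : Phi (fun k l => \sum_a f a k l) = \sum_a Phi (f a).
  rewrite /Phi [RHS]exchange_big; apply: eq_bigr => k _ /=.
  rewrite [RHS]exchange_big; apply: eq_bigr => l _ /=; exact: mulr_sumr.
have PhiE (f g : 'I_n -> 'I_n -> R) : (forall k l, f k l = g k l) -> Phi f = Phi g.
  by move=> fg; apply: eq_bigr => k _; apply: eq_bigr => l _; rewrite fg.
have bP a b : Phi (fun k l => ip a (x k) * ip b (x l)) = bil (B u) a b by rewrite bE.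
have bP' a b : Phi (fun k l => ip a (x l) * ip b (x k)) = bil (B u) a b.
  rewrite (bilC _ _ (metric_rate_sym eps0 Gs Gsym Uu)) -bP.
  by apply: PhiE => k l; exact: mulrC.
have tP : Phi (fun k l => ip (x k) (x l)) = \tr (invmx (G0 u) *m B u) by rewrite tE.
rewrite density_rateE -/(Phi (fun k l => el_form (x k) (x l))).
rewrite /el_form !PhiD PhiZ tP bP bP'.
have -> : 2 * bil (B u) H2 H1 = bil (B u) H2 H1 + bil (B u) H2 H1 by ring.
rewrite addrA; congr (_ + _ + _ + _).
rewrite PhiS; apply: eq_bigr => a _; rewrite PhiS; apply: eq_bigr => j _ /=.
move: (cov P1 P2 _ _) (cov P2 P1 _ _) => p q.
rewrite -{1}(bP p q) -{1}(bP' p q) -(bP p p) -(bP q q) -!mulNr -!PhiZ -!PhiD.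
by apply: PhiE => k l; rewrite /el_term; ring.
Qed.

End AtPoint.

End Density.

(** * Locality of the connection and of the curvature *)

Section Locality.
Context {R : realType} {n : nat}.
Local Notation vec := 'rV[R]_n.
Variables (U : set vec) (G G' : vec -> 'M[R]_n).
Hypotheses (oU : open U) (GG : forall v, U v -> G v = G' v).

Lemma chr_local u k : U u -> chr G k u = chr G' k u.
Proof.
move=> Uu; apply/matrixP => i j; rewrite !mxE /christoffel (GG Uu).
congr (_ * _); apply: eq_bigr => l _; congr (_ * _).
by congr (_ + _ - _); apply: near_eq_derive; apply: open_near_eq oU Uu _ => v Uv; rewrite GG.
Qed.

Lemma gam_local u x y : U u -> gam G u x y = gam G' u x y.
Proof. by move=> Uu; rewrite !gamE; apply/rowP => k; rewrite !mxE chr_local. Qed.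

Lemma riem_local u x y z : U u -> riem G u x y z = riem G' u x y z.
Proof.
move=> Uu; rewrite !riemE.
have D a b c : dgam G u a b c = dgam G' u a b c.
  by rewrite -!dgamE; apply: near_eq_derive; apply: open_near_eq oU Uu _ => v Uv; exact: gam_local.
by rewrite !D !(gam_local _ _ Uu).
Qed.

Lemma covd_local Pi Pi' Pj Pj' u v w : U u -> (forall x, U x -> Pi x = Pi' x) ->
  (forall x, U x -> Pj x = Pj' x) -> covd G u Pi Pj v w = covd G' u Pi' Pj' v w.
Proof.
move=> Uu Pii Pjj; rewrite (covE G) (covE G') (gam_local _ _ Uu) (Pii u Uu) (Pjj u Uu).
apply: (congr1 (fun m => w *m m + _)); by apply: near_eq_derive; exact: open_near_eq oU Uu Pjj.
Qed.

End Locality.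

(** * The Euler-Lagrange expression in a chart *)

Section EulerLagrangeLocal.
Context {R : realType} {n r1 r2 : nat}.
Local Notation vec := 'rV[R]_n.

(** Kept convertible to the left-hand side of the equation in the theorem; [el_exprE] rewrites it as
    [el_form]. *)
Definition el_expr (G D1 D2 : vec -> 'M[R]_n) u (E : 'M[R]_(r1, n)) (F : 'M[R]_(r2, n)) X Y : R :=
  let D3 := third_distr G D1 D2 in
  let P1 := orthoproj G D1 in
  let P2 := orthoproj G D2 in
  let P3 := orthoproj G D3 in
  let ip := inner_g G u in
  let A23 := Amix G P2 P3 P1 u in
  let A13 := Amix G P1 P3 P2 u in
  let T23 := Tsharpmix G P2 P3 P1 u in
  let T13 := Tsharpmix G P1 P3 P2 u in
  let h12 := at_vec (hmix G P1 P2 P3) u in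
  let t12 := at_vec (Tmix G P1 P2 P3) u in
  let H1 := mean_curv G P1 u in
  let H2 := mean_curv G P2 u in
  let S := mutual_curv G D1 D2 r1 r2 u in
  \sum_(a < r1) \sum_(j < r2)
    (let e := row a E in
     let f := row j F in
     - ip (A23 e f) Y * ip (h12 e f + t12 e f) X
     - ip (A23 e f) X * ip (h12 e f + t12 e f) Y
     - ip (A13 f e) Y * ip (h12 e f - t12 e f) X
     - ip (A13 f e) X * ip (h12 e f - t12 e f) Y
     - ip (A23 e f) X * ip (T23 e f) Y
     - ip (A23 e f) Y * ip (T23 e f) X
     - ip (A13 f e) X * ip (T13 f e) Y
     - ip (A13 f e) Y * ip (T13 f e) X
     - 2 * ip (T23 e f) X * ip (T23 e f) Y
     - 2 * ip (T13 f e) X * ip (T13 f e) Y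
     - 2 * ip X (h12 e f) * ip Y (h12 e f)
     - 2 * ip X (t12 e f) * ip Y (t12 e f))
  + ip (H2 *m P3 u) X * ip (H1 *m P3 u) Y
  + ip (H2 *m P3 u) Y * ip (H1 *m P3 u) X
  + S * ip X Y.

Lemma splitting_local (U : set vec) (G G' P1 P2 P3 P1' P2' P3' : vec -> 'M[R]_n) : open U ->
  (forall x, U x -> G x = G' x) -> (forall x, U x -> P1 x = P1' x) ->
  (forall x, U x -> P2 x = P2' x) -> (forall x, U x -> P3 x = P3' x) ->
  splitting U G P1 P2 P3 -> splitting U G' P1' P2' P3'.
Proof.
move=> oU e0 e1 e2 e3 [s0 p s1 s2 s3 s12 p12 p13 p21 p23 p31 p32 a1 a2 a3].
split; try (by apply: (smooth_on_congr oU _ s0)); try (by apply: (smooth_on_congr oU _ s1));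
 try (by apply: (smooth_on_congr oU _ s2)); try (by apply: (smooth_on_congr oU _ s3));
 by move=> v Uv; rewrite -?e0 // -?e1 // -?e2 // -?e3 //; auto.
Qed.

Lemma proj_row_frame (G : vec -> 'M[R]_n) (D : vec -> 'M[R]_n) r (E F : 'M[R]_(r, n)) u : posdef (G u) ->
  (F == D u)%MS -> row_free F -> orthoproj G D u = G u *m gramQ (G u) F.
Proof.
move=> pG FD fF; have [E0 E0F E0E] := exists_orthonormal pG fF.
have EF : (E0 <= F)%MS by case/andP: E0F.
rewrite /orthoproj (@proj_frame _ _ _ _ r E0) // ?(gramQE EF E0E) //.
by apply/eqmxP; apply: eqmx_trans (eqmxP FD); exact/eqmxP.
Qed.

Variables (eps : R) (U : set vec) (Gt : R^o -> vec -> 'M[R]_n) (G D1 D2 : vec -> 'M[R]_n).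
Variables (F1 : vec -> 'M[R]_(r1, n)) (F2 : vec -> 'M[R]_(r2, n)).
Hypotheses (eps0 : 0 < eps) (oU : open U).
Hypothesis Gs : smooth_on (cylinder eps U) (fun z => Gt z.1 z.2).
Hypothesis Gpos : forall t v, `|t| < eps -> U v -> posdef (Gt t v).
Hypotheses (F1s : smooth_on U F1) (F2s : smooth_on U F2).
Hypotheses (F1f : forall v, U v -> row_free (F1 v)) (F2f : forall v, U v -> row_free (F2 v)).
Hypothesis F12 : forall v, U v -> F1 v *m Gt 0 v *m (F2 v)^T = 0.
Hypothesis G0E : forall v, U v -> Gt 0 v = G v.
Hypotheses (F1D : forall v, U v -> (F1 v == D1 v)%MS) (F2D : forall v, U v -> (F2 v == D2 v)%MS).

Let e0 : `|0 : R| < eps. Proof. by rewrite normr0. Qed.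
Let Gpos0 v : U v -> posdef (G v). Proof. by move=> Uv; rewrite -G0E //; exact: Gpos. Qed.

Lemma orthoproj1E v : U v -> frame_proj Gt F1 v = orthoproj G D1 v.
Proof. by move=> Uv; rewrite (proj_row_frame (F1 v) (Gpos0 Uv) (F1D Uv) (F1f Uv)) /frame_proj G0E. Qed.

Lemma orthoproj2E v : U v -> frame_proj Gt F2 v = orthoproj G D2 v.
Proof. by move=> Uv; rewrite (proj_row_frame (F2 v) (Gpos0 Uv) (F2D Uv) (F2f Uv)) /frame_proj G0E. Qed.

Lemma orthoproj3E v : U v -> frame_proj3 Gt F1 F2 v = orthoproj G (third_distr G D1 D2) v.
Proof.
move=> Uv.
have [E EF EE] := exists_orthonormal (Gpos0 Uv) (F1f Uv).
have [F FF FFE] := exists_orthonormal (Gpos0 Uv) (F2f Uv).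
have EF1 : (E <= F1 v)%MS by case/andP: EF.
have FF2 : (F <= F2 v)%MS by case/andP: FF.
have ED1 : (E == D1 v)%MS by apply/eqmxP; apply: eqmx_trans (eqmxP (F1D Uv)); exact/eqmxP.
have FD2 : (F == D2 v)%MS by apply/eqmxP; apply: eqmx_trans (eqmxP (F2D Uv)); exact/eqmxP.
have EF0 : E *m G v *m F^T = 0.
  have [T1 ->] := submxP EF1; have [T2 ->] := submxP FF2.
  by rewrite trmx_mul !mulmxA -2!(mulmxA T1) -G0E // F12 // mulmx0 mul0mx.
rewrite /orthoproj /third_distr (proj_third (Gpos0 Uv) ED1 EE FD2 FFE EF0).
by rewrite /frame_proj3 /frame_proj G0E // (gramQE EF1 EE) (gramQE FF2 FFE).
Qed.

Lemma ortho_splitting :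
  splitting U G (orthoproj G D1) (orthoproj G D2) (orthoproj G (third_distr G D1 D2)).
Proof.
apply: (splitting_local oU G0E orthoproj1E orthoproj2E orthoproj3E).
exact: (frame_splitting eps0 oU Gs Gpos F1s F2s F1f F2f F12).
Qed.

Lemma mutual_scalE t u (G' : vec -> 'M[R]_n) : `|t| < eps -> U u -> (forall v, U v -> Gt t v = G' v) ->
  mutual_curv G' D1 D2 r1 r2 u = mutual_scal Gt F1 F2 t u.
Proof.
move=> te Uu GG.
have s' : smooth_on U G' by apply: (smooth_on_congr oU GG); have := slice_smooth Gs te; exact.
have p' v : U v -> posdef (G' v) by move=> Uv; rewrite -GG //; exact: Gpos.
rewrite (mutual_curvE oU s' (fun v Uv => posdef_unit (p' v Uv)) Uu (p' u Uu) (F1D Uu) (F2D Uu) (F1f Uu) (F2f Uu)).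
rewrite /mutual_scal GG //.
apply: eq_bigr => p _; apply: eq_bigr => s _; congr (_ * _).
apply: eq_bigr => k _; apply: eq_bigr => l _; congr (_ * _).
by rewrite /Rm GG // (riem_local oU GG).
Qed.

Lemma el_exprE u E F X Y : U u -> orthonormal_frame G D1 u E -> orthonormal_frame G D2 u F ->
  (X <= third_distr G D1 D2 u)%MS -> (Y <= third_distr G D1 D2 u)%MS ->
  el_expr G D1 D2 u E F X Y = el_form Gt F1 F2 u E F X Y.
Proof.
move=> Uu [ED1 EE] [FD2 FF] XD YD.
have sp := ortho_splitting.
have fix3 (Z : vec) : (Z <= third_distr G D1 D2 u)%MS -> Z *m orthoproj G (third_distr G D1 D2) u = Z.
  by move=> ZD; rewrite /orthoproj proj_mx_id //; exact: orth_cap0 (Gpos0 Uu).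
have rfix r (E' : 'M[R]_(r, n)) D a : (E' == D u)%MS -> row a E' *m orthoproj G D u = row a E'.
  move=> /andP [E'D _]; rewrite /orthoproj proj_mx_id //; first exact: orth_cap0 (Gpos0 Uu).
  exact: submx_trans (row_sub _ _) E'D.
have projE r (E' : 'M[R]_(r, n)) D : (E' == D u)%MS -> E' *m G u *m E'^T = 1%:M ->
    orthoproj G D u = G u *m (E'^T *m E').
  by move=> E'D E'E; rewrite /orthoproj (proj_frame (Gpos0 Uu) E'D E'E).
have idem P : (P = orthoproj G D1 \/ P = orthoproj G D2) -> forall x, U x -> P x *m P x = P x.
  move=> PE x Ux; rewrite -[RHS]mulmx1 -(sp_sum sp Ux) !mulmxDr.
  by case: PE => ->; rewrite ?(sp_12 sp Ux) ?(sp_13 sp Ux) ?(sp_21 sp Ux) ?(sp_23 sp Ux) ?addr0 ?add0r.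
rewrite /el_expr /el_form.
have gu : Gt 0 u = G u by rewrite G0E.
have bE x y : inner_g G u x y = bil (Gt 0 u) x y by rewrite inner_bil gu.
have C Pi Pi' Pj Pj' v w (ii : forall x, U x -> Pi x = Pi' x) (jj : forall x, U x -> Pj x = Pj' x) :=
  covd_local oU G0E v w Uu ii jj.
have HE r (E' : 'M[R]_(r, n)) P P' : (P' = orthoproj G D1 \/ P' = orthoproj G D2) ->
    (forall x, U x -> P x = P' x) -> P' u = G u *m (E'^T *m E') -> E' *m G u *m E'^T = 1%:M ->
    mean_curv G P' u *m orthoproj G (third_distr G D1 D2) u = normal_mean Gt F1 F2 u E' P.
  move=> PE PP' PE' EE'; rewrite (mean_curvE oU Uu sp _ _ _ PE' EE').
  - apply: eq_bigr => a _; rewrite orthoproj3E //; congr (_ *m _).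
    exact/esym/C.
  - by case: PE => ->; [exact: sp_smooth1 sp|exact: sp_smooth2 sp].
  - exact: idem.
  - by case: PE => ->; [exact: sp_13 sp|exact: sp_23 sp].
rewrite (HE _ E (frame_proj Gt F1) _ (or_introl erefl) orthoproj1E (projE _ _ _ ED1 EE) EE).
rewrite (HE _ F (frame_proj Gt F2) _ (or_intror erefl) orthoproj2E (projE _ _ _ FD2 FF) FF).
rewrite -[mutual_curv _ _ _ _ _ _](esym (mutual_scalE e0 Uu G0E)).
congr (_ + _ + _ + _); rewrite ?bE //.
apply: eq_bigr => a _; apply: eq_bigr => j _.
have T := el_termE oU Uu sp (rfix _ _ _ a ED1) (rfix _ _ _ j FD2) (fix3 _ XD) (fix3 _ YD).
cbv zeta in T; rewrite T {T}.
rewrite /el_term -gu.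
rewrite -(C _ _ _ _ (row a E) (row j F) orthoproj1E orthoproj2E).
by rewrite -(C _ _ _ _ (row j F) (row a E) orthoproj2E orthoproj1E).
Qed.

End EulerLagrangeLocal.

(** * Independence of the chart *)

Section ManifoldGeometry.
Context {R : realType} {n : nat} (M : manifold R n).
Local Notation vec := 'rV[R]_n.
Implicit Types (g : tensor02 R n) (D : subbundle M).

Lemma overlap_open i j : open (chart_overlap M i j).
Proof.
rewrite openE => u [cu du]; rewrite /interior.
have H1 := open_near (@ccod_open _ _ M i) cu.
have H2 : nbhs (cinv M i u) (@cdom _ _ M j) by apply: open_nbhs_nbhs; split=> //; exact: cdom_open.
have H3 := cinv_continuous cu H2.
exact: filterI H1 H3.
Qed.

Lemma transition_cod i j u : chart_overlap M i j u -> ccod M j (transition M i j u).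
Proof. by move=> [_ du]; exact: cmap_cod. Qed.

Lemma cinv_transition i j u : chart_overlap M i j u ->
  cinv M j (transition M i j u) = cinv M i u.
Proof. by move=> [_ du]; rewrite /transition /= cmapK. Qed.

Lemma transition_overlap i j u : chart_overlap M i j u ->
  chart_overlap M j i (transition M i j u).
Proof.
move=> o; split; first exact: transition_cod.
by rewrite cinv_transition //; exact: cinv_dom o.1.
Qed.

Lemma transitionK i j u : chart_overlap M i j u -> transition M j i (transition M i j u) = u.
Proof. move=> o; rewrite {1}/transition /= cinv_transition //; exact: cinvK o.1. Qed.

Lemma riemannian_posdef g i u : riemannian M g -> ccod M i u -> posdef (g i u).
Proof. by move=> [_ s p _] cu; split=> [|v]; [exact: s|exact: p]. Qed.

Lemma jacobian_unit g i j u : riemannian M g -> chart_overlap M i j u ->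
  'J (transition M i j) u \in unitmx.
Proof.
move=> hg o; have [_ _ _ tr] := hg.
have := posdef_unit (riemannian_posdef hg o.1).
by rewrite -(tr _ _ _ o) -mulmxA unitmx_mul => /andP [].
Qed.

Lemma local_frame D i u : ccod M i u -> exists U (F : vec -> 'M[R]_(drank D, n)),
  [/\ open U, U u, U `<=` ccod M i, smooth_on U F &
    forall v, U v -> row_free (F v) /\ (F v == fiber D i v)%MS].
Proof.
move=> cu; have [W [F [oW Wu Wc Fs FE]]] := fiber_smooth D cu.
exists W, F; split=> // v Wv; split; last exact: FE.
by rewrite /row_free (eqmxP (FE v Wv)) (fiber_rank D (Wc _ Wv)).
Qed.

Lemma orthonormal_row_free r (A : 'M[R]_n) (E : 'M[R]_(r, n)) : E *m A *m E^T = 1%:M -> row_free E.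
Proof. by rewrite -mulmxA => EE; apply/row_freeP; exists (A *m E^T). Qed.

Lemma exists_fiber_frame g D i u : riemannian M g -> ccod M i u ->
  exists E : 'M[R]_(drank D, n), orthonormal_frame (g i) (fiber D i) u E.
Proof.
move=> hg cu; have [U [F [_ Uu _ _ FE]]] := local_frame D cu; have [fF FD] := FE u Uu.
have [E EF EE] := exists_orthonormal (riemannian_posdef hg cu) fF.
by exists E; split=> //; apply/eqmxP; apply: eqmx_trans (eqmxP FD); exact/eqmxP.
Qed.

Variables (D1 D2 : subbundle M).

Definition chart_curv g i u : R :=
  mutual_curv (g i) (fiber D1 i) (fiber D2 i) (drank D1) (drank D2) u.

Lemma chart_curv_frame g i u E F : riemannian M g -> ccod M i u ->
  orthonormal_frame (g i) (fiber D1 i) u E -> orthonormal_frame (g i) (fiber D2 i) u F ->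
  chart_curv g i u =
  \sum_(a < drank D1) \sum_(j < drank D2) Rm (g i) u (row a E) (row j F) (row j F) (row a E).
Proof.
move=> hg cu [ED EE] [FD FF]; have [gs _ _ _] := hg.
have gu v : ccod M i v -> g i v \in unitmx.
  by move=> cv; exact/posdef_unit/riemannian_posdef.
rewrite /chart_curv (mutual_curvE (@ccod_open _ _ M i) (gs i) gu cu (riemannian_posdef hg cu) ED FD
  (orthonormal_row_free EE) (orthonormal_row_free FF)).
rewrite !gramQ_on // contract4_frame //.
exact: (Rm_linear (@ccod_open _ _ M i) (gs i) gu cu).
Qed.

Lemma orthonormal_transition g D i j u E : riemannian M g -> chart_overlap M i j u ->
  orthonormal_frame (g i) (fiber D i) u (E : 'M[R]_(drank D, n)) ->
  orthonormal_frame (g j) (fiber D j) (transition M i j u) (E *m 'J (transition M i j) u).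
Proof.
move=> hg o [ED EE]; have [_ _ _ tr] := hg; split.
  apply/eqmxP; apply: eqmx_trans (eqmxP (fiber_transition D o)).
  exact/eqmxMr/eqmxP.
by rewrite trmx_mul !mulmxA -2!(mulmxA E) -EE -(tr _ _ _ o) !mulmxA.
Qed.

(** The Jacobian carries orthonormal frames to orthonormal frames, so both charts sum the same
    components of the curvature tensor. *)
Lemma chart_curv_transition g i j u : riemannian M g -> chart_overlap M i j u ->
  chart_curv g j (transition M i j u) = chart_curv g i u.
Proof.
move=> hg o.
have [E oE] := exists_fiber_frame D1 hg o.1.
have [F oF] := exists_fiber_frame D2 hg o.1.
rewrite (chart_curv_frame hg (transition_cod o) (orthonormal_transition hg o oE) (orthonormal_transition hg o oF)).
rewrite (chart_curv_frame hg o.1 oE oF).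
apply: eq_bigr => a _; apply: eq_bigr => l _.
have [gs gsym _ tr] := hg.
have gu k v : ccod M k v -> g k v \in unitmx.
  by move=> cv; exact/posdef_unit/riemannian_posdef.
have H x y z := riem_transition (overlap_open (i := i) (j := j)) (@ccod_open _ _ M j)
  (fun u => @transition_cod i j u) (@transition_smooth _ _ M i j)
  (smooth_on_sub (fun v (ov : chart_overlap M i j v) => ov.1) (gs i)) (gs j)
  (fun v ov => gsym i v ov.1) (gsym j)
  (fun v ov => gu i v ov.1) (gu j) (fun v => jacobian_unit hg) (tr i j) x y z o.
by rewrite /Rm !row_mul -H -bil_congr tr.
Qed.

(* The density is relative to the fixed volume of [g], which makes it a function
   on the manifold. *)
Definition chart_density g gs i u : R :=
  chart_curv gs i u * (Num.sqrt (\det (gs i u)) / Num.sqrt (\det (g i u))).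

(** Both determinants acquire the square of the same Jacobian determinant, which cancels in the
    quotient. *)
Lemma chart_density_transition g gs i j u : riemannian M g -> riemannian M gs -> chart_overlap M i j u ->
  chart_density g gs j (transition M i j u) = chart_density g gs i u.
Proof.
move=> hg hs o; rewrite /chart_density chart_curv_transition //; congr (_ * _).
have [_ _ _ tr] := hg; have [_ _ _ trs] := hs.
have J0 : 0 < \det ('J (transition M i j) u) ^+ 2.
  rewrite exprn_even_gt0 //=; have := jacobian_unit hg o.
  by rewrite unitmxE unitfE.
have d h : riemannian M h -> 0 < \det (h j (transition M i j u)).
  by move=> hh; apply/posdef_det/riemannian_posdef => //; exact: transition_cod.
rewrite -(tr _ _ _ o) -(trs _ _ _ o) !det_mulmx det_tr.
rewrite ![\det ('J _ _) * _]mulrC -!mulrA -expr2.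
rewrite (sqrtrM _ (ltW (d _ hs))) (sqrtrM _ (ltW (d _ hg))).
by rewrite -mulf_div divff ?mulr1 // gt_eqF // sqrtr_gt0.
Qed.

Lemma ortho_third g i u x : riemannian M g -> orthogonal_subbundles g D1 D2 -> ccod M i u ->
  (x <= fiber D1 i u)%MS || (x <= fiber D2 i u)%MS ->
  x *m orthoproj (g i) (third_distr (g i) (fiber D1 i) (fiber D2 i)) u = 0 :> vec.
Proof.
move=> hg hD cu xD.
have pg := riemannian_posdef hg cu; have [sg _] := pg.
rewrite /orthoproj; apply: proj_orthE => //; first exact: sub0mx.
have : third_distr (g i) (fiber D1 i) (fiber D2 i) u *m (g i u *m (fiber D1 i u + fiber D2 i u)%MS^T) = 0.
  by apply/sub_kermxP; exact: submx_refl.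
move: (third_distr _ _ _ u) => D3 H3.
have /submxP [c ->] : (x <= fiber D1 i u + fiber D2 i u)%MS.
  by case/orP: xD => xD; apply: (submx_trans xD); [exact: addsmxSl|exact: addsmxSr].
rewrite subr0 -!mulmxA; apply: trmx_inj; rewrite !trmx_mul trmxK sg trmx0.
by rewrite -mulmxA mulmxA -(mulmxA D3) H3 mul0mx.
Qed.

(** Turns the condition on the rate of the metric into annihilation of the two distributions, the
    form in which it can be differentiated. *)
Lemma third_killed g (B : vec -> 'M[R]_n) i u : riemannian M g -> orthogonal_subbundles g D1 D2 ->
  ccod M i u ->
  (let P3 := orthoproj (g i) (third_distr (g i) (fiber D1 i) (fiber D2 i)) in
   forall X Y : vec, inner_g B u X Y = inner_g B u (X *m P3 u) (Y *m P3 u)) ->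
  fiber D1 i u *m B u = 0 /\ fiber D2 i u *m B u = 0.
Proof.
move=> hg hD cu /= BP.
have K (x : vec) : (x <= fiber D1 i u)%MS || (x <= fiber D2 i u)%MS -> x *m B u = 0.
  move=> xD; apply/rowP => k; have := BP x (delta_mx 0 k).
  rewrite (ortho_third hg hD cu xD) !inner_bil bil0l bilv trmx_delta -colE !mxE.
  by move=> ->.
by split; apply/row_matrixP => k; rewrite row_mul row0; apply: K; rewrite row_sub ?orbT.
Qed.

End ManifoldGeometry.

(** * Rate of the density along a variation *)

Section Variation.
Context {R : realType} {n : nat} (M : manifold R n) (D1 D2 : subbundle M).
Local Notation vec := 'rV[R]_n.
Variables (g : tensor02 R n) (eps : R) (gt : R -> tensor02 R n).
Hypotheses (hg : riemannian M g) (hD : orthogonal_subbundles g D1 D2) (eps0 : 0 < eps).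
Hypothesis gtR : forall t, `|t| < eps -> riemannian M (gt t).
Hypothesis gts : forall i, smooth_on (cylinder eps (ccod M i)) (fun z => gt z.1 i z.2).
Hypothesis gt0 : forall i u, ccod M i u -> gt 0 i u = g i u.
Hypothesis kill1 : forall i u, ccod M i u -> fiber D1 i u *m variation_deriv gt i u = 0.
Hypothesis kill2 : forall i u, ccod M i u -> fiber D2 i u *m variation_deriv gt i u = 0.

Local Notation Gt i := (fun t : R^o => gt t i).

Lemma variation_local i u : ccod M i u -> exists U (F1 : vec -> 'M[R]_(drank D1, n))
    (F2 : vec -> 'M[R]_(drank D2, n)), [/\ open U, U u, U `<=` ccod M i &
  [/\ smooth_on U F1, smooth_on U F2 &
  forall v, U v -> [/\ row_free (F1 v), row_free (F2 v), (F1 v == fiber D1 i v)%MS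
     & (F2 v == fiber D2 i v)%MS]]].
Proof.
move=> cu.
have [U1 [F1 [p1 u1 c1 s1 H1]]] := local_frame D1 cu.
have [U2 [F2 [p2 u2 c2 s2 H2]]] := local_frame D2 cu.
exists (U1 `&` U2), F1, F2; split; [exact: openI|by []|by move=> v [/c1]|].
split; [by apply: smooth_on_sub s1 => v []|by apply: smooth_on_sub s2 => v []|].
by move=> v [/H1 [? ?] /H2 [? ?]].
Qed.

Section Local.
Variables (i : nat) (U : set vec) (F1 : vec -> 'M[R]_(drank D1, n)) (F2 : vec -> 'M[R]_(drank D2, n)).
Hypotheses (oU : open U) (Uc : U `<=` ccod M i) (F1s : smooth_on U F1) (F2s : smooth_on U F2).
Hypothesis FH : forall v, U v -> [/\ row_free (F1 v), row_free (F2 v), (F1 v == fiber D1 i v)%MS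
     & (F2 v == fiber D2 i v)%MS].

Lemma var_smooth : smooth_on (cylinder eps U) (fun z => Gt i z.1 z.2).
Proof. by apply: smooth_on_sub (gts i) => z [ze /Uc]. Qed.

Lemma var_pos t v : `|t| < eps -> U v -> posdef (Gt i t v).
Proof. by move=> te Uv; apply: riemannian_posdef (gtR te) _; exact: Uc. Qed.

Lemma var_f1 v : U v -> row_free (F1 v). Proof. by case/FH. Qed.
Lemma var_f2 v : U v -> row_free (F2 v). Proof. by case/FH. Qed.
Lemma var_D1 v : U v -> (F1 v == fiber D1 i v)%MS. Proof. by case/FH. Qed.
Lemma var_D2 v : U v -> (F2 v == fiber D2 i v)%MS. Proof. by case/FH. Qed.

Lemma var_kill1 v : U v -> F1 v *m metric_rate (Gt i) v = 0.
Proof.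
move=> Uv; have /andP [/submxP [T ->] _] := var_D1 Uv.
by rewrite -mulmxA -metric_rateE kill1 ?mulmx0 //; exact: Uc.
Qed.

Lemma var_kill2 v : U v -> F2 v *m metric_rate (Gt i) v = 0.
Proof.
move=> Uv; have /andP [/submxP [T ->] _] := var_D2 Uv.
by rewrite -mulmxA -metric_rateE kill2 ?mulmx0 //; exact: Uc.
Qed.

Lemma var_g0 v : U v -> Gt i 0 v = g i v. Proof. by move=> /Uc; exact: gt0. Qed.

Lemma var_12 v : U v -> F1 v *m Gt i 0 v *m (F2 v)^T = 0.
Proof.
move=> Uv; rewrite /= var_g0 //.
have /andP [/submxP [T1 ->] _] := var_D1 Uv; have /andP [/submxP [T2 ->] _] := var_D2 Uv.
by rewrite trmx_mul !mulmxA -2!(mulmxA T1) hD ?mulmx0 ?mul0mx //; exact: Uc.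
Qed.

Lemma var_density t v : `|t| < eps -> U v -> chart_density D1 D2 g (gt t) i v =
  mutual_scal (Gt i) F1 F2 t v * (Num.sqrt (\det (Gt i t v)) / Num.sqrt (\det (Gt i 0 v))).
Proof.
move=> te Uv; rewrite /chart_density var_g0 //; congr (_ * _).
by apply: (mutual_scalE oU var_smooth var_pos var_f1 var_f2 var_D1 var_D2 te Uv).
Qed.

Lemma var_density_smooth : smooth_on (cylinder eps U) (fun z => chart_density D1 D2 g (gt z.1) i z.2 : R^o).
Proof.
have oZ : open (cylinder eps U) by exact: open_cylinder.
have := smooth_mutual_scal oU var_smooth var_pos F1s F2s var_f1 var_f2 => Ss.
have Ds : smooth_on (cylinder eps U) (fun z => Num.sqrt (\det (Gt i z.1 z.2)) : R^o).
  apply: smooth_on_sqrt => //; last by apply: smooth_on_det => //; exact: var_smooth.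
  by move=> z [ze Uz]; apply: posdef_det; exact: var_pos.
have D0 : smooth_on (cylinder eps U) (fun z => Num.sqrt (\det (Gt i 0 z.2)) : R^o).
  have e0 : `|0 : R| < eps by rewrite normr0.
  have H : smooth_on U (fun v => Num.sqrt (\det (Gt i 0 v)) : R^o).
    apply: smooth_on_sqrt => //; last by apply: smooth_on_det => //; have := slice_smooth var_smooth e0; exact.
    by move=> z Uz; apply: posdef_det; exact: var_pos.
  by have := smooth_on_snd H; apply: smooth_on_sub => z [].
have P : smooth_on (cylinder eps U) (fun z => mutual_scal (Gt i) F1 F2 z.1 z.2 *
    (Num.sqrt (\det (Gt i z.1 z.2)) * (Num.sqrt (\det (Gt i 0 z.2)))^-1) : R^o).
  apply: smooth_onM => //; apply: smooth_onM => //.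
  apply: smooth_onV => // z [ze Uz]; rewrite gt_eqF // sqrtr_gt0; apply: posdef_det.
  by apply: var_pos; rewrite ?normr0.
by apply: (smooth_on_congr oZ _ P) => z [ze Uz]; rewrite var_density.
Qed.

Lemma var_density_time v E F : U v -> orthonormal_frame (g i) (fiber D1 i) v E ->
  orthonormal_frame (g i) (fiber D2 i) v F ->
  is_derive (0 : R^o) 1 (fun t : R^o => chart_density D1 D2 g (gt t) i v : R^o)
    (density_rate (Gt i) F1 F2 v E F).
Proof.
move=> Uv [/andP [ED _] EE] [/andP [FD _] FF].
have ef : (E <= F1 v)%MS by apply: submx_trans ED _; case/andP: (var_D1 Uv).
have ff : (F <= F2 v)%MS by apply: submx_trans FD _; case/andP: (var_D2 Uv).
rewrite -(var_g0 Uv) in EE FF.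
have H := density_time eps0 oU var_smooth var_pos F1s F2s var_f1 var_f2 var_kill1 var_kill2 Uv ef ff EE FF.
apply: is_derive_near_eq H; near=> t.
have te : `|t| < eps by near: t; exact: near0_eps.
by rewrite (var_density te Uv).
Unshelve. all: by end_near. Qed.

Lemma var_rate_rank1 v E F X (s : R) : U v -> orthonormal_frame (g i) (fiber D1 i) v E ->
  orthonormal_frame (g i) (fiber D2 i) v F ->
  (X <= third_distr (g i) (fiber D1 i) (fiber D2 i) v)%MS ->
  variation_deriv gt i v = s *: ((X *m g i v)^T *m (X *m g i v)) ->
  2 * density_rate (Gt i) F1 F2 v E F = s * el_expr (g i) (fiber D1 i) (fiber D2 i) v E F X X.
Proof.
move=> Uv EO FO XD BE.
rewrite (el_exprE eps0 oU var_smooth var_pos F1s F2s var_f1 var_f2 var_12 var_g0 var_D1 var_D2 Uv EO FO XD XD).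
apply: (density_rate_rank1 eps0 var_smooth var_pos var_kill1 var_kill2) => //.
- rewrite (orthoproj3E eps0 var_pos var_f1 var_f2 var_12 var_g0 var_D1 var_D2 Uv).
  by rewrite /orthoproj proj_mx_id //; apply: orth_cap0; exact: riemannian_posdef hg (Uc Uv).
- by rewrite -metric_rateE var_g0.
Qed.

Lemma var_rate_el v E F : U v -> orthonormal_frame (g i) (fiber D1 i) v E ->
  orthonormal_frame (g i) (fiber D2 i) v F ->
  (forall X Y, (X <= third_distr (g i) (fiber D1 i) (fiber D2 i) v)%MS ->
     (Y <= third_distr (g i) (fiber D1 i) (fiber D2 i) v)%MS ->
     el_expr (g i) (fiber D1 i) (fiber D2 i) v E F X Y = 0) ->
  density_rate (Gt i) F1 F2 v E F = 0.
Proof.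
move=> Uv EO FO el0.
suff : 2 * density_rate (Gt i) F1 F2 v E F = 0 by move=> /eqP; rewrite mulf_eq0 pnatr_eq0 /= => /eqP.
have [[/andP [ED _] EE] [/andP [FD _] FF]] := (EO, FO).
have ef : (E <= F1 v)%MS by apply: submx_trans ED _; case/andP: (var_D1 Uv).
have ff : (F <= F2 v)%MS by apply: submx_trans FD _; case/andP: (var_D2 Uv).
rewrite -(var_g0 Uv) in EE FF.
rewrite (density_rate_contract eps0 oU var_smooth var_pos F1s F2s var_f1 var_f2 var_kill1 var_kill2 var_12 E F Uv).
apply: big1 => k _; apply: big1 => l _.
have x3 a : (row a (invmx (Gt i 0 v) *m frame_proj3 (Gt i) F1 F2 v) <= third_distr (g i) (fiber D1 i) (fiber D2 i) v)%MS.
  rewrite row_mul (orthoproj3E eps0 var_pos var_f1 var_f2 var_12 var_g0 var_D1 var_D2 Uv).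
  exact: proj_mx_sub.
rewrite -(el_exprE eps0 oU var_smooth var_pos F1s F2s var_f1 var_f2 var_12 var_g0 var_D1 var_D2 Uv EO FO (x3 k) (x3 l)).
by rewrite el0 ?mulr0.
Qed.

End Local.

End Variation.

(** * Integration on the manifold *)

Section CompactCover.
Context {T : topologicalType} {I : eqType}.

(** Compactness is used for the filter of finite lists ordered by inclusion: every list that
    contains the datum of a point also serves all points near it. *)
Lemma compact_finite_list (K : set T) (good : I -> T -> Prop) : compact K ->
  (forall p, K p -> exists k, \forall q \near p, good k q) ->
  exists l : seq I, forall p, K p -> exists2 k, k \in l & good k p.
Proof.
move=> /compact_near_coveringP cK loc.
pose F : set_system (seq I) := [set A | exists l : seq I, forall l' : seq I, {subset l <= l'} -> A l'].
have FF : Filter F.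
  split.
  - by exists [::].
  - move=> A A' [l lA] [l' lA']; exists (l ++ l') => m lm; split.
      by apply: lA => x xl; apply: lm; rewrite mem_cat xl.
    by apply: lA' => x xl; apply: lm; rewrite mem_cat xl orbT.
  - by move=> A A' AA' [l lA]; exists l => m /lA /AA'.
have [|l lP] := cK _ F (fun l p => exists2 k, k \in l & good k p) FF.
  move=> p /loc [k kp].
  exists ([set q | good k q], [set l : seq I | k \in l]).
    by split=> //=; exists [:: k] => l' /(_ k); rewrite mem_head; exact.
  by move=> [q l] [/= gq kl]; exists k.
by exists l => p; exact: lP.
Qed.

End CompactCover.

Section FiniteUnion.
Context {d} {T : measurableType d} {R : realType} (m : {measure set T -> \bar R}).
Local Open Scope ereal_scope.

Lemma integral_finite_cover (I : eqType) (l : seq I) (S : set T) (P : I -> set T) (w : T -> \bar R) :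
  measurable S -> (forall k, measurable (P k)) -> measurable_fun setT w -> (forall x, 0 <= w x) ->
  (forall k, k \in l -> \int[m]_(x in P k) w x < +oo) ->
  (forall x, S x -> exists2 k, k \in l & P k x) -> \int[m]_(x in S) w x < +oo.
Proof.
move=> + mP mw w0; elim: l S => [|k l IH] S mS fin cov.
  rewrite (_ : S = set0) ?integral_set0 ?ltry //.
  by apply/seteqP; split=> // x /cov [].
have mS1 : measurable (S `&` P k) by exact: measurableI.
have mS2 : measurable (S `\` P k) by exact: measurableD.
rewrite -(setUIDK S (P k)) ge0_integral_setU //.
- rewrite lte_add_pinfty //.
    apply: (le_lt_trans _ (fin k (mem_head _ _))).
    by apply: ge0_subset_integral => //; exact: measurable_funTS.
  apply: IH => // [j jl|x [/cov [j]]].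
    by apply: fin; rewrite inE jl orbT.
  by rewrite inE => /orP [/eqP -> ? []//|jl Pj _]; exists j.
- exact: measurable_funTS.
- by apply/disj_set2P/seteqP; split=> // x [[_ ?] []].
Qed.

End FiniteUnion.

(** * Finite volume of a relatively compact domain *)

Section Volume.
Context {R : realType} {n : nat} (M : manifold R n).
Local Notation vec := 'rV[R]_n.
Variables (g : tensor02 R n) (Omega : set M).
Hypotheses (hg : riemannian M g) (oO : open Omega) (cO : compact (closure Omega)).

Lemma chart_atP (p : M) : cdom (chart_at p) p.
Proof. by rewrite /chart_at; case: ex_minnP => k /asboolP. Qed.

Lemma chart_at_min (p : M) k : cdom k p -> (chart_at p <= k)%N.
Proof. by rewrite /chart_at; case: ex_minnP => j _ H /asboolP /H. Qed.

Definition piece i : set vec :=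
  [set u | [/\ ccod M i u, chart_at (cinv M i u) = i & Omega (cinv M i u)]].

Lemma piece_cod i : piece i `<=` ccod M i. Proof. by move=> u []. Qed.

Lemma open_preimage i (A : set M) : open A -> open [set u | ccod M i u /\ A (cinv M i u)].
Proof.
move=> oA; rewrite openE => u [cu Au]; rewrite /interior.
have H1 := open_near (@ccod_open _ _ M i) cu.
have H2 : nbhs (cinv M i u) A by apply: open_nbhs_nbhs.
exact: filterI H1 (cinv_continuous cu H2).
Qed.

(** [chart_at] takes the least index, so a piece is an open set minus the overlaps with finitely
    many earlier charts. *)
Lemma measurable_piece i : measurable (piece i : set (mvec n)).
Proof.
have -> : piece i = [set u | ccod M i u /\ Omega (cinv M i u)] `\`
    \bigcup_(j in [set j | (j < i)%N]) chart_overlap M i j.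
  apply/seteqP; split=> u.
    move=> [cu ci Ou]; split=> // -[j /= ji [_ /chart_at_min]].
    by rewrite ci leqNgt ji.
  move=> [[cu Ou] nj]; split=> //; apply/eqP; rewrite eqn_leq.
  rewrite (chart_at_min (cinv_dom cu)) /= leqNgt; apply/negP => ci.
  by apply: nj; exists (chart_at (cinv M i u)) => //; split=> //; exact: chart_atP.
apply: measurableD; first by apply: open_measurable_mvec; exact: open_preimage.
by apply: bigcup_measurable => j _; apply: open_measurable_mvec; exact: overlap_open.
Qed.

(** Finitely many charts cover the closure of [Omega], and the least index of a chart around a point
    is at most the largest of theirs. *)
Lemma piece_bound : exists N, forall i u, piece i u -> (i < N)%N.
Proof.
have [|l lP] := @compact_finite_list M nat (closure Omega) (fun k p => cdom k p) cO.
  move=> p _; exists (chart_at p); apply: open_nbhs_nbhs; split; first exact: cdom_open.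
  exact: chart_atP.
exists (\max_(k <- l) k).+1 => i u [cu ci Ou].
have [k kl kp] := lP _ (subset_closure Ou).
rewrite ltnS -ci (leq_trans (chart_at_min kp)) //.
exact: leq_bigmax_seq.
Qed.

Definition vol_density i u : R := Num.sqrt (\det (g i u)).

Lemma vol_density_gt0 i u : ccod M i u -> 0 < vol_density i u.
Proof. by move=> cu; rewrite sqrtr_gt0; apply/posdef_det/(riemannian_posdef hg). Qed.

Lemma vol_density_smooth i : smooth_on (ccod M i) (fun u => vol_density i u : R^o).
Proof.
have [gs _ _ _] := hg; have oC := @ccod_open _ _ M i.
apply: smooth_on_sqrt => //; last exact: smooth_on_det.
by move=> u cu; apply/posdef_det/(riemannian_posdef hg).
Qed.

Lemma vol_density_transition i j u : chart_overlap M i j u ->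
  vol_density i u = `|\det ('J (transition M i j) u)| * vol_density j (transition M i j u).
Proof.
move=> o; have [_ _ _ tr] := hg; rewrite /vol_density -(tr _ _ _ o) !det_mulmx det_tr.
rewrite mulrAC -expr2 sqrtrM ?sqr_ge0 // sqrtr_sqr //.
Qed.

Local Open Scope ereal_scope.

Definition vol_weight i : mvec n -> \bar R := (fun u => (vol_density i u)%:E) \_ (ccod M i).

Lemma measurable_weight i : measurable_fun setT (vol_weight i).
Proof.
have mC : measurable (ccod M i : set (mvec n)) by apply: open_measurable_mvec; exact: ccod_open.
apply/(measurable_restrictT _ mC)/measurable_EFinP.
apply: continuous_measurable_mvec; first exact: ccod_open.
by move=> x Ux; exact: smooth_on_continuous (@vol_density_smooth i) Ux.
Qed.

Lemma weight_ge0 i u : 0 <= vol_weight i u.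
Proof.
rewrite /vol_weight /patch; case: ifPn => // /set_mem cu.
by rewrite lee_fin ltW // vol_density_gt0.
Qed.

(** The triple [k] is a chart index, a centre and a radius. The chart is the one assigned to [p],
    which need not be the one in which nearby points are integrated. *)
Lemma good_cube (p : M) : exists k : nat * vec * R,
  [/\ (0 < k.2)%R, (forall x, cube k.1.2 k.2 x -> ccod M k.1.1 x),
    (exists2 C, (0 <= C)%R & forall x, cube k.1.2 k.2 x -> (vol_density k.1.1 x <= C)%R) &
    \forall q \near p, cdom k.1.1 q /\ cube k.1.2 k.2 (cmap k.1.1 q)].
Proof.
pose j := chart_at p; have dp := chart_atP p; pose c := cmap j p.
have cc : ccod M j c by exact: cmap_cod.
have Wc := smooth_on_continuous (@vol_density_smooth j) cc.
have H1 : \forall x \near c, ccod M j x by exact: open_near (@ccod_open _ _ M j) cc.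
have H2 : \forall x \near c, (vol_density j x <= vol_density j c + 1)%R.
  have B := Wc _ (nbhsx_ballx (vol_density j c : R^o) 1%R ltr01).
  near=> x; have : ball (vol_density j c : R^o) 1%R (vol_density j x : R^o) by near: x; exact: B.
  rewrite /ball /= => h.
  by rewrite -lerBlDl (le_trans (ler_norm _)) // distrC ltW.
have /nbhs_ballP [e /= e0 He] : nbhs c [set x | ccod M j x /\ (vol_density j x <= vol_density j c + 1)%R].
  exact: filterI H1 H2.
pose r : R := (e / 2)%R; have r0 : (0 < r)%R by rewrite divr_gt0.
have cb x : cube c r x -> ball c e x.
  move=> /(cube_ball c x (ltW r0)) h; rewrite -ball_normE /ball_ /= distrC.
  by rewrite (le_lt_trans h) // /r ltr_pdivrMr // ltr_pMr // ltr1n.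
exists (j, c, r); split=> //=.
- by move=> x /cb /He [].
- exists (vol_density j c + 1)%R; first by rewrite addr_ge0 // ltW // vol_density_gt0.
  by move=> x /cb /He [].
- have D1 : nbhs p (@cdom _ _ M j) by apply: open_nbhs_nbhs; split=> //; exact: cdom_open.
  have D2 := @cmap_continuous _ _ M j p dp _ (nbhsx_ballx c r r0).
  near=> q; split; first by near: q.
  apply/(cube_ball c _ (ltW r0)); rewrite distrC ltW //.
  by near: q; move: D2; rewrite -ball_normE.
Unshelve. all: by end_near. Qed.

(** A piece may approach the boundary of its own chart, where the density need not be bounded. It is
    covered by preimages of finitely many good cubes of other charts, each of which
    [transition_volume_bound] controls. *)
Lemma finite_volume i : \int[vol n]_(u in (piece i : set (mvec n))) vol_weight i u < +oo.
Proof.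
pose good (k : nat * vec * R) (q : M) := [/\ (0 < k.2)%R, (forall x, cube k.1.2 k.2 x -> ccod M k.1.1 x),
    (exists2 C, (0 <= C)%R & forall x, cube k.1.2 k.2 x -> (vol_density k.1.1 x <= C)%R) &
    cdom k.1.1 q /\ cube k.1.2 k.2 (cmap k.1.1 q)].
have [|l lP] := @compact_finite_list M _ (closure Omega) good cO.
  move=> p _; have [k [k0 k1 k2 k3]] := good_cube p; exists k.
  by apply: filterS k3 => q kq; split.
pose P (k : nat * vec * R) : set (mvec n) :=
  [set u | chart_overlap M i k.1.1 u /\ cube k.1.2 k.2 (transition M i k.1.1 u)].
have td k u : chart_overlap M i k u -> differentiable (transition M i k) u.
  move=> o; have := @transition_smooth _ _ M i k 1%N.
  by apply: C1_differentiable_mx => //; exact: overlap_open.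
have mP k : measurable (P k).
  have := @measurable_preimage_mvec R n n (chart_overlap M i k.1.1) (transition M i k.1.1)
    (cube k.1.2 k.2); apply; [exact: overlap_open| |exact: measurable_cube].
  by move=> u /td; exact: differentiable_continuous.
(* Entries of [l] that are good at no point carry no estimate and are discarded. *)
pose l' := [seq k <- l | `[< exists q, good k q >]].
apply: (@integral_finite_cover _ _ _ (vol n) _ l' _ P) => //.
- exact: measurable_piece.
- exact: measurable_weight.
- exact: weight_ge0.
- move=> k; rewrite mem_filter => /andP [/asboolP [q [k0 kc [C C0 kC] _]] _].
  pose j := k.1.1.
  have := @transition_volume_bound R n (chart_overlap M i j) (chart_overlap M j i)
    (transition M i j) (transition M j i) (vol_density i) (vol_density j) k.1.2 k.2 C.
  move=> B; apply: (@le_lt_trans _ _ (4 * C * 2 ^+ n * (2 * k.2) ^+ n)%:E); last exact: ltry.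
  apply: (le_trans _ (B _ _ _ _ _ _ _ _ _ _ _ _ C0 kC k0)).
  + rewrite le_eqVlt; apply/orP; left; apply/eqP; apply: eq_integral => u /set_mem [[cu _] _].
    by rewrite /vol_weight /patch mem_set.
  + exact: overlap_open.
  + exact: overlap_open.
  + by move=> u; exact: transition_overlap.
  + by move=> u; exact: transition_overlap.
  + by move=> u; exact: transitionK.
  + by move=> u; exact: transitionK.
  + exact: td.
  + move=> u o; apply: differentiable_continuous.
    exact: C1_differentiable_mx (overlap_open (i := j) (j := i)) o (@transition_smooth _ _ M j i 1%N).
  + by move=> u; exact: jacobian_unit hg.
  + by move=> u [cu _]; exact: smooth_on_continuous (@vol_density_smooth i) cu.
  + by move=> u [cu _]; exact: vol_density_gt0.
  + by move=> u; exact: vol_density_transition.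
- move=> u [cu ci Ou]; have [k kl gk] := lP _ (subset_closure Ou).
  exists k; first by rewrite mem_filter kl andbT; apply/asboolP; exists (cinv M i u).
  by have [_ _ _ [dk ck]] := gk; split.
Qed.

End Volume.

(** * Differentiation under the integral *)

Section VolumeIntegral.
Context {R : realType} {n : nat} (M : manifold R n).
Local Notation vec := 'rV[R]_n.
Variables (g : tensor02 R n) (Omega : set M) (N : nat).
Hypotheses (hg : riemannian M g) (oO : open Omega) (cO : compact (closure Omega)).
Hypothesis pieceN : forall i u, piece Omega i u -> (i < N)%N.
Local Open Scope ereal_scope.
Local Notation piece i := (piece Omega i : set (mvec n)).
Local Notation s i := (vol_density g i).

Let mP i : measurable (piece i). Proof. exact: measurable_piece. Qed.

Lemma vol_int_nnegE (gs : tensor02 R n) (f : M -> R) (h : nat -> mvec n -> R) :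
  (forall i, measurable_fun (piece i) (h i)) ->
  (forall i u, piece i u -> (f (cinv M i u) * Num.sqrt (\det (gs i u)))%R = h i u) ->
  vol_int_nneg gs (((EFin \o f) \_ Omega)^\+) =
  \sum_(0 <= i < N) \int[vol n]_(u in piece i) (EFin \o h i)^\+ u.
Proof.
move=> mh hE.
have T i : lebesgue_int (fun u : vec => if `[< ccod M i u /\ chart_at (cinv M i u) = i >]
    then ((EFin \o f) \_ Omega)^\+ (cinv M i u) * (Num.sqrt (\det (gs i u)))%:E else 0) =
    \int[vol n]_(u in piece i) (EFin \o h i)^\+ u.
  rewrite integral_mkcond -lebesgue_intE; last 2 first.
  - apply/(measurable_restrictT _ (mP i)); apply: measurable_funepos.
    by apply/measurable_EFinP.
  - by move=> x; rewrite /patch; case: ifP.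
  apply: lebesgue_int_ext => u; rewrite /patch.
  case: asboolP => [[cu ci]|nc]; last first.
    by rewrite ifF //; apply/negbTE/negP => /set_mem [cu ci _]; apply: nc.
  rewrite !funeposE; case: ifPn => Ou.
    have pu : piece i u by split=> //; exact/set_mem.
    rewrite mem_set //= -hE // -!EFin_max -EFinM; congr (_%:E).
    by rewrite maxr_pMl ?mul0r // sqrtr_ge0.
  rewrite ifF; last by apply/negbTE; apply: contra Ou => /set_mem [_ _ Ou]; exact/mem_set.
  by rewrite maxxx mul0e.
rewrite /vol_int_nneg (nneseries_split 0 N); last first.
  move=> k _; rewrite T; apply: integral_ge0 => u _; exact: funepos_ge0.
rewrite [X in _ + X]eseries0 ?adde0 ?add0n.
  by apply: eq_bigr => i _; rewrite T.
move=> k Nk _; rewrite T; rewrite (_ : piece k = set0) ?integral_set0 //.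
by apply/seteqP; split=> // u /pieceN; rewrite ltnNge Nk.
Qed.

(** [vol_int] subtracts extended reals and applies [fine]; both parts are finite here, so the result
    is a finite sum of ordinary integrals. *)
Lemma vol_intE (gs : tensor02 R n) (f : M -> R) (h : nat -> mvec n -> R) :
  (forall i, (vol n).-integrable (piece i) (EFin \o h i)) ->
  (forall i u, piece i u -> (f (cinv M i u) * Num.sqrt (\det (gs i u)))%R = h i u) ->
  vol_int Omega gs f = (\sum_(0 <= i < N) \int[vol n]_(u in piece i) h i u)%R.
Proof.
move=> ih hE.
have mh i : measurable_fun (piece i) (h i) by exact/measurable_EFinP/measurable_int/ih.
rewrite /vol_int (vol_int_nnegE mh hE).
have -> : ((EFin \o f) \_ Omega)^\- = ((EFin \o (\- f)%R) \_ Omega)^\+.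
  apply/funext => p; rewrite funeposE funenegE /patch; case: ifP => //= _.
  by rewrite oppr0.
rewrite (@vol_int_nnegE gs (\- f)%R (fun i => \- h i)%R); last 2 first.
- by move=> i; exact: measurable_funN.
- by move=> i u pu; rewrite /= mulNr hE.
have pE i : \int[vol n]_(u in piece i) (EFin \o h i)^\+ u =
    (fine (\int[vol n]_(u in piece i) (EFin \o h i)^\+ u))%:E.
  rewrite fineK // ge0_fin_numE; last by apply: integral_ge0 => u _; exact: funepos_ge0.
  by have := integral_funepos_lt_pinfty (mP i) (ih i).
have nE i : \int[vol n]_(u in piece i) (EFin \o (\- h i)%R)^\+ u =
    (fine (\int[vol n]_(u in piece i) (EFin \o h i)^\- u))%:E.
  have -> : (EFin \o (\- h i)%R)^\+ = (EFin \o h i)^\- by apply/funext => u; rewrite funeposE funenegE /= EFinN.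
  rewrite fineK // ge0_fin_numE; last by apply: integral_ge0 => u _; exact: funeneg_ge0.
  by have := integral_funeneg_lt_pinfty (mP i) (ih i).
rewrite (eq_bigr _ (fun i _ => pE i)) (eq_bigr _ (fun i _ => nE i)) !sumEFin -EFinB /= -sumrB.
apply: eq_bigr => i _; rewrite /Rintegral [in RHS]integralE pE.
have -> : \int[vol n]_(x in piece i) (EFin \o h i)^\- x =
   (fine (\int[vol n]_(u in piece i) (EFin \o h i)^\- u))%:E.
  rewrite fineK // ge0_fin_numE; last by apply: integral_ge0 => u _; exact: funeneg_ge0.
  by have := integral_funeneg_lt_pinfty (mP i) (ih i).
by [].
Qed.

Lemma integrable_density i : (vol n).-integrable (piece i) (EFin \o s i).
Proof.
have mC : measurable (ccod M i : set (mvec n)) by apply: open_measurable_mvec; exact: ccod_open.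
apply/integrableP; split.
  apply/measurable_EFinP; apply: (@measurable_funS _ _ _ _ (ccod M i : set (mvec n))) => //.
    exact: piece_cod.
  apply: continuous_measurable_mvec; first exact: ccod_open.
  by move=> x Ux; exact: smooth_on_continuous (@vol_density_smooth _ _ _ _ hg i) Ux.
apply: (le_lt_trans _ (finite_volume hg oO cO i)).
rewrite le_eqVlt; apply/orP; left; apply/eqP; apply: eq_integral => u /set_mem [cu _ _].
by rewrite /vol_weight /patch mem_set //= ger0_norm // ltW // (vol_density_gt0 hg).
Qed.

Definition bounded_on_pieces (phi : nat -> vec -> R) (C : R) :=
  forall i u, piece i u -> (`|phi i u| <= C)%R.

Lemma integrable_weighted i (phi : nat -> vec -> R) C : bounded_on_pieces phi C ->
  (forall u, ccod M i u -> {for u, continuous (phi i : vec -> R^o)}) ->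
  (vol n).-integrable (piece i) (EFin \o (fun u => phi i u * s i u)%R).
Proof.
move=> bC phic.
have C0 : (0 <= `|C|)%R by [].
have iC : (vol n).-integrable (piece i) (fun u => `|C|%:E * (EFin \o s i) u).
  by apply: integrableZl => //; exact: integrable_density.
apply: (le_integrable (mP i) _ _ iC).
  apply/measurable_EFinP; apply: (@measurable_funS _ _ _ _ (ccod M i : set (mvec n))) => //.
  - by apply: open_measurable_mvec; exact: ccod_open.
  - exact: piece_cod.
  apply: measurable_funM; apply: continuous_measurable_mvec => //; try exact: ccod_open.
  by move=> x Ux; exact: smooth_on_continuous (@vol_density_smooth _ _ _ _ hg i) Ux.
move=> u pu; have [cu _ _] := pu; have s0 := vol_density_gt0 hg cu.
rewrite /= lee_fin !normrM ler_wpM2r // normr_id (le_trans (bC _ _ pu)) //; exact: ler_norm.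
Qed.

Definition weighted (phi : nat -> vec -> R) : R :=
  (\sum_(0 <= i < N) \int[vol n]_(u in piece i) (phi i u * s i u)%R)%R.

Definition total_volume : R := (\sum_(0 <= i < N) \int[vol n]_(u in piece i) s i u)%R.

Local Close Scope ereal_scope.

Lemma total_volume_ge0 : 0 <= total_volume.
Proof.
apply: sumr_ge0 => i _; apply: Rintegral_ge0 => u [cu _ _].
by rewrite ltW // (vol_density_gt0 hg).
Qed.

Definition cont_on_charts (phi : nat -> vec -> R) :=
  forall i u, ccod M i u -> {for u, continuous (phi i : vec -> R^o)}.

Lemma weighted_bound phi e : cont_on_charts phi -> bounded_on_pieces phi e ->
  `|weighted phi| <= e * total_volume.
Proof.
move=> pc pb; rewrite /weighted /total_volume mulr_sumr.
apply: (le_trans (ler_norm_sum _ _ _)); apply: ler_sum => i _.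
have ip := integrable_weighted pb (pc i).
apply: (le_trans (le_normr_Rintegral (mP i) ip)).
rewrite -RintegralZl //; last exact: integrable_density.
apply: le_Rintegral => //.
- exact: integrable_norm.
- have := integrableZl (mP i) e (integrable_density i).
  by apply: eq_integrable => // u _.
- move=> u pu; have [cu _ _] := pu; have s0 := vol_density_gt0 hg cu.
  by rewrite normrM (ger0_norm (ltW s0)); apply: ler_wpM2r; [exact: ltW|exact: pb].
Qed.

Lemma weightedB phi psi C C' : cont_on_charts phi -> cont_on_charts psi ->
  bounded_on_pieces phi C -> bounded_on_pieces psi C' ->
  weighted (fun i u => phi i u - psi i u) = weighted phi - weighted psi.
Proof.
move=> pc qc pb qb; rewrite /weighted -sumrB; apply: eq_bigr => i _.
rewrite -RintegralB //; try exact: integrable_weighted pb (pc i); try exact: integrable_weighted qb (qc i).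
by apply: eq_Rintegral => u _; rewrite mulrBl.
Qed.

Lemma weightedZ phi C (t : R) : cont_on_charts phi -> bounded_on_pieces phi C ->
  weighted (fun i u => t * phi i u) = t * weighted phi.
Proof.
move=> pc pb; rewrite /weighted mulr_sumr; apply: eq_bigr => i _.
rewrite -RintegralZl //; last exact: integrable_weighted pb (pc i).
by apply: eq_Rintegral => u _; rewrite mulrA.
Qed.

(** The first-order remainder is uniform in space, so its integral is at most e |t| times the
    volume, which is finite; this takes the place of dominated convergence. *)
Lemma weighted_derive (J : R -> R) (rho : R -> nat -> vec -> R) (d : nat -> vec -> R) (C eps : R) :
  0 < eps -> (forall t, `|t| < eps -> J t = weighted (rho t)) ->
  (forall t, `|t| < eps -> cont_on_charts (rho t)) -> cont_on_charts d ->
  bounded_on_pieces (rho 0) C -> bounded_on_pieces d C ->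
  (forall e, 0 < e -> \forall t \near (0 : R), forall i u, piece i u ->
    `|rho t i u - rho 0 i u - t * d i u| <= e * `|t|) ->
  is_derive (0 : R^o) (1 : R^o) (J : R^o -> R^o) (weighted d).
Proof.
move=> eps0 JE rc dc rb db H.
have e0 : `|0 : R| < eps by rewrite normr0.
have K e : 0 < e -> \forall t \near (0 : R), `|J t - J 0 - t * weighted d| <= e * `|t|.
  move=> e_gt0.
  (* The summand 1 avoids dividing by a volume that may vanish. *)
  have e'0 : 0 < e / (total_volume + 1) by rewrite divr_gt0 // ltr_wpDl // total_volume_ge0.
  have H' := H _ e'0.
  near=> t.
  have te : `|t| < eps by near: t; exists eps => //= t'; rewrite /ball /= sub0r normrN.
  have Ht : forall i u, piece i u ->
      `|rho t i u - rho 0 i u - t * d i u| <= e / (total_volume + 1) * `|t| by near: t; exact: H'.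
  have tdb : bounded_on_pieces (fun i u => t * d i u) (`|t| * C).
    by move=> i u pu; rewrite normrM ler_wpM2l // db.
  have tdc : cont_on_charts (fun i u => t * d i u).
    move=> i u cu; apply: (@continuousM R vec (fun=> t : R^o) (d i : vec -> R^o)); last exact: dc.
    exact: cst_continuous.
  have rtb : bounded_on_pieces (rho t) (e / (total_volume + 1) * `|t| + C + `|t| * C).
    move=> i u pu.
    have -> : rho t i u = (rho t i u - rho 0 i u - t * d i u) + rho 0 i u + t * d i u by ring.
    apply: (le_trans (ler_normD _ _)); apply: lerD; last exact: tdb.
    by apply: (le_trans (ler_normD _ _)); apply: lerD; [exact: Ht|exact: rb].
  have rtc := rc t te; have r0c := rc 0 e0.
  have dfb : bounded_on_pieces (fun i u => rho t i u - rho 0 i u)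
      (e / (total_volume + 1) * `|t| + C + `|t| * C + C).
    move=> i u pu; apply: (le_trans (ler_normB _ _)); apply: lerD; [exact: rtb|exact: rb].
  have dfc : cont_on_charts (fun i u => rho t i u - rho 0 i u).
    move=> i u cu; apply: (@continuousB R R^o vec (rho t i : vec -> R^o) (rho 0 i : vec -> R^o)).
      exact: rtc.
    exact: r0c.
  rewrite !JE // -(weightedB rtc r0c rtb rb) -(weightedZ t dc db) -(weightedB dfc tdc dfb tdb).
  apply: (le_trans (weighted_bound _ Ht)).
    move=> i u cu; apply: (@continuousB R R^o vec (fun u => rho t i u - rho 0 i u : R^o) (fun u => t * d i u : R^o)).
      exact: dfc.
    exact: tdc.
  rewrite mulrAC ler_wpM2r // mulrAC ler_pdivrMr ?ltr_wpDl ?total_volume_ge0 //.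
  by apply: ler_wpM2l; [exact: ltW|rewrite lerDl ler01].
suff L : (fun h : R => h^-1 *: ((J \o shift (0 : R^o)) (h *: (1 : R^o)) - J 0)) @ 0^' -->
    (weighted d : R^o).
  by split; [apply/cvg_ex; eexists; exact: L|apply/cvg_lim].
apply/cvgrPdist_le => e e_gt0.
have := K e e_gt0 => Ke.
near=> h.
have h0 : h != 0 by near: h; exact: nbhs_dnbhs_neq.
have Kh : `|J h - J 0 - h * weighted d| <= e * `|h| by near: h; exact: nbhs_dnbhs Ke.
rewrite /= [h *: 1]mulr1 addr0 distrC.
have -> : h^-1 *: (J h - J 0) - weighted d = h^-1 * (J h - J 0 - h * weighted d).
  by rewrite [h^-1 *: _]/(_ * _) mulrBr mulKf.
by rewrite normrM normfV ler_pdivrMl ?normr_gt0 // [`|h| * e]mulrC.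
Unshelve. all: by end_near. Qed.

(** A neighbourhood of the given point may be split among several pieces, none of them containing a
    ball around it. Among the charts that meet the region of positivity, the one of least index owns
    all the points of the region that it contains, hence a whole cube. *)
Lemma weighted_gt0 phi C i0 u0 : cont_on_charts phi -> bounded_on_pieces phi C ->
  (forall i j u, chart_overlap M i j u -> phi i u = phi j (transition M i j u)) ->
  (forall i u, piece i u -> 0 <= phi i u) ->
  ccod M i0 u0 -> Omega (cinv M i0 u0) -> 0 < phi i0 u0 -> 0 < weighted phi.
Proof.
move=> pc pb ptr p0 cu0 Ou0 pu0.
have gtn (a x0 : R) : a < x0 -> nbhs (x0 : R^o) [set x : R^o | a < x].
  move=> ax; exists (x0 - a); first by rewrite /= subr_gt0.
  move=> y; rewrite /ball /= => h; have := le_lt_trans (ler_norm _) h; lra.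
pose O : set M := [set p | [/\ Omega p, cdom i0 p & 0 < phi i0 (cmap i0 p)]].
have Onear p : O p -> \forall q \near p, O q.
  move=> [Op dp pp].
  have N1 : nbhs p Omega by apply: open_nbhs_nbhs.
  have N2 : nbhs p (@cdom _ _ M i0) by apply: open_nbhs_nbhs; split=> //; exact: cdom_open.
  have N3 : nbhs (cmap i0 p) [set u | 0 < phi i0 u].
    have := pc i0 (cmap i0 p) (cmap_cod dp) [set x : R^o | 0 < x]; apply.
    exact: gtn.
  have N4 := cmap_continuous dp N3.
  by near=> q; split; near: q.
have O0 : O (cinv M i0 u0) by split=> //; [exact: cinv_dom|rewrite cinvK].
have exk : exists k, `[< exists q, cdom k q /\ O q >].
  by exists i0; apply/asboolP; exists (cinv M i0 u0); split=> //; exact: cinv_dom.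
pose k := ex_minn exk.
have [[q [kq Oq]] kmin] : (exists q, cdom k q /\ O q) /\ forall c q, cdom c q -> O q -> (k <= c)%N.
  rewrite /k; case: ex_minnP => c /asboolP H cm; split=> // c' q cq Oq.
  by apply: cm; apply/asboolP; exists q.
pose v := cmap k q; have cv : ccod M k v by exact: cmap_cod.
have inp p : cdom k p -> O p -> piece k (cmap k p) /\ 0 < phi k (cmap k p).
  move=> kp Op; have [Omp dp pp] := Op; have cp := cmap_cod kp.
  split.
    split; rewrite ?cmapK //; apply/eqP; rewrite eqn_leq chart_at_min //=.
    exact: kmin (chart_atP p) Op.
  have o : chart_overlap M k i0 (cmap k p) by split=> //; rewrite cmapK.
  by rewrite (ptr _ _ _ o) /transition /= cmapK.
have pv : 0 < phi k v by have [] := inp q kq Oq.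
have sv : 0 < s k v by exact: (vol_density_gt0 hg).
pose m := phi k v * s k v / 2.
have m0 : 0 < m by rewrite divr_gt0 // mulr_gt0.
have Vn : \forall u \near v, piece k u /\ m < phi k u * s k u.
  have N1 : \forall u \near v, ccod M k u by exact: open_near (@ccod_open _ _ M k) cv.
  have N2 : \forall u \near v, cdom k (cinv M k u) /\ O (cinv M k u).
    have W1 : nbhs (cinv M k v) (@cdom _ _ M k).
      by rewrite cmapK //; apply: open_nbhs_nbhs; split=> //; exact: cdom_open.
    have W2 : nbhs (cinv M k v) O by rewrite cmapK //; exact: Onear.
    exact: (cinv_continuous cv (filterI W1 W2)).
  have N3 : \forall u \near v, m < phi k u * s k u.
    have cs := smooth_on_continuous (@vol_density_smooth _ _ _ _ hg k) cv.
    have := (@continuousM R vec (phi k : vec -> R^o) (fun u => s k u : R^o) v (pc k v cv) cs) [set x : R^o | m < x].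
    apply; apply: gtn; rewrite /m ltr_pdivrMr // ltr_pMr ?ltr1n //.
    exact: mulr_gt0.
  near=> u; split; last by near: u.
  have cu : ccod M k u by near: u.
  have [d1 d2] : cdom k (cinv M k u) /\ O (cinv M k u) by near: u.
  by have [] := inp _ d1 d2; rewrite cinvK.
have /nbhs_ballP [e /= e_gt0 He] := Vn.
pose r : R := e / 2; have r0 : 0 < r by rewrite divr_gt0.
have cb x : cube v r x -> piece k x /\ m < phi k x * s k x.
  move=> /(cube_ball v x (ltW r0)) h; apply: He; rewrite -ball_normE /ball_ /= distrC.
  by rewrite (le_lt_trans h) // /r ltr_pdivrMr // ltr_pMr // ltr1n.
have kN : (k < N)%N by apply: (@pieceN k v); have [] := inp q kq Oq.
have ge0 i : 0 <= \int[vol n]_(u in piece i) (phi i u * s i u).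
  apply: Rintegral_ge0 => u pu; have [cu _ _] := pu.
  by rewrite mulr_ge0 ?p0 // ltW // (vol_density_gt0 hg).
rewrite /weighted big_mkord (bigD1 (Ordinal kN)) //= ltr_wpDr //; first exact: sumr_ge0.
have ik := integrable_weighted pb (pc k).
rewrite /Rintegral -lte_fin fineK; last exact: integrable_fin_num ik.
have mc : measurable (cube v r : set (mvec n)) by exact: measurable_cube.
apply: (@lt_le_trans _ _ (m%:E * vol n (cube v r))%E).
  by rewrite vol_cube ?ltW // -EFinM lte_fin mulr_gt0 // exprn_gt0 // mulr_gt0.
rewrite -integral_cst //.
have mf : measurable_fun (piece k) (fun u => (phi k u * s k u)%:E) by exact: measurable_int ik.
apply: (@le_trans _ _ (\int[vol n]_(u in (cube v r : set (mvec n))) (phi k u * s k u)%:E)%E).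
  apply: ge0_le_integral => //.
  - by move=> x _; rewrite lee_fin ltW.
  - by apply: measurable_funS mf => // x /cb [].
  - by move=> x /cb [_ h]; rewrite lee_fin ltW.
apply: ge0_subset_integral => //.
- by move=> x px; have [cx _ _] := px; rewrite lee_fin mulr_ge0 ?p0 // ltW // (vol_density_gt0 hg).
- by move=> x /cb [].
Unshelve. all: by end_near. Qed.

End VolumeIntegral.

(** * Taylor expansion in time, uniform in space *)

Section TimeTaylor.
Context {R : realType} {V : normedModType R}.

(** By the mean value theorem the remainder is [t] times the difference of the time derivatives at
    two times for the same [u]; both are within e / 2 of the value at (0, u0). *)
Lemma time_taylor (Z : set (R^o * V)) (f : R^o * V -> R^o) u0 e : open Z -> smooth_on Z f ->
  Z (0, u0) -> 0 < e ->
  exists2 r : R, 0 < r & \forall u \near u0, forall t : R^o, `|t| < r ->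
    `|f (t, u) - f (0, u) - t * 'D_1 (fun s : R^o => f (s, u)) 0| <= e * `|t|.
Proof.
move=> oZ fs Z0 e0; pose D := fun z => 'D_((1, 0) : R^o * V) f z.
have Ds : smooth_on Z D by exact: smooth_on_derive.
have Dc := smooth_on_continuous Ds Z0.
have e20 : 0 < e / 2 by rewrite divr_gt0.
have H1 : \forall z \near (0 : R^o, u0), `|D z - D (0, u0)| < e / 2.
  near=> z; have : ball (D (0, u0)) (e / 2) (D z).
    by near: z; exact: Dc _ (nbhsx_ballx (D (0, u0) : R^o) (e / 2) e20).
  by rewrite /ball /= distrC.
have H2 : \forall z \near (0 : R^o, u0), Z z by exact: open_near oZ Z0.
have [[A B] /= [A0 Bu] AB] := filterI H1 H2.
have /nbhs_ballP [r /= r0 rA] := A0.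
exists r => //; near=> u => t tr.
have Bu' : B u by near: u; exact: Bu.
have inA (s : R^o) : `|s| < r -> A s by move=> sr; apply: rA; rewrite /ball /= sub0r normrN.
have seg s : 0 <= s <= 1 -> `|s * t| < r.
  move=> /andP [s0 s1]; rewrite normrM (ger0_norm s0); apply: le_lt_trans tr.
  by rewrite ler_piMl.
have ptE s : (0 : R^o, u) + (s * t) *: ((1, 0) : R^o * V) = (s * t : R^o, u).
  by congr pair; rewrite /= ?scaler0 ?addr0 // add0r [_ *: _]mulr1.
have [|s s01] := @line_MVT R _ (f : R^o * V -> R^o) (0, u) ((1, 0) : R^o * V) t.
  move=> s s01; rewrite ptE; apply: smooth_on_derivable fs _.
  by have [] := AB (s * t, u) (conj (inA _ (seg _ s01)) Bu').
have -> : (0 : R^o, u) + t *: ((1, 0) : R^o * V) = (t, u) by rewrite -[t in t *: _]mul1r ptE mul1r.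
rewrite ptE => ->; rewrite (derive_time f 0 u) -mulrBr normrM mulrC.
apply: ler_wpM2r => //.
have [h1 _] := AB (s * t, u) (conj (inA _ (seg _ s01)) Bu').
have A00 : A 0 by apply: inA; rewrite normr0.
have [h2 _] := AB (0, u) (conj A00 Bu').
have -> : 'D_(1, 0) f (s * t, u) - 'D_(1, 0) f (0, u) =
   (D (s * t, u) - D (0, u0)) - (D (0, u) - D (0, u0)) by rewrite /D; ring.
apply: (le_trans (ler_normB _ _)); rewrite (splitr e) lerD // ltW //.
Unshelve. all: by end_near. Qed.

End TimeTaylor.

(** * Functions independent of the chart *)

Section ChartInvariant.
Context {R : realType} {n : nat} (M : manifold R n).
Local Notation vec := 'rV[R]_n.

Definition chart_invariant (phi : nat -> vec -> R) :=
  forall i j u, chart_overlap M i j u -> phi i u = phi j (transition M i j u).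

Lemma chart_invariant_cmap phi i j (p : M) : chart_invariant phi -> cdom i p -> cdom j p ->
  phi i (cmap i p) = phi j (cmap j p).
Proof.
move=> inv ip jp.
have o : chart_overlap M i j (cmap i p) by split; [exact: cmap_cod|rewrite cmapK].
by rewrite (inv _ _ _ o) /transition /= cmapK.
Qed.

(** A bound obtained near a point in one chart holds in every chart, the value being the same;
    finitely many such neighbourhoods cover the closure of [Omega]. *)
Lemma chart_invariant_bounded (Omega : set M) phi : compact (closure Omega) -> chart_invariant phi ->
  cont_on_charts M phi -> exists C, bounded_on_pieces Omega phi C.
Proof.
move=> cO inv pc.
have [|l lP] := @compact_finite_list M nat (closure Omega)
  (fun k p => forall i, cdom i p -> `|phi i (cmap i p)| <= k%:R) cO.
  move=> p _; pose j := chart_at p; have jp := chart_atP p.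
  have cc := cmap_cod jp.
  exists (Num.trunc (`|phi j (cmap j p)| + 1)).+1.
  have N1 : nbhs p (@cdom _ _ M j) by apply: open_nbhs_nbhs; split=> //; exact: cdom_open.
  have N2 := cmap_continuous jp (pc j _ cc _ (nbhsx_ballx (phi j (cmap j p) : R^o) 1 ltr01)).
  near=> q => i iq.
  have jq : cdom j q by near: q.
  rewrite (chart_invariant_cmap inv iq jq).
  have : ball (phi j (cmap j p) : R^o) 1 (phi j (cmap j q) : R^o) by near: q; exact: N2.
  rewrite /ball /= => h; apply: ltW; apply: le_lt_trans (truncnS_gt _).
  rewrite -lerBlDl (le_trans (lerB_dist _ _)) // distrC; exact: ltW.
exists (\max_(k <- l) k)%:R => i u [cu ci Ou].
have [k kl kb] := lP _ (subset_closure Ou).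
have := kb i (cinv_dom cu); rewrite cinvK // => h; apply: (le_trans h).
by rewrite ler_nat; exact: leq_bigmax_seq.
Unshelve. all: by end_near. Qed.

End ChartInvariant.

(** * Derivative of the action *)

Section ActionDerivative.
Context {R : realType} {n : nat} (M : manifold R n) (D1 D2 : subbundle M).
Local Notation vec := 'rV[R]_n.
Variables (g : tensor02 R n) (eps : R) (gt : R -> tensor02 R n).
Hypotheses (hg : riemannian M g) (hD : orthogonal_subbundles g D1 D2) (eps0 : 0 < eps).
Hypothesis gtR : forall t, `|t| < eps -> riemannian M (gt t).
Hypothesis gts : forall i, smooth_on (cylinder eps (ccod M i)) (fun z => gt z.1 i z.2).
Hypothesis gt0 : forall i u, ccod M i u -> gt 0 i u = g i u.
Variables (Omega : set M) (N : nat).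
Hypotheses (oO : open Omega) (cO : compact (closure Omega)).
Hypothesis pieceN : forall i u, piece Omega i u -> (i < N)%N.

Definition density t i u : R := chart_density D1 D2 g (gt t) i u.
Definition density_deriv i u : R := 'D_1 (fun t : R^o => density t i u : R^o) 0.

Let e0 : `|0 : R| < eps. Proof. by rewrite normr0. Qed.
Let oZ i : open (cylinder eps (ccod M i)).
Proof. by apply: open_cylinder; exact: ccod_open. Qed.

Lemma density_smooth i : smooth_on (cylinder eps (ccod M i)) (fun z => density z.1 i z.2 : R^o).
Proof.
apply: smooth_on_local => z [ze cz].
have [U [F1 [F2 [pU Uz Uc [s1 s2 FH]]]]] := variation_local D1 D2 cz.
exists (cylinder eps U); first by split.
exact: (var_density_smooth eps0 gtR gts gt0 pU Uc s1 s2 FH).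
Qed.

Lemma density_cont t : `|t| < eps -> cont_on_charts M (density t).
Proof.
move=> te i u cu.
have := smooth_on_continuous (@density_smooth i) (conj te cu : cylinder eps (ccod M i) (t, u)).
exact: (@continuous_slice R vec).
Qed.

Lemma density_deriv_cont : cont_on_charts M density_deriv.
Proof.
move=> i u cu.
have Ds := smooth_on_derive ((1, 0) : R^o * vec) (@density_smooth i).
have Dc := smooth_on_continuous Ds (conj e0 cu : cylinder eps (ccod M i) (0, u)).
have -> : density_deriv i = (fun v => 'D_((1, 0) : R^o * vec) (fun z => density z.1 i z.2 : R^o) (0, v)).
  by apply/funext => v; exact: derive_time (fun z => density z.1 i z.2 : R^o) 0 v.
exact: (@continuous_slice R vec R^o _ 0 u Dc).
Qed.

Lemma density_inv t : `|t| < eps -> chart_invariant M (density t).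
Proof. by move=> te i j u o; rewrite /density chart_density_transition //; exact: gtR. Qed.

Lemma density_deriv_inv : chart_invariant M density_deriv.
Proof.
move=> i j u o; rewrite /density_deriv; apply: near_eq_derive; near=> t.
by apply: density_inv => //; near: t; exact: near0_eps.
Unshelve. all: by end_near. Qed.

(** The expansion is obtained in one chart near each point. As the density and its derivative do not
    depend on the chart, it passes to every chart and becomes uniform by compactness. *)
Lemma density_taylor e : 0 < e -> \forall t \near (0 : R), forall i u, piece Omega i u ->
  `|density t i u - density 0 i u - t * density_deriv i u| <= e * `|t|.
Proof.
move=> e_gt0.
have [r r0 H] : exists2 r : R, 0 < r & forall p : M, closure Omega p -> forall (t : R) i, `|t| < r -> cdom i p ->
   `|density t i (cmap i p) - density 0 i (cmap i p) - t * density_deriv i (cmap i p)| <= e * `|t|.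
  have [|l lP] := @compact_finite_list M R (closure Omega) (fun r p => 0 < r /\ forall (t : R) i, `|t| < r -> cdom i p ->
   `|density t i (cmap i p) - density 0 i (cmap i p) - t * density_deriv i (cmap i p)| <= e * `|t|) cO.
    move=> p _; pose j := chart_at p; have jp := chart_atP p; have cc := cmap_cod jp.
    have [r r0 Hr] := time_taylor (@oZ j) (@density_smooth j) (conj e0 cc : cylinder eps (ccod M j) (0, cmap j p)) e_gt0.
    have N1 : nbhs p (@cdom _ _ M j) by apply: open_nbhs_nbhs; split=> //; exact: cdom_open.
    have N2 := cmap_continuous jp Hr.
    exists (Num.min r eps); near=> q; split; first by rewrite lt_min r0.
    move=> t i; rewrite lt_min => /andP [tr te] iq.
    have jq : cdom j q by near: q.
    rewrite (chart_invariant_cmap (density_inv te) iq jq) (chart_invariant_cmap (density_inv e0) iq jq).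
    rewrite (chart_invariant_cmap density_deriv_inv iq jq).
    by move: t tr {te}; near: q; exact: N2.
  (* Nonpositive entries of [l] are good at no point; leaving them out keeps the minimum
     positive. *)
  exists (\big[Num.min/1]_(r <- l | 0 < r) r).
    by apply: (big_ind (fun x : R => 0 < x)) => // x y x0 y0; rewrite lt_min x0 y0.
  move=> p cp t i; have [r rl [r0 H]] := lP p cp => tl; apply: H.
  apply: lt_le_trans tl _.
  elim: l rl {lP} => // a l IH; rewrite in_cons big_cons => /orP [/eqP <-|rl]; first by rewrite r0 ge_min lexx.
  by case: ifP => _; rewrite ?ge_min IH ?orbT.
near=> t => i u [cu ci Ou].
have := H _ (subset_closure Ou) t i _ (cinv_dom cu); rewrite cinvK //; apply.
by near: t; exists r => //= t; rewrite /ball /= sub0r normrN.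
Unshelve. all: by end_near. Qed.

(** The volume density of [g] divided out in [chart_density] reappears as the weight. *)
Lemma action_weighted t : `|t| < eps ->
  curv_action D1 D2 Omega (gt t) = weighted g Omega N (density t).
Proof.
move=> te; rewrite /curv_action.
have [C bC] := chart_invariant_bounded cO (density_inv te) (density_cont te).
rewrite (vol_intE (N := N) oO pieceN (h := fun i u => density t i u * vol_density g i u)) //.
  move=> i; have := integrable_weighted hg oO cO bC (@density_cont _ te i); exact.
move=> i u [cu ci Ou]; rewrite /mutual_curvature ci cinvK // /density /chart_density /vol_density.
by rewrite -mulrA divfK // gt_eqF // (vol_density_gt0 hg cu).
Qed.

Lemma action_derive : is_derive (0 : R^o) (1 : R^o)
  (fun t => curv_action D1 D2 Omega (gt t) : R^o) (weighted g Omega N density_deriv).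
Proof.
have [C1 b1] := chart_invariant_bounded cO (density_inv e0) (density_cont e0).
have [C2 b2] := chart_invariant_bounded cO density_deriv_inv density_deriv_cont.
apply: (weighted_derive (rho := density) (C := Num.max C1 C2) hg oO cO eps0).
- exact: action_weighted.
- exact: density_cont.
- exact: density_deriv_cont.
- by move=> i u pu; rewrite le_max b1.
- by move=> i u pu; rewrite le_max b2 ?orbT.
- exact: density_taylor.
Qed.

End ActionDerivative.

(** * Variations with compact support *)

Section FlatFunction.
Context {R : realType}.
Implicit Types (p : {poly R}) (x : R).

(* This family is closed under differentiation. *)
Definition flat p x : R := if 0 < x then p.[x^-1] * expR (- x^-1) else 0.

(** The exponential beats every power of 1/x. A bound linear in |x| is chosen because, applied to
    the product of [p] with the variable, it controls the difference quotient at 0. *)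
Lemma flat_bound p : exists2 C : R, 0 <= C & forall x, x < 1 -> `|flat p x| <= C * `|x|.
Proof.
pose m := size p; pose S := \sum_(k < m) `|p`_k|.
have S0 : 0 <= S by apply: sumr_ge0.
exists (S * m.+1%:R ^+ m.+1) => [|x x1]; first by rewrite mulr_ge0 // exprn_ge0.
rewrite /flat; case: ltP => [x0|_]; last by rewrite normr0 mulr_ge0 // mulr_ge0 // exprn_ge0.
set y := x^-1; have y0 : 0 < y by rewrite invr_gt0.
have y1 : 1 <= y by rewrite invr_ge1 ?unitfE ?gt_eqF ?ltW.
have pS : `|p.[y]| <= S * y ^+ m.
  rewrite horner_coef mulr_suml; apply: (le_trans (ler_norm_sum _ _ _)); apply: ler_sum => k _.
  by rewrite normrM (ger0_norm (exprn_ge0 _ (ltW y0))) ler_wpM2l // ler_weXn2l // ltnW.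
(* This is y / (m + 1) <= exp (y / (m + 1)), raised to the power m + 1. *)
have eB : expR (- y) <= m.+1%:R ^+ m.+1 / y ^+ m.+1.
  have m0 : 0 < m.+1%:R :> R by rewrite ltr0n.
  rewrite expRN -ler_pV2 ?inE ?unitfE ?gt_eqF ?invr_gt0 ?divr_gt0 ?exprn_gt0 ?expR_gt0 //.
  rewrite invrK invf_div -expr_div_n.
  have -> : expR y = expR (y / m.+1%:R) ^+ m.+1 by rewrite -expRM_natl mulrC divfK ?gt_eqF.
  rewrite lerXn2r ?nnegrE ?expR_ge0 ?divr_ge0 ?ltW //.
  apply: le_lt_trans (expR_gt1Dx _); first by rewrite lerDr.
  by rewrite gt_eqF // divr_gt0.
rewrite normrM (ger0_norm (expR_ge0 _)) (gtr0_norm x0).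
apply: (le_trans (ler_pM _ _ pS eB)); rewrite ?expR_ge0 //.
rewrite -!mulrA ler_wpM2l // (_ : x = y^-1); last by rewrite /y invrK.
rewrite [y ^+ m.+1]exprS; set a := m.+1%:R ^+ _; clearbody a.
by rewrite (_ : y ^+ m * (a / (y * y ^+ m)) = a / y) //; field; rewrite expf_neq0 ?gt_eqF.
Qed.

Lemma flat_poly_mulX p x : flat ('X * p) x = x^-1 * flat p x.
Proof. by rewrite /flat hornerM hornerX; case: ifP; rewrite ?mulr0 ?mulrA. Qed.

(** With y = 1/x, the chain rule multiplies the derivative in y by -y^2, whence the new polynomial.
    At 0 the difference quotient is the flat function of ['X * p], which tends to 0 by
    [flat_bound]. *)
Lemma is_derive_flat p x : is_derive (x : R^o) (1 : R^o) (flat p : R^o -> R^o) (flat ('X^2 * (p - p^`())) x).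
Proof.
have [x0|x0|->] := ltgtP x 0.
- rewrite {2}/flat ltNge (ltW x0) /=; apply: is_derive_near_eq (is_derive_cst _ _ _); near=> y.
  rewrite /flat ltNge ltW //=; near: y.
  by have := lt_nbhsl x0; apply.
- rewrite {2}/flat x0.
  have x00 : x != 0 by rewrite gt_eqF.
  have V : is_derive (x : R^o) (1 : R^o) (fun y : R^o => y^-1 : R^o) (- x ^- 2).
    by apply: is_derive_eq; first exact: (is_deriveV x00 (is_derive_id (x : R^o) (1 : R^o))); rewrite [_ *: _]mulr1.
  have P := is_derive1_comp (is_derive_poly p x^-1) V.
  have E := @is_derive1_comp R expR (fun y : R => - y^-1) x _ _ (is_derive_expR (- x^-1)) (is_deriveN V).
  have D := is_derive_mulr P E.
  apply: is_derive_near_eq (is_derive_eq D _).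
    near=> y; rewrite /flat /= ifT //; near: y.
    by have := lt_nbhsr x0; apply.
  by rewrite /= hornerM hornerXn hornerD hornerN exprVn; ring.
- rewrite {2}/flat ltxx.
  have [C C0 CB] := flat_bound ('X * p).
  suff L : (fun h : R => h^-1 *: ((flat p \o shift (0 : R^o)) (h *: (1 : R^o)) - flat p 0)) @ 0^' -->
    (0 : R^o).
    by split; [apply/cvg_ex; eexists; exact: L|apply/cvg_lim].
  apply/cvgrPdist_le => e e0; near=> h.
  rewrite /= [h *: 1]mulr1 addr0 sub0r normrN.
  have -> : h^-1 *: (flat p h - flat p 0) = flat ('X * p) h.
    by rewrite flat_poly_mulX {2}/flat ltxx subr0.
  have hC : `|h| < Num.min 1 (e / (C + 1)).
    near: h; apply: nbhs_dnbhs; exists (Num.min 1 (e / (C + 1))) => /=.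
      by rewrite lt_min ltr01 divr_gt0 // ltr_wpDl.
    by move=> t; rewrite /ball /= sub0r normrN.
  move: hC; rewrite lt_min => /andP [h1 h2].
  apply: (le_trans (CB _ (le_lt_trans (ler_norm _) h1))).
  move: h2; rewrite ltr_pdivlMr ?ltr_wpDl // => /ltW h2; apply: le_trans h2.
  by rewrite mulrC ler_wpM2l // lerDl.
Unshelve. all: by end_near. Qed.

Lemma flat_continuous p : continuous (flat p : R^o -> R^o).
Proof.
move=> x; have [d _] := is_derive_flat p x.
exact/differentiable_continuous/derivable1_diffP.
Qed.

Lemma smooth_on_flat {V : normedModType R} (U : set V) p (s : V -> R^o) : open U ->
  smooth_on U s -> smooth_on U (fun y => flat p (s y) : R^o).
Proof.
move=> oU ss k; elim: k p => [|k IH] p.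
  split=> // x Ux; apply: (@continuous_comp _ _ _ s (flat p : R^o -> R^o)); last exact: flat_continuous.
  exact: smooth_on_continuous ss Ux.
split=> [x Ux|v].
  apply: (@continuous_comp _ _ _ s (flat p : R^o -> R^o)); last exact: flat_continuous.
  exact: smooth_on_continuous ss Ux.
have H (x : V) (Ux : U x) : is_derive x v (fun y => flat p (s y) : R^o) (flat ('X^2 * (p - p^`())) (s x) * 'D_v (s : V -> R^o) x).
  have [d1 d2] := is_derive_flat p (s x).
  by have := is_derive_comp1 (smooth_on_derivable (v := v) ss Ux) d1; rewrite d2.
split=> [x Ux|]; first by have [] := H x Ux.
apply: (@Ck_on_congr _ _ _ _ _ (fun x : V => flat ('X^2 * (p - p^`())) (s x) * 'D_v (s : V -> R^o) x : R^o)) => //.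
  by move=> x Ux; have [_ ->] := H x Ux.
by apply: Ck_onM => //; exact: Ck_onS.
Qed.

End FlatFunction.

(** * Bump functions *)

Section Bump.
Context {R : realType} {n : nat}.
Local Notation vec := 'rV[R]_n.

(** The squared Euclidean distance is smooth, unlike the norm on row vectors; the Euclidean ball
    lies in the ball of the same radius for the sup norm. *)
Definition bump_fun (c : vec) (r : R) (u : vec) : R := flat 1 (r ^+ 2 - \sum_k (u 0 k - c 0 k) ^+ 2).

Lemma bump_smooth c r : smooth_on setT (bump_fun c r : vec -> R^o).
Proof.
have oT : open [set: vec] by exact: openT.
apply: smooth_on_flat => //; apply: smooth_onD => //; first exact: smooth_on_cst.
apply: smooth_onN => //; apply: smooth_on_sum => // k _.
have S : smooth_on setT (fun u : vec => u 0 k - c 0 k : R^o).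
  apply: smooth_onD => //; last by apply: smooth_on_cst.
  exact: ((smooth_on_mxP _ oT).1 (smooth_on_id setT) 0 k).
have := smooth_onM oT S S; by under eq_fun do rewrite -expr2.
Qed.

Lemma bump_ge0 c r u : 0 <= bump_fun c r u.
Proof. by rewrite /bump_fun /flat; case: ifP => // _; rewrite hornerC mul1r expR_ge0. Qed.

Lemma bump_le1 c r u : bump_fun c r u <= 1.
Proof.
rewrite /bump_fun /flat; case: ifP => // s0; rewrite hornerC mul1r.
by rewrite -expR0 ler_expR oppr_le0 invr_ge0 ltW.
Qed.

Lemma bump_center c r : 0 < r -> 0 < bump_fun c r c.
Proof.
move=> r0; rewrite /bump_fun big1 => [|k _]; last by rewrite subrr expr0n.
by rewrite subr0 /flat exprn_gt0 // hornerC mul1r expR_gt0.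
Qed.

Lemma bump_support c r u : 0 < r -> bump_fun c r u != 0 -> `|u - c| < r.
Proof.
move=> r0; rewrite /bump_fun /flat; case: ifP => [s0 _|_]; last by rewrite eqxx.
rewrite subr_gt0 in s0.
suff : ball c r u by rewrite -ball_normE /= distrC.
split=> // i j; rewrite ord1 -ball_normE /= distrC.
suff : `|u 0 j - c 0 j| ^+ 2 < r ^+ 2 by rewrite ltr_pXn2r // nnegrE ltW.
rewrite real_normK ?num_real //; apply: le_lt_trans s0; rewrite (bigD1 j) //= lerDl; apply: sumr_ge0 => k _; exact: sqr_ge0.
Qed.

End Bump.

Lemma is_derive_near_unique {R : realType} {V W : normedModType R} (f g : V -> W) x v df dg :
  (\forall y \near x, f y = g y) -> is_derive x v f df -> is_derive x v g dg -> df = dg.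
Proof.
by move=> fg /(is_derive_near_eq fg) [_ <-] [_ <-].
Qed.

(** * Extension of a compactly supported tensor from a chart *)

Section TensorExtension.
Context {R : realType} {n : nat} (M : manifold R n).
Local Notation vec := 'rV[R]_n.

Lemma derive_transition i j u v : chart_overlap M i j u ->
  is_derive u v (transition M i j) (v *m 'J (transition M i j) u).
Proof.
move=> o; rewrite -(derive_phi (@overlap_open _ _ M i j) (@transition_smooth _ _ M i j) v o).
exact: (smooth_on_is_derive v (@transition_smooth _ _ M i j) o).
Qed.

Lemma jacobian_smooth i j : smooth_on (chart_overlap M i j) (fun v => 'J (transition M i j) v).
Proof.
have oU := @overlap_open _ _ M i j; have ts := @transition_smooth _ _ M i j.
apply/smooth_on_mxP => // k l.
have H := (smooth_on_mxP _ oU).1 (smooth_on_derive (delta_mx 0 k) ts) 0 l.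
apply: (smooth_on_congr oU _ H) => v Uv.
by rewrite (derive_phi oU ts _ Uv) -rowE mxE.
Qed.

Lemma jacobian_chain i j k u : chart_overlap M i j u -> chart_overlap M i k u ->
  'J (transition M i k) u = 'J (transition M i j) u *m 'J (transition M j k) (transition M i j u).
Proof.
move=> ij ik.
have jk : chart_overlap M j k (transition M i j u).
  by split; [exact: transition_cod|rewrite cinv_transition //; exact: ik.2].
apply/row_matrixP => l; rewrite !rowE mulmxA; set v := delta_mx _ _.
have df := phi_diff (@overlap_open _ _ M j k) (@transition_smooth _ _ M j k) jk.
have D := is_derive_comp_phi (@overlap_open _ _ M i j) (@transition_smooth _ _ M i j) v ij df.
have D2 := derive_transition (v *m 'J (transition M i j) u) jk.
apply: (is_derive_near_unique _ (derive_transition v ik) (is_derive_eq D _)); last exact: (@derive_val _ _ _ _ _ _ _ D2).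
apply: (open_near_eq (@overlap_open _ _ M i j)) => // w ow.
by rewrite /transition /= cmapK //; exact: ow.2.
Qed.

Lemma jacobian_refl i u : ccod M i u -> 'J (transition M i i) u = 1%:M.
Proof.
move=> cu; have o : chart_overlap M i i u by split=> //; exact: cinv_dom.
apply/row_matrixP => l; rewrite !rowE mulmx1; set v := delta_mx _ _.
apply: (is_derive_near_unique _ (derive_transition v o) (is_derive_id u v)).
apply: (open_near_eq (@ccod_open _ _ M i)) => // w cw.
exact: cinvK.
Qed.

Variables (i0 : nat) (eta : vec -> 'M[R]_n) (K : set vec).
Hypotheses (etas : smooth_on (ccod M i0) eta) (cK : compact K) (Kc : K `<=` ccod M i0).
Hypothesis etaK : forall u, ccod M i0 u -> ~ K u -> eta u = 0.

Definition extend_tensor : tensor02 R n := fun i u =>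
  if `[< chart_overlap M i i0 u >] then
    'J (transition M i i0) u *m eta (transition M i i0 u) *m ('J (transition M i i0) u)^T
  else 0.

Lemma chart_image_compact : compact (cinv M i0 @` K).
Proof.
apply: continuous_compact => //; apply: continuous_in_subspaceT => u /set_mem Ku.
exact/cinv_continuous/Kc.
Qed.

Lemma extend_tensorE i u : chart_overlap M i i0 u -> extend_tensor i u =
  'J (transition M i i0) u *m eta (transition M i i0 u) *m ('J (transition M i i0) u)^T.
Proof. by move=> o; rewrite /extend_tensor asboolT. Qed.

Lemma extend_tensor_out i u : ~ chart_overlap M i i0 u -> extend_tensor i u = 0.
Proof. by move=> o; rewrite /extend_tensor asboolF. Qed.

Lemma extend_tensor_support i u : ~ (cinv M i0 @` K) (cinv M i u) -> extend_tensor i u = 0.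
Proof.
move=> nK; have [p0|p0] := pselect (chart_overlap M i i0 u); last exact: extend_tensor_out.
rewrite extend_tensorE // etaK ?mulmx0 ?mul0mx //; first exact: transition_cod.
by move=> Kt; apply: nK; exists (transition M i i0 u) => //; exact: cinv_transition.
Qed.

Lemma extend_tensor_base u : ccod M i0 u -> extend_tensor i0 u = eta u.
Proof.
move=> cu; have o : chart_overlap M i0 i0 u by split=> //; exact: cinv_dom.
by rewrite extend_tensorE // jacobian_refl // trmx1 mulmx1 mul1mx /transition /= cinvK.
Qed.

(** Away from the chart [i0] the tensor vanishes on a neighbourhood: the image of [K] is compact,
    hence closed since the manifold is Hausdorff, and its complement is open. *)
Lemma extend_tensor_smooth i : smooth_on (ccod M i) (extend_tensor i).
Proof.
apply: smooth_on_local => u cu; have [p0|p0] := pselect (chart_overlap M i i0 u).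
  have oU := @overlap_open _ _ M i i0.
  exists (chart_overlap M i i0); first exact: p0.
  apply: (smooth_on_congr oU) => [v ov|]; first by rewrite (extend_tensorE ov).
  have Js := @jacobian_smooth i i0.
  apply: smooth_on_mulmx => //; last exact: smooth_on_trmx.
  apply: smooth_on_mulmx => //.
  apply: (smooth_on_comp oU (@ccod_open _ _ M i0)) => //; last exact: transition_smooth.
  by move=> v; exact: transition_cod.
have cS := compact_closed (@manifold_hausdorff _ _ M) chart_image_compact.
pose W := [set v | ccod M i v /\ (~` (cinv M i0 @` K)) (cinv M i v)].
have oW : open W by apply: open_preimage; exact: closed_openC.
exists W.
  split=> //= -[w Kw wu]; apply: p0; split=> //.
  by rewrite -wu; exact/cinv_dom/Kc.
by apply: (smooth_on_congr oW _ (smooth_on_cst W 0)) => v [_ nK]; rewrite extend_tensor_support.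
Qed.

Lemma extend_tensor_transition i j u : chart_overlap M i j u ->
  'J (transition M i j) u *m extend_tensor j (transition M i j u) *m ('J (transition M i j) u)^T
  = extend_tensor i u.
Proof.
move=> ij; have [p0|p0] := pselect (chart_overlap M i i0 u).
  have jo : chart_overlap M j i0 (transition M i j u).
    by split; [exact: transition_cod|rewrite cinv_transition //; exact: p0.2].
  have tt : transition M j i0 (transition M i j u) = transition M i i0 u.
    by rewrite {1}/transition /= cinv_transition.
  rewrite (extend_tensorE p0) (extend_tensorE jo) tt.
  have := jacobian_chain ij p0; move: ('J _ _) ('J _ _) ('J _ _) => J1 J2 J3 ->.
  by rewrite trmx_mul !mulmxA.
rewrite (extend_tensor_out p0) extend_tensor_out ?mulmx0 ?mul0mx // => -[_ d]; apply: p0.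
by split; [exact: ij.1|rewrite -(cinv_transition ij)].
Qed.

End TensorExtension.

(** * Linear variations of the metric *)

Section TensorVariation.
Context {R : realType} {n : nat} (M : manifold R n) (D1 D2 : subbundle M).
Local Notation vec := 'rV[R]_n.
Variables (g : tensor02 R n).
Hypotheses (hg : riemannian M g) (hD : orthogonal_subbundles g D1 D2).

Local Notation third i := (third_distr (g i) (fiber D1 i) (fiber D2 i)).

Lemma chart_splitting i u : ccod M i u -> exists U, [/\ open U, U u, U `<=` ccod M i &
  splitting U (g i) (orthoproj (g i) (fiber D1 i)) (orthoproj (g i) (fiber D2 i))
    (orthoproj (g i) (third i))].
Proof.
move=> cu; have [U [F1 [F2 [pU Uu Uc [s1 s2 FH]]]]] := variation_local D1 D2 cu.
have [gs _ _ _] := hg.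
exists U; split=> //.
(* The results on families of metrics are applied to the constant family. *)
apply: (@ortho_splitting _ _ _ _ 1 U (fun _ => g i) (g i) (fiber D1 i) (fiber D2 i) F1 F2) => //.
- by have := smooth_on_snd (smooth_on_sub Uc (gs i)); apply: smooth_on_sub => z [].
- by move=> t v _ Uv; apply: riemannian_posdef hg _; exact: Uc.
- by move=> v /FH [].
- by move=> v /FH [].
- move=> v Uv; have [_ _ /andP [/submxP [T1 ->] _] /andP [/submxP [T2 ->] _]] := FH v Uv.
  by rewrite trmx_mul !mulmxA -2!(mulmxA T1) hD ?mulmx0 ?mul0mx //; exact: Uc.
- by move=> v /FH [].
- by move=> v /FH [].
Qed.

Lemma third_proj_smooth i : smooth_on (ccod M i) (orthoproj (g i) (third i)).
Proof.
by apply: smooth_on_local => u /chart_splitting [U [_ Uu _ sp]]; exists U => //; exact: sp_smooth3 sp.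
Qed.

Lemma third_orthogonal i u (X : vec) : ccod M i u -> (X <= third i u)%MS ->
  fiber D1 i u *m (X *m g i u)^T = 0 /\ fiber D2 i u *m (X *m g i u)^T = 0.
Proof.
move=> cu XD; have [sg _] := riemannian_posdef hg cu.
have X0 : X *m (g i u *m (fiber D1 i u + fiber D2 i u)%MS^T) = 0 by apply/sub_kermxP.
have K (D : 'M[R]_n) : (D <= fiber D1 i u + fiber D2 i u)%MS -> D *m (X *m g i u)^T = 0.
  move=> /submxP [c ->]; rewrite -mulmxA; apply: trmx_inj.
  by rewrite trmx_mul [(_ *m (X *m _)^T)^T]trmx_mul trmxK -(mulmxA X) X0 mul0mx trmx0.
by split; apply: K; [exact: addsmxSl|exact: addsmxSr].
Qed.

Variables (i0 : nat) (eta : vec -> 'M[R]_n) (K : set vec).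
Hypotheses (etas : smooth_on (ccod M i0) eta) (cK : compact K) (Kc : K `<=` ccod M i0).
Hypothesis etaK : forall u, ccod M i0 u -> ~ K u -> eta u = 0.
Hypothesis eta_sym : forall u, ccod M i0 u -> (eta u)^T = eta u.
Hypothesis eta_small : forall u (v : vec), ccod M i0 u -> v != 0 -> `|bil (eta u) v v| < bil (g i0 u) v v.
Hypothesis eta_kill1 : forall u, ccod M i0 u -> fiber D1 i0 u *m eta u = 0.
Hypothesis eta_kill2 : forall u, ccod M i0 u -> fiber D2 i0 u *m eta u = 0.

Local Notation ext := (extend_tensor M i0 eta).

Definition linear_variation (t : R) : tensor02 R n := fun i u => g i u + t *: ext i u.

Lemma extend_tensor_sym i u : (ext i u)^T = ext i u.
Proof.
have [p0|p0] := pselect (chart_overlap M i i0 u); last by rewrite extend_tensor_out // trmx0.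
by rewrite extend_tensorE // !trmx_mul trmxK eta_sym ?mulmxA //; exact: transition_cod.
Qed.

Lemma extend_tensor_kill (D : subbundle M) i u :
  (forall u, ccod M i0 u -> fiber D i0 u *m eta u = 0) -> fiber D i u *m ext i u = 0.
Proof.
move=> k; have [p0|p0] := pselect (chart_overlap M i i0 u); last by rewrite extend_tensor_out // mulmx0.
rewrite extend_tensorE // !mulmxA.
have /andP [/submxP [T ->] _] := fiber_transition D p0.
by rewrite -(mulmxA T) k ?mulmx0 ?mul0mx //; exact: transition_cod.
Qed.

Lemma extend_tensor_small i u v : ccod M i u -> v != 0 -> `|bil (ext i u) v v| < bil (g i u) v v.
Proof.
move=> cu v0; have [sg pg] := riemannian_posdef hg cu.
have [p0|p0] := pselect (chart_overlap M i i0 u); last first.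
  by rewrite extend_tensor_out // bil0A normr0 bilv; exact: pg.
have [_ _ _ tr] := hg.
rewrite extend_tensorE // -(tr _ _ _ p0) !bil_congr; apply: eta_small; first exact: transition_cod.
apply: contra v0 => /eqP vJ; apply/eqP.
by rewrite -[v](mulmxK (jacobian_unit hg p0)) vJ mul0mx.
Qed.

Lemma linear_variation_riemannian t : `|t| < 1 -> riemannian M (linear_variation t).
Proof.
move=> t1; have [gs gsym gp tr] := hg; split.
- move=> i; apply: smooth_onD; [exact: ccod_open|exact: gs|].
  have oC := @ccod_open _ _ M i.
  apply/smooth_on_mxP => // k l.
  have := smooth_onM oC (smooth_on_cst _ t) ((smooth_on_mxP _ oC).1 (extend_tensor_smooth etas cK Kc etaK i) k l).
  by apply: smooth_on_congr => // v _; rewrite mxE.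
- by move=> i u cu; rewrite /linear_variation linearD linearZ /= extend_tensor_sym gsym.
- move=> i u v cu v0; rewrite -bilv bilDA bilZA.
  have := extend_tensor_small cu v0; move: (bil _ v v) (bil _ v v) => a b ab.
  rewrite -ltrBlDr sub0r; apply: le_lt_trans ab; apply: (le_trans (ler_norm _)).
  by rewrite normrN normrM ler_piMl // ltW.
- move=> i j u o; rewrite /linear_variation mulmxDr mulmxDl tr // -scalemxAr -scalemxAl.
  by rewrite extend_tensor_transition.
Qed.

Lemma linear_variation_smooth i : smooth_on (cylinder 1 (ccod M i)) (fun z => linear_variation z.1 i z.2).
Proof.
have oC := @ccod_open _ _ M i; have oZ : open (cylinder 1 (ccod M i)) by exact: open_cylinder.
have [gs _ _ _] := hg.
have lift p q (F : vec -> 'M[R]_(p, q)) : smooth_on (ccod M i) F -> smooth_on (cylinder 1 (ccod M i)) (fun z => F z.2).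
  by move=> /smooth_on_snd; apply: smooth_on_sub => z [].
apply: smooth_onD => //; first exact: lift.
have es := lift _ _ _ (extend_tensor_smooth etas cK Kc etaK i).
apply/smooth_on_mxP => // k l.
have := smooth_onM oZ (smooth_on_fst _) ((smooth_on_mxP _ oZ).1 es k l).
by apply: smooth_on_congr => // v _; rewrite mxE.
Qed.

Lemma linear_variation0 i u : linear_variation 0 i u = g i u.
Proof. by rewrite /linear_variation scale0r addr0. Qed.

Lemma linear_variation_deriv i u : variation_deriv linear_variation i u = ext i u.
Proof.
rewrite /variation_deriv /linear_variation; move: (g i u) (ext i u) => A B.
suff H : is_derive (0 : R^o) (1 : R^o) (fun t : R^o => A + t *: B) B by case: H.
apply/is_derive_mxP => k l.
have D := is_deriveD (is_derive_cst (A k l : R^o) (0 : R^o) (1 : R^o))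
  (is_derive_mulr (is_derive_id (0 : R^o) (1 : R^o)) (is_derive_cst (B k l : R^o) (0 : R^o) (1 : R^o))).
apply: is_derive_near_eq (is_derive_eq D _); last by rewrite mulr0 mul1r addr0 add0r.
by near=> t; rewrite !mxE.
Unshelve. all: by end_near. Qed.

Lemma linear_variation_metric Omega : cinv M i0 @` K `<=` Omega ->
  metric_variation g Omega 1 linear_variation.
Proof.
move=> KO; split=> //.
- exact: linear_variation_riemannian.
- exact: linear_variation_smooth.
- by move=> i u _; exact: linear_variation0.
apply: subset_trans KO.
have cS := compact_closed (@manifold_hausdorff _ _ M) (chart_image_compact cK Kc).
rewrite [X in _ `<=` X](closure_id _).1 //; apply: closureS => p [t [i [_ ip H]]].
apply: contrapT => nK; apply: H; rewrite /linear_variation.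
by rewrite (extend_tensor_support etaK) ?scaler0 ?addr0 // cmapK.
Qed.

Lemma linear_variation_orthogonal t : orthogonal_subbundles (linear_variation t) D1 D2.
Proof.
move=> i u cu; rewrite /linear_variation mulmxDr mulmxDl hD // -scalemxAr -scalemxAl.
by rewrite extend_tensor_kill // mul0mx scaler0 addr0.
Qed.

Lemma linear_variation_third i u : ccod M i u ->
  let P3 := orthoproj (g i) (third i) in
  let B := variation_deriv linear_variation i in
  forall X Y : vec, inner_g B u X Y = inner_g B u (X *m P3 u) (Y *m P3 u).
Proof.
move=> cu P3 B X Y; rewrite !inner_bil /B linear_variation_deriv.
have [U [_ Uu _ sp]] := chart_splitting cu.
have kill (x y : vec) : bil (ext i u) (x *m P3 u) y = bil (ext i u) x y.
  rewrite -[in RHS](mulmx1 x) -(sp_sum sp Uu) !mulmxDr !bilDl -/P3.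
  have Z (D : subbundle M) : (forall u, ccod M i0 u -> fiber D i0 u *m eta u = 0) ->
      bil (ext i u) (x *m orthoproj (g i) (fiber D i) u) y = 0.
    move=> k; have /submxP [c ->] : (x *m orthoproj (g i) (fiber D i) u <= fiber D i u)%MS by exact: proj_mx_sub.
    by rewrite bilv -(mulmxA c) extend_tensor_kill // mulmx0 mul0mx mxE.
  by rewrite (Z D1 eta_kill1) (Z D2 eta_kill2) !add0r.
have sE := bilC _ _ (extend_tensor_sym i u).
exact: (etrans (sE X Y) (etrans (esym (kill Y X)) (etrans (sE _ _) (esym (kill X _))))).
Qed.

End TensorVariation.

(** * Density derivative and the Euler-Lagrange expression *)

Section DensityDerivative.
Context {R : realType} {n : nat} (M : manifold R n) (D1 D2 : subbundle M).
Local Notation vec := 'rV[R]_n.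
Variables (g : tensor02 R n) (eps : R) (gt : R -> tensor02 R n).
Hypotheses (hg : riemannian M g) (hD : orthogonal_subbundles g D1 D2) (eps0 : 0 < eps).
Hypothesis gtR : forall t, `|t| < eps -> riemannian M (gt t).
Hypothesis gts : forall i, smooth_on (cylinder eps (ccod M i)) (fun z => gt z.1 i z.2).
Hypothesis gt0 : forall i u, ccod M i u -> gt 0 i u = g i u.
Hypothesis kill1 : forall i u, ccod M i u -> fiber D1 i u *m variation_deriv gt i u = 0.
Hypothesis kill2 : forall i u, ccod M i u -> fiber D2 i u *m variation_deriv gt i u = 0.

Local Notation third i := (third_distr (g i) (fiber D1 i) (fiber D2 i)).
Local Notation el i := (el_expr (g i) (fiber D1 i) (fiber D2 i)).

Lemma density_deriv_rank1 i u E F X (s : R) : ccod M i u ->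
  orthonormal_frame (g i) (fiber D1 i) u (E : 'M[R]_(drank D1, n)) ->
  orthonormal_frame (g i) (fiber D2 i) u (F : 'M[R]_(drank D2, n)) ->
  (X <= third i u)%MS -> variation_deriv gt i u = s *: ((X *m g i u)^T *m (X *m g i u)) ->
  2 * density_deriv D1 D2 g gt i u = s * el i u E F X X.
Proof.
move=> cu EO FO XD BE; have [U [F1 [F2 [pU Uu Uc [s1 s2 FH]]]]] := variation_local D1 D2 cu.
rewrite -(var_rate_rank1 hg hD eps0 gtR gts gt0 kill1 kill2 pU Uc s1 s2 FH Uu EO FO XD BE).
have [_ H] := var_density_time eps0 gtR gts gt0 kill1 kill2 pU Uc s1 s2 FH Uu EO FO.
by rewrite /density_deriv /density; congr (2 * _).
Qed.

Lemma density_deriv_el i u E F : ccod M i u ->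
  orthonormal_frame (g i) (fiber D1 i) u (E : 'M[R]_(drank D1, n)) ->
  orthonormal_frame (g i) (fiber D2 i) u (F : 'M[R]_(drank D2, n)) ->
  (forall X Y, (X <= third i u)%MS -> (Y <= third i u)%MS -> el i u E F X Y = 0) ->
  density_deriv D1 D2 g gt i u = 0.
Proof.
move=> cu EO FO el0; have [U [F1 [F2 [pU Uu Uc [s1 s2 FH]]]]] := variation_local D1 D2 cu.
have [_ H] := var_density_time eps0 gtR gts gt0 kill1 kill2 pU Uc s1 s2 FH Uu EO FO.
rewrite -(var_rate_el hD eps0 gtR gts gt0 kill1 kill2 pU Uc s1 s2 FH Uu EO FO el0) -H.
by [].
Qed.

(** The rank-one formula applies with coefficient 0. *)
Lemma density_deriv_vanish i u : ccod M i u -> variation_deriv gt i u = 0 ->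
  density_deriv D1 D2 g gt i u = 0.
Proof.
move=> cu B0.
have [E EO] := exists_fiber_frame D1 hg cu; have [F FO] := exists_fiber_frame D2 hg cu.
have : 2 * density_deriv D1 D2 g gt i u = 0 * el i u E F 0 0.
  by apply: density_deriv_rank1 => //; [exact: sub0mx|rewrite scale0r].
by rewrite mul0r => /eqP; rewrite mulf_eq0 pnatr_eq0 /= => /eqP.
Qed.

Lemma el_stationary Omega : open Omega -> compact (closure Omega) ->
  (forall i u, ccod M i u -> forall E F,
    orthonormal_frame (g i) (fiber D1 i) u (E : 'M[R]_(drank D1, n)) ->
    orthonormal_frame (g i) (fiber D2 i) u (F : 'M[R]_(drank D2, n)) ->
    forall X Y, (X <= third i u)%MS -> (Y <= third i u)%MS -> el i u E F X Y = 0) ->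
  is_derive (0 : R^o) (1 : R^o) (fun t => curv_action D1 D2 Omega (gt t) : R^o) 0.
Proof.
move=> oO cO el0; have [N pN] := piece_bound cO.
have := action_derive D1 D2 hg eps0 gtR gts gt0 oO cO pN.
suff -> : weighted g Omega N (density_deriv D1 D2 g gt) = 0 by [].
apply: big1 => i _; transitivity (\int[vol n]_(u in (piece Omega i : set (mvec n))) (0 : R)); last first.
  by rewrite Rintegral_cst ?mul0r //; exact: measurable_piece.
apply: eq_Rintegral => u /set_mem [cu _ _].
have [E EO] := exists_fiber_frame D1 hg cu; have [F FO] := exists_fiber_frame D2 hg cu.
by rewrite (density_deriv_el cu EO FO (el0 i u cu E F EO FO)) mul0r.
Qed.

End DensityDerivative.

(** * Cauchy-Schwarz inequality *)

Section CauchySchwarz.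
Context {R : realType} {n : nat}.
Local Notation vec := 'rV[R]_n.

Lemma posdef_ge0 (A : 'M[R]_n) (x : vec) : posdef A -> 0 <= bil A x x.
Proof.
by move=> [_ pA]; have [->|x0] := eqVneq x 0; [rewrite bil0l|rewrite bilv ltW // pA].
Qed.

Lemma posdef_cauchy (A : 'M[R]_n) (x y : vec) : posdef A -> bil A x y ^+ 2 <= bil A x x * bil A y y.
Proof.
move=> pA; have [sA pA'] := pA; have [->|y0] := eqVneq y 0; first by rewrite !bil0r expr0n mulr0.
have yy : 0 < bil A y y by rewrite bilv pA'.
have := posdef_ge0 (bil A y y *: x - bil A x y *: y) pA.
rewrite bilBl !bilBr !bilZl !bilZr (bilC y x sA).
set a := bil A x x; set b := bil A x y; set c := bil A y y => h.
have : 0 <= c * (a * c - b ^+ 2) by apply: le_trans h _; rewrite le_eqVlt; apply/orP; left; apply/eqP; ring.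
by rewrite pmulr_rge0 // subr_ge0.
Qed.

End CauchySchwarz.

(** * A rank-one tensor with small support *)

Section BumpTensor.
Context {R : realType} {n : nat} (M : manifold R n) (D1 D2 : subbundle M).
Local Notation vec := 'rV[R]_n.
Variables (g : tensor02 R n).
Hypotheses (hg : riemannian M g) (hD : orthogonal_subbundles g D1 D2).
Variables (i : nat) (u0 : vec) (X0 : vec).

Local Notation P3 := (orthoproj (g i) (third_distr (g i) (fiber D1 i) (fiber D2 i))).

(** Extends a vector of D3 at [u0] to a section of D3 over the chart. *)
Definition third_field (u : vec) : vec := X0 *m P3 u.

Definition third_covector (u : vec) : vec := third_field u *m g i u.

(* The denominator keeps g + t * bump_tensor positive definite for |t| < 1. *)
Definition bump_weight (r : R) (u : vec) : R :=
  bump_fun u0 r u / (1 + bil (g i u) (third_field u) (third_field u)).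

Definition bump_tensor (s r : R) (u : vec) : 'M[R]_n :=
  (s * bump_weight r u) *: ((third_covector u)^T *m third_covector u).

Lemma third_field_third u : (third_field u <= third_distr (g i) (fiber D1 i) (fiber D2 i) u)%MS.
Proof. exact: proj_mx_sub. Qed.

Lemma third_field_smooth : smooth_on (ccod M i) third_field.
Proof.
have oC := @ccod_open _ _ M i.
by apply: smooth_on_mulmx => //; [exact: smooth_on_cst|exact: third_proj_smooth hg hD i].
Qed.

Let denom_gt0 u : ccod M i u -> 0 < 1 + bil (g i u) (third_field u) (third_field u).
Proof. by move=> cu; rewrite ltr_pwDl // posdef_ge0 //; exact: riemannian_posdef hg cu. Qed.

Lemma bump_weight_ge0 r u : ccod M i u -> 0 <= bump_weight r u.
Proof. by move=> cu; rewrite divr_ge0 ?bump_ge0 // ltW // denom_gt0. Qed.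

Lemma bump_weight_center r : ccod M i u0 -> 0 < r -> 0 < bump_weight r u0.
Proof. by move=> cu r0; rewrite divr_gt0 ?bump_center // denom_gt0. Qed.

Lemma bump_weight_support r u : 0 < r -> bump_weight r u != 0 -> `|u - u0| < r.
Proof. by move=> r0; rewrite mulf_eq0 negb_or => /andP [b0 _]; exact: bump_support b0. Qed.

Lemma bump_tensor_smooth s r : smooth_on (ccod M i) (bump_tensor s r).
Proof.
have oC := @ccod_open _ _ M i; have [gs _ _ _] := hg; have Xs := third_field_smooth.
have cs : smooth_on (ccod M i) third_covector by apply: smooth_on_mulmx.
have ws : smooth_on (ccod M i) (bump_weight r : vec -> R^o).
  apply: smooth_onM => //; first by apply: smooth_on_sub (bump_smooth u0 r).
  apply: smooth_onV => // [u cu|]; first by rewrite gt_eqF // denom_gt0.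
  by apply: smooth_onD => //; [exact: smooth_on_cst|exact: smooth_on_bil].
have ts : smooth_on (ccod M i) (fun u => (third_covector u)^T *m third_covector u).
  by apply: smooth_on_mulmx => //; exact: smooth_on_trmx.
apply/smooth_on_mxP => // k l.
have := smooth_onM oC (smooth_onM oC (smooth_on_cst _ s) ws) ((smooth_on_mxP _ oC).1 ts k l).
by apply: smooth_on_congr => // v _; rewrite /bump_tensor [RHS]mxE.
Qed.

Lemma bump_tensor_sym s r u : (bump_tensor s r u)^T = bump_tensor s r u.
Proof. by rewrite /bump_tensor linearZ /= trmx_mul trmxK. Qed.

Lemma bump_tensor_kill s r u : ccod M i u ->
  fiber D1 i u *m bump_tensor s r u = 0 /\ fiber D2 i u *m bump_tensor s r u = 0.
Proof.
move=> cu; have [k1 k2] := third_orthogonal hg cu (third_field_third u).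
by rewrite /bump_tensor /third_covector -!scalemxAr !mulmxA k1 k2 !mul0mx !scaler0.
Qed.

(** By Cauchy-Schwarz the square of g(v, X) is at most g(v, v) g(X, X), and the denominator 1 + g(X,
    X) makes the bound strict; [s] and the bump function are at most 1 in absolute value. *)
Lemma bump_tensor_small s r u (v : vec) : `|s| <= 1 -> ccod M i u -> v != 0 ->
  `|bil (bump_tensor s r u) v v| < bil (g i u) v v.
Proof.
move=> s1 cu v0; have pg := riemannian_posdef hg cu; have [sg pg'] := pg.
rewrite /bump_tensor bilZA bil_rank1.
have -> : (v *m (third_covector u)^T) 0 0 = bil (g i u) v (third_field u).
  by rewrite bilv /third_covector trmx_mul sg mulmxA.
have -> : (third_covector u *m v^T) 0 0 = bil (g i u) v (third_field u).
  by rewrite (bilC _ _ sg) bilv.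
have CS := posdef_cauchy v (third_field u) pg.
have d0 := denom_gt0 cu; have q0 := posdef_ge0 (third_field u) pg.
have p0 : 0 < bil (g i u) v v by rewrite bilv pg'.
rewrite -expr2 normrM (ger0_norm (sqr_ge0 _)) normrM (ger0_norm (bump_weight_ge0 r cu)).
move: CS d0 q0 p0 (bump_ge0 u0 r u) (bump_le1 u0 r u); rewrite /bump_weight.
move: (bil _ v (third_field u)) (bil _ (third_field u) _) (bil _ v v) (bump_fun _ _ _) => a q p b CS d0 q0 p0 b0 b1.
move: (a ^+ 2) (sqr_ge0 a) CS => A A0 CS.
rewrite mulrA mulrAC ltr_pdivrMr //.
apply: (@le_lt_trans _ _ (1 * 1 * (p * q))).
  by apply: ler_pM => //; rewrite ?mulr_ge0 //; apply: ler_pM.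
by rewrite !mul1r mulrDr mulr1 ltrDr.
Qed.

Lemma bump_tensor_out s r u : 0 < r -> ~ `|u - u0| < r -> bump_tensor s r u = 0.
Proof.
move=> r0 nu; rewrite /bump_tensor; suff -> : bump_weight r u = 0 by rewrite mulr0 scale0r.
by apply: contrapT => /eqP /(bump_weight_support r0).
Qed.

End BumpTensor.

(** * Polarization of the Euler-Lagrange expression *)

Section Polarization.
Context {R : realType} {n r1 r2 : nat}.
Local Notation vec := 'rV[R]_n.

(** The mixed tensors are abstracted to arbitrary families of vectors, since only the dependence on
    [X] and [Y] matters. *)
Lemma quadratic_polarization (G : vec -> 'M[R]_n) u (A23 A13 T23 T13 h t : 'I_r1 -> 'I_r2 -> vec)
    (H1 H2 : vec) (S : R) (Q : vec -> vec -> R) : (G u)^T = G u ->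
  let ip := inner_g G u in
  (forall X Y, Q X Y = \sum_(a < r1) \sum_(j < r2)
    (- ip (A23 a j) Y * ip (h a j + t a j) X
     - ip (A23 a j) X * ip (h a j + t a j) Y
     - ip (A13 a j) Y * ip (h a j - t a j) X
     - ip (A13 a j) X * ip (h a j - t a j) Y
     - ip (A23 a j) X * ip (T23 a j) Y
     - ip (A23 a j) Y * ip (T23 a j) X
     - ip (A13 a j) X * ip (T13 a j) Y
     - ip (A13 a j) Y * ip (T13 a j) X
     - 2 * ip (T23 a j) X * ip (T23 a j) Y
     - 2 * ip (T13 a j) X * ip (T13 a j) Y
     - 2 * ip X (h a j) * ip Y (h a j)
     - 2 * ip X (t a j) * ip Y (t a j))
   + ip H2 X * ip H1 Y + ip H2 Y * ip H1 X + S * ip X Y) ->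
  forall X Y, Q (X + Y) (X + Y) = Q X X + Q Y Y + 2 * Q X Y.
Proof.
move=> sG ip QE X Y; rewrite !QE.
have Dl x y z : ip (x + y) z = ip x z + ip y z by exact: inner_gDl.
have C x y : ip x y = ip y x by exact: inner_gC.
have Dr x y z : ip z (x + y) = ip z x + ip z y by rewrite C Dl !(C z).
set s1 := \sum_a _; set s2 := \sum_a _; set s3 := \sum_a _; set s4 := \sum_a _.
have -> : s1 = s2 + s3 + 2 * s4.
  rewrite /s1 /s2 /s3 /s4 mulr_sumr -!big_split /=; apply: eq_bigr => a _.
  rewrite mulr_sumr -!big_split /=; apply: eq_bigr => j _.
  by rewrite !(Dr X Y) !(Dl X Y); ring.
by rewrite !(Dr X Y) !(Dl X Y) (C Y X); ring.
Qed.

Lemma el_polarization (G D1 D2 : vec -> 'M[R]_n) u (E : 'M[R]_(r1, n)) (F : 'M[R]_(r2, n)) X Y :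
  (G u)^T = G u ->
  el_expr G D1 D2 u E F (X + Y) (X + Y) =
  el_expr G D1 D2 u E F X X + el_expr G D1 D2 u E F Y Y + 2 * el_expr G D1 D2 u E F X Y.
Proof.
move=> sG; pose D3 := third_distr G D1 D2.
pose P1 := orthoproj G D1; pose P2 := orthoproj G D2; pose P3 := orthoproj G D3.
exact: (@quadratic_polarization G u (fun a j => Amix G P2 P3 P1 u (row a E) (row j F))
  (fun a j => Amix G P1 P3 P2 u (row j F) (row a E))
  (fun a j => Tsharpmix G P2 P3 P1 u (row a E) (row j F))
  (fun a j => Tsharpmix G P1 P3 P2 u (row j F) (row a E))
  (fun a j => at_vec (hmix G P1 P2 P3) u (row a E) (row j F))
  (fun a j => at_vec (Tmix G P1 P2 P3) u (row a E) (row j F))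
  (mean_curv G P1 u *m P3 u) (mean_curv G P2 u *m P3 u) (mutual_curv G D1 D2 r1 r2 u)
  (fun X Y => el_expr G D1 D2 u E F X Y) sG (fun X Y => erefl)).
Qed.

End Polarization.

(** * The variation defined by a bump *)

Section BumpVariation.
Context {R : realType} {n : nat} (M : manifold R n) (D1 D2 : subbundle M).
Local Notation vec := 'rV[R]_n.
Variables (g : tensor02 R n).
Hypotheses (hg : riemannian M g) (hD : orthogonal_subbundles g D1 D2).
Variables (i : nat) (u0 X0 : vec) (s rho : R).
Hypothesis s1 : `|s| <= 1.

Local Notation K := (closed_ball_ Num.norm u0 rho : set vec).
Hypothesis Kc : K `<=` ccod M i.
Local Notation third j := (third_distr (g j) (fiber D1 j) (fiber D2 j)).
Local Notation el j := (el_expr (g j) (fiber D1 j) (fiber D2 j)).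
Local Notation X u := (third_field D1 D2 g i X0 u).
Local Notation w r u := (bump_weight D1 D2 g i u0 X0 r u).

Lemma closed_ball_compact (c : vec) (r : R) : compact (closed_ball_ Num.norm c r : set vec).
Proof.
apply: bounded_closed_compact; last exact: closed_closed_ball_.
exists (`|c| + r); split=> [|y yr x]; first exact: num_real.
rewrite /closed_ball_ /= => xc; apply: ltW; apply: le_lt_trans yr.
by rewrite -(subrK c x) [leRHS]addrC; apply: le_trans (ler_normD _ _) _; rewrite lerD2r distrC.
Qed.

(** The radius [r] of the bump is separate from the radius [rho] of the compact set, so that two
    bumps of different sizes share the same hypotheses. *)
Definition bump_variation r := linear_variation M g i (bump_tensor D1 D2 g i u0 X0 s r).
Definition bump_rate r := density_deriv D1 D2 g (bump_variation r).

Section Radius.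
Variable r : R.
Hypotheses (r0 : 0 < r) (rr : r <= rho).
Local Notation eta := (bump_tensor D1 D2 g i u0 X0 s r).

Let cK : compact K. Proof. exact: closed_ball_compact. Qed.
Let etas : smooth_on (ccod M i) eta. Proof. exact: bump_tensor_smooth. Qed.
Let etaK u : ccod M i u -> ~ K u -> eta u = 0.
Proof.
move=> _ nK; apply: bump_tensor_out => // ur; apply: nK.
by rewrite /closed_ball_ /= distrC; apply: ltW; exact: lt_le_trans ur rr.
Qed.
Let eta_sym u : ccod M i u -> (eta u)^T = eta u. Proof. by move=> _; exact: bump_tensor_sym. Qed.
Let eta_small u (v : vec) : ccod M i u -> v != 0 -> `|bil (eta u) v v| < bil (g i u) v v.
Proof. exact: bump_tensor_small. Qed.
Let eta_kill1 u : ccod M i u -> fiber D1 i u *m eta u = 0.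
Proof. by move=> cu; have [] := bump_tensor_kill D1 D2 hg u0 X0 s r cu. Qed.
Let eta_kill2 u : ccod M i u -> fiber D2 i u *m eta u = 0.
Proof. by move=> cu; have [] := bump_tensor_kill D1 D2 hg u0 X0 s r cu. Qed.

Let gtR t : `|t| < 1 -> riemannian M (bump_variation r t).
Proof. exact: (linear_variation_riemannian hg etas cK Kc etaK eta_sym eta_small). Qed.
Let gts j : smooth_on (cylinder 1 (ccod M j)) (fun z => bump_variation r z.1 j z.2).
Proof. exact: (linear_variation_smooth hg etas cK Kc etaK). Qed.
Let gt0 j u : ccod M j u -> bump_variation r 0 j u = g j u.
Proof. by move=> _; exact: linear_variation0. Qed.
Let kill1 j u : ccod M j u -> fiber D1 j u *m variation_deriv (bump_variation r) j u = 0.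
Proof. by move=> _; rewrite linear_variation_deriv; exact: extend_tensor_kill. Qed.
Let kill2 j u : ccod M j u -> fiber D2 j u *m variation_deriv (bump_variation r) j u = 0.
Proof. by move=> _; rewrite linear_variation_deriv; exact: extend_tensor_kill. Qed.

Lemma bump_rateE u E F : ccod M i u ->
  orthonormal_frame (g i) (fiber D1 i) u (E : 'M[R]_(drank D1, n)) ->
  orthonormal_frame (g i) (fiber D2 i) u (F : 'M[R]_(drank D2, n)) ->
  2 * bump_rate r i u = s * w r u * el i u E F (X u) (X u).
Proof.
move=> cu EO FO.
apply: (density_deriv_rank1 hg hD ltr01 gtR gts gt0 kill1 kill2 cu EO FO); first exact: third_field_third.
by rewrite linear_variation_deriv extend_tensor_base.
Qed.

Lemma bump_rate_out j u : ccod M j u -> ~ chart_overlap M j i u -> bump_rate r j u = 0.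
Proof.
move=> cu no; apply: (density_deriv_vanish hg hD ltr01 gtR gts gt0 kill1 kill2 cu).
by rewrite linear_variation_deriv extend_tensor_out.
Qed.

Lemma bump_rate_inv : chart_invariant M (bump_rate r).
Proof. exact: (density_deriv_inv D1 D2 hg ltr01 gtR). Qed.

Lemma bump_rate_cont : cont_on_charts M (bump_rate r).
Proof. exact: (density_deriv_cont ltr01 gtR gts gt0). Qed.

Lemma bump_action_derive Omega N : open Omega -> compact (closure Omega) ->
  (forall j u, piece Omega j u -> (j < N)%N) ->
  is_derive (0 : R^o) (1 : R^o)
    (fun t => curv_action D1 D2 Omega (bump_variation r t) : R^o) (weighted g Omega N (bump_rate r)).
Proof. by move=> oO cO pN; exact: (action_derive D1 D2 hg ltr01 gtR gts gt0 oO cO pN). Qed.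

Lemma bump_metric_variation (Omega : set M) : cinv M i @` K `<=` Omega ->
  metric_variation g Omega 1 (bump_variation r).
Proof. exact: (linear_variation_metric hg etas cK Kc etaK eta_sym eta_small). Qed.

Lemma bump_variation_orthogonal t : orthogonal_subbundles (bump_variation r t) D1 D2.
Proof. exact: linear_variation_orthogonal. Qed.

Lemma bump_variation_third j u : ccod M j u ->
  let P3 := orthoproj (g j) (third j) in
  let B := variation_deriv (bump_variation r) j in
  forall X Y : vec, inner_g B u X Y = inner_g B u (X *m P3 u) (Y *m P3 u).
Proof. exact: (linear_variation_third hg hD eta_sym eta_kill1 eta_kill2). Qed.

End Radius.

End BumpVariation.

(** * From stationarity to the equation *)

Section Stationarity.
Context {R : realType} {n : nat} (M : manifold R n) (D1 D2 : subbundle M).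
Local Notation vec := 'rV[R]_n.
Variables (g : tensor02 R n).
Hypotheses (hg : riemannian M g) (hD : orthogonal_subbundles g D1 D2).
Hypothesis stationary : forall (Omega : set M) (eps : R) (gt : R -> tensor02 R n),
  open Omega -> compact (closure Omega) -> metric_variation g Omega eps gt ->
  (forall t, `|t| < eps -> orthogonal_subbundles (gt t) D1 D2) ->
  (forall i u, ccod M i u ->
     let P3 := orthoproj (g i) (third_distr (g i) (fiber D1 i) (fiber D2 i)) in
     let B := variation_deriv gt i in
     forall X Y : vec, inner_g B u X Y = inner_g B u (X *m P3 u) (Y *m P3 u)) ->
  is_derive (0 : R^o) (1 : R^o) (fun t => curv_action D1 D2 Omega (gt t) : R^o) 0.

Local Notation third j := (third_distr (g j) (fiber D1 j) (fiber D2 j)).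
Local Notation el j := (el_expr (g j) (fiber D1 j) (fiber D2 j)).

(* A variation of radius [rho] shows that the sign of the expression persists in a
   neighbourhood of [u0]; a second one, of radius [r], is supported there. *)
Lemma el_diagonal i u0 E F X0 : ccod M i u0 ->
  orthonormal_frame (g i) (fiber D1 i) u0 (E : 'M[R]_(drank D1, n)) ->
  orthonormal_frame (g i) (fiber D2 i) u0 (F : 'M[R]_(drank D2, n)) ->
  (X0 <= third i u0)%MS -> el i u0 E F X0 X0 = 0.
Proof.
move=> cu0 EO FO X0D; apply: contrapT => /eqP L0.
have [r0 r00 r0C] := near_ball_segment (@ccod_open _ _ M i) cu0.
(* The radii r0 / 3 < r0 / 2 < r0 are those of the compact set containing the supports, of [Omega],
   and of a ball inside the chart; the sign [s] makes the rates positive at [u0]. *)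
pose rho := r0 / 3; pose s : R := Num.sg (el i u0 E F X0 X0).
have rho0 : 0 < rho by rewrite divr_gt0.
have s1 : `|s| <= 1 by rewrite normr_sg L0.
have Kc r : r < r0 -> (closed_ball_ Num.norm u0 r : set vec) `<=` ccod M i.
  move=> rr v vK; apply: r0C; rewrite distrC; exact: le_lt_trans vK rr.
have rho_r0 : rho < r0 by rewrite /rho; lra.
have rho_r02 : rho < r0 / 2 by rewrite /rho; lra.
have r02 : r0 / 2 < r0 by lra.
have KC := Kc rho rho_r0.
have XE : third_field D1 D2 g i X0 u0 = X0.
  by rewrite /third_field /orthoproj proj_mx_id //; exact: orth_cap0 (riemannian_posdef hg cu0).
have gt1 : 0 < bump_rate D1 D2 g i u0 X0 s rho i u0.
  rewrite -(pmulr_rgt0 _ (ltr0Sn R 1)).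
  rewrite (bump_rateE hg hD X0 s1 KC rho0 (lexx rho) cu0 EO FO) XE mulrAC.
  rewrite mulr_gt0 //; first by rewrite /s -normrEsg normr_gt0.
  exact: (bump_weight_center D1 D2 hg X0 cu0 rho0).
(* Continuity is taken from the rate of the density, because the expression itself is evaluated on
   frames chosen separately at each point. *)
have bc : {for u0, continuous (bump_rate D1 D2 g i u0 X0 s rho i : vec -> R^o)}.
  exact: (bump_rate_cont hg hD s1 KC rho0 (lexx rho) cu0).
have [d d0 dP] := continuous_forP bc gt1.
pose r := Num.min d rho.
have rpos : 0 < r by rewrite lt_min d0.
have rr : r <= rho by rewrite ge_min lexx orbT.
have gt2 : 0 < bump_rate D1 D2 g i u0 X0 s r i u0.
  rewrite -(pmulr_rgt0 _ (ltr0Sn R 1)).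
  rewrite (bump_rateE hg hD X0 s1 KC rpos rr cu0 EO FO) XE mulrAC.
  rewrite mulr_gt0 //; first by rewrite /s -normrEsg normr_gt0.
  exact: (bump_weight_center D1 D2 hg X0 cu0 rpos).
have ge2 u : ccod M i u -> 0 <= bump_rate D1 D2 g i u0 X0 s r i u.
  move=> cu; rewrite -(pmulr_rge0 _ (ltr0Sn R 1)).
  have [E' EO'] := exists_fiber_frame D1 hg cu; have [F' FO'] := exists_fiber_frame D2 hg cu.
  rewrite (bump_rateE hg hD X0 s1 KC rpos rr cu EO' FO').
  have [->|wn] := eqVneq (bump_weight D1 D2 g i u0 X0 r u) 0; first by rewrite mulr0 mul0r.
  have ur : `|u - u0| < d.
    by apply: lt_le_trans (bump_weight_support rpos wn) _; rewrite ge_min lexx.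
  have b1 : 0 < bump_rate D1 D2 g i u0 X0 s rho i u.
    have pos (a b : R) : `|a - b| < b -> 0 < a by rewrite ltr_norml ltrBrDr addNr => /andP [].
    exact: pos (dP u ur).
  (* Both rates are the same expression times nonnegative weights, so the sign obtained with radius
     [rho] passes to radius [r]. *)
  rewrite -(pmulr_rgt0 _ (ltr0Sn R 1)) in b1.
  rewrite (bump_rateE hg hD X0 s1 KC rho0 (lexx rho) cu EO' FO') in b1.
  rewrite mulrAC in b1; rewrite mulrAC mulr_ge0 ?bump_weight_ge0 //.
  have := bump_weight_ge0 D1 D2 hg u0 X0 rho cu; rewrite le_eqVlt => /orP [/eqP w0|w0].
    by move: b1; rewrite -w0 mulr0 ltxx.
  by rewrite -(pmulr_lge0 _ w0) ltW.
have geA j u : ccod M j u -> 0 <= bump_rate D1 D2 g i u0 X0 s r j u.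
  move=> cu; have [p0|p0] := pselect (chart_overlap M j i u).
    rewrite (bump_rate_inv hg hD X0 s1 KC rpos rr p0); apply: ge2; exact: transition_cod.
  by rewrite (bump_rate_out hg hD X0 s1 KC rpos rr cu p0).
pose Omega : set M := [set p | cdom i p /\ `|cmap i p - u0| < r0 / 2].
have oO : open Omega.
  rewrite openE => p [ip pr]; rewrite /interior.
  have N1 : nbhs p (@cdom _ _ M i) by apply: open_nbhs_nbhs; split=> //; exact: cdom_open.
  have oB : open (ball u0 (r0 / 2) : set vec) by exact: ball_open.
  have N2 : nbhs (cmap i p) (ball u0 (r0 / 2)).
    by apply: open_nbhs_nbhs; split=> //; rewrite -ball_normE /= distrC.
  have {}N2 : nbhs (cmap i p) [set v : vec | `|v - u0| < r0 / 2].
    by apply: filterS N2 => v; rewrite -ball_normE /= distrC.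
  have N3 := cmap_continuous ip N2.
  near=> q; split; near: q; first exact: N1.
  exact: N3.
have cK2 := chart_image_compact (closed_ball_compact (c := u0) (r := r0 / 2)) (Kc _ r02).
have OK : closure Omega `<=` cinv M i @` (closed_ball_ Num.norm u0 (r0 / 2) : set vec).
  have cS := compact_closed (@manifold_hausdorff _ _ M) cK2.
  rewrite [X in _ `<=` X](closure_id _).1 //; apply: closureS => p [ip pr].
  by exists (cmap i p); [rewrite /closed_ball_ /= distrC ltW|exact: cmapK].
have cO : compact (closure Omega).
  by apply: (subclosed_compact _ cK2 OK); exact: closed_closure.
have [N pN] := piece_bound cO.
have KO : cinv M i @` (closed_ball_ Num.norm u0 rho : set vec) `<=` Omega.
  move=> p [v vK <-]; have cv := KC v vK; split; first exact: cinv_dom.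
  by rewrite cinvK // distrC; exact: le_lt_trans vK rho_r02.
have [_ D0] := stationary oO cO (bump_metric_variation hg hD X0 s1 KC rpos rr KO)
  (fun t _ => bump_variation_orthogonal hg hD i u0 X0 s r t)
  (fun j u => bump_variation_third hg hD i u0 X0 s r (j := j) (u := u)).
have [_ D1'] := bump_action_derive hg hD X0 s1 KC rpos rr oO cO pN.
have cont := bump_rate_cont hg hD (X0 := X0) s1 KC rpos rr.
have inv := bump_rate_inv hg hD X0 s1 KC rpos rr.
have [C bC] := chart_invariant_bounded cO inv cont.
have Ou0 : Omega (cinv M i u0).
  by split; [exact: cinv_dom|rewrite cinvK // subrr normr0 divr_gt0].
have := weighted_gt0 hg oO cO pN cont bC inv (fun j u pu => geA j u (let: And3 c _ _ := pu in c)) cu0 Ou0 gt2.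
by rewrite -D1' D0 ltxx.
Unshelve. all: by end_near. Qed.

Lemma el_vanishes i u E F X Y : ccod M i u ->
  orthonormal_frame (g i) (fiber D1 i) u (E : 'M[R]_(drank D1, n)) ->
  orthonormal_frame (g i) (fiber D2 i) u (F : 'M[R]_(drank D2, n)) ->
  (X <= third i u)%MS -> (Y <= third i u)%MS -> el i u E F X Y = 0.
Proof.
move=> cu EO FO XD YD; have [sg _] := riemannian_posdef hg cu.
have := el_polarization (fiber D1 i) (fiber D2 i) E F X Y sg.
rewrite !(el_diagonal cu EO FO) ?addmx_sub // !add0r => /esym /eqP.
by rewrite mulf_eq0 pnatr_eq0 /= => /eqP.
Qed.

End Stationarity.
Theorem proposition5 (R : realType) (n : nat) (M : manifold R n)
    (hn : (2 < n)%N) (g : tensor02 R n) (hg : riemannian M g)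
    (D1 D2 : subbundle M) (hD : orthogonal_subbundles g D1 D2) :
  (forall (Omega : set M) (eps : R) (gt : R -> tensor02 R n),
     open Omega -> compact (closure Omega) ->
     metric_variation g Omega eps gt ->
     (forall t, `|t| < eps -> orthogonal_subbundles (gt t) D1 D2) ->
     (forall i u, ccod M i u ->
        let P3 := orthoproj (g i)
                    (third_distr (g i) (fiber D1 i) (fiber D2 i)) in
        let B := variation_deriv gt i in
        forall X Y : 'rV[R]_n,
          inner_g B u X Y = inner_g B u (X *m P3 u) (Y *m P3 u)) ->
     is_derive (0 : R^o) (1 : R^o)
       (fun t => curv_action D1 D2 Omega (gt t) : R^o) 0)
  <->
  (forall i u, ccod M i u ->
     let G := g i in
     let D3 := third_distr G (fiber D1 i) (fiber D2 i) in
     let P1 := orthoproj G (fiber D1 i) in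
     let P2 := orthoproj G (fiber D2 i) in
     let P3 := orthoproj G D3 in
     let ip := inner_g G u in
     let A23 := Amix G P2 P3 P1 u in
     let A13 := Amix G P1 P3 P2 u in
     let T23 := Tsharpmix G P2 P3 P1 u in
     let T13 := Tsharpmix G P1 P3 P2 u in
     let h12 := at_vec (hmix G P1 P2 P3) u in
     let t12 := at_vec (Tmix G P1 P2 P3) u in
     let H1 := mean_curv G P1 u in
     let H2 := mean_curv G P2 u in
     let S := mutual_curv G (fiber D1 i) (fiber D2 i)
                (drank D1) (drank D2) u in
     forall (E : 'M[R]_(drank D1, n)) (F : 'M[R]_(drank D2, n)),
       orthonormal_frame G (fiber D1 i) u E ->
       orthonormal_frame G (fiber D2 i) u F ->
       forall X Y : 'rV[R]_n, (X <= D3 u)%MS -> (Y <= D3 u)%MS ->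
       \sum_(a < drank D1) \sum_(j < drank D2)
         (let e := row a E in
          let f := row j F in
          - ip (A23 e f) Y * ip (h12 e f + t12 e f) X
          - ip (A23 e f) X * ip (h12 e f + t12 e f) Y
          - ip (A13 f e) Y * ip (h12 e f - t12 e f) X
          - ip (A13 f e) X * ip (h12 e f - t12 e f) Y
          - ip (A23 e f) X * ip (T23 e f) Y
          - ip (A23 e f) Y * ip (T23 e f) X
          - ip (A13 f e) X * ip (T13 f e) Y
          - ip (A13 f e) Y * ip (T13 f e) X
          - 2 * ip (T23 e f) X * ip (T23 e f) Y
          - 2 * ip (T13 f e) X * ip (T13 f e) Y
          - 2 * ip X (h12 e f) * ip Y (h12 e f)
          - 2 * ip X (t12 e f) * ip Y (t12 e f))
       + ip (H2 *m P3 u) X * ip (H1 *m P3 u) Y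
       + ip (H2 *m P3 u) Y * ip (H1 *m P3 u) X
       + S * ip X Y = 0).

Proof.
split=> [stat i u cu /= E F EO FO X Y XD YD|H Omega eps gt oO cO [eps0 gtR gts gt0 _] hO hB].
  exact: (el_vanishes hg hD stat cu EO FO XD YD).
have kill i u : ccod M i u -> fiber D1 i u *m variation_deriv gt i u = 0 /\
    fiber D2 i u *m variation_deriv gt i u = 0.
  by move=> cu; exact: (third_killed hg hD cu (hB i u cu)).
apply: (el_stationary hg hD eps0 gtR gts gt0 _ _ oO cO) => [i u /kill []|i u /kill []|] //.
Qed.
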